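(* Let $(A, I)$ be a Henselian pair. Let $A \to B$ be a ring map which is weakly étale and faithfully flat. Let $B^h$ and $(B \otimes_A B)^h$ denote the Henselizations of $B$ and $B \otimes_A B$ with respect to the ideals $IB$ and $I(B \otimes_A B)$. Let $X$ be a scheme. Then the diagram of sets $$ X(A) \to X(B^h) \rightrightarrows X((B \otimes_A B)^h) $$ is an equalizer.
   Context: A ring map $A \to B$ is weakly étale if both $A \to B$ and the multiplication map $B \otimes_A B \to B$ are flat. For a ring $R$ and a scheme $X$, $X(R)$ denotes the set of morphisms of schemes $\mathrm{Spec}(R) \to X$. The Henselization of a ring $R$ with respect to an ideal $J$ means the Henselization of the pair $(R, J)$. The first map of the diagram is induced by $A \to B \to B^h$, and the two parallel maps are induced by the ring maps $B^h \to (B \otimes_A B)^h$ obtained by Henselizing the two maps $B \to B \otimes_A B$, $b \mapsto b \otimes 1$ and $b \mapsto 1 \otimes b$. *)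

(* Defs.v *)
(* Rings are commutative with unit and may be zero (comPzRingType), since the
   zero ring occurs as a ring of sections. *)
From HB Require Import structures.
From mathcomp Require Import all_boot all_algebra ring.
From mathcomp Require Import boolp classical_sets topology_structure.

Set Implicit Arguments.
Unset Strict Implicit.
Unset Printing Implicit Defensive.

Import GRing.Theory.

Local Open Scope classical_set_scope.
Local Open Scope ring_scope.

(* A type with operations satisfying the axioms up to an equivalence relation;
   tensor products, localizations and stalks are quotients of such types. *)
Record preZmod := PreZmod {
  pz_car :> Type;
  pz_eq : pz_car -> pz_car -> Prop;
  pz_zero : pz_car;
  pz_opp : pz_car -> pz_car;
  pz_add : pz_car -> pz_car -> pz_car;
  pz_refl : forall x, pz_eq x x;
  pz_sym : forall x y, pz_eq x y -> pz_eq y x;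
  pz_trans : forall x y z, pz_eq x y -> pz_eq y z -> pz_eq x z;
  pz_oppE : forall x y, pz_eq x y -> pz_eq (pz_opp x) (pz_opp y);
  pz_addE : forall x y x' y', pz_eq x x' -> pz_eq y y' ->
    pz_eq (pz_add x y) (pz_add x' y');
  pz_addA : forall x y z,
    pz_eq (pz_add x (pz_add y z)) (pz_add (pz_add x y) z);
  pz_addC : forall x y, pz_eq (pz_add x y) (pz_add y x);
  pz_add0 : forall x, pz_eq (pz_add pz_zero x) x;
  pz_addN : forall x, pz_eq (pz_add (pz_opp x) x) pz_zero
}.

Record preRing := PreRing {
  pr_zmod :> preZmod;
  pr_one : pr_zmod;
  pr_mul : pr_zmod -> pr_zmod -> pr_zmod;
  pr_mulE : forall x y x' y', pz_eq x x' -> pz_eq y y' ->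
    pz_eq (pr_mul x y) (pr_mul x' y');
  pr_mulA : forall x y z,
    pz_eq (pr_mul x (pr_mul y z)) (pr_mul (pr_mul x y) z);
  pr_mulC : forall x y, pz_eq (pr_mul x y) (pr_mul y x);
  pr_mul1 : forall x, pz_eq (pr_mul pr_one x) x;
  pr_mulD : forall x y z,
    pz_eq (pr_mul (pz_add x y) z) (pz_add (pr_mul x z) (pr_mul y z))
}.

Definition quot (P : preZmod) : Type :=
  {C : set P | exists x, C = [set y | pz_eq x y]}.

Section Quot.
Variable P : preZmod.

Definition qpi (x : P) : quot P :=
  exist _ [set y | pz_eq x y] (ex_intro _ x erefl).

Definition qrepr (X : quot P) : P := projT1 (cid (svalP X)).

Lemma qreprK X : qpi (qrepr X) = X.
Proof.
rewrite /qrepr /qpi; case: cid => x /= e.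
by case: X e => C hC /= e; apply: eq_exist; rewrite e.
Qed.

Lemma qpiE x y : qpi x = qpi y <-> pz_eq x y.
Proof.
split=> [[e]|h].
  have : [set z | pz_eq y z] y by exact: pz_refl.
  by rewrite -e.
apply: eq_exist; apply/seteqP; split=> z /= h'.
  exact: pz_trans (pz_sym h) h'.
exact: pz_trans h h'.
Qed.

Lemma qpiK x : pz_eq (qrepr (qpi x)) x.
Proof. by apply/qpiE; rewrite qreprK. Qed.

Lemma quotW (Q : quot P -> Prop) : (forall x, Q (qpi x)) -> forall X, Q X.
Proof. by move=> h X; rewrite -(qreprK X). Qed.

Definition qopp X := qpi (pz_opp (qrepr X)).
Definition qadd X Y := qpi (pz_add (qrepr X) (qrepr Y)).

Lemma qoppE x : qopp (qpi x) = qpi (pz_opp x).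
Proof. by apply/qpiE/pz_oppE/qpiK. Qed.
Lemma qaddE x y : qadd (qpi x) (qpi y) = qpi (pz_add x y).
Proof. by apply/qpiE/pz_addE; exact: qpiK. Qed.

Lemma qaddA : associative qadd.
Proof.
elim/quotW=> x; elim/quotW=> y; elim/quotW=> z.
by rewrite !qaddE; apply/qpiE/pz_addA.
Qed.
Lemma qaddC : commutative qadd.
Proof.
by elim/quotW=> x; elim/quotW=> y; rewrite !qaddE; apply/qpiE/pz_addC.
Qed.
Lemma qadd0 : left_id (qpi (pz_zero P)) qadd.
Proof. by elim/quotW=> x; rewrite qaddE; apply/qpiE/pz_add0. Qed.
Lemma qaddN : left_inverse (qpi (pz_zero P)) qopp qadd.
Proof. by elim/quotW=> x; rewrite qoppE qaddE; apply/qpiE/pz_addN. Qed.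

HB.instance Definition _ := gen_eqMixin (quot P).
HB.instance Definition _ := gen_choiceMixin (quot P).
HB.instance Definition _ :=
  GRing.isZmodule.Build (quot P) qaddA qaddC qadd0 qaddN.

Lemma qpiN x : - qpi x = qpi (pz_opp x). Proof. exact: qoppE. Qed.
Lemma qpiD x y : qpi x + qpi y = qpi (pz_add x y). Proof. exact: qaddE. Qed.
Lemma qpi0 : 0 = qpi (pz_zero P). Proof. by []. Qed.

Definition qlift (T : Type) (f : P -> T) (X : quot P) : T := f (qrepr X).

Lemma qliftE (T : Type) (f : P -> T) x :
  (forall x y, pz_eq x y -> f x = f y) -> qlift f (qpi x) = f x.
Proof. by move=> h; apply: h; exact: qpiK. Qed.

End Quot.

Definition quotr (P : preRing) : Type := quot P.

Section QuotRing.
Variable P : preRing.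

HB.instance Definition _ := GRing.Zmodule.on (quotr P).

Definition rpi (x : P) : quotr P := qpi x.

Lemma rpiE x y : rpi x = rpi y <-> pz_eq x y. Proof. exact: qpiE. Qed.
Lemma rpiW (Q : quotr P -> Prop) : (forall x, Q (rpi x)) -> forall X, Q X.
Proof. exact: quotW. Qed.

Definition qmul (X Y : quotr P) : quotr P :=
  rpi (pr_mul (qrepr X) (qrepr Y)).

Lemma qmulE x y : qmul (rpi x) (rpi y) = rpi (pr_mul x y).
Proof. by apply/rpiE/pr_mulE; exact: qpiK. Qed.

Lemma qmulA : associative qmul.
Proof.
elim/rpiW=> x; elim/rpiW=> y; elim/rpiW=> z.
by rewrite !qmulE; apply/rpiE; exact: pr_mulA.
Qed.
Lemma qmulC : commutative qmul.
Proof.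
by elim/rpiW=> x; elim/rpiW=> y; rewrite !qmulE; apply/rpiE; exact: pr_mulC.
Qed.
Lemma qmul1 : left_id (rpi (pr_one P)) qmul.
Proof. by elim/rpiW=> x; rewrite qmulE; apply/rpiE; exact: pr_mul1. Qed.
Lemma qmulD : left_distributive qmul +%R.
Proof.
elim/rpiW=> x; elim/rpiW=> y; elim/rpiW=> z.
have D u v : rpi u + rpi v = rpi (pz_add u v) by exact: qaddE.
by rewrite D !qmulE D; apply/rpiE; exact: pr_mulD.
Qed.

HB.instance Definition _ :=
  GRing.Zmodule_isComPzRing.Build (quotr P) qmulA qmulC qmul1 qmulD.

Lemma rpiN x : - rpi x = rpi (pz_opp x). Proof. exact: qoppE. Qed.
Lemma rpiD x y : rpi x + rpi y = rpi (pz_add x y). Proof. exact: qaddE. Qed.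
Lemma rpiM x y : rpi x * rpi y = rpi (pr_mul x y). Proof. exact: qmulE. Qed.
Lemma rpi0 : 0 = rpi (pz_zero P). Proof. by []. Qed.
Lemma rpi1 : 1 = rpi (pr_one P). Proof. by []. Qed.

End QuotRing.

Definition ideal (R : comPzRingType) (I : set R) : Prop :=
  [/\ I 0, (forall a b, I a -> I b -> I (a + b))
    & (forall a b, I b -> I (a * b))].

Definition prime_ideal (R : comPzRingType) (p : set R) : Prop :=
  [/\ ideal p, ~ p 1 & forall a b, p (a * b) -> p a \/ p b].

Definition maximal_ideal (R : comPzRingType) (m : set R) : Prop :=
  [/\ ideal m, ~ m 1 & forall J, ideal J -> ~ J 1 -> m `<=` J -> J = m].

Definition local_ring (R : comPzRingType) : Prop :=
  exists! m : set R, maximal_ideal m.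

Definition local_map (R S : comPzRingType) (f : R -> S) : Prop :=
  forall m n, maximal_ideal m -> maximal_ideal n -> f @` m `<=` n.

(* The ideal f(I)S of S. *)
Definition extend (R S : comPzRingType) (f : R -> S) (I : set R) : set S :=
  smallest (@ideal S) (f @` I).

(* The tensor product of modules over A: formal sums of pairs modulo the
   congruence generated by bilinearity. *)
Section Tensor.
Variables (A : comPzRingType) (M N : lmodType A).

Inductive tens_eq : seq (M * N) -> seq (M * N) -> Prop :=
| tens_perm s t : perm_eq s t -> tens_eq s t
| tens_sym s t : tens_eq s t -> tens_eq t s
| tens_trans s t u : tens_eq s t -> tens_eq t u -> tens_eq s u
| tens_cat s t s' t' : tens_eq s s' -> tens_eq t t' ->
    tens_eq (s ++ t) (s' ++ t')
| tens_zero y : tens_eq [:: (0, y)] [::]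
| tens_addl x x' y : tens_eq [:: (x + x', y)] [:: (x, y); (x', y)]
| tens_addr x y y' : tens_eq [:: (x, y + y')] [:: (x, y); (x, y')]
| tens_scale a x y : tens_eq [:: (a *: x, y)] [:: (x, a *: y)].

Definition tens_opp (s : seq (M * N)) := [seq (- z.1, z.2) | z <- s].

Lemma tens_refl s : tens_eq s s. Proof. exact/tens_perm/perm_refl. Qed.

Lemma tens_map (s t : seq (M * N)) (h : M * N -> M * N) :
  (forall y, h (0, y) = (0, (h (0, y)).2)) ->
  (forall x x' y, tens_eq [:: h (x + x', y)] [:: h (x, y); h (x', y)]) ->
  (forall x y y', tens_eq [:: h (x, y + y')] [:: h (x, y); h (x, y')]) ->
  (forall a x y, tens_eq [:: h (a *: x, y)] [:: h (x, a *: y)]) ->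
  tens_eq s t -> tens_eq (map h s) (map h t).
Proof.
move=> h0 hl hr hs; elim=> {s t}.
- by move=> s t st; apply/tens_perm/perm_map.
- by move=> s t _; exact: tens_sym.
- by move=> s t u _ st _; exact: tens_trans.
- by move=> s t s' t' _ ss _ tt; rewrite !map_cat; exact: tens_cat.
- by move=> y /=; rewrite h0; exact: tens_zero.
- exact: hl.
- exact: hr.
- exact: hs.
Qed.

Lemma tens_oppE s t : tens_eq s t -> tens_eq (tens_opp s) (tens_opp t).
Proof.
apply: tens_map => [y|x x' y|x y y'|a x y] /=; rewrite ?oppr0 //.
- by rewrite opprD; exact: tens_addl.
- exact: tens_addr.
- by rewrite -scalerN; exact: tens_scale.
Qed.

Lemma tens_addN s : tens_eq (tens_opp s ++ s) [::].
Proof.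
elim: s => [|[x y] s IH] /=; first exact: tens_refl.
apply: (@tens_trans _ ([:: (- x, y); (x, y)] ++ (tens_opp s ++ s))).
  apply: tens_perm; rewrite /= perm_cons.
  by rewrite -cat1s perm_catCA.
rewrite -[[::]]/([::] ++ [::]); apply: tens_cat => //.
apply: tens_trans (tens_zero y); rewrite -(addNr x).
exact/tens_sym/tens_addl.
Qed.

Definition tens_zmod : preZmod.
refine (@PreZmod (seq (M * N)) tens_eq [::] tens_opp cat
  tens_refl tens_sym tens_trans tens_oppE _ _ _ _ tens_addN).
- by move=> s t s' t'; exact: tens_cat.
- by move=> s t u; rewrite catA; exact: tens_refl.
- by move=> s t; apply/tens_perm; rewrite perm_catC.
- by move=> s; exact: tens_refl.
Defined.

Definition tensor : zmodType := quot tens_zmod.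

Definition tens (x : M) (y : N) : tensor := @qpi tens_zmod [:: (x, y)].

End Tensor.

Definition tensor_map (A : comPzRingType) (M N N' : lmodType A)
    (v : {linear N -> N'}) : tensor M N -> tensor M N' :=
  qlift (fun s : tens_zmod M N =>
    @qpi (tens_zmod M N') [seq (z.1, v z.2) | z <- s]).

Lemma tensor_mapE (A : comPzRingType) (M N N' : lmodType A)
    (v : {linear N -> N'}) x y :
  tensor_map v (tens x y) = tens x (v y) :> tensor M N'.
Proof.
rewrite /tensor_map qliftE // => s t st; apply/qpiE.
elim: st => {s t}.
- by move=> s t st; apply/tens_perm/perm_map.
- by move=> s t _; exact: tens_sym.
- by move=> s t u _ st _; exact: tens_trans.
- by move=> s t s' t' _ ss _ tt; rewrite !map_cat; exact: tens_cat.
- by move=> z /=; exact: tens_zero.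
- by move=> * /=; exact: tens_addl.
- by move=> * /=; rewrite linearD; exact: tens_addr.
- by move=> * /=; rewrite linearZ; exact: tens_scale.
Qed.

(* B as an A-module through f. *)
Definition restr (A B : comPzRingType) (f : {rmorphism A -> B}) : Type := B.

Section Restr.
Variables (A B : comPzRingType) (f : {rmorphism A -> B}).
HB.instance Definition _ := GRing.ComPzRing.on (restr f).

Definition restr_scale (a : A) (b : restr f) : restr f := (f a : restr f) * b.

Fact restr_scaleA a b v :
  restr_scale a (restr_scale b v) = restr_scale (a * b) v.
Proof. by rewrite /restr_scale rmorphM mulrA. Qed.
Fact restr_scale1 : left_id 1 restr_scale.
Proof. by move=> v; rewrite /restr_scale rmorph1 mul1r. Qed.
Fact restr_scaleDr : right_distributive restr_scale +%R.
Proof. by move=> a u v; rewrite /restr_scale mulrDr. Qed.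
Fact restr_scaleDl v : {morph restr_scale^~ v : a b / a + b}.
Proof. by move=> a b; rewrite /restr_scale rmorphD mulrDl. Qed.

HB.instance Definition _ := GRing.Zmodule_isLmodule.Build A (restr f)
  restr_scaleA restr_scale1 restr_scaleDr restr_scaleDl.

Local Notation E := (restr f * restr f)%type.
Local Notation BB := (tens_zmod (restr f) (restr f)).

Definition mulp (x y : E) : E := (x.1 * y.1, x.2 * y.2).

Lemma mulpC x y : mulp x y = mulp y x.
Proof. by rewrite /mulp ![x.1 * _]mulrC ![x.2 * _]mulrC. Qed.
Lemma mulpA x y z : mulp x (mulp y z) = mulp (mulp x y) z.
Proof. by rewrite /mulp /= !mulrA. Qed.

Definition ta_mul (s t : seq E) : seq E := [seq mulp x y | x <- s, y <- t].

Fact ta_mul_consr s y t :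
  perm_eq (ta_mul s (y :: t)) ([seq mulp x y | x <- s] ++ ta_mul s t).
Proof.
by apply/permPl; exact: (perm_allpairs_consr mulp s (fun=> y) (fun=> t)).
Qed.

Fact ta_mulC s t : tens_eq (ta_mul s t) (ta_mul t s).
Proof.
apply: tens_perm; elim: s => [|x s IH]; first by rewrite /ta_mul allpairs0r.
rewrite perm_sym (permPl (ta_mul_consr _ _ _)) perm_sym.
rewrite /ta_mul allpairs_cons (@eq_map _ _ (mulp x) (mulp^~ x)).
  by rewrite perm_cat2l.
by move=> z; exact: mulpC.
Qed.

Fact ta_mulEl s s' t : tens_eq s s' -> tens_eq (ta_mul s t) (ta_mul s' t).
Proof.
move=> ss; elim: t => [|y t IH].
  by rewrite /ta_mul !allpairs0r; exact: tens_refl.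
apply: tens_trans (tens_perm (ta_mul_consr _ _ _)) _.
apply: tens_trans; last exact/tens_sym/tens_perm/ta_mul_consr.
apply: tens_cat => //.
apply: tens_map ss => [z|x x' z|x z z'|a x z]; rewrite /mulp /= ?mul0r //.
- by rewrite mulrDl; exact: tens_addl.
- by rewrite mulrDl; exact: tens_addr.
- have E1 (u v : restr f) : a *: u * v = a *: (u * v).
    by rewrite /GRing.scale /= /restr_scale mulrA.
  by rewrite !E1; exact: tens_scale.
Qed.

Fact ta_mulE s t s' t' : tens_eq s s' -> tens_eq t t' ->
  tens_eq (ta_mul s t) (ta_mul s' t').
Proof.
move=> ss tt; apply: tens_trans (ta_mulEl t ss) _.
apply: tens_trans (ta_mulC _ _) _; apply: tens_trans (ta_mulEl _ tt) _.
exact: ta_mulC.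
Qed.

Fact ta_mulA s t u :
  tens_eq (ta_mul s (ta_mul t u)) (ta_mul (ta_mul s t) u).
Proof.
suff -> : ta_mul s (ta_mul t u) = ta_mul (ta_mul s t) u by exact: tens_refl.
elim: s => [//|x s IH]; rewrite /ta_mul !allpairs_cons allpairs_cat.
rewrite -/(ta_mul _ _) -/(ta_mul s _) -/(ta_mul s t) -/(ta_mul (ta_mul s t) u).
rewrite IH; congr (_ ++ _); rewrite /ta_mul map_allpairs allpairs_mapl.
by apply: eq_allpairs => y z; rewrite mulpA.
Qed.

Fact ta_mul1 s : tens_eq (ta_mul [:: (1, 1)] s) s.
Proof.
rewrite /ta_mul allpairs1l map_id_in; first exact: tens_refl.
by case=> x y _; rewrite /mulp /= !mul1r.
Qed.

Fact ta_mulD s t u :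
  tens_eq (ta_mul (s ++ t) u) (ta_mul s u ++ ta_mul t u).
Proof. by rewrite /ta_mul allpairs_cat; exact: tens_refl. Qed.

Definition tens_ring : preRing :=
  @PreRing BB [:: (1, 1)] ta_mul ta_mulE ta_mulA ta_mulC ta_mul1 ta_mulD.

(* B (x)_A B with (b (x) c) (b' (x) c') = bb' (x) cc'. *)
Definition tensor_sq : comPzRingType := quotr tens_ring.

Definition ta_pure (x y : B) : tensor_sq := @rpi tens_ring [:: (x, y)].

Definition tensor_inl (b : B) : tensor_sq := ta_pure b 1.
Definition tensor_inr (b : B) : tensor_sq := ta_pure 1 b.

Lemma ta_pureDl x x' y : ta_pure (x + x') y = ta_pure x y + ta_pure x' y.
Proof. by rewrite rpiD; apply/rpiE; exact: tens_addl. Qed.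
Lemma ta_pureDr x y y' : ta_pure x (y + y') = ta_pure x y + ta_pure x y'.
Proof. by rewrite rpiD; apply/rpiE; exact: tens_addr. Qed.
Lemma ta_pureM x y x' y' :
  ta_pure x y * ta_pure x' y' = ta_pure (x * x') (y * y').
Proof. by rewrite rpiM. Qed.

Fact tensor_inl_zmod : zmod_morphism tensor_inl.
Proof.
move=> x y; apply/eqP; rewrite eq_sym subr_eq; apply/eqP.
by rewrite /tensor_inl -ta_pureDl subrK.
Qed.
Fact tensor_inl_monoid : monoid_morphism tensor_inl.
Proof. by split=> // x y; rewrite /tensor_inl ta_pureM mulr1. Qed.
HB.instance Definition _ :=
  GRing.isZmodMorphism.Build B tensor_sq tensor_inl tensor_inl_zmod.
HB.instance Definition _ :=
  GRing.isMonoidMorphism.Build B tensor_sq tensor_inl tensor_inl_monoid.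

Fact tensor_inr_zmod : zmod_morphism tensor_inr.
Proof.
move=> x y; apply/eqP; rewrite eq_sym subr_eq; apply/eqP.
by rewrite /tensor_inr -ta_pureDr subrK.
Qed.
Fact tensor_inr_monoid : monoid_morphism tensor_inr.
Proof. by split=> // x y; rewrite /tensor_inr ta_pureM mulr1. Qed.
HB.instance Definition _ :=
  GRing.isZmodMorphism.Build B tensor_sq tensor_inr tensor_inr_zmod.
HB.instance Definition _ :=
  GRing.isMonoidMorphism.Build B tensor_sq tensor_inr tensor_inr_monoid.

Definition ta_sum (s : tens_ring) : B := \sum_(x <- (s : seq E)) x.1 * x.2.

(* The map b (x) c |-> bc. *)
Definition tensor_mult : tensor_sq -> B := qlift ta_sum.

Lemma tensor_multE s : tensor_mult (rpi s) = ta_sum s.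
Proof.
apply: qliftE => {s} s t; rewrite /ta_sum; elim=> {s t}.
- by move=> s t; exact: perm_big.
- by move=> s t _ ->.
- by move=> s t u _ -> _ ->.
- by move=> s t s' t' _ e _ e'; rewrite !big_cat /= e e'.
- by move=> y; rewrite big_seq1 big_nil mul0r.
- by move=> *; rewrite !big_cons !big_nil /= mulrDl !addr0.
- by move=> *; rewrite !big_cons !big_nil /= mulrDr !addr0.
- move=> a x y; rewrite !big_seq1 /=.
  by rewrite /GRing.scale /= /restr_scale -mulrA mulrCA.
Qed.

Fact tensor_mult_zmod : zmod_morphism tensor_mult.
Proof.
move=> X Y; apply/eqP; rewrite eq_sym subr_eq; apply/eqP.
suff D U V : tensor_mult (U + V) = tensor_mult U + tensor_mult V.
  by rewrite -D subrK.
elim/rpiW: U => s; elim/rpiW: V => t.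
by rewrite rpiD !tensor_multE /ta_sum big_cat.
Qed.
Fact tensor_mult_monoid : monoid_morphism tensor_mult.
Proof.
split; first by rewrite rpi1 tensor_multE /ta_sum big_seq1 mulr1.
elim/rpiW=> s; elim/rpiW=> t; rewrite rpiM !tensor_multE /ta_sum.
rewrite big_flatten big_map mulr_suml; apply: eq_bigr => x _.
by rewrite big_map mulr_sumr; apply: eq_bigr => y _; rewrite mulrACA.
Qed.
HB.instance Definition _ :=
  GRing.isZmodMorphism.Build tensor_sq B tensor_mult tensor_mult_zmod.
HB.instance Definition _ :=
  GRing.isMonoidMorphism.Build tensor_sq B tensor_mult tensor_mult_monoid.

End Restr.

Arguments tensor_inl {A B} f b.
Arguments tensor_inr {A B} f b.
Arguments tensor_mult {A B} f X.

Definition exact_seq (U V W : zmodType) (u : U -> V) (v : V -> W) : Prop :=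
  forall y, v y = 0 <-> exists x, u x = y.

Definition flat (A B : comPzRingType) (f : {rmorphism A -> B}) : Prop :=
  forall (L M N : lmodType A) (u : {linear L -> M}) (v : {linear M -> N}),
    exact_seq u v ->
    exact_seq (tensor_map (M := restr f) u) (tensor_map (M := restr f) v).

(* A complex of A-modules is exact iff its base change to B is. *)
Definition faithfully_flat (A B : comPzRingType) (f : {rmorphism A -> B}) :
    Prop :=
  forall (L M N : lmodType A) (u : {linear L -> M}) (v : {linear M -> N}),
    (forall x, v (u x) = 0) ->
    exact_seq u v <->
    exact_seq (tensor_map (M := restr f) u) (tensor_map (M := restr f) v).

Definition weakly_etale (A B : comPzRingType) (f : {rmorphism A -> B}) :
    Prop :=
  flat f /\ flat (tensor_mult f).

(* Polynomials are coefficient sequences, since {poly R} needs R nonzero. *)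
Definition finite_coefs (R : comPzRingType) (p : nat -> R) : Prop :=
  exists n, forall k, (n <= k)%N -> p k = 0.

Definition monic_coefs (R : comPzRingType) (p : nat -> R) : Prop :=
  exists n, p n = 1 /\ forall k, (n < k)%N -> p k = 0.

Definition pmul (R : comPzRingType) (p q : nat -> R) (n : nat) : R :=
  \sum_(i < n.+1) p i * q (n - i)%N.

Definition pone (R : comPzRingType) (n : nat) : R := (n == 0%N)%:R.

Definition cong (R : comPzRingType) (I : set R) (p q : nat -> R) : Prop :=
  forall n, I (p n - q n).

(* Polynomials over R / I are given by lifts to R; a monic polynomial over
   R / I has a monic lift. *)
Definition henselian_pair (R : comPzRingType) (I : set R) : Prop :=
  [/\ ideal I,
      (forall m, maximal_ideal m -> I `<=` m)
    & forall f g0 h0 : nat -> R, monic_coefs f -> monic_coefs g0 -> monic_coefs h0 ->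
        cong I f (pmul g0 h0) ->
        (exists u v : nat -> R, [/\ finite_coefs u, finite_coefs v
          & cong I (fun n => pmul u g0 n + pmul v h0 n) (@pone R)]) ->
        exists g h : nat -> R, [/\ monic_coefs g, monic_coefs h,
          (forall n, f n = pmul g h n), cong I g g0 & cong I h h0]].

(* The Henselization of the pair (R, J): the universal map from (R, J) to a
   Henselian pair. *)
Record henselization (R : comPzRingType) (J : set R) := Henselization {
  hz_ring : comPzRingType;
  hz_ideal : set hz_ring;
  hz_map : {rmorphism R -> hz_ring};
  hz_sub : hz_map @` J `<=` hz_ideal;
  hz_henselian : henselian_pair hz_ideal;
  hz_universal : forall (S : comPzRingType) (K : set S)
      (g : {rmorphism R -> S}), henselian_pair K -> g @` J `<=` K ->
    exists! g' : {rmorphism hz_ring -> S},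
      g' @` hz_ideal `<=` K /\ forall x, g' (hz_map x) = g x
}.

Section Henselize.
Variables (R S : comPzRingType) (J : set R) (K : set S).
Variables (HJ : henselization J) (HK : henselization K).
Variables (g : {rmorphism R -> S}) (gJ : g @` J `<=` K).

Fact henselize_sub :
  ((hz_map HK \o g : {rmorphism R -> hz_ring HK}) @` J) `<=` @hz_ideal _ _ HK.
Proof.
move=> _ [x Jx <-] /=; apply: hz_sub; exists (g x) => //.
by apply: gJ; exists x.
Qed.

Definition henselize : {rmorphism hz_ring HJ -> hz_ring HK} :=
  projT1 (cid (hz_universal HJ (@hz_henselian _ _ HK) henselize_sub)).

Lemma henselizeE x : henselize (hz_map HJ x) = hz_map HK (g x).
Proof.
by rewrite /henselize; case: cid => g' /= [[_ h] _]; exact: h.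
Qed.

End Henselize.

Lemma extend_sub (R S T : comPzRingType) (f : {rmorphism R -> S})
    (g : {rmorphism S -> T}) (k : {rmorphism R -> T}) (I : set R) :
  (forall x, g (f x) = k x) -> g @` (extend f I) `<=` extend k I.
Proof.
move=> gf _ [x fx <-] J [[J0 JD JM] IJ].
apply: (fx (g @^-1` J)); split=> [|_ [a Ia <-] /=].
  split=> [|a b|a b] /=; rewrite ?rmorph0 ?rmorphD ?rmorphM //; first exact: JD.
  exact: JM.
by rewrite gf; apply: IJ; exists a.
Qed.


Section SquareIdeal.
Variables (A B : comPzRingType) (f : {rmorphism A -> B}) (I : set A).

Definition tensor_sq_map : {rmorphism A -> tensor_sq f} := tensor_inl f \o f.

Lemma tensor_sq_mapE a : tensor_inr f (f a) = tensor_sq_map a.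
Proof.
apply/rpiE; apply: tens_sym; rewrite -(mulr1 (f a)).
exact: (@tens_scale A (restr f) (restr f) a 1 1).
Qed.

Lemma inl_sub : tensor_inl f @` extend f I `<=` extend tensor_sq_map I.
Proof. exact: extend_sub. Qed.

Lemma inr_sub : tensor_inr f @` extend f I `<=` extend tensor_sq_map I.
Proof. exact: extend_sub tensor_sq_mapE. Qed.

End SquareIdeal.

Arguments inl_sub {A B} f I [t] _.
Arguments inr_sub {A B} f I [t] _.

Record opens (X : topologicalType) := Opens {
  oset :> set X;
  openP : open oset
}.

Definition opensI (X : topologicalType) (U V : opens X) : opens X :=
  Opens (openI (openP U) (openP V)).

Lemma opensIl (X : topologicalType) (U V : opens X) : opensI U V `<=` U.
Proof. by move=> x []. Qed.
Lemma opensIr (X : topologicalType) (U V : opens X) : opensI U V `<=` V.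
Proof. by move=> x []. Qed.

Definition preimo (Y X : topologicalType) (f : Y -> X) (cf : continuous f)
  (U : opens X) : opens Y :=
  @Opens Y (f @^-1` U) ((continuousP f).1 cf U (openP U)).

Lemma preimoS (Y X : topologicalType) (f : Y -> X) (cf : continuous f)
  (U V : opens X) : V `<=` U -> preimo cf V `<=` preimo cf U.
Proof. by move=> h y; exact: h. Qed.

Arguments preimoS {Y X f} cf {U V} _.

Record ringedSpace := RingedSpace {
  rs_space :> topologicalType;
  sect : opens rs_space -> comPzRingType;
  res : forall U V : opens rs_space, V `<=` U -> {rmorphism sect U -> sect V};
  res_id : forall (U : opens rs_space) (h : U `<=` U) s, res h s = s;
  res_comp : forall (U V W : opens rs_space) (h : V `<=` U) (k : W `<=` V)
    (l : W `<=` U) s, res k (res h s) = res l s;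
  sheaf_glue : forall (U : opens rs_space) (I : Type) (V : I -> opens rs_space)
    (VU : forall i, V i `<=` U), U `<=` \bigcup_i V i ->
    forall s : (forall i, sect (V i)),
      (forall i j, res (@opensIl _ (V i) (V j)) (s i) =
                   res (@opensIr _ (V i) (V j)) (s j)) ->
    exists! t : sect U, forall i, res (VU i) t = s i
}.

Section Stalk.
Variables (X : ringedSpace) (x : X).

Record germ_pair := GermPair {
  gp_nbhd : opens X;
  gp_mem : oset gp_nbhd x;
  gp_sect : sect gp_nbhd
}.

Definition germ_eq (s t : germ_pair) : Prop :=
  exists (W : opens X) (h : W `<=` gp_nbhd s) (k : W `<=` gp_nbhd t),
    oset W x /\ res h (gp_sect s) = res k (gp_sect t).

Let resC (U V V' W : opens X) (h : V `<=` U) (k : W `<=` V)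
    (h' : V' `<=` U) (k' : W `<=` V') s : res k (res h s) = res k' (res h' s).
Proof.
have l : W `<=` U by move=> z /k /h.
by rewrite (res_comp h k l) (res_comp h' k' l).
Qed.

Fact germ_refl s : germ_eq s s.
Proof.
exists (gp_nbhd s), (fun _ => id), (fun _ => id); split=> //.
exact: gp_mem.
Qed.
Fact germ_sym s t : germ_eq s t -> germ_eq t s.
Proof. by move=> [W [h [k [Wx e]]]]; exists W, k, h. Qed.
Fact germ_trans s t u : germ_eq s t -> germ_eq t u -> germ_eq s u.
Proof.
move=> [W [h [k [Wx e]]]] [W' [h' [k' [Wx' e']]]].
pose V := opensI W W'.
have VW : V `<=` W by apply: opensIl.
have VW' : V `<=` W' by apply: opensIr.
have hs : V `<=` gp_nbhd s by move=> z /VW /h.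
have ht : V `<=` gp_nbhd t by move=> z /VW /k.
have hu : V `<=` gp_nbhd u by move=> z /VW' /k'.
exists V, hs, hu; split; first by split.
rewrite -(res_comp h VW hs) e (res_comp k VW ht).
by rewrite -(res_comp k' VW' hu) -e' (res_comp h' VW' ht).
Qed.

Definition germ_const (a : sect (Opens openT)) : germ_pair :=
  @GermPair (Opens openT) I a.

Definition germ_opp (s : germ_pair) : germ_pair :=
  GermPair (gp_mem s) (- gp_sect s).

Definition germ_op2 (op : forall R : comPzRingType, R -> R -> R)
    (s t : germ_pair) : germ_pair :=
  @GermPair (opensI (gp_nbhd s) (gp_nbhd t)) (conj (gp_mem s) (gp_mem t))
    (op _ (res (@opensIl _ _ _) (gp_sect s))
          (res (@opensIr _ _ _) (gp_sect t))).

Definition germ_add := germ_op2 (fun R => +%R).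
Definition germ_mul := germ_op2 (fun R => *%R).

Fact germ_oppE s t : germ_eq s t -> germ_eq (germ_opp s) (germ_opp t).
Proof.
move=> [W [h [k [Wx e]]]]; exists W, h, k; split=> //=.
by rewrite !rmorphN e.
Qed.

(* Comparing germs on a neighbourhood contained in all domains. *)
Let germ_eqI (s t : germ_pair) (W : opens X) (h : W `<=` gp_nbhd s)
    (k : W `<=` gp_nbhd t) : oset W x -> res h (gp_sect s) = res k (gp_sect t) ->
  germ_eq s t.
Proof. by move=> Wx e; exists W, h, k. Qed.

Definition op_res (op : forall R : comPzRingType, R -> R -> R) :=
  forall (R S : comPzRingType) (f : {rmorphism R -> S}) a b,
    f (op _ a b) = op _ (f a) (f b).

Let germ_op2E op (op_resP : op_res op) s t s' t' :
  germ_eq s s' -> germ_eq t t' -> germ_eq (germ_op2 op s t) (germ_op2 op s' t').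
Proof.
move=> [W [h [k [Wx e]]]] [W' [h' [k' [Wx' e']]]].
pose V := opensI W W'.
have VW : V `<=` W by apply: opensIl.
have VW' : V `<=` W' by apply: opensIr.
have a : V `<=` gp_nbhd (germ_op2 op s t).
  by move=> z zV; split; [exact/h/VW | exact/h'/VW'].
have b : V `<=` gp_nbhd (germ_op2 op s' t').
  by move=> z zV; split; [exact/k/VW | exact/k'/VW'].
apply: (germ_eqI (W := V) (h := a) (k := b)); first by split.
rewrite /= !op_resP; congr (op _ _ _).
  by rewrite (resC _ a h VW) e (resC _ b k VW).
by rewrite (resC _ a h' VW') e' (resC _ b k' VW').
Qed.

Fact add_res : op_res (fun R => +%R). Proof. by move=> *; exact: rmorphD. Qed.
Fact mul_res : op_res (fun R => *%R). Proof. by move=> *; exact: rmorphM. Qed.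

Let resE (U V W : opens X) (h : V `<=` U) (k : W `<=` V) s :
  res k (res h s) = res (fun z Wz => h z (k z Wz)) s.
Proof. exact: res_comp. Qed.

Let res_irr (U V : opens X) (h k : V `<=` U) s : res h s = res k s.
Proof. by rewrite (Prop_irrelevance h k). Qed.

Let germ_op2A op (op_resP : op_res op)
    (opA : forall R : comPzRingType, associative (op R)) s t u :
  germ_eq (germ_op2 op s (germ_op2 op t u)) (germ_op2 op (germ_op2 op s t) u).
Proof.
pose V := opensI (gp_nbhd s) (opensI (gp_nbhd t) (gp_nbhd u)).
have b : V `<=` gp_nbhd (germ_op2 op (germ_op2 op s t) u).
  by move=> z [? []].
have a : V `<=` gp_nbhd (germ_op2 op s (germ_op2 op t u)) by [].
apply: (germ_eqI (W := V) (h := a) (k := b)).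
  by do 2?split; exact: gp_mem.
rewrite /= !op_resP !resE opA.
by congr (op _ (op _ _ _) _); exact: res_irr.
Qed.

Let germ_op2C op (op_resP : op_res op)
    (opC : forall R : comPzRingType, commutative (op R)) s t :
  germ_eq (germ_op2 op s t) (germ_op2 op t s).
Proof.
pose V := opensI (gp_nbhd s) (gp_nbhd t).
have a : V `<=` gp_nbhd (germ_op2 op s t) by [].
have b : V `<=` gp_nbhd (germ_op2 op t s) by move=> z [].
apply: (germ_eqI (W := V) (h := a) (k := b)).
  by split; exact: gp_mem.
by rewrite /= !op_resP !resE opC; congr (op _ _ _); exact: res_irr.
Qed.

Fact germ_add0 s : germ_eq (germ_add (germ_const 0) s) s.
Proof.
have a : gp_nbhd s `<=` gp_nbhd (germ_add (germ_const 0) s) by [].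
have b : gp_nbhd s `<=` gp_nbhd s by [].
apply: (germ_eqI (h := a) (k := b)); first exact: gp_mem.
by rewrite /= rmorphD !resE rmorph0 add0r; exact: res_irr.
Qed.
Fact germ_mul1 s : germ_eq (germ_mul (germ_const 1) s) s.
Proof.
have a : gp_nbhd s `<=` gp_nbhd (germ_mul (germ_const 1) s) by [].
have b : gp_nbhd s `<=` gp_nbhd s by [].
apply: (germ_eqI (h := a) (k := b)); first exact: gp_mem.
by rewrite /= rmorphM !resE rmorph1 mul1r; exact: res_irr.
Qed.
Fact germ_addN s : germ_eq (germ_add (germ_opp s) s) (germ_const 0).
Proof.
have a : gp_nbhd s `<=` gp_nbhd (germ_add (germ_opp s) s) by [].
have b : gp_nbhd s `<=` gp_nbhd (germ_const 0) by [].
apply: (germ_eqI (h := a) (k := b)); first exact: gp_mem.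
rewrite /= rmorphD !resE /= !rmorphN rmorph0.
by apply/eqP; rewrite addrC subr_eq0; apply/eqP; exact: res_irr.
Qed.
Fact germ_mulD s t u :
  germ_eq (germ_mul (germ_add s t) u) (germ_add (germ_mul s u) (germ_mul t u)).
Proof.
pose V := opensI (opensI (gp_nbhd s) (gp_nbhd t)) (gp_nbhd u).
have b : V `<=` gp_nbhd (germ_add (germ_mul s u) (germ_mul t u)).
  by move=> z [[? ?] ?].
have a : V `<=` gp_nbhd (germ_mul (germ_add s t) u) by [].
apply: (germ_eqI (W := V) (h := a) (k := b)).
  by do 2?split; exact: gp_mem.
rewrite /= !(rmorphM, rmorphD) !resE /= mulrDl.
by congr (_ * _ + _ * _); exact: res_irr.
Qed.

Definition germ_zmod : preZmod :=
  @PreZmod germ_pair germ_eq (germ_const 0) germ_opp germ_add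
    germ_refl germ_sym germ_trans germ_oppE
    (fun s t s' t' => @germ_op2E _ add_res s t s' t')
    (germ_op2A add_res (fun R => @addrA R))
    (germ_op2C add_res (fun R => @addrC R))
    germ_add0 germ_addN.

Definition germ_ring : preRing :=
  @PreRing germ_zmod (germ_const 1) germ_mul
    (fun s t s' t' => @germ_op2E _ mul_res s t s' t')
    (germ_op2A mul_res (fun R => @mulrA R))
    (germ_op2C mul_res (fun R => @mulrC R))
    germ_mul1 germ_mulD.

Definition stalk : comPzRingType := quotr germ_ring.

Definition germ (U : opens X) (Ux : oset U x) (s : sect U) : stalk :=
  @rpi germ_ring (GermPair Ux s).

Lemma germW (Q : stalk -> Prop) :
  (forall U (Ux : oset U x) s, Q (germ Ux s)) -> forall c, Q c.
Proof. by move=> h; elim/rpiW => -[U Ux s]; exact: h. Qed.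

Lemma germ_res (U V : opens X) (h : V `<=` U) (Ux : oset U x) (Vx : oset V x) s :
  germ Vx (res h s) = germ Ux s.
Proof.
apply/rpiE; exists V, (fun _ => id), h; split=> //=.
by rewrite resE; exact: res_irr.
Qed.

Lemma germD (U : opens X) (Ux : oset U x) s t :
  germ Ux s + germ Ux t = germ Ux (s + t).
Proof.
rewrite rpiD; apply/rpiE.
have a : U `<=` opensI U U by [].
exists U, a, (fun _ => id); split=> //=.
by rewrite !rmorphD !resE /=; congr (_ + _); exact: res_irr.
Qed.

Lemma germM (U : opens X) (Ux : oset U x) s t :
  germ Ux s * germ Ux t = germ Ux (s * t).
Proof.
rewrite rpiM; apply/rpiE.
have a : U `<=` opensI U U by [].
exists U, a, (fun _ => id); split=> //=.
by rewrite !rmorphM !resE /=; congr (_ * _); exact: res_irr.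
Qed.

Lemma germ1 (U : opens X) (Ux : oset U x) : germ Ux 1 = 1.
Proof.
apply/rpiE; have a : U `<=` Opens openT by [].
by exists U, (fun _ => id), a; split; rewrite //= !rmorph1.
Qed.

Lemma germ0 (U : opens X) (Ux : oset U x) : germ Ux 0 = 0.
Proof.
apply/rpiE; have a : U `<=` Opens openT by [].
by exists U, (fun _ => id), a; split; rewrite //= !rmorph0.
Qed.

Lemma germ2W (Q : stalk -> stalk -> Prop) :
  (forall U (Ux : oset U x) s t, Q (germ Ux s) (germ Ux t)) -> forall c d, Q c d.
Proof.
move=> h; elim/germW=> U Ux s; elim/germW=> V Vx t.
have UVx : oset (opensI U V) x by split.
rewrite -(germ_res (@opensIl _ U V) Ux UVx).
by rewrite -(germ_res (@opensIr _ U V) Vx UVx).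
Qed.

End Stalk.

Record rs_hom (Y X : ringedSpace) := RsHom {
  rh_fun :> Y -> X;
  rh_cont : continuous rh_fun;
  rh_sharp : forall U : opens X,
    {rmorphism sect U -> sect (preimo rh_cont U)};
  rh_res : forall (U V : opens X) (h : V `<=` U) s,
    rh_sharp V (res h s) =
    res (preimoS rh_cont h) (rh_sharp U s)
}.

Arguments rh_cont {Y X} r.
Arguments rh_sharp {Y X} r U.

Definition stalk_map (Y X : ringedSpace) (f : rs_hom Y X) (y : Y) :
    stalk (f y) -> stalk y :=
  qlift (fun s : germ_ring (f y) =>
    @germ Y y (preimo (rh_cont f) (gp_nbhd s)) (gp_mem s)
      (rh_sharp f _ (gp_sect s))).

Lemma stalk_mapE (Y X : ringedSpace) (f : rs_hom Y X) (y : Y) (U : opens X)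
    (Ux : oset U (f y)) s :
  stalk_map (germ Ux s) =
  @germ Y y (preimo (rh_cont f) U) Ux (rh_sharp f U s).
Proof.
rewrite /stalk_map qliftE // => {Ux} a b [W [h [k [Wx e]]]].
have Wx' : oset (preimo (rh_cont f) W) y by [].
rewrite -(@germ_res Y y _ (preimo (rh_cont f) W) (preimoS (rh_cont f) h) _ Wx').
rewrite -(@germ_res Y y _ (preimo (rh_cont f) W) (preimoS (rh_cont f) k) _ Wx').
by rewrite -!rh_res e.
Qed.

Record lrs := Lrs {
  lrs_rs :> ringedSpace;
  lrs_local : forall x : lrs_rs, local_ring (stalk x)
}.

Record lrs_hom (Y X : lrs) := LrsHom {
  lh_hom :> rs_hom Y X;
  lh_local : forall y, local_map (@stalk_map Y X lh_hom y)
}.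

Section Comp.
Variables (Z Y X : lrs) (f : lrs_hom Y X) (g : lrs_hom Z Y).

Fact comp_cont : continuous (f \o g).
Proof.
apply/continuousP => U oU.
exact: openP (preimo (rh_cont g) (preimo (rh_cont f) (Opens oU))).
Qed.

Fact comp_sub (U : opens X) :
  preimo comp_cont U `<=` preimo (rh_cont g) (preimo (rh_cont f) U).
Proof. by []. Qed.

(* The restriction below is along an equality of open sets. *)
Definition comp_sharp (U : opens X) : sect U -> sect (preimo comp_cont U) :=
  res (@comp_sub U)
    \o rh_sharp g (preimo (rh_cont f) U) \o rh_sharp f U.

HB.instance Definition _ U := GRing.RMorphism.on (@comp_sharp U).

Fact comp_res (U V : opens X) (h : V `<=` U) s :
  comp_sharp (res h s) =
  res (preimoS comp_cont h) (comp_sharp s).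
Proof.
rewrite /comp_sharp /= !rh_res.
have l : preimo comp_cont V `<=` preimo (rh_cont g) (preimo (rh_cont f) U).
  by move=> z; exact: h.
by rewrite !(res_comp _ _ l).
Qed.

Definition rs_comp : rs_hom Z X :=
  @RsHom Z X (f \o g) comp_cont (fun U => @comp_sharp U) comp_res.

Fact comp_local z : local_map (@stalk_map Z X rs_comp z).
Proof.
move=> m n Mm Mn _ [c mc <-].
have [l [Ml _]] := lrs_local (g z).
have -> : stalk_map (f := rs_comp) c = stalk_map (f := g) (stalk_map (f := f) c).
  move: {mc} c; elim/germW => U Ux s.
  rewrite (@stalk_mapE Z X rs_comp z U Ux s).
  rewrite (@stalk_mapE Y X f (g z) U Ux s) stalk_mapE.
  exact: (germ_res (comp_sub (U := U))).
apply: (lh_local Ml Mn); exists (stalk_map (f := f) c) => //.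
by apply: (lh_local Mm Ml); exists c.
Qed.

Definition lrs_comp : lrs_hom Z X := LrsHom comp_local.

End Comp.
Record spec (R : comPzRingType) := SpecPt {
  spec_ideal :> set R;
  spec_prime : prime_ideal spec_ideal
}.

Section PrimeTheory.
Variables (R : comPzRingType) (p : spec R).
Local Notation "a \inp" := (spec_ideal p a) (at level 70).

Lemma prime0 : 0 \inp.
Proof. by have [[]] := spec_prime p. Qed.
Lemma primeD a b : a \inp -> b \inp -> (a + b) \inp.
Proof. by have [[_ h _] _ _] := spec_prime p; exact: h. Qed.
Lemma primeMl a b : b \inp -> (a * b) \inp.
Proof. by have [[_ _ h] _ _] := spec_prime p; exact: h. Qed.
Lemma primeMr a b : a \inp -> (a * b) \inp.
Proof. by rewrite mulrC; exact: primeMl. Qed.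
Lemma primeN1 : ~ 1 \inp.
Proof. by have [] := spec_prime p. Qed.
Lemma primeNM a b : ~ a \inp -> ~ b \inp -> ~ (a * b) \inp.
Proof. by have [_ _ h] := spec_prime p; move=> na nb /h[]. Qed.

End PrimeTheory.

Definition vanishing (R : comPzRingType) (E : set R) : set (spec R) :=
  [set p : spec R | E `<=` p].

Section SpecTopology.
Variable R : comPzRingType.

HB.instance Definition _ := gen_eqMixin (spec R).
HB.instance Definition _ := gen_choiceMixin (spec R).

Definition spec_open (U : set (spec R)) : Prop :=
  exists E : set R, U = ~` vanishing E.

Fact spec_openT : spec_open setT.
Proof.
exists setT; apply/seteqP; split=> // p _ h.
by apply: (@primeN1 _ p); exact: h.
Qed.

Lemma vanishingN (E : set R) (p : spec R) :
  (~` vanishing E) p <-> exists2 a, E a & ~ spec_ideal p a.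
Proof.
split=> [h|[a Ea na] h]; last by apply: na; exact: h.
apply: contrapT => h'; apply: h => a Ea; apply: contrapT => na.
by apply: h'; exists a.
Qed.

Fact spec_openI : setI_closed spec_open.
Proof.
move=> _ _ [E ->] [F ->].
exists [set c | exists a b, [/\ E a, F b & c = a * b]].
apply/seteqP; split=> p.
  move=> [/vanishingN[a Ea na] /vanishingN[b Fb nb]]; apply/vanishingN.
  by exists (a * b); [exists a, b | exact: primeNM].
move=> /vanishingN[_ [a [b [Ea Fb ->]]] nab].
split; apply/vanishingN; [exists a => // pa | exists b => // pb]; apply: nab.
  exact: primeMr.
exact: primeMl.
Qed.

Fact spec_open_bigU (I : Type) (U : I -> set (spec R)) :
  (forall i, spec_open (U i)) -> spec_open (\bigcup_i U i).
Proof.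
move=> h; exists (\bigcup_i projT1 (cid (h i))).
have hU i : U i = ~` vanishing (projT1 (cid (h i))) by case: cid.
apply/seteqP; split=> p.
  move=> [i _]; rewrite hU => /vanishingN[a Ea na]; apply/vanishingN.
  by exists a => //; exists i.
move=> /vanishingN[a [i _ Ea] na]; exists i => //; rewrite hU.
by apply/vanishingN; exists a.
Qed.

HB.instance Definition _ :=
  isOpenTopological.Build (spec R) spec_openT spec_openI spec_open_bigU.

Fact dopen_open (f : R) : open (~` vanishing [set f]).
Proof. by exists [set f]. Qed.
Definition dopen (f : R) : opens (spec R) := Opens (dopen_open f).

Lemma dopenE (f : R) (p : spec R) : oset (dopen f) p <-> ~ spec_ideal p f.
Proof.
split; first by move=> /vanishingN[_ ->].
by move=> nf; apply/vanishingN; exists f.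
Qed.

End SpecTopology.

Section Localization.
Variables (R : comPzRingType) (p : spec R).

Record frac_pair := FracPair {
  fp_num : R;
  fp_den : R;
  fp_denP : ~ spec_ideal p fp_den
}.

Definition frac_eq (x y : frac_pair) : Prop :=
  exists t, ~ spec_ideal p t /\
    t * (fp_num x * fp_den y - fp_num y * fp_den x) = 0.

Definition frac_zero := FracPair 0 (@primeN1 R p).
Definition frac_one := FracPair 1 (@primeN1 R p).
Definition frac_opp x := FracPair (- fp_num x) (@fp_denP x).
Definition frac_add x y :=
  FracPair (fp_num x * fp_den y + fp_num y * fp_den x)
    (primeNM (@fp_denP x) (@fp_denP y)).
Definition frac_mul x y :=
  FracPair (fp_num x * fp_num y) (primeNM (@fp_denP x) (@fp_denP y)).

Lemma frac_eqR x y : fp_num x * fp_den y = fp_num y * fp_den x -> frac_eq x y.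
Proof.
by move=> e; exists 1; split; [exact: primeN1 | rewrite e subrr mulr0].
Qed.

Fact frac_refl x : frac_eq x x. Proof. exact: frac_eqR. Qed.
Fact frac_sym x y : frac_eq x y -> frac_eq y x.
Proof.
by move=> [t [nt e]]; exists t; split=> //; rewrite -opprB mulrN e oppr0.
Qed.
Fact frac_trans x y z : frac_eq x y -> frac_eq y z -> frac_eq x z.
Proof.
case: x y z => [a f nf] [b g ng] [c h nh] [t /= [nt e]] [u /= [nu e']].
exists (t * u * g); split; first by do 2?apply: primeNM.
rewrite /=; transitivity
  (u * h * (t * (a * g - b * f)) + t * f * (u * (b * h - c * g))).
  by ring.
by rewrite e e' !mulr0 addr0.
Qed.
Fact frac_oppE x y : frac_eq x y -> frac_eq (frac_opp x) (frac_opp y).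
Proof.
move=> [t [nt e]]; exists t; split=> //=.
by rewrite !mulNr -opprD mulrN e oppr0.
Qed.
Fact frac_addE x y x' y' : frac_eq x x' -> frac_eq y y' ->
  frac_eq (frac_add x y) (frac_add x' y').
Proof.
case: x y x' y' => [a f nf] [b g ng] [a' f' nf'] [b' g' ng'].
move=> [t /= [nt e]] [u /= [nu e']].
exists (t * u); split; first exact: primeNM.
rewrite /=; transitivity (u * g * g' * (t * (a * f' - a' * f)) +
  t * f * f' * (u * (b * g' - b' * g))); first by ring.
by rewrite e e' !mulr0 addr0.
Qed.
Fact frac_mulE x y x' y' : frac_eq x x' -> frac_eq y y' ->
  frac_eq (frac_mul x y) (frac_mul x' y').
Proof.
case: x y x' y' => [a f nf] [b g ng] [a' f' nf'] [b' g' ng'].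
move=> [t /= [nt e]] [u /= [nu e']].
exists (t * u); split; first exact: primeNM.
rewrite /=; transitivity (u * b * g' * (t * (a * f' - a' * f)) +
  t * a' * f * (u * (b * g' - b' * g))); first by ring.
by rewrite e e' !mulr0 addr0.
Qed.

Definition frac_zmod : preZmod.
refine (@PreZmod frac_pair frac_eq frac_zero frac_opp frac_add
  frac_refl frac_sym frac_trans frac_oppE frac_addE _ _ _ _).
all: by intros; apply: frac_eqR => /=; ring.
Defined.

Definition frac_ring : preRing.
refine (@PreRing frac_zmod frac_one frac_mul frac_mulE _ _ _ _).
all: by intros; apply: frac_eqR => /=; ring.
Defined.

(* The localization of R at the prime ideal p. *)
Definition loc : comPzRingType := quotr frac_ring.

Definition frac (a f : R) (nf : ~ spec_ideal p f) : loc :=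
  @rpi frac_ring (FracPair a nf).

Lemma fracW (Q : loc -> Prop) :
  (forall a f (nf : ~ spec_ideal p f), Q (frac a nf)) -> forall x, Q x.
Proof. by move=> h; elim/rpiW => -[a f nf]; exact: h. Qed.

Lemma fracE a b f g (nf : ~ spec_ideal p f) (ng : ~ spec_ideal p g) :
  frac a nf = frac b ng <->
  exists t, ~ spec_ideal p t /\ t * (a * g - b * f) = 0.
Proof. exact: rpiE. Qed.

Lemma frac_eq_in a b f g (nf : ~ spec_ideal p f) (ng : ~ spec_ideal p g) :
  frac a nf = frac b ng -> spec_ideal p b -> spec_ideal p a.
Proof.
move=> /fracE[t [nt e]] pb; apply: contrapT => na.
apply: (primeNM (primeNM nt na) ng).
have -> : t * a * g = t * (a * g - b * f) + t * f * b by ring.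
by rewrite e add0r; exact: primeMl.
Qed.

Lemma fracD a b f g (nf : ~ spec_ideal p f) (ng : ~ spec_ideal p g) :
  frac a nf + frac b ng = frac (a * g + b * f) (primeNM nf ng).
Proof. exact: rpiD. Qed.
Lemma fracM a b f g (nf : ~ spec_ideal p f) (ng : ~ spec_ideal p g) :
  frac a nf * frac b ng = frac (a * b) (primeNM nf ng).
Proof. exact: rpiM. Qed.
Lemma fracN a f (nf : ~ spec_ideal p f) : - frac a nf = frac (- a) nf.
Proof. exact: rpiN. Qed.

End Localization.

Section SpecSheaf.
Variable R : comPzRingType.
Implicit Types U V W : opens (spec R).

(* A section over U is a family of elements of the local rings R_p, p in U,
   which is locally given by a fraction a / f. *)
Definition locally_frac U (s : forall p, oset U p -> loc p) : Prop :=
  forall p, oset U p -> exists V (a f : R), [/\ oset V p, V `<=` U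
    & forall q (Uq : oset U q), oset V q ->
        exists nf : ~ spec_ideal q f, s q Uq = frac a nf].

Record spec_sect U := SpecSect {
  ss_val :> forall p, oset U p -> loc p;
  ss_locP : locally_frac ss_val
}.

Lemma ss_eq U (s t : spec_sect U) :
  (forall p (Up : oset U p), s p Up = t p Up) -> s = t.
Proof.
case: s t => [s sP] [t tP] /= e.
have st : s = t.
  by apply: functional_extensionality_dep => p;
     apply: functional_extensionality_dep; exact: e.
by case: t / st tP {e} => tP; rewrite (Prop_irrelevance sP tP).
Qed.

Fact const_locP U (a : R) :
  locally_frac (fun p (_ : oset U p) => frac a (@primeN1 R p)).
Proof.
by move=> p Up; exists U, a, 1; split=> // q Uq _; exists (@primeN1 R q).
Qed.

Fact opp_locP U (s : spec_sect U) : locally_frac (fun p Up => - s p Up).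
Proof.
move=> p Up; have [V [a [f [Vp VU h]]]] := ss_locP s Up.
exists V, (- a), f; split=> // q Uq Vq; have [nf ->] := h q Uq Vq.
by exists nf; rewrite fracN.
Qed.

Fact add_locP U (s t : spec_sect U) :
  locally_frac (fun p Up => s p Up + t p Up).
Proof.
move=> p Up; have [V [a [f [Vp VU h]]]] := ss_locP s Up.
have [V' [b [g [Vp' VU' h']]]] := ss_locP t Up.
exists (opensI V V'), (a * g + b * f), (f * g); split=> //.
  by move=> q [/VU].
move=> q Uq [/(h q Uq)[nf ->] /(h' q Uq)[ng ->]].
by exists (primeNM nf ng); rewrite fracD.
Qed.

Fact mul_locP U (s t : spec_sect U) :
  locally_frac (fun p Up => s p Up * t p Up).
Proof.
move=> p Up; have [V [a [f [Vp VU h]]]] := ss_locP s Up.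
have [V' [b [g [Vp' VU' h']]]] := ss_locP t Up.
exists (opensI V V'), (a * b), (f * g); split=> //.
  by move=> q [/VU].
move=> q Uq [/(h q Uq)[nf ->] /(h' q Uq)[ng ->]].
by exists (primeNM nf ng); rewrite fracM.
Qed.

Section SpecSectRing.
Variable U : opens (spec R).

Definition ss_const a : spec_sect U := SpecSect (@const_locP U a).
Definition ss_opp s : spec_sect U := SpecSect (opp_locP s).
Definition ss_add s t : spec_sect U := SpecSect (add_locP s t).
Definition ss_mul s t : spec_sect U := SpecSect (mul_locP s t).

Fact ss_addA : associative ss_add.
Proof. by move=> s t u; apply: ss_eq => p Up /=; rewrite addrA. Qed.
Fact ss_addC : commutative ss_add.
Proof. by move=> s t; apply: ss_eq => p Up /=; rewrite addrC. Qed.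
Fact ss_add0 : left_id (ss_const 0) ss_add.
Proof. by move=> s; apply: ss_eq => p Up; exact: (add0r (s p Up)). Qed.
Fact ss_addN : left_inverse (ss_const 0) ss_opp ss_add.
Proof. by move=> s; apply: ss_eq => p Up; exact: (addNr (s p Up)). Qed.

HB.instance Definition _ := gen_eqMixin (spec_sect U).
HB.instance Definition _ := gen_choiceMixin (spec_sect U).
HB.instance Definition _ :=
  GRing.isZmodule.Build (spec_sect U) ss_addA ss_addC ss_add0 ss_addN.

Fact ss_mulA : associative ss_mul.
Proof. by move=> s t u; apply: ss_eq => p Up /=; rewrite mulrA. Qed.
Fact ss_mulC : commutative ss_mul.
Proof. by move=> s t; apply: ss_eq => p Up /=; rewrite mulrC. Qed.
Fact ss_mul1 : left_id (ss_const 1) ss_mul.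
Proof. by move=> s; apply: ss_eq => p Up; exact: (mul1r (s p Up)). Qed.
Fact ss_mulD : left_distributive ss_mul +%R.
Proof. by move=> s t u; apply: ss_eq => p Up /=; rewrite mulrDl. Qed.

HB.instance Definition _ :=
  GRing.Zmodule_isComPzRing.Build (spec_sect U)
    ss_mulA ss_mulC ss_mul1 ss_mulD.

End SpecSectRing.

Definition spec_ring U : comPzRingType := spec_sect U.

Fact res_locP U V (h : V `<=` U) (s : spec_sect U) :
  locally_frac (fun p (Vp : oset V p) => s p (h p Vp)).
Proof.
move=> p Vp; have [W [a [f [Wp WU k]]]] := ss_locP s (h p Vp).
exists (opensI V W), a, f; split=> //; first by move=> q [].
by move=> q Vq [_ Wq]; exact: k.
Qed.

Definition spec_res U V (h : V `<=` U) (s : spec_ring U) : spec_ring V :=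
  SpecSect (res_locP h s).

Fact spec_res_zmod U V (h : V `<=` U) : zmod_morphism (spec_res h).
Proof. by move=> s t; apply: ss_eq. Qed.
Fact spec_res_monoid U V (h : V `<=` U) : monoid_morphism (spec_res h).
Proof. by split=> [|s t]; apply: ss_eq. Qed.
HB.instance Definition _ U V (h : V `<=` U) :=
  GRing.isZmodMorphism.Build (spec_ring U) (spec_ring V) (spec_res h)
    (spec_res_zmod h).
HB.instance Definition _ U V (h : V `<=` U) :=
  GRing.isMonoidMorphism.Build (spec_ring U) (spec_ring V) (spec_res h)
    (spec_res_monoid h).

Fact spec_res_id U (h : U `<=` U) (s : spec_ring U) : spec_res h s = s.
Proof.
by apply: ss_eq => p Up /=; rewrite (Prop_irrelevance (h p Up) Up).
Qed.

Fact spec_res_comp U V W (h : V `<=` U) (k : W `<=` V) (l : W `<=` U)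
    (s : spec_ring U) : spec_res k (spec_res h s) = spec_res l s.
Proof.
apply: ss_eq => p Wp /=.
by rewrite (Prop_irrelevance (h p (k p Wp)) (l p Wp)).
Qed.

Fact spec_glue U (I : Type) (V : I -> opens (spec R))
    (VU : forall i, V i `<=` U) : U `<=` \bigcup_i V i ->
  forall s : (forall i, spec_ring (V i)),
    (forall i j, spec_res (@opensIl _ (V i) (V j)) (s i) =
                 spec_res (@opensIr _ (V i) (V j)) (s j)) ->
  exists! t : spec_ring U, forall i, spec_res (VU i) t = s i.
Proof.
move=> cov s comp.
have compE i j p (Vi : oset (V i) p) (Vj : oset (V j) p) :
    s i p Vi = s j p Vj.
  have Vij : oset (opensI (V i) (V j)) p by split.
  have /(congr1 (fun t : spec_ring _ => ss_val t Vij)) /= := comp i j.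
  by rewrite (Prop_irrelevance (opensIl Vij) Vi)
             (Prop_irrelevance (opensIr Vij) Vj).
have idx p (Up : oset U p) : {i | oset (V i) p}.
  by apply: cid; have [i _ Vi] := cov p Up; exists i.
pose t p Up := s (projT1 (idx p Up)) p (projT2 (idx p Up)).
have tE i p (Up : oset U p) (Vi : oset (V i) p) : t p Up = s i p Vi.
  exact: compE.
have tP : locally_frac t.
  move=> p Up; have [i _ Vi] := cov p Up.
  have [W [a [f [Wp WV h]]]] := ss_locP (s i) Vi.
  exists W, a, f; split=> //; first by move=> q /WV /VU.
  by move=> q Uq Wq; rewrite (tE i q Uq (WV q Wq)); exact: h.
exists (SpecSect tP); split=> [i|u hu]; first by apply: ss_eq => p Vp; exact: tE.
apply: ss_eq => p Up /=; have [i _ Vi] := cov p Up.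
rewrite (tE i p Up Vi) -hu /=.
by rewrite (Prop_irrelevance (VU i p Vi) Up).
Qed.

Definition spec_rs : ringedSpace :=
  @RingedSpace (spec R) spec_ring (fun U V h => @spec_res U V h)
    spec_res_id spec_res_comp spec_glue.

Section SpecStalk.
Variable p : spec R.

Definition germ_eval : stalk (X := spec_rs) p -> loc p :=
  qlift (fun s : germ_ring (X := spec_rs) p =>
    ss_val (gp_sect s : spec_sect _) (gp_mem s)).

Lemma germ_evalE U (Up : oset U p) (s : spec_sect U) :
  germ_eval (@germ spec_rs p U Up s) = s p Up.
Proof.
rewrite /germ_eval qliftE // => {s Up} x y [W [h [k [Wp e]]]].
have /(congr1 (fun t : spec_ring _ => ss_val t Wp)) /= := e.
by rewrite (Prop_irrelevance (h p Wp) (gp_mem x))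
           (Prop_irrelevance (k p Wp) (gp_mem y)).
Qed.

Definition stalk_max : set (stalk (X := spec_rs) p) :=
  [set c | exists (a f : R) (nf : ~ spec_ideal p f),
    spec_ideal p a /\ germ_eval c = frac a nf].

Fact stalk_max_ideal : ideal stalk_max.
Proof.
split.
- exists 0, 1, (@primeN1 R p); split; first exact: prime0.
  by rewrite -(@germ0 spec_rs p (Opens openT) Logic.I) germ_evalE.
- apply: (@germ2W spec_rs p) => U Up s t; rewrite germD.
  move=> [a [f [nf [pa]]]]; rewrite germ_evalE => ea.
  move=> [b [g [ng [pb]]]]; rewrite germ_evalE => eb.
  exists (a * g + b * f), (f * g), (primeNM nf ng); split.
    by apply: primeD; exact: primeMr.
  by rewrite germ_evalE -fracD -ea -eb.
- apply: (@germ2W spec_rs p) => U Up s t; rewrite germM.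
  move=> [b [g [ng [pb]]]]; rewrite germ_evalE => eb.
  rewrite /stalk_max /= germ_evalE.
  have -> : (s * t : spec_sect U) p Up = s p Up * t p Up by [].
  rewrite eb; elim/fracW: (s p Up) => a f nf.
  exists (a * b), (f * g), (primeNM nf ng); split; first exact: primeMl.
  exact: fracM.
Qed.

Fact stalk_max_unit c : ~ stalk_max c -> exists d, c * d = 1.
Proof.
elim/(@germW spec_rs p): c => U Up s ns.
have [V [a [f [Vp VU h]]]] := ss_locP s Up.
have na : ~ spec_ideal p a.
  move=> pa; apply: ns; have [nf e] := h p Up Vp.
  by exists a, f, nf; rewrite germ_evalE.
pose W := opensI V (dopen a).
have Wp : oset W p by split=> //; apply/dopenE.
have naW q : oset W q -> ~ spec_ideal q a by move=> [_ /dopenE].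
have tP : locally_frac (fun q (Wq : oset W q) => frac f (naW q Wq)).
  by move=> q Wq; exists W, f, a; split=> // r Wr _; exists (naW r Wr).
have WU : W `<=` U by move=> q [/VU].
exists (@germ spec_rs p W Wp (SpecSect tP)).
rewrite -(@germ_res spec_rs p U W WU Up Wp) germM.
rewrite -(@germ1 spec_rs p W Wp); congr germ; apply: ss_eq => q Wq /=.
have [nf e] := h q (WU q Wq) (proj1 Wq).
transitivity (s q (WU q Wq) * frac f (naW q Wq)); first by [].
rewrite e fracM; apply/fracE; exists 1; split; first exact: primeN1.
by ring.
Qed.

Fact stalk_maxN1 : ~ stalk_max 1.
Proof.
move=> [a [f [nf [pa]]]].
rewrite -(@germ1 spec_rs p (Opens openT) Logic.I) germ_evalE => e.
by apply: (@primeN1 R p); exact: frac_eq_in e pa.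
Qed.

End SpecStalk.

End SpecSheaf.

Lemma max_ideal_unit (R : comPzRingType) (N : set R) :
  ideal N -> ~ N 1 -> (forall a, ~ N a -> exists b, a * b = 1) ->
  maximal_ideal N /\ forall M, maximal_ideal M -> N = M.
Proof.
move=> iN N1 NU.
have sub J : ideal J -> ~ J 1 -> J `<=` N.
  move=> [_ _ JM] J1 a Ja; apply: contrapT => /NU[b e].
  by apply: J1; rewrite -e mulrC; exact: JM.
split=> [|M [iM M1 MM]]; last by apply: MM => //; exact: sub.
split=> // J iJ J1 NJ; apply/seteqP; split=> //; exact: sub.
Qed.

Fact spec_local (R : comPzRingType) (p : spec_rs R) : local_ring (stalk p).
Proof.
exists (@stalk_max R p).
exact: max_ideal_unit (@stalk_max_ideal R p) (@stalk_maxN1 R p)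
  (@stalk_max_unit R p).
Qed.

Definition Spec (R : comPzRingType) : lrs := Lrs (@spec_local R).

Section SpecMap.
Variables (R S : comPzRingType) (phi : {rmorphism R -> S}).

Fact preim_prime (q : spec S) : prime_ideal (phi @^-1` (spec_ideal q)).
Proof.
split=> [||a b] /=.
- split=> [|a b|a b] /=; rewrite ?rmorph0 ?rmorphD ?rmorphM.
  + exact: prime0.
  + exact: primeD.
  + exact: primeMl.
- by rewrite rmorph1; exact: primeN1.
- by rewrite rmorphM; have [_ _ h] := spec_prime q; exact: h.
Qed.

Definition spec_fun (q : spec S) : spec R := SpecPt (preim_prime q).

Fact spec_fun_cont : continuous spec_fun.
Proof.
apply/continuousP => _ [E ->]; exists (phi @` E); apply/seteqP; split=> q.
  move=> /vanishingN[a Ea na]; apply/vanishingN.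
  by exists (phi a) => //; exists a.
move=> /vanishingN[_ [a Ea <-] na]; apply/vanishingN.
by exists a.
Qed.

Definition loc_map (q : spec S) : loc (spec_fun q) -> loc q :=
  qlift (fun x : frac_ring (spec_fun q) =>
    @frac S q (phi (fp_num x)) (phi (fp_den x)) (@fp_denP _ _ x)).

Lemma loc_mapE (q : spec S) a f (nf : ~ spec_ideal (spec_fun q) f) :
  loc_map (frac a nf) = @frac S q (phi a) (phi f) nf.
Proof.
rewrite /loc_map qliftE // => {a f nf} x y [t [nt e]].
apply/fracE; exists (phi t); split=> //.
by rewrite -!rmorphM -rmorphB -rmorphM e rmorph0.
Qed.

Lemma loc_mapD (q : spec S) x y :
  loc_map (x + y) = loc_map x + loc_map y :> loc q.
Proof.
elim/fracW: x => a f nf; elim/fracW: y => b g ng.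
rewrite fracD !loc_mapE fracD; apply/fracE; exists 1.
by split; [exact: primeN1 | rewrite rmorphD !rmorphM; ring].
Qed.
Lemma loc_mapM (q : spec S) x y :
  loc_map (x * y) = loc_map x * loc_map y :> loc q.
Proof.
elim/fracW: x => a f nf; elim/fracW: y => b g ng.
rewrite fracM !loc_mapE fracM; apply/fracE; exists 1.
by split; [exact: primeN1 | rewrite !rmorphM; ring].
Qed.

Fact sharp_locP (U : opens (spec R)) (s : spec_sect U) :
  locally_frac (U := preimo spec_fun_cont U)
    (fun q Uq => @loc_map q (s (spec_fun q) Uq)).
Proof.
move=> q Uq; have [V [a [f [Vp VU h]]]] := ss_locP s Uq.
exists (preimo spec_fun_cont V), (phi a), (phi f); split=> //.
  exact: preimoS.
move=> r Ur Vr; have [nf ->] := h _ Ur Vr.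
by exists nf; exact: loc_mapE.
Qed.

Definition spec_sharp (U : opens (spec R)) (s : spec_ring U) :
  spec_ring (preimo spec_fun_cont U) := SpecSect (sharp_locP s).

Fact spec_sharp_zmod U : zmod_morphism (@spec_sharp U).
Proof.
move=> s t; apply/eqP; rewrite eq_sym subr_eq; apply/eqP.
apply: ss_eq => q Uq.
transitivity (loc_map ((s - t) _ Uq + t _ Uq)); last exact: loc_mapD.
by rewrite /= subrK.
Qed.
Fact spec_sharp_monoid U : monoid_morphism (@spec_sharp U).
Proof.
split=> [|s t]; apply: ss_eq => q Uq; last exact: loc_mapM.
rewrite [LHS]loc_mapE; apply/fracE; exists 1.
by split; [exact: primeN1 | rewrite rmorph1; ring].
Qed.
HB.instance Definition _ U :=
  GRing.isZmodMorphism.Build (spec_ring U)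
    (spec_ring (preimo spec_fun_cont U)) (@spec_sharp U) (@spec_sharp_zmod U).
HB.instance Definition _ U :=
  GRing.isMonoidMorphism.Build (spec_ring U)
    (spec_ring (preimo spec_fun_cont U)) (@spec_sharp U) (@spec_sharp_monoid U).

Fact spec_sharp_res (U V : opens (spec R)) (h : V `<=` U) (s : spec_ring U) :
  spec_sharp (spec_res h s) =
  spec_res (preimoS spec_fun_cont h) (spec_sharp s).
Proof.
apply: ss_eq => q Vq /=.
by rewrite (Prop_irrelevance (h _ Vq) (preimoS spec_fun_cont h q Vq)).
Qed.

Definition spec_rs_map : rs_hom (spec_rs S) (spec_rs R) :=
  @RsHom (spec_rs S) (spec_rs R) spec_fun spec_fun_cont
    (fun U => @spec_sharp U) spec_sharp_res.

Fact spec_map_local (q : spec_rs S) :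
  local_map (@stalk_map _ _ spec_rs_map q).
Proof.
move=> m n Mm Mn _ [c mc <-].
have [_ /(_ _ Mm) mE] := max_ideal_unit (@stalk_max_ideal R (spec_fun q))
  (@stalk_maxN1 R (spec_fun q)) (@stalk_max_unit R (spec_fun q)).
have [_ /(_ _ Mn) nE] := max_ideal_unit (@stalk_max_ideal S q)
  (@stalk_maxN1 S q) (@stalk_max_unit S q).
rewrite -nE; move: mc; rewrite -mE; elim/(@germW (spec_rs R)): c => U Ux s.
move=> [a [f [nf [pa]]]]; rewrite germ_evalE => e.
exists (phi a), (phi f), nf; split=> //.
rewrite (@stalk_mapE _ _ spec_rs_map q U Ux s) germ_evalE.
by rewrite -loc_mapE -e.
Qed.

Definition Spec_map : lrs_hom (Spec S) (Spec R) :=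
  @LrsHom (Spec S) (Spec R) spec_rs_map spec_map_local.

End SpecMap.

Section Identity.
Variable X : lrs.

Fact id_cont : continuous (@idfun X).
Proof. by apply/continuousP. Qed.

Fact id_sub (U : opens X) : preimo id_cont U `<=` U.
Proof. by []. Qed.

Fact id_res (U V : opens X) (h : V `<=` U) s :
  res (@id_sub V) (res h s) = res (preimoS id_cont h) (res (@id_sub U) s).
Proof.
have l : preimo id_cont V `<=` U by move=> x; exact: h.
by rewrite !(res_comp _ _ l).
Qed.

Definition rs_id : rs_hom X X :=
  @RsHom X X idfun id_cont (fun U => res (@id_sub U)) id_res.

Fact id_local x : local_map (@stalk_map X X rs_id x).
Proof.
move=> m n Mm Mn _ [c mc <-].
have -> : stalk_map (f := rs_id) c = c.
  move: {mc} c; elim/germW => U Ux s; rewrite stalk_mapE.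
  exact: (germ_res (@id_sub U)).
have [l [_ lE]] := lrs_local (x : X).
by rewrite -(lE _ Mn) (lE _ Mm).
Qed.

Definition lrs_id : lrs_hom X X := LrsHom id_local.

Fact id_bij (U : opens X) : bijective (res (@id_sub U)).
Proof.
have h : U `<=` preimo id_cont U by [].
have hU : U `<=` U by [].
have hV : preimo id_cont U `<=` preimo id_cont U by [].
exists (res h) => s.
  by rewrite (res_comp _ _ hU) res_id.
by rewrite (res_comp _ _ hV) res_id.
Qed.

End Identity.

(* An isomorphism of Y onto an open subspace of X: a homeomorphism onto an open
   subset, with O_X(U) -> O_Y(j^-1 U) an isomorphism for every open U in it. *)
Definition open_immersion (Y X : lrs) (j : lrs_hom Y X) : Prop :=
  [/\ injective j,
      (forall V : set Y, open V -> open (j @` V))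
    & forall U : opens X, U `<=` range j -> bijective (rh_sharp j U)].

Record scheme := Scheme {
  scheme_lrs :> lrs;
  scheme_affine : forall x : scheme_lrs,
    exists (R : comPzRingType) (j : lrs_hom (Spec R) scheme_lrs),
      open_immersion j /\ range j x
}.

Fact Spec_affine (R : comPzRingType) (x : Spec R) :
  exists (S : comPzRingType) (j : lrs_hom (Spec S) (Spec R)),
    open_immersion j /\ range j x.
Proof.
exists R, (lrs_id (Spec R)); split; last by exists x.
split=> [//|V oV|U _]; first by rewrite image_id.
exact: id_bij.
Qed.

Definition Spec_scheme (R : comPzRingType) : scheme :=
  Scheme (@Spec_affine R).

(* X(R).  Morphisms are compared by Leibniz equality: with the extensionality
   axioms of boolp this is equality of the continuous maps and of the maps on
   sections. *)
Definition points (X : scheme) (R : comPzRingType) : Type :=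
  lrs_hom (Spec R) X.

Definition points_map (X : scheme) (R S : comPzRingType)
    (phi : {rmorphism R -> S}) (x : points X R) : points X S :=
  lrs_comp x (Spec_map phi).

Definition equalizer (S T W : Type) (a : S -> T) (u v : T -> W) : Prop :=
  (forall s, u (a s) = v (a s)) /\
  forall t, u t = v t -> exists! s, a s = t.

(* Main.v *)
From Pilot Require Import Defs.
From HB Require Import structures.
From mathcomp Require Import all_boot all_algebra ring.
From mathcomp Require Import boolp classical_sets topology_structure.

(* Write R = B^h, C = (B (x)_A B)^h and D = R (x)_A R; C is also the Henselization
   of D along ID. Flatness is used through its equational criterion, and weak
   etaleness through the fact that every b in R is an eigenvalue of a matrix
   pencil over A; both properties pass from B to R.

   Fix an algebraically closed field K and a map A -> K. By the pencils, every
   element of L = R (x)_A K is killed by a polynomial over K with distinct roots,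
   so Spec L is a profinite set of K-points. An idempotent of L is defined over
   the integral closure A' of A in K. If its two images in C (x)_A K agree, then
   it descends modulo I to an idempotent of A'/IA', which is 0 or 1 because A is
   Henselian and A' is a domain. Hence a nonempty clopen set of K-points of the
   fibre that is stable under the relation defined by C is the whole fibre.

   If b in R has equal images in C, the relation that b (x) 1 = 1 (x) b near (p, q)
   has clopen classes, so b (x) 1 = 1 (x) b in D and b comes from A by faithfully
   flat descent. If w : Spec R -> X is equalized, a compactness argument shows
   that w takes the same value at all K-points of a fibre. So w factors through
   Spec A, of which Spec R -> Spec A is a topological quotient, and the case of
   functions descends the map on sections. *)

Set Implicit Arguments.
Unset Strict Implicit.
Unset Printing Implicit Defensive.

Import Pilot.Defs GRing.Theory.
Local Open Scope classical_set_scope.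
Local Open Scope ring_scope.

(** * Ideals, quotients, localizations and subrings *)

(** The hypothesis is an equality in C, which sees D only near V(ID), while faithfully flat descent
    needs an equality in D itself. Connectedness of the fibres under the relation defined by C
    bridges this gap: it spreads a property from the diagonal, where pencils provide it, to all
    pairs of points in a fibre.

    The Henselizations are given by their universal property alone, so every fact about them has to
    be drawn from it. A property that is stable under what a Henselian pair provides (ring
    operations, inverses of elements congruent to 1, lifted coprime factorizations) holds on all of
    B^h. Flatness is read off from algebras representing factorizations, and these are compared with
    B^h by mapping them to sufficiently many Henselian local rings, built by adjoining roots of all
    monic polynomials.

    A weakly etale algebra need not be of finite presentation. A pencil is a finite certificate for
    a single element that survives base change and Henselization, and it takes the place of a
    presentation. *)

Definition is_rmorph (R S : comPzRingType) (f : R -> S) : Prop :=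
  [/\ f 1 = 1, (forall x y, f (x + y) = f x + f y)
    & forall x y, f (x * y) = f x * f y].

Lemma rmorph_of (R S : comPzRingType) (f : R -> S) : is_rmorph f ->
  exists g : {rmorphism R -> S}, forall x, g x = f x.
Proof.
move=> [f1 fD fM].
have fz : zmod_morphism f.
  by move=> x y; apply/eqP; rewrite eq_sym subr_eq -fD subrK.
have fm : monoid_morphism f by split.
pose g : {rmorphism R -> S} := HB.pack f
  (GRing.isZmodMorphism.Build R S f fz) (GRing.isMonoidMorphism.Build R S f fm).
by exists g.
Qed.

Lemma rmorph_ext (R S : comPzRingType) (f g : {rmorphism R -> S}) :
  f =1 g -> f = g.
Proof.
case: f g => f [[fa] [fb]] [g [[ga] [gb]]] /= e.
have fg : f = g by apply: functional_extensionality_dep.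
case: g / fg ga gb e => ga gb _.
by rewrite (Prop_irrelevance fa ga) (Prop_irrelevance fb gb).
Qed.

(** Residue rings arise below as quotients of type [comPzRingType]; polynomials and matrices over
    them require a [fieldType]. The inverse is obtained by choice. *)
Lemma field_of (R : comPzRingType) : (1 : R) <> 0 ->
  (forall x : R, x <> 0 -> exists y, x * y = 1) ->
  exists (K : fieldType) (h : {rmorphism R -> K}), bijective h.
Proof.
move=> n1 inv.
pose R1 : comNzRingType := HB.pack (R : Type) R
  (GRing.PzSemiRing_isNonZero.Build R (introN eqP n1)).
pose iv (x : R) : R :=
  if pselect (exists y, x * y = 1) is left h then projT1 (cid h) else 0.
have ivV : forall x : R1, x != 0 -> iv x * x = 1.
  move=> x /eqP x0; rewrite /iv; case: pselect => [h|[]]; last exact: inv.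
  by case: cid => y /= e; rewrite mulrC.
have iv0 : iv 0 = 0.
  rewrite /iv; case: pselect => // -[y yE]; exfalso; apply: (n1 : 1 <> 0).
  by rewrite -yE mul0r.
pose K : fieldType := HB.pack (R : Type) R1
  (GRing.ComNzRing_isField.Build R1 ivV iv0).
have [h hE] : exists h : {rmorphism R -> K}, forall x, h x = x.
  exact: (@rmorph_of R K id).
by exists K, h; exists id => x; rewrite hE.
Qed.

Section Ideals.
Variable R : comPzRingType.
Implicit Types (I J M : set R).

Lemma ideal0 I : ideal I -> I 0. Proof. by case. Qed.
Lemma idealD I a b : ideal I -> I a -> I b -> I (a + b).
Proof. by move=> [_ h _]; exact: h. Qed.
Lemma idealMl I a b : ideal I -> I b -> I (a * b).
Proof. by move=> [_ _ h]; exact: h. Qed.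
Lemma idealMr I a b : ideal I -> I a -> I (a * b).
Proof. by rewrite mulrC; exact: idealMl. Qed.
Lemma idealN I a : ideal I -> I a -> I (- a).
Proof. by move=> iI Ia; rewrite -mulN1r; exact: idealMl. Qed.
Lemma idealB I a b : ideal I -> I a -> I b -> I (a - b).
Proof. by move=> iI Ia Ib; apply: idealD => //; exact: idealN. Qed.
Lemma ideal_sum I (T : Type) (r : seq T) (P : pred T) (F : T -> R) : ideal I ->
  (forall i, P i -> I (F i)) -> I (\sum_(i <- r | P i) F i).
Proof.
move=> iI h; apply: big_ind => //; first exact: ideal0.
by move=> *; exact: idealD.
Qed.
Lemma ideal_eqm I a b : ideal I -> I (a - b) -> I b -> I a.
Proof. by move=> iI h Ib; rewrite -(subrK b a); exact: idealD. Qed.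

Lemma ideal_zero : ideal [set (0 : R)].
Proof.
split=> // [a b /= -> ->|a b /= ->]; first by rewrite addr0.
by rewrite mulr0.
Qed.

Definition addpr I (a : R) : set R := [set x | exists i r, I i /\ x = i + r * a].

Lemma addpr_ideal I a : ideal I -> ideal (addpr I a).
Proof.
move=> iI; split.
- by exists 0, 0; split; [exact: ideal0 | rewrite mul0r addr0].
- move=> _ _ [i [r [Ii ->]]] [j [s [Ij ->]]]; exists (i + j), (r + s).
  by split; [exact: idealD | ring].
- move=> b _ [i [r [Ii ->]]]; exists (b * i), (b * r).
  by split; [exact: idealMl | ring].
Qed.

Lemma addpr_sub I a : I `<=` addpr I a.
Proof. by move=> i Ii; exists i, 0; rewrite mul0r addr0. Qed.
Lemma addpr_mem I a : ideal I -> addpr I a a.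
Proof. by move=> iI; exists 0, 1; rewrite mul1r add0r; split=> //; exact: ideal0. Qed.

Definition mulset M := M 1 /\ forall a b, M a -> M b -> M (a * b).

Lemma maximal_avoiding J M : ideal J -> (forall x, J x -> ~ M x) ->
  exists I, [/\ ideal I, J `<=` I, (forall x, I x -> ~ M x)
    & forall I', ideal I' -> I `<=` I' -> (forall x, I' x -> ~ M x) -> I' `<=` I].
Proof.
move=> iJ JM.
(* It is X together with J that has to be an ideal, not X: the empty chain, whose union is empty,
   then also satisfies the condition. *)
pose P := [set X : set R | ideal (X `|` J) /\ forall x, X x -> ~ M x].
have [F FP tot|A [[iA AM] Amax]] := @Zorn_bigcup R P.
  split; last by move=> x [X /FP[_ h] Xx]; exact: h.
  have up X Y : F X -> F Y -> exists Z, [/\ F Z, X `<=` Z & Y `<=` Z].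
    move=> FX FY; have [h|h] := tot X Y FX FY; [exists Y | exists X];
      by split=> //; exact: subset_refl.
  split.
  - by right; exact: ideal0.
  - move=> a b [[X FX Xa]|Ja] [[Y FY Yb]|Jb].
    + have [Z [FZ /(_ _ Xa) Za /(_ _ Yb) Zb]] := up X Y FX FY.
      have [iZ _] := FP Z FZ.
      by have [h|h] := @idealD _ a b iZ (or_introl Za) (or_introl Zb);
        [left; exists Z | right].
    + have [iZ _] := FP X FX.
      by have [h|h] := @idealD _ a b iZ (or_introl Xa) (or_intror Jb);
        [left; exists X | right].
    + have [iZ _] := FP Y FY.
      by have [h|h] := @idealD _ a b iZ (or_intror Ja) (or_introl Yb);
        [left; exists Y | right].
    + by right; exact: idealD.
  - move=> a b [[X FX Xb]|Jb]; last by right; exact: idealMl.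
    have [iX _] := FP X FX.
    by have [h|h] := @idealMl _ a b iX (or_introl Xb);
      [left; exists X | right].
exists (A `|` J); split; [exact: iA | by move=> x Jx; right | by move=> x [/AM|/JM] |].
move=> I' iI' sub I'M x I'x; apply: contrapT => nx; apply: (Amax I').
  split=> [y Ay|h]; first by apply: sub; left.
  by apply: nx; left; exact: h.
split=> //; suff -> : I' `|` J = I' by [].
by apply/seteqP; split=> y; [case=> // Jy; apply: sub; right | left].
Qed.

Lemma prime_avoiding J M : ideal J -> mulset M -> (forall x, J x -> ~ M x) ->
  exists P, [/\ prime_ideal P, J `<=` P & forall x, P x -> ~ M x].
Proof.
move=> iJ [M1 MM] JM.
have [I [iI JI IM Imax]] := maximal_avoiding iJ JM.
exists I; split=> //; split=> //; first by move/IM.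
have key c : ~ I c -> exists2 m, addpr I c m & M m.
  move=> nc; apply: contrapT => h; apply: nc.
  apply: (Imax (addpr I c)); first exact: addpr_ideal.
  - exact: addpr_sub.
  - by move=> x Ix Mx; apply: h; exists x.
  - exact: addpr_mem.
move=> a b Iab; apply: contrapT => /not_orP[/key[_ [i [r [Ii ->]]] Ma]].
move=> /key[_ [j [s [Ij ->]]] Mb]; apply: (IM _ _ (MM _ _ Ma Mb)).
have -> : (i + r * a) * (j + s * b) = i * (j + s * b) + r * a * j + r * s * (a * b).
  by ring.
by apply: idealD => //; [apply: idealD => //; [exact: idealMr | exact: idealMl]
  | exact: idealMl].
Qed.

Lemma maximal_over J : ideal J -> ~ J 1 ->
  exists I, [/\ maximal_ideal I & J `<=` I].
Proof.
move=> iJ J1.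
have [x Jx /= e|I [iI JI IM Imax]] := @maximal_avoiding J [set 1] iJ.
  by apply: J1; rewrite -e.
exists I; split=> //; split=> //; first by move=> /IM; exact.
move=> I' iI' I'1 sub; apply/seteqP; split=> //; apply: Imax => //.
by move=> x I'x /= e; apply: I'1; rewrite -e.
Qed.

Lemma maximal_inv I a : maximal_ideal I -> ~ I a -> exists b, I (1 - a * b).
Proof.
move=> [iI I1 Imax] na; apply: contrapT => h.
have e : addpr I a = I.
  apply: Imax; [exact: addpr_ideal | | exact: addpr_sub].
  move=> [i [r [Ii e]]]; apply: h; exists r.
  by rewrite e [a * r]mulrC addrK.
by apply: na; rewrite -e; exact: addpr_mem.
Qed.

Lemma maximal_prime I : maximal_ideal I -> prime_ideal I.
Proof.
move=> mI; have [iI I1 _] := mI; split=> // a b Iab.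
apply: contrapT => /not_orP[na nb].
have [c cE] := maximal_inv mI na.
apply: nb; have -> : b = (1 - a * c) * b + c * (a * b) by ring.
by apply: idealD => //; [exact: idealMr | exact: idealMl].
Qed.

Lemma jacobsonP I : ideal I ->
  (forall m, maximal_ideal m -> I `<=` m) <->
  (forall a, I a -> exists b, (1 + a) * b = 1).
Proof.
move=> iI; split=> [h a Ia|h m mm a Ia].
  apply: contrapT => na.
  have iJ := addpr_ideal (1 + a) ideal_zero.
  have [|m [mm Jm]] := maximal_over iJ.
    by move=> [i [r [/= -> e]]]; apply: na; exists r; rewrite [RHS]e add0r mulrC.
  have [im m1 _] := mm; apply: m1.
  have -> : 1 = (1 + a) - a :> R by ring.
  apply: idealB => //; last exact: h Ia.
  by apply: Jm; exact: addpr_mem ideal_zero.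
apply: contrapT => na; have [b bE] := maximal_inv mm na.
have [c cE] := h (- (a * b)) (idealN iI (idealMr _ iI Ia)).
by have [im m1 _] := mm; apply: m1; rewrite -cE; exact: idealMr.
Qed.

End Ideals.

Lemma preim_ideal (R S : comPzRingType) (f : {rmorphism R -> S}) (I : set S) :
  ideal I -> ideal (f @^-1` I).
Proof.
move=> iI; split=> [|a b|a b] /=; rewrite ?rmorph0 ?rmorphD ?rmorphM.
- exact: ideal0.
- exact: idealD.
- exact: idealMl.
Qed.

Section Extend.
Variables (R S : comPzRingType) (f : {rmorphism R -> S}) (I : set R).

Lemma extend_ideal : ideal (extend f I).
Proof.
split.
- by move=> J [iJ _]; exact: ideal0.
- by move=> a b ha hb J hJ; apply: idealD; [case: hJ | exact: ha | exact: hb].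
- by move=> a b hb J hJ; apply: idealMl; [case: hJ | exact: hb].
Qed.

Lemma extend_mem a : I a -> extend f I (f a).
Proof. by move=> Ia J [_]; apply; exists a. Qed.

Lemma extend_min (J : set S) : ideal J -> (forall a, I a -> J (f a)) ->
  extend f I `<=` J.
Proof. by move=> iJ h x; apply; split=> // _ [a Ia <-]; exact: h. Qed.

Lemma extendP x : extend f I x -> exists s : seq (R * S),
  (forall z, z \in s -> I z.1) /\ x = \sum_(z <- s) f z.1 * z.2.
Proof.
pose P := [set x | exists s : seq (R * S),
  (forall z, z \in s -> I z.1) /\ x = \sum_(z <- s) f z.1 * z.2].
move=> hx; apply: (hx P); split.
- split.
  + by exists [::]; split=> //; rewrite big_nil.
  + move=> a b [s [sI ->]] [t [tI ->]]; exists (s ++ t); split.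
      by move=> z; rewrite mem_cat => /orP[/sI|/tI].
    by rewrite big_cat.
  + move=> a b [s [sI ->]]; exists [seq (z.1, a * z.2) | z <- s]; split.
      by move=> z /mapP[y /sI h ->].
    rewrite big_map mulr_sumr; apply: eq_bigr => z _ /=; ring.
- move=> _ [a Ia <-]; exists [:: (a, 1)]; split=> [z|].
    by rewrite inE => /eqP->.
  by rewrite big_seq1 mulr1.
Qed.

End Extend.

(** Stated as existence with characteristic properties, like the localizations, subrings and tensor
    products below, so that the underlying quotient types are never unfolded afterwards. *)
Lemma quotient_ring (R : comPzRingType) (J : set R) : ideal J ->
  exists (S : comPzRingType) (p : {rmorphism R -> S}),
    (forall y, exists x, p x = y) /\ (forall x, p x = 0 <-> J x).
Proof.
move=> iJ; pose e (x y : R) := J (x - y).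
have eE x y : x = y -> e x y by move=> ->; rewrite /e subrr; exact: ideal0.
have @Z : preZmod.
  refine (@PreZmod R e 0 (@GRing.opp R) +%R _ _ _ _ _ _ _ _ _).
  - by move=> x; exact: (eE).
  - by move=> x y h; rewrite /e -opprB; exact: idealN.
  - move=> x y z h k; rewrite /e; have -> : x - z = (x - y) + (y - z) by ring.
    exact: idealD.
  - move=> x y h; rewrite /e; have -> : - x - - y = - (x - y) by ring.
    exact: idealN.
  - move=> x y x' y' h k; rewrite /e.
    have -> : x + y - (x' + y') = (x - x') + (y - y') by ring.
    exact: idealD.
  - by move=> x y z; apply: (eE); rewrite addrA.
  - by move=> x y; apply: (eE); rewrite addrC.
  - by move=> x; apply: (eE); rewrite add0r.
  - by move=> x; apply: (eE); rewrite addNr.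
have @P : preRing.
  refine (@PreRing Z (1 : R) (@GRing.mul R) _ _ _ _ _).
  - move=> x y x' y' h k; rewrite /= /e.
    have -> : x * y - x' * y' = y * (x - x') + x' * (y - y') :> R by ring.
    by apply: idealD => //; exact: idealMl.
  - by move=> x y z; apply: (eE); exact: mulrA.
  - by move=> x y; apply: (eE); exact: mulrC.
  - by move=> x; apply: (eE); exact: mul1r.
  - by move=> x y z; apply: (eE); exact: mulrDl.
have [p pE] : exists p : {rmorphism R -> quotr P}, forall x, p x = @rpi P x.
  apply: (@rmorph_of R (quotr P)).
  by split=> [//|x y|x y]; [exact: esym (@rpiD P x y) | exact: esym (@rpiM P x y)].
exists (quotr P), p; split.
  by elim/rpiW=> x; exists x.
move=> x; rewrite pE; split=> [/(@rpiE P)|h]; first by rewrite /= /e subr0.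
by apply/(@rpiE P); rewrite /= /e subr0.
Qed.

Lemma surj_lift (R S U : comPzRingType) (p : {rmorphism R -> S})
    (g : {rmorphism R -> U}) :
  (forall y, exists x, p x = y) -> (forall x, p x = 0 -> g x = 0) ->
  exists h : {rmorphism S -> U}, forall x, h (p x) = g x.
Proof.
move=> sp k; pose r y := projT1 (cid (sp y)).
have rK y : p (r y) = y by rewrite /r; case: cid.
have gE x y : p x = p y -> g x = g y.
  move=> e; apply/eqP; rewrite -subr_eq0 -rmorphB; apply/eqP/k.
  by rewrite rmorphB e subrr.
have [|h hE] := @rmorph_of S U (fun y => g (r y)).
  split=> [|x y|x y].
  - by rewrite -(rmorph1 g); apply: gE; rewrite rK rmorph1.
  - by rewrite -rmorphD; apply: gE; rewrite rmorphD !rK.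
  - by rewrite -rmorphM; apply: gE; rewrite rmorphM !rK.
by exists h => x; rewrite hE; apply: gE; rewrite rK.
Qed.

Lemma localization (R : comPzRingType) (M : set R) : mulset M ->
  exists (S : comPzRingType) (l : {rmorphism R -> S}),
    [/\ (forall m, M m -> exists y, l m * y = 1),
        (forall s, exists r m, M m /\ s * l m = l r)
      & (forall r, l r = 0 -> exists2 m, M m & m * r = 0)].
Proof.
move=> [M1 MM]; pose E := {z : R * R | M z.2}.
pose mk a f (h : M f) : E := exist _ (a, f) h.
pose nu (x : E) := (sval x).1; pose de (x : E) := (sval x).2.
have dM x : M (de x) by exact: (svalP x).
pose e (x y : E) := exists2 t, M t & t * (nu x * de y - nu y * de x) = 0.
have eE x y : nu x * de y = nu y * de x -> e x y.
  by move=> h; exists 1 => //; rewrite h subrr mulr0.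
have @Z : preZmod.
  refine (@PreZmod E e (mk 0 1 M1) (fun x => mk (- nu x) _ (dM x))
    (fun x y => mk (nu x * de y + nu y * de x) _ (MM _ _ (dM x) (dM y)))
    _ _ _ _ _ _ _ _ _).
  - by move=> x; exact: (eE).
  - move=> x y [t Mt h]; exists t => //.
    by rewrite -opprB mulrN h oppr0.
  - move=> x y z [t Mt h] [u Mu k]; exists (t * u * de y).
      by apply: (MM _ _ _ (dM y)); exact: (MM).
    transitivity (u * de z * (t * (nu x * de y - nu y * de x))
      + t * de x * (u * (nu y * de z - nu z * de y))); first by ring.
    by rewrite h k !mulr0 addr0.
  - move=> x y [t Mt h]; exists t => //; rewrite /nu /de /= -/(nu x) -/(de x) -/(nu y) -/(de y).
    by rewrite !mulNr -opprD mulrN h oppr0.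
  - move=> x y x' y' [t Mt h] [u Mu k]; exists (t * u); first exact: (MM).
    rewrite {1 2 3 4}/nu {1 4}/de /=.
    transitivity (u * de y * de y' * (t * (nu x * de x' - nu x' * de x))
      + t * de x * de x' * (u * (nu y * de y' - nu y' * de y))); last first.
      by rewrite h k !mulr0 addr0.
    by rewrite /= /nu /de /=; ring.
  - by move=> x y z; apply: (eE); rewrite /= /nu /de /=; ring.
  - by move=> x y; apply: (eE); rewrite /= /nu /de /=; ring.
  - by move=> x; apply: (eE); rewrite /= /nu /de /=; ring.
  - by move=> x; apply: (eE); rewrite /= /nu /de /=; ring.
have @P : preRing.
  refine (@PreRing Z (mk 1 1 M1)
    (fun x y : E => mk (nu x * nu y) _ (MM _ _ (dM x) (dM y))) _ _ _ _ _).
  - move=> x y x' y' [t Mt h] [u Mu k]; exists (t * u); first exact: (MM).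
    transitivity (u * nu y * de y' * (t * (nu x * de x' - nu x' * de x))
      + t * nu x' * de x * (u * (nu y * de y' - nu y' * de y))); last first.
      by rewrite h k !mulr0 addr0.
    by rewrite /= /nu /de /=; ring.
  - by move=> x y z; apply: (eE); rewrite /= /nu /de /=; ring.
  - by move=> x y; apply: (eE); rewrite /= /nu /de /=; ring.
  - by move=> x; apply: (eE); rewrite /= /nu /de /=; ring.
  - by move=> x y z; apply: (eE); rewrite /= /nu /de /=; ring.
have rE (x y : E) : nu x * de y = nu y * de x -> @rpi P x = @rpi P y.
  by move=> h; apply/(@rpiE P); exact: (eE).
have [l lE] : exists l : {rmorphism R -> quotr P},
    forall x, l x = @rpi P (mk x 1 M1).
  apply: (@rmorph_of R (quotr P)); split=> [//|x y|x y].
    by rewrite (@rpiD P); apply: rE; rewrite /= /nu /de /=; ring.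
  by rewrite (@rpiM P); apply: rE; rewrite /= /nu /de /=; ring.
exists (quotr P), l; split.
- move=> m Mm; exists (@rpi P (mk 1 m Mm)); rewrite lE (@rpiM P) (@rpi1 P).
  by apply: rE; rewrite /= /nu /de /=; ring.
- elim/rpiW=> x; exists (nu x), (de x); split=> //.
  by rewrite !lE (@rpiM P); apply: rE; rewrite /= /nu /de /=; ring.
- move=> r; rewrite lE => /(@rpiE P)[t Mt h]; exists t => //.
  by rewrite -{}h /nu /de /=; ring.
Qed.

Lemma loc_lift (R S U : comPzRingType) (M : set R) (l : {rmorphism R -> S})
    (g : {rmorphism R -> U}) :
  mulset M ->
  (forall m, M m -> exists y, l m * y = 1) ->
  (forall s, exists r m, M m /\ s * l m = l r) ->
  (forall r, l r = 0 -> exists2 m, M m & m * r = 0) ->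
  (forall m, M m -> exists y, g m * y = 1) ->
  exists h : {rmorphism S -> U}, forall x, h (l x) = g x.
Proof.
move=> [M1 MM] lu lf lk gu.
have ex s : exists u, forall r m, M m -> s * l m = l r -> u * g m = g r.
  have [r [m [Mm e]]] := lf s; have [y yE] := gu m Mm.
  exists (g r * y) => r' m' Mm' e'.
  have : l (r * m' - r' * m) = 0.
    rewrite rmorphB !rmorphM -e -e'; ring.
  move=> /lk[t Mt h]; have [z zE] := gu t Mt.
  have : g (t * (r * m' - r' * m)) = 0 by rewrite h rmorph0.
  rewrite rmorphM rmorphB !rmorphM => k.
  have -> : g r * y * g m' = g r' + y * z * (g t * (g r * g m' - g r' * g m)) +
     g r * y * g m' * (1 - g t * z) + g r' * (g t * z * (g m * y) - 1) by ring.
  by rewrite k zE yE !(mul1r, subrr, mulr0, addr0).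
pose h s := projT1 (cid (ex s)).
have hP s r m : M m -> s * l m = l r -> h s * g m = g r.
  by rewrite /h; case: cid => u hu; exact: hu.
have can m a b : M m -> a * g m = b * g m -> a = b.
  move=> /gu[y yE] e.
  by rewrite -[a]mulr1 -[b]mulr1 -yE !mulrA e.
have [|H HE] := @rmorph_of S U h.
  split.
  - by apply: (can 1 _ _ M1); rewrite (hP 1 1 1) // ?mul1r ?rmorph1 ?mul1r.
  - move=> x y; have [r [m [Mm e]]] := lf x; have [s [n [Mn e']]] := lf y.
    apply: (can _ _ _ (MM _ _ Mm Mn)).
    rewrite (hP _ (r * n + s * m)); last 2 first.
    + exact: (MM).
    + by rewrite rmorphD !rmorphM -e -e'; ring.
    rewrite rmorphD !rmorphM -(hP _ _ _ Mm e) -(hP _ _ _ Mn e'); ring.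
  - move=> x y; have [r [m [Mm e]]] := lf x; have [s [n [Mn e']]] := lf y.
    apply: (can _ _ _ (MM _ _ Mm Mn)).
    rewrite (hP _ (r * s)); last 2 first.
    + exact: (MM).
    + by rewrite !rmorphM -e -e'; ring.
    rewrite !rmorphM -(hP _ _ _ Mm e) -(hP _ _ _ Mn e'); ring.
exists H => x; rewrite HE; apply: (can 1 _ _ M1).
by rewrite (hP _ x 1 M1) rmorph1 mulr1.
Qed.

Definition subring (R : comPzRingType) (P : set R) : Prop :=
  [/\ P 1, (forall x, P x -> P (- x)), (forall x y, P x -> P y -> P (x + y))
    & forall x y, P x -> P y -> P (x * y)].

Lemma subring0 (R : comPzRingType) (P : set R) : subring P -> P 0.
Proof. by move=> [P1 PN PD _]; rewrite -(addNr 1); apply: PD => //; exact: PN. Qed.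

Lemma subring_sum (R : comPzRingType) (P : set R) (T : Type) (r : seq T)
    (Q : pred T) (F : T -> R) : subring P ->
  (forall i, Q i -> P (F i)) -> P (\sum_(i <- r | Q i) F i).
Proof.
move=> sP h; apply: big_ind => //; first exact: subring0.
by case: sP.
Qed.

Lemma subring_ring (R : comPzRingType) (P : set R) : subring P ->
  exists (S : comPzRingType) (v : {rmorphism S -> R}),
    injective v /\ forall x, P x <-> exists s, v s = x.
Proof.
move=> sP; have P0 := subring0 sP; have [P1 PN PD PM] := sP.
pose E := {x : R | P x}; pose mk x (h : P x) : E := exist _ x h.
have vP (x : E) : P (sval x) by exact: (svalP x).
pose e (x y : E) := sval x = sval y.
have @Z : preZmod.
  refine (@PreZmod E e (mk 0 P0) (fun x => mk _ (PN _ (vP x)))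
    (fun x y => mk _ (PD _ _ (vP x) (vP y))) _ _ _ _ _ _ _ _ _); rewrite /e /=.
  - by [].
  - by move=> x y ->.
  - by move=> x y z -> ->.
  - by move=> x y ->.
  - by move=> x y x' y' -> ->.
  - by move=> x y z; rewrite addrA.
  - by move=> x y; rewrite addrC.
  - by move=> x; rewrite add0r.
  - by move=> x; rewrite addNr.
have @Q : preRing.
  refine (@PreRing Z (mk 1 P1) (fun x y : E => mk _ (PM _ _ (vP x) (vP y)))
    _ _ _ _ _); rewrite /= /e /=.
  - by move=> x y x' y' -> ->.
  - by move=> x y z; rewrite mulrA.
  - by move=> x y; rewrite mulrC.
  - by move=> x; rewrite mul1r.
  - by move=> x y z; rewrite mulrDl.
pose v0 : quotr Q -> R := @qlift Z R (fun x : E => sval x).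
have vE x : v0 (@rpi Q x) = sval x by exact: qliftE.
have [|v vE'] := @rmorph_of (quotr Q) R v0.
  split; first by rewrite (@rpi1 Q) vE.
    by elim/rpiW=> x; elim/rpiW=> y; rewrite (@rpiD Q) !vE.
  by elim/rpiW=> x; elim/rpiW=> y; rewrite (@rpiM Q) !vE.
exists (quotr Q), v; split.
  elim/rpiW=> x; elim/rpiW=> y; rewrite !vE' !vE => h.
  exact/(@rpiE Q).
move=> x; split=> [Px|[s <-]]; first by exists (@rpi Q (mk x Px)); rewrite vE' vE.
by rewrite vE'; elim/rpiW: s => s; rewrite vE.
Qed.

Lemma inj_lift (R S U : comPzRingType) (v : {rmorphism S -> R})
    (g : {rmorphism U -> R}) :
  injective v -> (forall u, exists s, v s = g u) ->
  exists h : {rmorphism U -> S}, forall u, v (h u) = g u.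
Proof.
move=> vi ex; pose h u := projT1 (cid (ex u)).
have hE u : v (h u) = g u by rewrite /h; case: cid.
have [|H HE] := @rmorph_of U S h; last by exists H => u; rewrite HE.
split=> [|x y|x y]; apply: vi; rewrite ?(rmorph1, rmorphD, rmorphM) !hE.
- exact: rmorph1.
- exact: rmorphD.
- exact: rmorphM.
Qed.

Lemma range_subring (R S : comPzRingType) (f : {rmorphism R -> S}) :
  subring (range f).
Proof.
split=> [|_ [a _ <-]|_ _ [a _ <-] [b _ <-]|_ _ [a _ <-] [b _ <-]].
- by exists 1; rewrite ?rmorph1.
- by exists (- a); rewrite ?rmorphN.
- by exists (a + b); rewrite ?rmorphD.
- by exists (a * b); rewrite ?rmorphM.
Qed.

Lemma subring_preim (R S : comPzRingType) (f : {rmorphism R -> S}) (P : set S) :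
  subring P -> subring (f @^-1` P).
Proof.
move=> [P1 PN PD PM].
by split=> [|x|x y|x y] /=;
  rewrite ?rmorph1 ?rmorphN ?rmorphD ?rmorphM //; [exact: PN|exact: PD|exact: PM].
Qed.

Lemma subring_eq (R S : comPzRingType) (f g : {rmorphism R -> S}) :
  subring [set x | f x = g x].
Proof.
split=> [|x|x y|x y] /=; first by rewrite !rmorph1.
- by rewrite !rmorphN => ->.
- by rewrite !rmorphD => -> ->.
- by rewrite !rmorphM => -> ->.
Qed.

(** * Equational flatness and tensor products *)

(** Every linear relation over A among elements of B is a consequence of relations in A. Unlike
    [flat], this speaks of finite families of elements only, so it can be verified on a directed
    union such as a Henselization. *)
Definition eqflat (A B : comPzRingType) (f : {rmorphism A -> B}) : Prop :=
  forall (I : finType) (r : I -> A) (s : I -> B), \sum_i f (r i) * s i = 0 ->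
  exists (J : finType) (c : I -> J -> A) (t : J -> B),
    (forall i, s i = \sum_j f (c i j) * t j) /\
    forall j, \sum_i r i * c i j = 0.

Lemma exchange_mul (R : comPzRingType) (I J : finType) (a : I -> R)
    (c : I -> J -> R) (t : J -> R) :
  \sum_i a i * (\sum_j c i j * t j) = \sum_j (\sum_i a i * c i j) * t j.
Proof.
rewrite (eq_bigr (fun i => \sum_j a i * c i j * t j)); last first.
  by move=> i _; rewrite mulr_sumr; apply: eq_bigr => j _; rewrite mulrA.
by rewrite exchange_big; apply: eq_bigr => j _; rewrite mulr_suml.
Qed.

Lemma delta_sum (R : comPzRingType) (I : finType) (i : I) (x : I -> R) :
  \sum_j (i == j)%:R * x j = x i.
Proof.
rewrite (bigD1 i) //= eqxx mul1r big1 ?addr0 // => j /negbTE.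
by rewrite eq_sym => ->; rewrite mul0r.
Qed.

(** Flatness of g gives coefficients in B which, for each j, satisfy a relation over A; flatness of
    f is then applied once for each j, and the pairs (j, k) index the result. *)
Lemma eqflat_comp (A B C : comPzRingType) (f : {rmorphism A -> B})
    (g : {rmorphism B -> C}) (h : {rmorphism A -> C}) :
  (forall a, h a = g (f a)) -> eqflat f -> eqflat g -> eqflat h.
Proof.
move=> hE flf flg I r s e.
have : \sum_i g (f (r i)) * s i = 0.
  by rewrite -[RHS]e; apply: eq_bigr => i _; rewrite hE.
move=> /flg[J [c [t [sE cE]]]].
have ex j : exists (K : finType) (d : I -> K -> A) (u : K -> B),
    (forall i, c i j = \sum_k f (d i k) * u k) /\
    forall k, \sum_i r i * d i k = 0 by apply: flf; exact: cE.
pose K j := projT1 (cid (ex j)).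
have [d dP] : exists d : (forall j, I -> K j -> A), forall j,
    exists u : K j -> B, (forall i, c i j = \sum_k f (d j i k) * u k) /\
    forall k, \sum_i r i * d j i k = 0.
  exists (fun j => projT1 (cid (projT2 (cid (ex j))))) => j.
  exact: (projT2 (cid (projT2 (cid (ex j))))).
pose u j := projT1 (cid (dP j)).
have uP j : (forall i, c i j = \sum_k f (d j i k) * u j k) /\
    forall k, \sum_i r i * d j i k = 0 by exact: (projT2 (cid (dP j))).
exists {j : J & K j}, (fun i p => d (tag p) i (tagged p)),
  (fun p => g (u (tag p) (tagged p)) * t (tag p)).
split=> [i|[j k]] /=; last by case: (uP j).
rewrite sE (eq_bigr (fun j => \sum_k h (d j i k) * (g (u j k) * t j))).
  by rewrite (sig_big_dep (fun=> true) (fun _ => fun=> true)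
    (fun j k => h (d j i k) * (g (u j k) * t j))).
move=> j _; have [-> _] := uP j; rewrite rmorph_sum mulr_suml.
by apply: eq_bigr => k _; rewrite rmorphM -hE mulrA.
Qed.

(** A direct summand of a flat module is flat; [rho] is only R-linear, not multiplicative. *)
Lemma eqflat_retract (R F G : comPzRingType) (p : {rmorphism R -> F})
    (th : {rmorphism F -> G}) (q : {rmorphism R -> G}) (rho : G -> F) :
  (forall r, q r = th (p r)) -> rho 0 = 0 ->
  (forall x y, rho (x + y) = rho x + rho y) ->
  (forall r x, rho (q r * x) = p r * rho x) -> (forall x, rho (th x) = x) ->
  eqflat q -> eqflat p.
Proof.
move=> qE rho0 rhoD rhoZ rhoK flq I r s e.
have : \sum_i q (r i) * th (s i) = 0.
  transitivity (th (\sum_i p (r i) * s i)); last by rewrite e rmorph0.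
  by rewrite rmorph_sum; apply: eq_bigr => i _; rewrite rmorphM qE.
move=> /flq[J [c [t [sE cE]]]]; exists J, c, (fun j => rho (t j)); split=> // i.
rewrite -[LHS]rhoK sE (big_morph rho rhoD rho0).
by apply: eq_bigr => j _; rewrite rhoZ.
Qed.

(* The last clause is the equational criterion for the vanishing of a tensor
   over a flat algebra. *)
Record is_tensor (A B C : comPzRingType) (f : {rmorphism A -> B})
    (g : {rmorphism A -> C}) (T : comPzRingType) (il : {rmorphism B -> T})
    (ir : {rmorphism C -> T}) : Prop := IsTensor {
  it_comm : forall a, il (f a) = ir (g a);
  it_span : forall t, exists s : seq (B * C),
    t = \sum_(z <- s) il z.1 * ir z.2;
  it_univ : forall (U : comPzRingType) (p : {rmorphism B -> U})
    (q : {rmorphism C -> U}), (forall a, p (f a) = q (g a)) ->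
    exists h : {rmorphism T -> U},
      (forall b, h (il b) = p b) /\ forall c, h (ir c) = q c;
  it_zero : eqflat f -> forall (I : finType) (x : I -> B) (y : I -> C),
    \sum_i il (x i) * ir (y i) = 0 ->
    exists (J : finType) (c : I -> J -> A) (z : J -> B),
      (forall i, x i = \sum_j f (c i j) * z j) /\
      forall j, \sum_i g (c i j) * y i = 0
}.

(** * Vanishing of a tensor over a flat algebra *)

Section TensorZero.
Variables (A B C : comPzRingType) (f : {rmorphism A -> B})
  (g : {rmorphism A -> C}).
Hypothesis flf : eqflat f.
Local Notation E := (restr f * restr g)%type.

Definition expand (J : finType) (z : J -> B) (p : (J -> A) * C) : E :=
  (\sum_j f (p.1 j) * z j, p.2).

(** The conclusion of the equational criterion for the formal sum s. It is shown for s - t whenever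
    s and t are identified by [tens_eq], by induction on the derivation. *)
Definition tens_rel (s : seq E) : Prop :=
  exists (J : finType) (z : J -> B) (d : seq ((J -> A) * C)),
    s = map (expand z) d /\ forall j, \sum_(p <- d) g (p.1 j) * p.2 = 0.

Definition tens_neg (s : seq E) : seq E := [seq (z.1, - z.2) | z <- s].

Lemma tens_rel_cat s t : tens_rel s -> tens_rel t -> tens_rel (s ++ t).
Proof.
move=> [J [z [d [-> dE]]]] [K [w [e [-> eE]]]].
exists (J + K)%type, (fun x => match x with inl j => z j | inr k => w k end),
  ([seq (fun x => match x with inl j => p.1 j | inr k => 0 end, p.2) | p <- d]
   ++ [seq (fun x => match x with inl j => 0 | inr k => p.1 k end, p.2)
      | p <- e]).
split=> [|[j|k]].
- rewrite map_cat -!map_comp; congr (_ ++ _); apply: eq_map => p;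
    rewrite /expand /= big_sumType /=; congr pair.
    by rewrite [X in _ + X]big1 ?addr0 // => k _; rewrite rmorph0 mul0r.
  by rewrite [X in X + _]big1 ?add0r // => k _; rewrite rmorph0 mul0r.
- rewrite big_cat !big_map /= dE add0r big1 // => p _.
  by rewrite rmorph0 mul0r.
- rewrite big_cat !big_map /= eE addr0 big1 // => p _.
  by rewrite rmorph0 mul0r.
Qed.

Lemma tens_rel_perm s t : perm_eq s t -> tens_rel s -> tens_rel t.
Proof.
move=> st [J [z [d [sE dE]]]].
pose d0 : (J -> A) * C := (fun=> 0, 0).
move: st; rewrite perm_sym sE => /(perm_iotaP (expand z d0))[Is pI ->].
rewrite size_map in pI.
exists J, z, [seq nth d0 d i | i <- Is]; split.
  rewrite -map_comp; apply/eq_in_map => i; rewrite (perm_mem pI) mem_iota add0n.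
  by move=> /andP[_ h]; rewrite (nth_map d0).
have pd : perm_eq [seq nth d0 d i | i <- Is] d.
  by rewrite -[X in perm_eq _ X](mkseq_nth d0); exact: perm_map.
by move=> j; rewrite (perm_big _ pd) dE.
Qed.

Lemma tens_rel_neg s : tens_rel s -> tens_rel (tens_neg s).
Proof.
move=> [J [z [d [-> dE]]]]; exists J, z, [seq (p.1, - p.2) | p <- d]; split.
  by rewrite /tens_neg -!map_comp; apply: eq_map.
move=> j; rewrite big_map /= (eq_bigr (fun p => - (g (p.1 j) * p.2))).
  by rewrite sumrN dE oppr0.
by move=> p _; rewrite mulrN.
Qed.

Lemma tens_rel_one (x : B) (s : seq (A * C)) :
  \sum_(p <- s) g p.1 * p.2 = 0 ->
  tens_rel [seq (f p.1 * x, p.2) | p <- s].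
Proof.
move=> h; exists unit, (fun=> x), [seq (fun=> p.1, p.2) | p <- s]; split.
  rewrite -map_comp; apply: eq_map => p; rewrite /expand /=.
  by rewrite (big_pred1 tt) //; case.
by move=> j; rewrite big_map.
Qed.

Lemma tens_rel_negr s : tens_rel (s ++ tens_neg s).
Proof.
elim: s => [|[x y] s IH]; first by exists void, (fun=> 0), [::]; split=> //; case.
have h : tens_rel [:: (x, y); (x, - y)].
  have := @tens_rel_one x [:: (1, y); (1, - y)].
  rewrite /= !rmorph1 !mul1r; apply.
  by rewrite !big_cons big_nil /= !rmorph1 !mul1r addr0 subrr.
apply: tens_rel_perm (tens_rel_cat h IH) => /=.
rewrite perm_cons -[_ :: (s ++ _)]cat1s -[_ :: tens_neg s]cat1s.
by rewrite perm_catCA.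
Qed.

(** Flatness enters here. The two expressions of x differ by a relation among the z j; in terms of
    the generators w that flatness supplies, both occurrences of x have the same coefficients, so
    their contributions y and - y cancel. *)
Lemma tens_rel_cancel1 v x y :
  tens_rel ([:: (x, y); (x, - y)] ++ v) -> tens_rel v.
Proof.
move=> [J [z [[|[c y1] [|[c' y2] d]] [//= [xE yE xE' yE' vE] dE]]]].
have : \sum_j f (c j - c' j) * z j = 0.
  transitivity (x - x); last by rewrite subrr.
  rewrite {1}xE xE' -sumrB; apply: eq_bigr => j _.
  by rewrite rmorphB mulrBl.
move=> /flf[L [e [w [zE eE]]]].
exists L, w, [seq (fun l => \sum_j p.1 j * e j l, p.2) | p <- d]; split.
  rewrite vE -map_comp; apply: eq_map => p; rewrite /expand /=; congr pair.
  rewrite (eq_bigr (fun j => f (p.1 j) * \sum_l f (e j l) * w l)).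
    rewrite exchange_mul; apply: eq_bigr => l _; congr (_ * _).
    by rewrite rmorph_sum; apply: eq_bigr => j _; rewrite rmorphM.
  by move=> j _; rewrite -zE.
move=> l; rewrite big_map /=.
have key j : g (e j l) * \sum_(p <- d) g (p.1 j) * p.2 =
    - (g (e j l) * ((g (c j) - g (c' j)) * y)).
  have := dE j; rewrite !big_cons /= -yE -yE' => h.
  have -> : \sum_(p <- d) g (p.1 j) * p.2 = - ((g (c j) - g (c' j)) * y).
    apply/eqP; rewrite eq_sym -subr_eq0 -oppr_eq0; apply/eqP.
    rewrite -[RHS]h; ring.
  by rewrite mulrN.
transitivity (\sum_j g (e j l) * \sum_(p <- d) g (p.1 j) * p.2).
  rewrite (eq_bigr (fun p => \sum_j g (e j l) * (g (p.1 j) * p.2))).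
    by rewrite exchange_big; apply: eq_bigr => j _; rewrite mulr_sumr.
  move=> p _; rewrite rmorph_sum mulr_suml; apply: eq_bigr => j _.
  by rewrite rmorphM; ring.
rewrite (eq_bigr _ (fun j _ => key j)) sumrN.
rewrite (eq_bigr (fun j => g ((c j - c' j) * e j l) * y)); last first.
  by move=> j _; rewrite rmorphM rmorphB; ring.
by rewrite -mulr_suml -rmorph_sum eE rmorph0 mul0r oppr0.
Qed.

Lemma tens_rel_cancel t v : tens_rel ((t ++ tens_neg t) ++ v) -> tens_rel v.
Proof.
elim: t v => [//|[x y] t IH] v h; apply: IH; apply: (@tens_rel_cancel1 _ x y).
apply: tens_rel_perm h => /=; rewrite perm_cons -!catA /=.
by rewrite -[_ :: (t ++ _)]cat1s -[_ :: tens_neg t ++ v]cat1s perm_catCA.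
Qed.

Lemma tens_eq_rel (s t : seq E) : tens_eq s t -> tens_rel (s ++ tens_neg t).
Proof.
have negK u : tens_neg (tens_neg u) = u.
  rewrite /tens_neg -map_comp -[RHS]map_id; apply: eq_map => -[x y] /=.
  by rewrite opprK.
have neg_cat u v : tens_neg (u ++ v) = tens_neg u ++ tens_neg v by exact: map_cat.
elim=> {s t}.
- move=> s t st; apply: tens_rel_perm (tens_rel_negr s).
  by rewrite perm_cat2l; exact: perm_map.
- move=> s t _ /tens_rel_neg; rewrite neg_cat negK; apply: tens_rel_perm.
  by rewrite perm_catC.
(* The two hypotheses add up to s - t + t - u, from which the middle terms have to be removed. *)
- move=> s t u _ st _ tu; apply: (@tens_rel_cancel t).
  apply: tens_rel_perm (tens_rel_cat st tu).
  by rewrite -!catA perm_catCA perm_sym perm_catCA perm_cat2l perm_catCA.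
- move=> s t s' t' _ ss _ tt; apply: tens_rel_perm (tens_rel_cat ss tt).
  by rewrite neg_cat -!catA perm_cat2l perm_catCA.
- move=> y; rewrite cats0; have := @tens_rel_one 0 [:: (0, y)].
  by rewrite /= mulr0; apply; rewrite big_seq1 rmorph0 mul0r.
- move=> x x' y; pose z b : B := if b then x else x'.
  pose d : seq ((bool -> A) * C) := [:: (fun=> 1, y);
    (fun b : bool => (b : nat)%:R, - y);
    (fun b : bool => (~~ b : nat)%:R, - y)].
  exists bool, z, d.
  split=> [|b] /=; last first.
    rewrite !big_cons big_nil /= !rmorph_nat rmorph1.
    by case: b => /=; rewrite !mul1r !mul0r ?add0r ?addr0 subrr.
  by rewrite /expand /= !big_bool /= !rmorph1 !rmorph0 !mul1r !mul0r add0r addr0.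
- move=> x y y'; have := @tens_rel_one x [:: (1, y + y'); (1, - y); (1, - y')].
  rewrite /= !rmorph1 !mul1r; apply; rewrite !big_cons big_nil /= !rmorph1 !mul1r.
  by ring.
- move=> a x y; have := @tens_rel_one x [:: (a, y); (1, - (g a * y))].
  rewrite /= !rmorph1 !mul1r; apply; rewrite !big_cons big_nil /= !rmorph1 !mul1r.
  by ring.
Qed.

Lemma tens_zero_rel (I : finType) (x : I -> B) (y : I -> C) :
  tens_eq [seq ((x i, y i) : E) | i <- enum I] [::] ->
  exists (J : finType) (c : I -> J -> A) (z : J -> B),
    (forall i, x i = \sum_j f (c i j) * z j) /\
    forall j, \sum_i g (c i j) * y i = 0.
Proof.
move=> /tens_eq_rel; rewrite cats0 => -[J [z [d [dE relE]]]].
pose d0 : (J -> A) * C := (fun=> 0, 0).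
pose h i := nth d0 d (index i (enum I)).
have sz : size d = size (enum I) by rewrite -(size_map (expand z)) -dE size_map.
have hd : d = map h (enum I).
  apply: (@eq_from_nth _ d0) => [|k kd]; first by rewrite size_map.
  have [i0 _] : exists i0 : I, true.
    by move: kd; rewrite sz; case: (enum I) => // i0 *; exists i0.
  rewrite (nth_map i0) -?sz // /h index_uniq ?enum_uniq -?sz //.
have hE i : expand z (h i) = (x i, y i).
  have lt : (index i (enum I) < size (enum I))%N by rewrite index_mem mem_enum.
  have := congr1 (fun s => nth (0, 0) s (index i (enum I))) dE.
  by rewrite (nth_map i) // nth_index ?mem_enum // (nth_map d0) ?sz.
exists J, (fun i => (h i).1), z; split=> [i|j].
  by have /(congr1 fst) /= := hE i.
rewrite -[RHS](relE j) hd big_map big_enum /=; apply: eq_bigr => i _.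
by have /(congr1 snd) /= -> := hE i.
Qed.

End TensorZero.

Section TensorAlgebra.
Variables (A B C : comPzRingType) (f : {rmorphism A -> B})
  (g : {rmorphism A -> C}).
Local Notation E := (restr f * restr g)%type.
Local Notation TT := (tens_zmod (restr f) (restr g)).

Definition tmul2 (x y : E) : E := (x.1 * y.1, x.2 * y.2).
Definition tmul (s t : seq E) : seq E := [seq tmul2 x y | x <- s, y <- t].

Lemma tmul2C x y : tmul2 x y = tmul2 y x.
Proof. by rewrite /tmul2 ![x.1 * _]mulrC ![x.2 * _]mulrC. Qed.

Lemma tmul_consr s y t :
  perm_eq (tmul s (y :: t)) ([seq tmul2 x y | x <- s] ++ tmul s t).
Proof.
by apply/permPl; exact: (perm_allpairs_consr tmul2 s (fun=> y) (fun=> t)).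
Qed.

Lemma tmulC s t : tens_eq (tmul s t) (tmul t s).
Proof.
apply: tens_perm; elim: s => [|x s IH]; first by rewrite /tmul allpairs0r.
rewrite perm_sym (permPl (tmul_consr _ _ _)) perm_sym /tmul allpairs_cons.
rewrite (@eq_map _ _ (tmul2 x) (tmul2^~ x)) ?perm_cat2l // => z.
exact: tmul2C.
Qed.

Lemma restr_scaleE (S : comPzRingType) (h : {rmorphism A -> S}) a
  (x : restr h) : a *: x = (h a : restr h) * x.
Proof. by []. Qed.

Lemma tmulEl s s' t : tens_eq s s' -> tens_eq (tmul s t) (tmul s' t).
Proof.
move=> ss; elim: t => [|y t IH].
  by rewrite /tmul !allpairs0r; exact: tens_refl.
apply: tens_trans (tens_perm (tmul_consr _ _ _)) _.
apply: tens_trans (tens_sym (tens_perm (tmul_consr _ _ _))).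
apply: tens_cat => //.
apply: tens_map ss => [z|x x' z|x z z'|a x z]; rewrite /tmul2 /= ?mul0r //.
- by rewrite mulrDl; exact: tens_addl.
- by rewrite mulrDl; exact: tens_addr.
- by rewrite !restr_scaleE -!mulrA -!restr_scaleE; exact: tens_scale.
Qed.

Lemma tmulE s t s' t' : tens_eq s s' -> tens_eq t t' ->
  tens_eq (tmul s t) (tmul s' t').
Proof.
move=> ss tt; apply: tens_trans (tmulEl t ss) _.
by apply: tens_trans (tmulC _ _) _; apply: tens_trans (tmulEl _ tt) (tmulC _ _).
Qed.

Lemma tmulA s t u : tens_eq (tmul s (tmul t u)) (tmul (tmul s t) u).
Proof.
suff -> : tmul s (tmul t u) = tmul (tmul s t) u by exact: tens_refl.
elim: s => [//|x s IH]; rewrite /tmul !allpairs_cons allpairs_cat.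
rewrite -/(tmul _ _) -/(tmul s _) -/(tmul s t) -/(tmul (tmul s t) u) IH.
congr (_ ++ _); rewrite /tmul map_allpairs allpairs_mapl.
by apply: eq_allpairs => y z; rewrite /tmul2 /= !mulrA.
Qed.

Lemma tmul1 s : tens_eq (tmul [:: (1, 1)] s) s.
Proof.
rewrite /tmul allpairs1l map_id_in; first exact: tens_refl.
by case=> x y _; rewrite /tmul2 /= !mul1r.
Qed.

Lemma tmulD s t u : tens_eq (tmul (s ++ t) u) (tmul s u ++ tmul t u).
Proof. by rewrite /tmul allpairs_cat; exact: tens_refl. Qed.

Definition talg_ring : preRing :=
  @PreRing TT [:: (1, 1)] tmul tmulE tmulA tmulC tmul1 tmulD.

(** The multiplication and the proofs of its axioms are left open, so that this covers both
    [talg_ring] and the ring [tensor_sq] of the statement. *)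
Lemma quot_is_tensor (mul : seq E -> seq E -> seq E) h1 h2 h3 h4 h5 :
  (forall s t, mul s t = tmul s t) ->
  let Q := @PreRing TT [:: (1, 1)] mul h1 h2 h3 h4 h5 in
  forall (il : {rmorphism B -> quotr Q}) (ir : {rmorphism C -> quotr Q}),
  (forall b, il b = @rpi Q [:: (b, 1)]) ->
  (forall c, ir c = @rpi Q [:: (1, c)]) -> is_tensor f g il ir.
Proof.
move=> mE Q il ir ilE irE.
have pureM (x y : B) (x' y' : C) : @rpi Q [:: (x, x')] * @rpi Q [:: (y, y')] =
    @rpi Q [:: (x * y, x' * y')] by rewrite (@rpiM Q) /= mE.
have sumE s : \sum_(z <- s) il z.1 * ir z.2 = @rpi Q s.
  elim: s => [|[x y] s IH]; first by rewrite big_nil.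
  by rewrite big_cons IH ilE irE pureM mulr1 mul1r (@rpiD Q).
split.
- move=> a; rewrite ilE irE; apply/(@rpiE Q).
  by have := @tens_scale A (restr f) (restr g) a 1 1; rewrite !restr_scaleE !mulr1.
- by elim/rpiW=> s; exists s; rewrite sumE.
- move=> U p q pq.
  pose h0 (s : seq (restr f * restr g)) : U := \sum_(z <- s) p z.1 * q z.2.
  pose h : quotr Q -> U := qlift (h0 : Q -> U).
  have hE s : h (@rpi Q s) = h0 s.
    apply: qliftE => {}s t; rewrite /h0; elim=> {s t}.
    + by move=> s t; exact: perm_big.
    + by move=> s t _ ->.
    + by move=> s t u _ -> _ ->.
    + by move=> s t s' t' _ e _ e'; rewrite !big_cat /= e e'.
    + by move=> y; rewrite big_seq1 big_nil rmorph0 mul0r.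
    + by move=> *; rewrite !big_cons !big_nil /= rmorphD mulrDl !addr0.
    + by move=> *; rewrite !big_cons !big_nil /= rmorphD mulrDr !addr0.
    + move=> a x y; rewrite !big_seq1 /= !restr_scaleE (rmorphM p) (rmorphM q).
      by rewrite pq; ring.
  have [|H HE] := @rmorph_of (quotr Q) U h.
    split; first by rewrite (@rpi1 Q) hE /h0 big_seq1 !rmorph1 mulr1.
      elim/rpiW=> s; elim/rpiW=> t.
      by rewrite (@rpiD Q) !hE /h0 big_cat.
    elim/rpiW=> s; elim/rpiW=> t; rewrite (@rpiM Q) !hE /= mE /h0 /tmul.
    rewrite big_allpairs_dep mulr_suml; apply: eq_bigr => x _.
    rewrite mulr_sumr; apply: eq_bigr => y _.
    by rewrite (rmorphM p) (rmorphM q) mulrACA.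
  exists H; split=> [b|c]; rewrite HE ?ilE ?irE hE /h0 big_seq1 rmorph1.
    by rewrite mulr1.
  by rewrite mul1r.
- move=> flf I x y.
  pose l := [seq ((x i, y i) : restr f * restr g) | i <- enum I].
  have -> : \sum_i il (x i) * ir (y i) = @rpi Q l.
    by rewrite -sumE big_map big_enum.
  by move=> /(@rpiE Q)/(tens_zero_rel flf).
Qed.

End TensorAlgebra.

Lemma tensor_alg (A B C : comPzRingType) (f : {rmorphism A -> B})
    (g : {rmorphism A -> C}) :
  exists (T : comPzRingType) (il : {rmorphism B -> T}) (ir : {rmorphism C -> T}),
    is_tensor f g il ir.
Proof.
pose Q := talg_ring f g.
have pureM (x y : B) (x' y' : C) : @rpi Q [:: (x, x')] * @rpi Q [:: (y, y')] =
    @rpi Q [:: (x * y, x' * y')] by rewrite (@rpiM Q).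
have [il ilE] : exists il : {rmorphism B -> quotr Q},
    forall b, il b = @rpi Q [:: (b, 1)].
  apply: (@rmorph_of B (quotr Q)); split=> [//|x y|x y].
    by rewrite (@rpiD Q); apply/(@rpiE Q); exact: tens_addl.
  by rewrite pureM mulr1.
have [ir irE] : exists ir : {rmorphism C -> quotr Q},
    forall c, ir c = @rpi Q [:: (1, c)].
  apply: (@rmorph_of C (quotr Q)); split=> [//|x y|x y].
    by rewrite (@rpiD Q); apply/(@rpiE Q); exact: tens_addr.
  by rewrite pureM mulr1.
by exists (quotr Q), il, ir; exact: quot_is_tensor.
Qed.

Lemma tensor_sq_is_tensor (A B : comPzRingType) (f : {rmorphism A -> B}) :
  is_tensor f f (tensor_inl f) (tensor_inr f).
Proof. exact: (@quot_is_tensor _ _ _ f f (@ta_mul _ _ f)). Qed.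

(** * Weakly etale maps and pencils *)

Section Kernel.
Variables (A : comPzRingType) (M N : lmodType A) (v : {linear M -> N}).

Definition kerp : {pred M} := [pred x | v x == 0].

Lemma kerp_submod : submod_closed kerp.
Proof.
split=> [|a x y]; rewrite !inE ?linear0 // => /eqP x0 /eqP y0.
by rewrite linearP x0 y0 scaler0 addr0.
Qed.

HB.instance Definition _ := GRing.isSubmodClosed.Build A M kerp kerp_submod.

Record ker := Ker { kerv :> M; _ : kerv \in kerp }.

HB.instance Definition _ := [isSub for kerv].
HB.instance Definition _ := [Choice of ker by <:].
HB.instance Definition _ := [SubChoice_isSubLmodule of ker by <:].

Lemma ker_exact : exact_seq (val : {linear ker -> M}) v.
Proof.
move=> y; split=> [y0|[[x xP] <-]]; last by apply/eqP.
have yP : y \in kerp by rewrite inE y0.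
by exists (Ker yP).
Qed.

End Kernel.

Lemma tens_out (A : comPzRingType) (M N : lmodType A) (U : zmodType)
    (h : M -> N -> U) :
  (forall x x' y, h (x + x') y = h x y + h x' y) ->
  (forall x y y', h x (y + y') = h x y + h x y') ->
  (forall a x y, h (a *: x) y = h x (a *: y)) ->
  exists H : tensor M N -> U,
    forall s, H (@qpi (tens_zmod M N) s) = \sum_(z <- s) h z.1 z.2.
Proof.
move=> hl hr hs; pose H0 (s : tens_zmod M N) : U :=
  \sum_(z <- (s : seq (M * N))) h z.1 z.2.
exists (qlift H0) => s; apply: (@qliftE (tens_zmod M N)) => {}s t.
rewrite /H0; elim=> {s t}.
- by move=> s t; exact: perm_big.
- by move=> s t _ ->.
- by move=> s t u _ -> _ ->.
- by move=> s t s' t' _ e _ e'; rewrite !big_cat /= e e'.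
- move=> y; rewrite big_seq1 big_nil /=.
  by apply: (@addrI _ (h 0 y)); rewrite -hl !addr0.
- by move=> *; rewrite !big_cons !big_nil /= hl !addr0.
- by move=> *; rewrite !big_cons !big_nil /= hr !addr0.
- by move=> *; rewrite !big_seq1 /= hs.
Qed.

Lemma tensor_map_qpi (A : comPzRingType) (M N N' : lmodType A)
    (v : {linear N -> N'}) (s : seq (M * N)) :
  tensor_map v (@qpi (tens_zmod M N) s) =
  @qpi (tens_zmod M N') [seq (z.1, v z.2) | z <- s].
Proof.
rewrite /tensor_map qliftE // => {}s t st; apply/qpiE; elim: st => {s t}.
- by move=> s t st; apply/tens_perm/perm_map.
- by move=> s t _; exact: tens_sym.
- by move=> s t u _ st _; exact: tens_trans.
- by move=> s t s' t' _ ss _ tt; rewrite !map_cat; exact: tens_cat.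
- by move=> z /=; exact: tens_zero.
- by move=> * /=; exact: tens_addl.
- by move=> * /=; rewrite linearD; exact: tens_addr.
- by move=> * /=; rewrite linearZ; exact: tens_scale.
Qed.

(** Flatness is applied to ker v -> A^I -> A with v (x) = sum r_i x_i. The relation says that the
    tensor of the s_i with the basis vectors dies in B, so it comes from the kernel; the coordinates
    of the kernel elements are the c_ij. *)
Lemma flat_eqflat (A B : comPzRingType) (f : {rmorphism A -> B}) :
  flat f -> eqflat f.
Proof.
move=> flf I r s rs; pose M : lmodType A := {ffun I -> A^o}.
pose v0 (x : M) : A^o := \sum_i r i * x i.
have v0D : linear v0.
  move=> a x y; rewrite /v0 scaler_sumr -big_split; apply: eq_bigr => i _.
  by rewrite !ffunE mulrDr /GRing.scale /=; congr (_ + _); ring.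
pose v : {linear M -> A^o} := HB.pack v0 (GRing.isLinear.Build A M A^o _ v0 v0D).
have ex := flf _ _ _ _ _ (@ker_exact A M A^o v).
pose e (i : I) : M := [ffun k => (k == i)%:R].
have ve i : v0 (e i) = r i.
  rewrite /= /v0 (bigD1 i) //= ffunE eqxx mulr1 big1 ?addr0 // => k /negbTE.
  by rewrite ffunE => ->; rewrite mulr0.
pose y : seq (restr f * M) := [seq (s i, e i) | i <- enum I].
have [+ _] := ex (@qpi (tens_zmod (restr f) M) y).
case.
  rewrite tensor_map_qpi -map_comp; apply/(@qpiE (tens_zmod _ _)).
  have key l : tens_eq [seq ((s i : restr f), (r i : A^o)) | i <- l]
      [:: (\sum_(i <- l) f (r i) * s i : restr f, 1 : A^o)].
    elim: l => [|i l IH] /=.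
      by rewrite big_nil; apply: tens_sym; exact: tens_zero.
    rewrite big_cons; apply: tens_trans (tens_sym (tens_addl _ _ _)).
    rewrite -[_ :: [seq _ | _ <- _]]cat1s -[X in tens_eq _ X]cat1s.
    apply: tens_cat IH; apply: tens_sym.
    have := @tens_scale A (restr f) A^o (r i) (s i) 1.
    by rewrite {2}/GRing.scale /= mulr1.
  rewrite (@eq_map _ _ _ (fun i => ((s i : restr f), (r i : A^o)))); last first.
    by move=> i /=; rewrite ve.
  apply: tens_trans (key _) _; rewrite big_enum /= rs; exact: tens_zero.
move=> x; rewrite -(qreprK x); move: (qrepr x) => t {x}.
rewrite (@tensor_map_qpi A (restr f)) => tE.
pose J := 'I_(size t).
pose z (j : J) := tnth (in_tuple t) j.
exists J, (fun i j => (val (z j).2 : M) i), (fun j => (z j).1); split=> [i|j].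
  (* Equality of tensors is compared after the i-th coordinate map from the tensor product of B and
     A^I to B. *)
  have [|||H HE] := @tens_out A (restr f) M B (fun b m => f (m i) * b).
  - by move=> b b' m; rewrite mulrDr.
  - by move=> b m m'; rewrite ffunE rmorphD mulrDl.
  - move=> a b m; rewrite ffunE restr_scaleE [in RHS]/GRing.scale /= rmorphM.
    by ring.
  have := congr1 H tE; rewrite !HE /y big_map big_map big_enum /=.
  rewrite [X in _ = X -> _](bigD1 i) //= ffunE eqxx rmorph1 mul1r.
  rewrite [X in _ = _ + X -> _]big1 ?addr0 => [<-|k /negbTE]; last first.
    by rewrite ffunE eq_sym => ->; rewrite rmorph0 mul0r.
  by rewrite [LHS]big_tnth.
by have := valP (z j).2; rewrite inE => /eqP.
Qed.

Lemma is_tensor_spanI (A B C : comPzRingType) (f : {rmorphism A -> B})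
    (g : {rmorphism A -> C}) (T : comPzRingType) (il : {rmorphism B -> T})
    (ir : {rmorphism C -> T}) : is_tensor f g il ir ->
  forall t, exists n (x : 'I_n -> B) (y : 'I_n -> C),
    t = \sum_i il (x i) * ir (y i).
Proof.
move=> iT t; have [s ->] := it_span iT t.
exists (size s), (fun i => (tnth (in_tuple s) i).1),
  (fun i => (tnth (in_tuple s) i).2).
by rewrite big_tnth.
Qed.

(** Writing each s i as a sum of pure tensors turns the relation into the vanishing of one tensor,
    to which the criterion over f applies. *)
Lemma eqflat_base_change (A B C : comPzRingType) (f : {rmorphism A -> B})
    (g : {rmorphism A -> C}) (T : comPzRingType) (il : {rmorphism B -> T})
    (ir : {rmorphism C -> T}) : is_tensor f g il ir -> eqflat f -> eqflat ir.
Proof.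
move=> iT flf I r s rs; have sp := is_tensor_spanI iT.
pose n i := projT1 (cid (sp (s i))).
have [x [y xy]] : exists (x : forall i, 'I_(n i) -> B) (y : forall i, 'I_(n i) -> C),
    forall i, s i = \sum_k il (x i k) * ir (y i k).
  have h i := projT2 (cid (sp (s i))).
  exists (fun i => projT1 (cid (h i))), (fun i => projT1 (cid (projT2 (cid (h i))))).
  move=> i; exact: (projT2 (cid (projT2 (cid (h i))))).
pose P := {i : I & 'I_(n i)}.
pose pk i k : P := existT (fun i => 'I_(n i)) i k.
have sumP (U : nmodType) (F : forall i, 'I_(n i) -> U) :
    \sum_i \sum_k F i k = \sum_(p : P) F (tag p) (tagged p).
  exact: (sig_big_dep (fun=> true) (fun _ => fun=> true) F).
have : \sum_(p : P) il (x (tag p) (tagged p)) *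
    ir (r (tag p) * y (tag p) (tagged p)) = 0.
  rewrite -(sumP _ (fun i k => il (x i k) * ir (r i * y i k))) -[RHS]rs.
  apply: eq_bigr => i _; rewrite [in RHS]xy mulr_sumr; apply: eq_bigr => k _.
  by rewrite rmorphM; ring.
move=> /(it_zero iT flf)[J [c [z [xE cE]]]].
exists J, (fun i j => \sum_k g (c (pk i k) j) * y i k), (fun j => il (z j)).
split=> [i|j].
  rewrite xy (eq_bigr (fun k =>
    ir (y i k) * \sum_j ir (g (c (pk i k) j)) * il (z j))).
    rewrite exchange_mul; apply: eq_bigr => j _; congr (_ * _).
    by rewrite rmorph_sum; apply: eq_bigr => k _; rewrite rmorphM mulrC.
  move=> k _; have /= -> := xE (pk i k); rewrite mulrC; congr (_ * _).
  by rewrite rmorph_sum; apply: eq_bigr => j _; rewrite rmorphM (it_comm iT).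
transitivity (\sum_i \sum_k g (c (pk i k) j) * (r i * y i k)); last first.
  by rewrite sumP -[RHS](cE j); apply: eq_bigr => -[].
apply: eq_bigr => i _; rewrite mulr_sumr; apply: eq_bigr => k _; ring.
Qed.

(** * Matrix pencils and their Kronecker products *)

Section Pencil.
Variables (A B : comPzRingType) (f : {rmorphism A -> B}).
Implicit Types I J : finType.

Definition mxcol (I J : finType) (a : I -> J -> A) (z : J -> B) (i : I) : B :=
  \sum_j f (a i j) * z j.
Definition mxrow (I J : finType) (a : I -> J -> A) (x : I -> B) (j : J) : B :=
  \sum_i f (a i j) * x i.

(* [b] is an eigenvalue of a matrix pencil over [A], with right and left
   eigenvectors [z] and [x]. *)
Definition pencil (I J : finType) (a : I -> J -> A) (x : I -> B) (z : J -> B)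
    (b : B) : Prop :=
  exists a' : I -> J -> A,
    (forall i, mxcol a' z i = b * mxcol a z i) /\
    forall j, mxrow a' x j = b * mxrow a x j.

Lemma pencilD I J (a : I -> J -> A) x z b c :
  pencil a x z b -> pencil a x z c -> pencil a x z (b + c).
Proof.
move=> [a1 [h1 k1]] [a2 [h2 k2]]; exists (fun i j => a1 i j + a2 i j).
split=> [i|j]; rewrite mulrDl -?h1 -?h2 -?k1 -?k2 -big_split.
  by apply: eq_bigr => j _; rewrite rmorphD mulrDl.
by apply: eq_bigr => i _; rewrite rmorphD mulrDl.
Qed.

Lemma pencilZ I J (a : I -> J -> A) x z r b :
  pencil a x z b -> pencil a x z (f r * b).
Proof.
move=> [a1 [h1 k1]]; exists (fun i j => r * a1 i j).
split=> [i|j]; rewrite -mulrA -?h1 -?k1 mulr_sumr.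
  by apply: eq_bigr => j _; rewrite rmorphM mulrA.
by apply: eq_bigr => i _; rewrite rmorphM mulrA.
Qed.

Lemma pencil1 I J (a : I -> J -> A) x z : pencil a x z 1.
Proof. by exists a; split=> *; rewrite mul1r. Qed.

Lemma pencil_base r I J (a : I -> J -> A) x z : pencil a x z (f r).
Proof. by rewrite -[f r]mulr1; apply/pencilZ/pencil1. Qed.

Section Kron.
Variables (I J I' J' : finType) (a : I -> J -> A) (a' : I' -> J' -> A).
Variables (x : I -> B) (z : J -> B) (x' : I' -> B) (z' : J' -> B).

Definition kron (b : I -> J -> A) (b' : I' -> J' -> A)
  (p : I * I') (q : J * J') : A := b p.1 q.1 * b' p.2 q.2.

Lemma sum_pair (S T : finType) (F : S -> B) (G : T -> B) :
  \sum_(p : S * T) F p.1 * G p.2 = (\sum_s F s) * (\sum_t G t).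
Proof. by rewrite big_distrlr pair_bigA. Qed.

Lemma kron_col b b' p : mxcol (kron b b') (fun q => z q.1 * z' q.2) p =
  mxcol b z p.1 * mxcol b' z' p.2.
Proof.
rewrite /mxcol -sum_pair; apply: eq_bigr => q _.
by rewrite /kron rmorphM mulrACA.
Qed.

Lemma kron_row b b' q : mxrow (kron b b') (fun p => x p.1 * x' p.2) q =
  mxrow b x q.1 * mxrow b' x' q.2.
Proof.
rewrite /mxrow -sum_pair; apply: eq_bigr => p _.
by rewrite /kron rmorphM mulrACA.
Qed.

Lemma kron_pencil b c : pencil a x z b -> pencil a' x' z' c ->
  pencil (kron a a') (fun p => x p.1 * x' p.2) (fun q => z q.1 * z' q.2) (b * c).
Proof.
move=> [a1 [h1 k1]] [a2 [h2 k2]]; exists (kron a1 a2).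
by split=> p; rewrite ?kron_col ?kron_row ?h1 ?h2 ?k1 ?k2 mulrACA.
Qed.

End Kron.

(** All elements of s are eigenvalues for the same matrix a and the same eigenvectors. The
    normalization x a z = 1 excludes degenerate pencils: a factor 1 can be expanded through the
    eigenvectors. *)
Definition jepd (s : seq B) : Prop :=
  exists (I J : finType) (a : I -> J -> A) (x : I -> B) (z : J -> B),
    \sum_i x i * mxcol a z i = 1 /\ forall b, b \in s -> pencil a x z b.

Lemma jepd_cat s t : jepd s -> jepd t -> jepd (s ++ t).
Proof.
move=> [I [J [a [x [z [e h]]]]]] [I' [J' [a' [x' [z' [e' h']]]]]].
exists (I * I')%type, (J * J')%type, (kron a a'),
  (fun p => x p.1 * x' p.2), (fun q => z q.1 * z' q.2); split.
  rewrite -[RHS]mulr1 -{1}e -e' -sum_pair; apply: eq_bigr => p _.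
  by rewrite kron_col mulrACA.
move=> b; rewrite mem_cat => /orP[/h hb|/h' hb].
  by rewrite -[b]mulr1; apply: kron_pencil => //; exact: pencil1.
by rewrite -[b]mul1r; apply: kron_pencil => //; exact: pencil1.
Qed.

Definition epd (b : B) : Prop := jepd [:: b].

Lemma epd_jepd s : (forall b, epd b) -> jepd s.
Proof.
move=> h; elim: s => [|b s IH]; last by rewrite -cat1s; apply: jepd_cat => //; exact: h.
have [I [J [a [x [z [e _]]]]]] := h 0.
by exists I, J, a, x, z; split=> // b; rewrite in_nil.
Qed.

(** On the Kronecker product of two pencils, b and c acquire common eigenvectors; Q is the sum or
    the product. *)
Lemma epd2 (Q : B -> B -> B) b c :
  (forall I J (a : I -> J -> A) x z I' J' (a' : I' -> J' -> A) x' z',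
    pencil a x z b -> pencil a' x' z' c ->
    pencil (kron a a') (fun p => x p.1 * x' p.2) (fun q => z q.1 * z' q.2)
      (Q b c)) ->
  epd b -> epd c -> epd (Q b c).
Proof.
move=> hQ [I [J [a [x [z [e h]]]]]] [I' [J' [a' [x' [z' [e' h']]]]]].
exists (I * I')%type, (J * J')%type, (kron a a'),
  (fun p => x p.1 * x' p.2), (fun q => z q.1 * z' q.2); split.
  rewrite -[RHS]mulr1 -{1}e -e' -sum_pair; apply: eq_bigr => p _.
  by rewrite kron_col mulrACA.
move=> d; rewrite inE => /eqP->; apply: hQ; [apply: h | apply: h'];
  by rewrite inE.
Qed.

Lemma epd_base r : epd (f r).
Proof.
exists unit, unit, (fun _ _ => 1), (fun=> 1), (fun=> 1); split.
  by rewrite /mxcol !(big_pred1 tt) ?rmorph1 ?mulr1 //; case.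
by move=> b; rewrite inE => /eqP->; exact: pencil_base.
Qed.

Lemma epd_subring : subring [set b | epd b].
Proof.
have eD b c : epd b -> epd c -> epd (b + c).
  apply: (epd2 (Q := +%R)) => I J a x z I' J' a' x' z' pb pc.
  apply: pencilD; [rewrite -[b]mulr1|rewrite -[c]mul1r];
    by apply: kron_pencil => //; exact: pencil1.
have eM b c : epd b -> epd c -> epd (b * c).
  by apply: (epd2 (Q := *%R)) => *; exact: kron_pencil.
split=> //=; first by rewrite -(rmorph1 f); exact: epd_base.
move=> b eb; rewrite -mulN1r; apply: eM => //.
by rewrite -(rmorph1 f) -rmorphN; exact: epd_base.
Qed.

End Pencil.

Lemma jepd_map (A B K E : comPzRingType) (f : {rmorphism A -> B})
    (q : {rmorphism A -> K}) (p : {rmorphism B -> E}) (k : {rmorphism K -> E}) :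
  (forall a, p (f a) = k (q a)) ->
  forall s, jepd f s -> jepd k (map p s).
Proof.
move=> pk s [I [J [a [x [z [e h]]]]]].
have colE a0 i : mxcol k (fun i j => q (a0 i j)) (p \o z) i = p (mxcol f a0 z i).
  by rewrite /mxcol rmorph_sum; apply: eq_bigr => j _; rewrite rmorphM pk.
have rowE a0 j : mxrow k (fun i j => q (a0 i j)) (p \o x) j = p (mxrow f a0 x j).
  by rewrite /mxrow rmorph_sum; apply: eq_bigr => i _; rewrite rmorphM pk.
exists I, J, (fun i j => q (a i j)), (p \o x), (p \o z); split.
  rewrite -(rmorph1 p) -e rmorph_sum; apply: eq_bigr => i _.
  by rewrite rmorphM colE.
move=> _ /mapP[b /h[a' [h1 k1]] ->]; exists (fun i j => q (a' i j)).
by split=> *; rewrite ?colE ?rowE ?h1 ?k1 rmorphM.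
Qed.

(** With g = sum x_i (x) y_i, the equation g (b (x) 1 - 1 (x) b) = 0 says that the family of the x_i
    b and x_i is orthogonal to that of the y_i and - y_i b. The equational criterion yields two
    matrices over A: both families on the left come from one vector z, and y is the left
    eigenvector. The normalization is mu g = 1. *)
Lemma tensor_epd (A B T : comPzRingType) (f : {rmorphism A -> B})
    (il ir : {rmorphism B -> T}) (mu : {rmorphism T -> B}) :
  is_tensor f f il ir -> eqflat f -> (forall b, mu (il b) = b) ->
  (forall b, mu (ir b) = b) ->
  forall b g, mu g = 1 -> g * (il b - ir b) = 0 -> epd f b.
Proof.
move=> iT flf mul mur b g g1 gb.
have [n [x [y gE]]] := is_tensor_spanI iT g.
have : \sum_(p : 'I_n * bool) il (if p.2 then x p.1 * b else x p.1) *
    ir (if p.2 then y p.1 else - (y p.1 * b)) = 0.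
  rewrite -(pair_bigA _ (fun i c => il (if c then x i * b else x i) *
    ir (if c then y i else - (y i * b)))) /= -[RHS]gb gE mulr_suml.
  apply: eq_bigr => i _; rewrite big_bool /= rmorphN !rmorphM; ring.
move=> /(it_zero iT flf)[J [c [z [xE cE]]]].
exists 'I_n, J, (fun i j => c (i, false) j), y, z; split.
  rewrite -g1 gE rmorph_sum; apply: eq_bigr => i _.
  by rewrite rmorphM mul mur mulrC; congr (_ * _); have /= -> := xE (i, false).
move=> d; rewrite inE => /eqP->; exists (fun i j => c (i, true) j); split=> [i|j].
  rewrite /mxcol; have /= <- := xE (i, true); rewrite mulrC; congr (_ * _).
  by have /= -> := xE (i, false).
have : \sum_i \sum_(d : bool) f (c (i, d) j) *
    (if d then y i else - (y i * b)) = 0.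
  by rewrite pair_bigA -[RHS](cE j); apply: eq_bigr => -[].
under eq_bigr do rewrite big_bool /=.
rewrite big_split /= => /eqP; rewrite addr_eq0 -sumrN => /eqP.
rewrite /mxrow => ->; rewrite mulr_sumr; apply: eq_bigr => i _; ring.
Qed.

(** The element b (x) 1 - 1 (x) b dies under multiplication. Flatness of the multiplication map
    writes 1 as a combination of images of elements annihilating it, and these assemble to the g of
    [tensor_epd]. *)
Lemma weakly_etale_epd (A B : comPzRingType) (f : {rmorphism A -> B}) :
  weakly_etale f -> forall b, epd f b.
Proof.
move=> [/flat_eqflat flf /flat_eqflat flm] b.
have ml c : tensor_mult f (tensor_inl f c) = c.
  by rewrite tensor_multE /ta_sum big_seq1 /= mulr1.
have mr c : tensor_mult f (tensor_inr f c) = c.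
  by rewrite tensor_multE /ta_sum big_seq1 /= mul1r.
have [|J [c [t [tE cE]]]] := flm unit (fun=> tensor_inl f b - tensor_inr f b)
  (fun=> 1).
  rewrite (big_pred1 tt) ?mulr1 ?rmorphB; last by case.
  by rewrite -[RHS](subrr b); congr (_ - _); [exact: ml | exact: mr].
pose g := \sum_j c tt j * tensor_inl f (t j).
apply: (@tensor_epd _ _ _ f _ _ (tensor_mult f) (tensor_sq_is_tensor f) flf
  ml mr b g).
  rewrite rmorph_sum [RHS](tE tt); apply: eq_bigr => j _.
  by rewrite rmorphM; congr (_ * _); exact: ml.
rewrite mulr_suml big1 // => j _; have := cE j.
rewrite (big_pred1 tt) /=; last by case.
by move=> h; rewrite mulrAC [c tt j * _]mulrC h mul0r.
Qed.

(** If mB = B, the tensor product of B with M = A/m is zero, so the sequence M -> M -> M with zero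
    maps becomes exact over B. Faithful flatness makes it exact over A, that is, M = 0. *)
Lemma faithfully_flat_extend (A B : comPzRingType) (f : {rmorphism A -> B})
    (m : set A) : faithfully_flat f -> ideal m -> extend f m 1 -> m 1.
Proof.
move=> ff im h1; have [S [p [sp pE]]] := quotient_ring im.
pose M : lmodType A := restr p.
pose J : set B := [set c | forall b (y : M),
  @tens_eq A (restr f) M [:: ((c * b : B) : restr f, y)] [::]].
have iJ : ideal J.
  split=> [b y|c c' hc hc' b y|c c' hc' b y].
  - by rewrite mul0r; exact: tens_zero.
  - rewrite mulrDl; apply: tens_trans (tens_addl _ _ _) _.
    by rewrite -[[::]]/([::] ++ [::]) -cat1s; apply: tens_cat; [exact: hc | exact: hc'].
  - by rewrite mulrAC mulrC; exact: hc'.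
have J1 : J 1.
  apply: (extend_min iJ) h1 => a ma b y.
  apply: tens_trans (tens_scale _ _ _) _; rewrite restr_scaleE.
  have -> : p a = 0 by apply/pE.
  rewrite mul0r -(scale0r y); apply: tens_trans (tens_sym (tens_scale _ _ _)) _.
  by rewrite scale0r; exact: tens_zero.
have all0 (X : tensor (restr f) M) : X = 0.
  rewrite -(qreprK X); move: (qrepr X) => s.
  apply/(@qpiE (tens_zmod (restr f) M)); elim: s => [|[b y] s IH].
    exact: tens_refl.
  rewrite -cat1s -[pz_zero _]/([::] ++ [::]); apply: tens_cat => //.
  by have := J1 b y; rewrite mul1r.
pose u : {linear M -> M} := \0.
have ex : exact_seq (tensor_map (M := restr f) u) (tensor_map (M := restr f) u).
  by move=> y; split=> _; [exists y | ]; rewrite [LHS]all0 ?[RHS]all0.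
have /(_ 1)[/(_ erefl)[x e] _] := (ff M M M u u (fun=> erefl)).2 ex.
by apply/pE; rewrite rmorph1; symmetry; exact: e.
Qed.

(** * Coefficient sequences and uniqueness of coprime factorizations *)

Lemma det_congr (R : comPzRingType) (I : set R) n (M M' : 'M[R]_n) :
  ideal I -> (forall i j, I (M i j - M' i j)) -> I (\det M - \det M').
Proof.
move=> iI h; rewrite /determinant -sumrB; apply: ideal_sum => // s _.
rewrite -mulrBr; apply: idealMl => //.
pose K (a b : R) := I (a - b); apply: (big_ind2 K); first by rewrite /K subrr; exact: ideal0.
  move=> a a' b b' ha hb; rewrite /K.
  have -> : a * b - a' * b' = (a - a') * b + a' * (b - b') by ring.
  by apply: idealD => //; [exact: idealMr | exact: idealMl].
by move=> i _; exact: h.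
Qed.

(** The determinant trick: det (1 - N) is congruent to 1 modulo r, hence a unit of S, and its image
    annihilates v. The vector lives in an S-algebra T, while the unit condition concerns S alone. *)
Lemma nakayama (S T : comPzRingType) (p : {rmorphism S -> T}) (r : set S)
    (J : finType) (N : J -> J -> S) (v : J -> T) :
  ideal r -> (forall a, r a -> exists b, (1 + a) * b = 1) ->
  (forall i j, r (N i j)) -> (forall i, v i = \sum_j p (N i j) * v j) ->
  forall i, v i = 0.
Proof.
move=> ir ru Nr vE; set n := #|J|.
pose M : 'M[S]_n := \matrix_(i, j) ((i == j)%:R - N (enum_val i) (enum_val j)).
pose V : 'cV[T]_n := \col_i v (enum_val i).
have MV : map_mx p M *m V = 0.
  apply/colP => i; rewrite !mxE.
  rewrite (eq_bigr (fun j => (i == j)%:R * v (enum_val j) -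
      p (N (enum_val i) (enum_val j)) * v (enum_val j))); last first.
    by move=> j _; rewrite !mxE rmorphB rmorph_nat mulrBl.
  rewrite sumrB delta_sum [X in X - _]vE (reindex (@enum_val J J)) ?subrr //=.
  exact/onW_bij/enum_val_bij.
have : \adj (map_mx p M) *m (map_mx p M *m V) = 0 by rewrite MV mulmx0.
rewrite mulmxA mul_adj_mx det_map_mx mul_scalar_mx => dV.
have [|b bE] := ru (\det M - 1).
  rewrite -[X in _ - X](det1 _ n); apply: det_congr => // i j.
  rewrite !mxE; have -> : forall a b : S, a - b - a = - b by move=> a b; ring.
  exact: idealN.
move=> i; have /colP/(_ (enum_rank i)) := dV; rewrite !mxE enum_rankK => e.
have {}bE : p (\det M) * p b = 1.
  by rewrite -rmorphM; transitivity (p 1); [rewrite -bE; congr (p _); ring | exact: rmorph1].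
by rewrite -[LHS]mul1r -bE mulrAC e mul0r.
Qed.

(** The coefficient sequences of the definition of a Henselian pair, as the ring of power series:
    [pmul] becomes the product of a ring, over the zero ring as well. Polynomials are the sequences
    satisfying [finps] or [monps]. *)
Definition ps (R : comPzRingType) : Type := nat -> R.

Section PowerSeries.
Variable R : comPzRingType.
Implicit Types p q r : ps R.

HB.instance Definition _ := gen_eqMixin (ps R).
HB.instance Definition _ := gen_choiceMixin (ps R).

Lemma ps_ext p q : (forall n, p n = q n) -> p = q.
Proof. by move=> h; apply: functional_extensionality_dep. Qed.

Definition ps_const (c : R) : ps R := fun n => if n is 0 then c else 0.
Definition ps_add p q : ps R := fun n => p n + q n.
Definition ps_opp p : ps R := fun n => - p n.

Lemma ps_addA : associative ps_add.
Proof. by move=> p q r; apply: ps_ext => n; exact: addrA. Qed.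
Lemma ps_addC : commutative ps_add.
Proof. by move=> p q; apply: ps_ext => n; exact: addrC. Qed.
Lemma ps_add0 : left_id (fun=> 0) ps_add.
Proof. by move=> p; apply: ps_ext => n; exact: add0r. Qed.
Lemma ps_addN : left_inverse (fun=> 0) ps_opp ps_add.
Proof. by move=> p; apply: ps_ext => n; exact: addNr. Qed.

HB.instance Definition _ :=
  GRing.isZmodule.Build (ps R) ps_addA ps_addC ps_add0 ps_addN.

Lemma pmulC p q : pmul p q = pmul q p.
Proof.
apply: ps_ext => n; rewrite /pmul (reindex_inj rev_ord_inj) /=.
by apply: eq_bigr => i _; rewrite subSS (subKn (leq_ord i)) mulrC.
Qed.

Lemma pmulA p q r : pmul p (pmul q r) = pmul (pmul p q) r.
Proof.
apply: ps_ext => i; rewrite [in RHS]pmulC /pmul.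
pose c3 j k := p j * (q (i - j - k)%N * r k).
transitivity (\sum_(j < i.+1) \sum_(k < i.+1 | (k <= i - j)%N) c3 j k).
  apply: eq_bigr => /= j _; rewrite -/(pmul q r _) [pmul q r]pmulC /pmul mulr_sumr.
  rewrite (big_ord_narrow_leq (leq_subr _ _)); apply: eq_bigr => k _.
  by rewrite /c3 /= mulrC [r _ * _]mulrC mulrC.
rewrite (exchange_big_dep predT) //=; apply: eq_bigr => k _.
transitivity (\sum_(j < i.+1 | (j <= i - k)%N) c3 j k).
  by apply: eq_bigl => j; rewrite -ltnS -(ltnS j) -!subSn ?leq_ord // !ltn_subRL addnC.
rewrite (big_ord_narrow_leq (leq_subr _ _)) mulr_sumr /=.
by apply: eq_bigr => j _; rewrite /c3 subnAC mulrA mulrC.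
Qed.

Lemma pmul_const c p : pmul (ps_const c) p = (fun n => c * p n).
Proof.
apply: ps_ext => n; rewrite /pmul big_ord_recl subn0 big1 ?addr0 // => i _.
by rewrite mul0r.
Qed.

Lemma pmul1 : left_id (ps_const 1) (@pmul R : ps R -> ps R -> ps R).
Proof. by move=> p; rewrite pmul_const; apply: ps_ext => n; exact: mul1r. Qed.

Lemma pmulDl : left_distributive (@pmul R : ps R -> ps R -> ps R) ps_add.
Proof.
move=> p q r; apply: ps_ext => n; rewrite /ps_add /pmul -big_split.
by apply: eq_bigr => i _; rewrite mulrDl.
Qed.

HB.instance Definition _ :=
  GRing.Zmodule_isComPzRing.Build (ps R) pmulA pmulC pmul1 pmulDl.

Lemma psM p q n : (p * q) n = \sum_(i < n.+1) p i * q (n - i)%N. Proof. by []. Qed.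
Lemma psD p q n : (p + q) n = p n + q n. Proof. by []. Qed.
Lemma psN p n : (- p) n = - p n. Proof. by []. Qed.
Lemma psB p q n : (p - q) n = p n - q n. Proof. by []. Qed.
Lemma psCM c p n : (ps_const c * p) n = c * p n.
Proof. by rewrite /GRing.mul /= pmul_const. Qed.

Definition finps n p := forall k, (n <= k)%N -> p k = 0.
Definition monps n p := p n = 1 /\ forall k, (n < k)%N -> p k = 0.

Lemma finpsW m n p : (m <= n)%N -> finps m p -> finps n p.
Proof. by move=> mn h k nk; apply: h; exact: leq_trans nk. Qed.
Lemma monps_fin n p : monps n p -> finps n.+1 p.
Proof. by case. Qed.
Lemma finpsN n p : finps n p -> finps n (- p).
Proof. by move=> h k nk; rewrite psN h ?oppr0. Qed.
Lemma finpsD n p q : finps n p -> finps n q -> finps n (p + q).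
Proof. by move=> h h' k nk; rewrite psD h ?h' ?addr0. Qed.
Lemma finps_mul m n p q : finps m p -> finps n q -> finps (m + n) (p * q).
Proof.
move=> hp hq k mnk; rewrite psM big1 // => i _.
have [mi|im] := leqP m i; first by rewrite hp ?mul0r.
by rewrite hq ?mulr0 // leq_subRL ?(ltnW (leq_trans im _)) ?(leq_trans _ mnk) //
  ?leq_add2r ?(ltnW im) ?leq_addr // -ltnS.
Qed.

Lemma monps_mul m n p q : monps m p -> monps n q -> monps (m + n) (p * q).
Proof.
move=> [p1 hp] [q1 hq]; split; last first.
  move=> k mnk; rewrite psM big1 // => i _.
  have [mi|im] := ltnP m i; first by rewrite hp ?mul0r.
  by rewrite hq ?mulr0 // ltn_subRL; apply: leq_ltn_trans mnk; rewrite leq_add2r.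
have lt : (m < (m + n).+1)%N by rewrite ltnS leq_addr.
rewrite psM (bigD1 (Ordinal lt)) //= p1 mul1r addKn q1 big1 ?addr0 // => i ne.
have [mi|im] := ltnP m i; first by rewrite hp ?mul0r.
have {ne im}im : (i < m)%N by rewrite ltn_neqAle im andbT; apply: contraNneq ne => e; exact/eqP/val_inj.
by rewrite hq ?mulr0 // ltn_subRL ltn_add2r.
Qed.

Lemma ps_ideal (I : set R) : ideal I -> ideal [set p : ps R | forall n, I (p n)].
Proof.
move=> iI; split=> [n|p q hp hq n|p q hq n] /=; first exact: ideal0.
  by rewrite psD; exact: idealD.
by rewrite psM; apply: ideal_sum => // i _; exact: idealMl.
Qed.

(** Descending induction on n: the coefficient of index k + n of g * w is w n plus multiples of
    coefficients of w of larger index. *)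
Lemma monps_cancel (I : set R) k m g w : ideal I -> monps k g -> finps m w ->
  (forall n, (k <= n)%N -> I ((g * w) n)) -> forall n, I (w n).
Proof.
move=> iI [g1 gk] wm h.
suff key d n : (m <= n + d)%N -> I (w n).
  by move=> n; apply: (key m); rewrite leq_addl.
elim: d n => [|d IH] n; first by rewrite addn0 => /wm->; exact: ideal0.
move=> mnd; have := h (k + n)%N (leq_addr _ _).
have lt : (k < (k + n).+1)%N by rewrite ltnS leq_addr.
rewrite psM (bigD1 (Ordinal lt)) //= g1 mul1r addKn => hs.
rewrite -[w n](addrK (\sum_(i < (k + n).+1 | i != Ordinal lt) g i * w (k + n - i)%N)).
apply: idealB => //; apply: ideal_sum => // i ne.
have [ki|ik] := ltnP k i; first by rewrite gk ?mul0r //; exact: ideal0.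
have {ne ik}ik : (i < k)%N by rewrite ltn_neqAle ik andbT; apply: contraNneq ne => e; exact/eqP/val_inj.
apply: idealMl => //; apply: IH; apply: leq_trans mnd _.
by rewrite addnS -addSn leq_add2r ltn_subRL ltn_add2r.
Qed.

Definition lin (x : R) : ps R :=
  fun n => match n with 0 => - x | 1 => 1 | _ => 0 end.

Lemma lin_mon x : monps 1 (lin x).
Proof. by split=> // -[|[|k]]. Qed.

Lemma lin_mul0 x p : (lin x * p) 0%N = - x * p 0%N.
Proof. by rewrite psM big_ord1. Qed.
Lemma lin_mulS x p n : (lin x * p) n.+1 = p n - x * p n.+1.
Proof.
rewrite psM big_ord_recl big_ord_recl big1 => [|i _].
  by rewrite /= /bump /= subn0 subSS subn0; ring.
by rewrite /lin /= /bump /= !add1n mul0r.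
Qed.

Definition evps n p x := \sum_(i < n) p i * x ^+ i.

(** Horner's scheme: the quotient by X - x has the coefficients sum_j p_(i+1+j) x^j. *)
Lemma lin_div n x p : finps n p ->
  exists q, [/\ p = lin x * q + ps_const (evps n p x),
    finps n.-1 q & forall k, monps k.+1 p -> monps k q].
Proof.
move=> pn; pose q : ps R := fun i => \sum_(j < n) p (i.+1 + j)%N * x ^+ j.
have tel i : p i = (\sum_(j < n) p (i + j)%N * x ^+ j) - x * q i.
  have -> : x * q i = \sum_(j < n) p (i + j.+1)%N * x ^+ j.+1.
    by rewrite mulr_sumr; apply: eq_bigr => j _; rewrite addnS exprS; ring.
  have <- : \sum_(j < n.+1) p (i + j)%N * x ^+ j =
      \sum_(j < n) p (i + j)%N * x ^+ j.
    by rewrite big_ord_recr /= [p (i + n)%N]pn ?leq_addl // mul0r addr0.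
  by rewrite big_ord_recl /= addn0 expr0 mulr1 addrK.
exists q; split.
- apply: ps_ext => -[|i]; rewrite psD ?lin_mul0 ?lin_mulS /=.
    by rewrite [LHS]tel /evps addrC mulNr.
  by rewrite addr0 [LHS]tel.
- move=> i ni; have {}ni : (n <= i.+1)%N by case: (n) ni.
  by apply: big1 => j _; rewrite pn ?mul0r // (leq_trans ni) ?leq_addr.
- move=> k [p1 pk]; have q0 i : (k < i)%N -> q i = 0.
    by move=> ki; apply: big1 => j _; rewrite pk ?mul0r // addSn ltnS ltn_addr ?(leq_trans _ ki).
  split=> //; have := tel k.+1.
  have -> : \sum_(j < n) p (k.+1 + j)%N * x ^+ j = q k by [].
  by rewrite p1 (q0 k.+1) // mulr0 subr0.
Qed.

End PowerSeries.

Section MapPs.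
Variables (R S : comPzRingType) (f : {rmorphism R -> S}).

Definition mapps (p : ps R) : ps S := fun n => f (p n).

Lemma mapps_rmorph : is_rmorph mapps.
Proof.
split=> [|p q|p q]; apply: ps_ext => n; rewrite /mapps.
- by case: n => [|n]; rewrite ?rmorph1 ?rmorph0.
- exact: rmorphD.
- by rewrite !psM rmorph_sum; apply: eq_bigr => i _; rewrite rmorphM.
Qed.

Lemma mappsM p q : mapps (p * q) = mapps p * mapps q.
Proof. by have [_ _] := mapps_rmorph. Qed.
Lemma mappsD p q : mapps (p + q) = mapps p + mapps q.
Proof. by have [_ h _] := mapps_rmorph. Qed.

Lemma mapps_mon n p : monps n p -> monps n (mapps p).
Proof. by move=> [p1 h]; split=> [|k kn]; rewrite /mapps ?p1 ?rmorph1 ?h ?rmorph0. Qed.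

Lemma mapps_fin n p : finps n p -> finps n (mapps p).
Proof. by move=> h k kn; rewrite /mapps h ?rmorph0. Qed.

Lemma mapps_lin x : mapps (lin x) = lin (f x).
Proof.
by apply: ps_ext => -[|[|n]]; rewrite /mapps /= ?rmorphN ?rmorph1 ?rmorph0.
Qed.

End MapPs.

(* With d = g1 - g2 and e = h1 - h2, one has d h1 + g2 e = 0; multiplying by the
   Bezout relation shows that g2 divides d modulo r (d, e), hence d = 0 modulo
   r (d, e) by degree reasons. *)
Lemma factorization_unique (R : comPzRingType) (r : set R) k l
    (g1 g2 h1 h2 u v : ps R) m :
  ideal r -> (forall a, r a -> exists b, (1 + a) * b = 1) ->
  monps k g1 -> monps k g2 -> monps l h1 -> monps l h2 ->
  finps m u -> finps m v ->
  (forall n, r ((u * g1 + v * h1 - 1) n)) ->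
  (forall n, r ((g1 - g2) n)) -> (forall n, r ((h1 - h2) n)) ->
  g1 * h1 = g2 * h2 -> g1 = g2 /\ h1 = h2.
Proof.
move=> ir ru mg1 mg2 mh1 mh2 fu fv bez rg rh e.
pose d := g1 - g2; pose c := h1 - h2; pose rho := u * g1 + v * h1 - 1.
have fd : finps k d.
  move=> n; rewrite leq_eqVlt /d psB => /orP[/eqP<-|kn].
    by case: mg1 mg2 => -> _ [-> _]; rewrite subrr.
  by case: mg1 mg2 => _ -> // [_ ->] //; rewrite subrr.
have fc : finps l c.
  move=> n; rewrite leq_eqVlt /c psB => /orP[/eqP<-|ln].
    by case: mh1 mh2 => -> _ [-> _]; rewrite subrr.
  by case: mh1 mh2 => _ -> // [_ ->] //; rewrite subrr.
pose J := ('I_k + 'I_l)%type.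
pose gen (j : J) := match j with inl i => d i | inr i => c i end.
pose a := [set x | exists w : J -> R, (forall j, r (w j)) /\
  x = \sum_j w j * gen j].
have ia : ideal a.
  split.
  - exists (fun=> 0); split=> [j|]; first exact: ideal0.
    by rewrite big1 // => j _; rewrite mul0r.
  - move=> _ _ [w [wr ->]] [w' [wr' ->]]; exists (fun j => w j + w' j).
    split=> [j|]; first exact: idealD.
    by rewrite -big_split; apply: eq_bigr => j _; rewrite mulrDl.
  - move=> b _ [w [wr ->]]; exists (fun j => b * w j); split=> [j|].
      exact: idealMl.
    by rewrite mulr_sumr; apply: eq_bigr => j _; rewrite mulrA.
have agen x j : r x -> a (x * gen j).
  move=> rx; exists (fun j' => (j == j')%:R * x); split=> [j'|].
    exact: idealMl.
  rewrite -[LHS](delta_sum j (fun j => x * gen j)).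
  by apply: eq_bigr => j' _; rewrite mulrA.
have ad x n : r x -> a (x * d n).
  move=> rx; have [kn|nk] := leqP k n; first by rewrite fd ?mulr0 //; exact: ideal0.
  exact: (agen x (inl (Ordinal nk))).
have ac x n : r x -> a (x * c n).
  move=> rx; have [ln|nl] := leqP l n; first by rewrite fc ?mulr0 //; exact: ideal0.
  exact: (agen x (inr (Ordinal nl))).
have ia' := ps_ideal ia.
have arho : forall n, a ((rho * d) n).
  by move=> n; rewrite psM; apply: ideal_sum => // i _; apply: ad; exact: bez.
have add : forall n, a ((d * d) n).
  by move=> n; rewrite psM; apply: ideal_sum => // i _; apply: ad; exact: rg.
have audd : forall n, a ((u * (d * d)) n) by exact: (idealMl u ia' add).
pose w := u * d - v * c.
have rel : d * h1 + g2 * c = 0.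
  have -> : d * h1 + g2 * c = g1 * h1 - g2 * h2 by rewrite /d /c; ring.
  by rewrite e subrr.
have dE : g2 * w = d + rho * d - u * (d * d).
  rewrite /w /rho; apply/eqP; rewrite -subr_eq0; apply/eqP.
  transitivity (- (v * (d * h1 + g2 * c))); last by rewrite rel mulr0 oppr0.
  by rewrite /d; ring.
have fw : finps (m + (k + l)) w.
  apply: finpsD; first apply: finpsW (finps_mul fu fd).
    by rewrite leq_add2l leq_addr.
  by apply: finpsN; apply: finpsW (finps_mul fv fc); rewrite leq_add2l leq_addl.
have aw : forall n, a (w n).
  apply: (monps_cancel ia mg2 fw) => n kn; rewrite dE psB psD fd // add0r.
  exact: idealB.
have adn : forall n, a (d n).
  have -> : d = g2 * w - rho * d + u * (d * d) by rewrite dE; ring.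
  move=> n; rewrite psD psB; apply: idealD => //; apply: idealB => //.
  exact: (idealMl g2 ia' aw).
have acn : forall n, a (c n).
  apply: (monps_cancel ia mg2 fc) => n _.
  have -> : g2 * c = - (h1 * d) by apply/eqP; rewrite -addr_eq0 addrC mulrC rel.
  exact: (idealN ia' (idealMl h1 ia' adn)).
have ag j : a (gen j) by case: j => i /=.
(* The differences of coefficients now lie in r times the ideal they generate, which is the
   situation of [nakayama]. *)
have [N NP] : exists N : J -> J -> R, forall i, (forall j, r (N i j)) /\
    gen i = \sum_j N i j * gen j.
  by exists (fun i => projT1 (cid (ag i))) => i; exact: (projT2 (cid (ag i))).
have g0 := @nakayama R R idfun r J N gen ir ru (fun i => (NP i).1) (fun i => (NP i).2).
split; apply/eqP; rewrite -subr_eq0; apply/eqP/ps_ext => n.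
  have [kn|nk] := leqP k n; first exact: fd.
  exact: (g0 (inl (Ordinal nk))).
have [ln|nl] := leqP l n; first exact: fc.
exact: (g0 (inr (Ordinal nl))).
Qed.

(** * The universal factorization *)

Import Pdiv.CommonRing Pdiv.RingMonic.

Definition retraction (S T : comPzRingType) (i : {rmorphism S -> T})
    (rho : T -> S) : Prop :=
  [/\ rho 0 = 0, (forall x y, rho (x + y) = rho x + rho y),
      (forall a x, rho (i a * x) = a * rho x) & rho 1 = 1].

Lemma retractionK (S T : comPzRingType) (i : {rmorphism S -> T}) rho a :
  retraction i rho -> rho (i a) = a.
Proof. by move=> [_ _ rZ r1]; rewrite -[i a]mulr1 rZ r1 mulr1. Qed.

Lemma poly_eval_hom (R : comNzRingType) (U : comPzRingType)
    (g : {rmorphism R -> U}) (y : U) :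
  exists h : {rmorphism {poly R} -> U}, h 'X = y /\ forall a, h a%:P = g a.
Proof.
have [e|ne] := pselect ((1 : U) = 0).
  have all0 (u v : U) : u = v by rewrite -[u]mul1r -[v]mul1r e !mul0r.
  have [|h _] := @rmorph_of {poly R} U (fun=> 0); first by split.
  by exists h.
pose V : comNzRingType := HB.pack (U : Type) U
  (GRing.PzSemiRing_isNonZero.Build U (introN eqP ne)).
pose gV : {rmorphism R -> V} := g.
have cV : commr_rmorph gV (y : V) by move=> a; exact: mulrC.
pose h : {rmorphism {poly R} -> V} := horner_morph cV.
exists h; split; first exact: (horner_morphX cV).
by move=> a; exact: (horner_morphC cV).
Qed.

(** T is S[X]/(c), free on the powers of X up to k; the coordinates [co j] are read off from the
    remainder modulo a monic polynomial. They prove flatness, and [co 0] is the retraction, for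
    which the degree k.+1 must be positive. *)
Lemma adjoin_root_nz (S : comNzRingType) (k : nat) (c : ps S) :
  monps k.+1 c ->
  exists (T : comPzRingType) (i : {rmorphism S -> T}) (x : T) (rho : T -> S),
  [/\ evps k.+2 (mapps i c) x = 0, retraction i rho, eqflat i
    & forall (U : comPzRingType) (g : {rmorphism S -> U}) (y : U),
      evps k.+2 (mapps g c) y = 0 ->
      exists h : {rmorphism T -> U}, (forall a, h (i a) = g a) /\ h x = y].
Proof.
move=> [c1 ck]; pose g : {poly S} := \poly_(j < k.+2) c j.
have sg : size g = k.+2 by rewrite size_poly_eq // c1 oner_neq0.
have mg : g \is monic by rewrite monicE lead_coefE sg coef_poly ltnSn c1.
pose J : set {poly S} := [set p | exists q, p = q * g].
have iJ : ideal J.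
  split=> [|_ _ [p ->] [q ->]|a _ [q ->]].
  - by exists 0; rewrite mul0r.
  - by exists (p + q); rewrite mulrDl.
  - by exists (a * q); rewrite mulrA.
have [T [p [sp pE]]] := quotient_ring iJ.
have [i iE] : exists i : {rmorphism S -> T}, forall a, i a = p a%:P.
  apply: rmorph_of; split=> [|a b|a b]; first by rewrite polyC1 rmorph1.
    by rewrite polyCD rmorphD.
  by rewrite polyCM rmorphM.
have evE (U : comPzRingType) (h : {rmorphism {poly S} -> U})
    (g0 : {rmorphism S -> U}) : (forall a, h a%:P = g0 a) ->
    evps k.+2 (mapps g0 c) (h 'X) = h g.
  move=> hC; rewrite /g poly_def rmorph_sum; apply: eq_bigr => j _.
  by rewrite -mul_polyC rmorphM hC rmorphXn.
pose rep t := projT1 (cid (sp t)).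
have repK t : p (rep t) = t by rewrite /rep; case: cid.
pose co j t := (rmodp (rep t) g)`_j.
have coE j q : co j (p q) = (rmodp q g)`_j.
  have /pE[q' e] : p (rep (p q) - q) = 0 by rewrite rmorphB repK subrr.
  rewrite /co; have -> : rep (p q) = q' * g + q by rewrite -e subrK.
  by rewrite rmodpD // rmodp_mull // add0r.
have coD j t u : co j (t + u) = co j t + co j u.
  by rewrite -(repK t) -(repK u) -rmorphD !coE rmodpD // coefD.
have coZ j a t : co j (i a * t) = a * co j t.
  by rewrite -(repK t) iE -rmorphM !coE mul_polyC rmodpZ // coefZ.
have co0 j : co j 0 = 0 by rewrite -(rmorph0 p) coE rmod0p coef0.
have spanE t : t = \sum_(j < k.+1) i (co j t) * p 'X ^+ j.
  rewrite -{1}(repK t) {1}(rdivp_eq mg (rep t)) rmorphD.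
  have -> : p (rdivp (rep t) g * g) = 0 by apply/pE; exists (rdivp (rep t) g).
  rewrite add0r -{1}[rmodp _ _]coefK poly_def.
  have lt : (size (rmodp (rep t) g) <= k.+1)%N.
    by rewrite -ltnS -sg ltn_rmodpN0 // monic_neq0.
  rewrite (big_ord_widen _ (fun j => (rmodp (rep t) g)`_j *: 'X^j) lt).
  rewrite rmorph_sum big_mkcond /=; apply: eq_bigr => j _.
  rewrite -mul_polyC rmorphM iE rmorphXn; case: ifP => // /negbT.
  by rewrite -leqNgt => sj; rewrite /co nth_default // polyC0 rmorph0 mul0r.
exists T, i, (p 'X), (co 0%N); split.
- by rewrite (evE T p i (fun a => esym (iE a))); apply/pE; exists 1; rewrite mul1r.
- split=> //; rewrite -(rmorph1 p) coE rmodp_small ?coef1 //.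
  by rewrite size_poly1 sg.
- move=> I r s rs; exists 'I_k.+1, (fun n (j : 'I_k.+1) => co j (s n)), (fun j : 'I_k.+1 => p 'X ^+ j).
  split=> [n|j]; first exact: spanE.
  transitivity (co j (\sum_n i (r n) * s n)); last by rewrite rs co0.
  rewrite (big_morph (co j) (coD j) (co0 j)).
  by apply: eq_bigr => n _; rewrite coZ.
- move=> U g0 y ev; have [h0 [h0X h0C]] := poly_eval_hom g0 y.
  have [q|h hE] := @surj_lift {poly S} T U p h0 sp.
    move=> /pE[q' ->]; rewrite rmorphM -(evE _ h0 g0 h0C) h0X ev mulr0 //.
  by exists h; split=> [a|]; rewrite ?iE hE.
Qed.

Lemma eqflat_id (S : comPzRingType) (i : {rmorphism S -> S}) :
  (forall a, i a = a) -> eqflat i.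
Proof.
move=> iE I r s rs; exists unit, (fun n _ => s n), (fun=> 1).
split=> [n|_]; first by rewrite (big_pred1 tt) ?mulr1 ?iE //; case.
by rewrite -[RHS]rs; apply: eq_bigr => n _; rewrite iE.
Qed.

Lemma adjoin_root (S : comPzRingType) (k : nat) (c : ps S) :
  monps k.+1 c ->
  exists (T : comPzRingType) (i : {rmorphism S -> T}) (x : T) (rho : T -> S),
  [/\ evps k.+2 (mapps i c) x = 0, retraction i rho, eqflat i
    & forall (U : comPzRingType) (g : {rmorphism S -> U}) (y : U),
      evps k.+2 (mapps g c) y = 0 ->
      exists h : {rmorphism T -> U}, (forall a, h (i a) = g a) /\ h x = y].
Proof.
move=> mc; have [e|ne] := pselect ((1 : S) = 0); last first.
  pose R : comNzRingType := HB.pack (S : Type) S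
    (GRing.PzSemiRing_isNonZero.Build S (introN eqP ne)).
  exact: (@adjoin_root_nz R k c mc).
have all0 (u v : S) : u = v by rewrite -[u]mul1r -[v]mul1r e !mul0r.
exists S, idfun, 0, id; split=> //; first exact: eqflat_id.
move=> U g y _; exists g; split=> //.
have e' : 1 = 0 :> U by rewrite -(rmorph1 g) e rmorph0.
by rewrite -[LHS]mul1r -[RHS]mul1r e' !mul0r.
Qed.

Lemma mapps_comp (R S T : comPzRingType) (f : {rmorphism R -> S})
    (g : {rmorphism S -> T}) (h : {rmorphism R -> T}) (p : ps R) :
  (forall a, g (f a) = h a) -> mapps g (mapps f p) = mapps h p.
Proof. by move=> e; apply: ps_ext => n; exact: e. Qed.

Lemma monps_inj k m (R : comPzRingType) (g p q : ps R) :
  monps k g -> finps m p -> finps m q -> g * p = g * q -> p = q.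
Proof.
move=> mg fp fq e; apply/eqP; rewrite -subr_eq0; apply/eqP/ps_ext.
apply: (monps_cancel (ideal_zero R) mg (finpsD fp (finpsN fq))) => n _.
by rewrite mulrBr e subrr.
Qed.

(** Uniqueness of the division by X - x: a remainder that is a multiple of a monic polynomial of
    degree one vanishes. *)
Lemma evps_lin (R : comPzRingType) m n x (p q : ps R) :
  finps n p -> finps m q -> p = lin x * q -> evps n p x = 0.
Proof.
move=> fp fq e; have [q' [e' fq' _]] := lin_div x fp.
set c := evps n p x in e' *.
have h : lin x * (q - q') = ps_const c.
  by rewrite mulrBr -e {1}e' addrC addKr.
have fqq : finps (m + n) (q - q').
  apply: finpsD; [apply: finpsW fq | apply/finpsN/(finpsW _ fq')].
    exact: leq_addr.
  by rewrite (leq_trans (leq_pred n)) ?leq_addl.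
have z : q - q' = 0.
  apply: ps_ext.
  apply: (monps_cancel (ideal_zero R) (lin_mon x) fqq) => -[|k] // _.
  by rewrite h.
by have : ps_const c 0%N = 0 by rewrite -h z mulr0.
Qed.

(* F is flat because adjoining a root of the first factor yields the universal
   factorization of a polynomial of smaller degree over a free algebra, in which
   it sits as a direct summand. *)
Lemma factorization_algebra k : forall l (R : comPzRingType) (f : ps R),
  monps (k + l) f ->
  exists (F : comPzRingType) (i : {rmorphism R -> F}) (g h : ps F),
  [/\ [/\ monps k g, monps l h, mapps i f = g * h & eqflat i],
      forall (U : comPzRingType) (u : {rmorphism R -> U}) (g' h' : ps U),
        monps k g' -> monps l h' -> mapps u f = g' * h' ->
        exists w : {rmorphism F -> U},
          [/\ forall a, w (i a) = u a, mapps w g = g' & mapps w h = h']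
    & forall P : set F, subring P -> (forall a, P (i a)) ->
        (forall n, P (g n)) -> (forall n, P (h n)) -> forall x, P x].
Proof.
elim: k => [|k IH] l R f mf.
  exists R, idfun, 1, f; split.
  - split; [by split=> // -[] | exact: mf | by rewrite mul1r | exact: eqflat_id].
  - move=> U u g' h' [g1 g0] mh e; have {g1 g0}gE : g' = 1.
      by apply: ps_ext => -[|n]; rewrite ?g1 ?g0.
    exists u; split=> //; last by rewrite e gE mul1r.
    by rewrite gE; apply: ps_ext => -[|n]; rewrite /mapps ?rmorph1 ?rmorph0.
  - by move=> P _ h _ _ x; exact: h.
rewrite addSn in mf.
have [R1 [i1 [x1 [_ [ev1 _ fl1 univ1]]]]] := adjoin_root mf.
have ff := monps_fin mf.
have [f1 [f1E _ f1m]] := lin_div x1 (mapps_fin i1 ff).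
have {}f1m := f1m _ (mapps_mon i1 mf).
have {}f1E : mapps i1 f = lin x1 * f1.
  rewrite {1}f1E ev1 (_ : ps_const 0 = 0) ?addr0 //.
  by apply: ps_ext => -[].
have [G [j [g' [h' [[mg' mh' e' flj] univG _]]]]] := IH l R1 f1 f1m.
have [q qE] : exists q : {rmorphism R -> G}, forall a, q a = j (i1 a).
  by exists (j \o i1).
have flq : eqflat q by exact: eqflat_comp qE fl1 flj.
pose gG := lin (j x1) * g'.
have mgG : monps k.+1 gG by rewrite -add1n; exact: monps_mul (lin_mon _) mg'.
have eG : mapps q f = gG * h'.
  rewrite -(@mapps_comp _ _ _ i1 j q) => [|a]; last by rewrite qE.
  by rewrite f1E mappsM mapps_lin e' mulrA.
(* G represents a factorization together with a root of its first factor. F is the subring of G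
   generated by R and the coefficients of the two factors, in which the choice of a root is
   forgotten. *)
pose P0 : set G := [set x | forall P : set G, subring P ->
  (forall a, P (q a)) -> (forall n, P (gG n)) -> (forall n, P (h' n)) -> P x].
have sP0 : subring P0.
  split=> [P [P1 _ _ _]|x Px P sP Pq Pg Ph|x y Px Py P sP Pq Pg Ph|x y Px Py P sP Pq Pg Ph] //;
    have [_ PN PD PM] := sP.
  - by apply: PN; exact: Px.
  - by apply: PD; [exact: Px | exact: Py].
  - by apply: PM; [exact: Px | exact: Py].
have [F [v [vi vP]]] := subring_ring sP0.
have [|i iE] := @inj_lift _ _ _ v q vi.
  by move=> a; apply/vP => P _ h *; exact: h.
have lift (p : ps G) : (forall n, P0 (p n)) -> exists p' : ps F, mapps v p' = p.
  move=> p0; have p1 n := (vP (p n)).1 (p0 n).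
  exists (fun n => projT1 (cid (p1 n))); apply: ps_ext => n.
  exact: (projT2 (cid (p1 n))).
have [g gE] : exists g : ps F, mapps v g = gG.
  by apply: lift => n P _ _ h *; exact: h.
have [h hE] : exists h : ps F, mapps v h = h'.
  by apply: lift => n P _ _ _ h; exact: h.
have mapi (p p' : ps F) : mapps v p = mapps v p' -> p = p'.
  by move=> e; apply: ps_ext => n; apply: vi; exact: (congr1 (fun p => p n) e).
have vmon n p : monps n (mapps v p) -> monps n p.
  move=> [p1 p0]; split=> [|m nm]; apply: vi; first by rewrite rmorph1; exact: p1.
  by rewrite rmorph0; exact: p0.
have mg : monps k.+1 g by apply: vmon; rewrite gE.
have mh : monps l h by apply: vmon; rewrite hE.
have fE : mapps i f = g * h.
  by apply: mapi; rewrite (mapps_comp _ iE) mappsM gE hE.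
have gen (P : set F) : subring P -> (forall a, P (i a)) ->
    (forall n, P (g n)) -> (forall n, P (h n)) -> forall x, P x.
  move=> sP Pi Pg Ph x.
  have /vP : exists s, v s = v x by exists x.
  have [P1 PN PD PM] := sP.
  move=> /(_ [set y | exists2 s, P s & v s = y])[].
  - split=> [|_ [s Ps <-]|_ _ [s Ps <-] [t Pt <-]|_ _ [s Ps <-] [t Pt <-]].
    + by exists 1; rewrite ?rmorph1.
    + by exists (- s); rewrite ?rmorphN //; exact: PN.
    + by exists (s + t); rewrite ?rmorphD //; exact: PD.
    + by exists (s * t); rewrite ?rmorphM //; exact: PM.
  - by move=> a; exists (i a); rewrite ?iE.
  - by move=> n; exists (g n) => //; exact: (congr1 (fun p => p n) gE).
  - by move=> n; exists (h n) => //; exact: (congr1 (fun p => p n) hE).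
  - by move=> s Ps /vi <-.
(* The universal property of G: a factorization over U and a root y of its first factor. *)
have extend_G (U : comPzRingType) (u : {rmorphism R -> U}) (y : U) g0 h0 :
    monps k.+1 g0 -> monps l h0 -> mapps u f = g0 * h0 ->
    evps k.+2 g0 y = 0 ->
    exists w : {rmorphism G -> U},
      [/\ forall a, w (q a) = u a, mapps w gG = g0 & mapps w h' = h0].
  move=> mg0 mh0 e0 ev0.
  have [g1 [g1E _ g1m]] := lin_div y (monps_fin mg0).
  have {}g1m := g1m _ mg0.
  have {}g1E : g0 = lin y * g1.
    rewrite {1}g1E ev0 (_ : ps_const 0 = 0) ?addr0 //.
    by apply: ps_ext => -[].
  have fgh := finps_mul (monps_fin g1m) (monps_fin mh0).
  have [|u1 [u1i u1x]] := univ1 U u y.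
    apply: (evps_lin (mapps_fin u ff) fgh).
    by rewrite e0 g1E mulrA.
  have [|w [wj wg wh]] := univG U u1 g1 h0 g1m mh0.
    apply: (monps_inj (lin_mon y) (m := (k + l).+2)); last 1 first.
    - have := congr1 (mapps u1) f1E.
      rewrite (mapps_comp _ u1i) mappsM mapps_lin u1x => <-.
      by rewrite e0 g1E mulrA.
    - by apply: mapps_fin; apply: finpsW (monps_fin f1m).
    - by apply: finpsW fgh; rewrite addSn addnS.
  exists w; split=> // [a|]; first by rewrite qE wj u1i.
  by rewrite mappsM mapps_lin wj u1x wg g1E.
exists F, i, g, h; split=> //.
  split=> //.
  (* A root adjoined to F gives a map from G to F[y] that restricts to the inclusion of F; composed
     with the retraction of F[y] onto F it splits v. *)
  have [Ad [a [y [rho [eva rr _ _]]]]] := adjoin_root mg.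
  have [|w [wq wg wh]] := extend_G Ad (a \o i) y (mapps a g) (mapps a h)
    (mapps_mon a mg) (mapps_mon a mh) _ eva.
    by rewrite -mappsM -fE; symmetry; exact: mapps_comp.
  have wv x : w (v x) = a x.
    apply: (gen [set x | w (v x) = a x]) => [|r|n|n] /=.
    - exact: (subring_eq (w \o v) a).
    - by rewrite iE wq.
    - by have /= := congr1 (fun p => p n) wg; rewrite -gE.
    - by have /= := congr1 (fun p => p n) wh; rewrite -hE.
  have [rho0 rhoD rhoZ _] := rr.
  apply: (@eqflat_retract _ _ _ i v q (rho \o w)) => //= [|x x'|r x|x].
  - by rewrite rmorph0 rho0.
  - by rewrite rmorphD rhoD.
  - by rewrite rmorphM wq /= rhoZ.
  - by rewrite wv; exact: retractionK.
move=> U u g0 h0 mg0 mh0 e0.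
(* The first factor need not have a root in U. One is adjoined in an extension that contains U, and
   the values on F fall back into U because the generators do. *)
have [Ad [b [y [rho [evb rr _ _]]]]] := adjoin_root mg0.
have bi : injective b by move=> s t e; rewrite -(retractionK s rr) e retractionK.
have [|w [wq wg wh]] := extend_G Ad (b \o u) y (mapps b g0) (mapps b h0)
    (mapps_mon b mg0) (mapps_mon b mh0) _ evb.
  by rewrite -mappsM -e0; symmetry; exact: mapps_comp.
have wvg n : w (v (g n)) = b (g0 n).
  by have := congr1 (fun p => p n) wg; rewrite -gE.
have wvh n : w (v (h n)) = b (h0 n).
  by have := congr1 (fun p => p n) wh; rewrite -hE.
have [|W WE] := @inj_lift _ _ _ b (w \o v) bi.
  move=> x; apply: (gen [set x | exists s, b s = (w \o v) x]) => [|r|n|n] /=.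
  - have sb : subring [set y | exists s, b s = y].
      split=> [|_ [s <-]|_ _ [s <-] [t <-]|_ _ [s <-] [t <-]].
      + by exists 1; rewrite rmorph1.
      + by exists (- s); rewrite rmorphN.
      + by exists (s + t); rewrite rmorphD.
      + by exists (s * t); rewrite rmorphM.
    exact: (subring_preim (w \o v) sb).
  - by exists (u r); rewrite iE wq.
  - by exists (g0 n); rewrite wvg.
  - by exists (h0 n); rewrite wvh.
exists W; split=> [r||].
- by apply: bi; rewrite WE /= iE wq.
- by apply: ps_ext => n; apply: bi; rewrite WE /= wvg.
- by apply: ps_ext => n; apply: bi; rewrite WE /= wvh.
Qed.

(** * Adjoining roots of all monic polynomials *)

Section RootClosure.
Variable R : comPzRingType.

(* [Root c] names a root of X^(d+1) + sum_i c_i X^i *)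
Inductive term : Type :=
| Cst of R
| Add of term & term
| Mul of term & term
| Opp of term
| Root d of ('I_d.+1 -> term).

Definition tpow (t : term) n := iter n (Mul t) (Cst 1).
Definition tsum (T : Type) (s : seq T) (F : T -> term) :=
  foldr (fun i => Add (F i)) (Cst 0) s.

Definition root_rel d (c : 'I_d.+1 -> term) : term :=
  Add (tpow (Root c) d.+1)
    (tsum (enum 'I_d.+1) (fun i => Mul (c i) (tpow (Root c) i))).

Inductive teq : term -> term -> Prop :=
| teq_refl t : teq t t
| teq_sym t u : teq t u -> teq u t
| teq_trans t u v : teq t u -> teq u v -> teq t v
| teq_add t u t' u' : teq t t' -> teq u u' -> teq (Add t u) (Add t' u')
| teq_mul t u t' u' : teq t t' -> teq u u' -> teq (Mul t u) (Mul t' u')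
| teq_opp t t' : teq t t' -> teq (Opp t) (Opp t')
| teq_addA t u v : teq (Add t (Add u v)) (Add (Add t u) v)
| teq_addC t u : teq (Add t u) (Add u t)
| teq_add0 t : teq (Add (Cst 0) t) t
| teq_addN t : teq (Add (Opp t) t) (Cst 0)
| teq_mulA t u v : teq (Mul t (Mul u v)) (Mul (Mul t u) v)
| teq_mulC t u : teq (Mul t u) (Mul u t)
| teq_mul1 t : teq (Mul (Cst 1) t) t
| teq_mulD t u v : teq (Mul (Add t u) v) (Add (Mul t v) (Mul u v))
| teq_cstD a b : teq (Cst (a + b)) (Add (Cst a) (Cst b))
| teq_cstM a b : teq (Cst (a * b)) (Mul (Cst a) (Cst b))
| teq_root d (c : 'I_d.+1 -> term) : teq (root_rel c) (Cst 0).

Definition symb : Type := {d : nat & 'I_d.+1 -> term}.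
HB.instance Definition _ := gen_eqMixin symb.
Definition sroot (s : symb) : term := Root (tagged s).

Section Eval.
Variables (T : comPzRingType) (i : {rmorphism R -> T}) (nu : symb -> T).

Fixpoint teval (t : term) : T :=
  match t with
  | Cst a => i a
  | Add t u => teval t + teval u
  | Mul t u => teval t * teval u
  | Opp t => - teval t
  | Root d c => nu (existT _ d c)
  end.

Lemma teval_pow t n : teval (tpow t n) = teval t ^+ n.
Proof.
by elim: n => [|n IH] /=; rewrite ?rmorph1 // -/(tpow t n) IH exprS.
Qed.

Lemma teval_sum (U : Type) (s : seq U) (F : U -> term) :
  teval (tsum s F) = \sum_(x <- s) teval (F x).
Proof.
by elim: s => [|x s IH] /=; rewrite ?big_nil ?rmorph0 // big_cons -IH.
Qed.

Definition sat (s : symb) : Prop := teval (root_rel (tagged s)) = 0.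

End Eval.

(** A derivation involves finitely many root relations, so its conclusion holds in every model of
    these. This replaces a transfinite tower of extensions. *)
Lemma teq_sound t u : teq t u -> exists l : seq symb,
  forall (T : comPzRingType) (i : {rmorphism R -> T}) (nu : symb -> T),
    (forall s, s \in l -> sat i nu s) -> teval i nu t = teval i nu u.
Proof.
elim=> {t u}.
- by exists [::].
- by move=> t u _ [l h]; exists l => T i nu hl; rewrite h.
- move=> t u v _ [l h] _ [l' h']; exists (l ++ l') => T i nu hl.
  by rewrite h ?h' // => s sl; apply: hl; rewrite mem_cat sl ?orbT.
- move=> t u t' u' _ [l h] _ [l' h']; exists (l ++ l') => T i nu hl /=.
  by rewrite h ?h' // => s sl; apply: hl; rewrite mem_cat sl ?orbT.
- move=> t u t' u' _ [l h] _ [l' h']; exists (l ++ l') => T i nu hl /=.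
  by rewrite h ?h' // => s sl; apply: hl; rewrite mem_cat sl ?orbT.
- by move=> t t' _ [l h]; exists l => T i nu hl /=; rewrite h.
- by move=> t u v; exists [::] => T i nu _ /=; rewrite addrA.
- by move=> t u; exists [::] => T i nu _ /=; rewrite addrC.
- by move=> t; exists [::] => T i nu _ /=; rewrite rmorph0 add0r.
- by move=> t; exists [::] => T i nu _ /=; rewrite rmorph0 addNr.
- by move=> t u v; exists [::] => T i nu _ /=; rewrite mulrA.
- by move=> t u; exists [::] => T i nu _ /=; rewrite mulrC.
- by move=> t; exists [::] => T i nu _ /=; rewrite rmorph1 mul1r.
- by move=> t u v; exists [::] => T i nu _ /=; rewrite mulrDl.
- by move=> a b; exists [::] => T i nu _ /=; rewrite rmorphD.
- by move=> a b; exists [::] => T i nu _ /=; rewrite rmorphM.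
- move=> d c; exists [:: existT _ d c] => T i nu hl.
  by rewrite [RHS]rmorph0; apply: (hl (existT _ d c)); rewrite inE.
Qed.

Fixpoint height (t : term) : nat :=
  match t with
  | Cst _ => 0
  | Add t u | Mul t u => maxn (height t) (height u)
  | Opp t => height t
  | Root d c => (\max_(j < d.+1) height (c j)).+1
  end.

Lemma teval_ext (T T' : comPzRingType) (i : {rmorphism R -> T})
    (j : {rmorphism T -> T'}) (i' : {rmorphism R -> T'}) nu nu' t :
  (forall a, i' a = j (i a)) ->
  (forall s, (height (sroot s) <= height t)%N -> nu' s = j (nu s)) ->
  teval i' nu' t = j (teval i nu t).
Proof.
move=> iE; elim: t => [a|t IHt u IHu|t IHt u IHu|t IHt|d c _] h /=.
- exact: iE.
- rewrite rmorphD IHt ?IHu // => s hs; apply: h; apply: leq_trans hs _ => /=.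
    exact: leq_maxr.
  exact: leq_maxl.
- rewrite rmorphM IHt ?IHu // => s hs; apply: h; apply: leq_trans hs _ => /=.
    exact: leq_maxr.
  exact: leq_maxl.
- by rewrite rmorphN IHt.
- exact: (h (existT _ d c)).
Qed.

Lemma teval_root (T : comPzRingType) (i : {rmorphism R -> T}) nu (s : symb) :
  teval i nu (root_rel (tagged s)) = nu s ^+ (tag s).+1 +
    \sum_(j < (tag s).+1) teval i nu (tagged s j) * nu s ^+ j.
Proof.
case: s => d c; rewrite [LHS]/= !teval_sum -/(tpow _ _) (teval_pow _ _ _ d).
rewrite -exprS big_enum /=; congr (_ + _); apply: eq_bigr => j _.
by rewrite teval_pow.
Qed.

(** The coefficients of a symbol have smaller height than the symbol itself, so roots can be
    adjoined by increasing height, each time with a retraction onto the preceding ring. *)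
Lemma root_model (l : seq symb) :
  exists (T : comPzRingType) (i : {rmorphism R -> T}) (rho : T -> R)
    (nu : symb -> T), retraction i rho /\ forall s, s \in l -> sat i nu s.
Proof.
(* Decreasing height: the induction treats the tail first and adjoins the head, of largest height,
   last. *)
pose r (s s' : symb) := (height (sroot s') <= height (sroot s))%N.
have rtot : total r by move=> s s'; exact: leq_total.
have rtr : transitive r by move=> s s' s'' h h'; exact: leq_trans h' h.
suff [T [i [rho [nu [ri h]]]]] :
    exists (T : comPzRingType) (i : {rmorphism R -> T}) (rho : T -> R)
    (nu : symb -> T), retraction i rho /\ forall s, s \in sort r l -> sat i nu s.
  by exists T, i, rho, nu; split=> // s sl; apply: h; rewrite mem_sort.
have := sort_sorted rtot l; elim: (sort r l) => [_|s l' IH].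
  by exists R, idfun, id, (fun=> 0); split.
rewrite /= (path_sortedE rtr) => /andP[/allP smax /IH[T [i [rho [nu [ri h]]]]]].
case: s smax => d c smax.
pose p : ps T := fun n => if n == d.+1 then 1 else
  if insub n is Some j then teval i nu (c j) else 0.
have mp : monps d.+1 p.
  split=> [|n dn]; rewrite /p ?eqxx // gtn_eqF // insubF //.
  by apply/negbTE; rewrite -leqNgt ltnW.
have [T' [j [x [rho' [evx rr _ _]]]]] := adjoin_root mp.
pose s0 : symb := existT _ d c.
pose nu' s := if pselect (s = s0) then x else j (nu s).
have nuE s' : s' <> s0 -> nu' s' = j (nu s') by rewrite /nu'; case: pselect.
have low t : (height t < height (sroot s0))%N ->
    teval (j \o i) nu' t = j (teval i nu t).
  move=> ht; apply: teval_ext => // s' hs'; apply: nuE => e.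
  by move: hs'; rewrite e leqNgt ht.
have lowc (s' : symb) k : (height (sroot s') <= height (sroot s0))%N ->
    (height (tagged s' k) < height (sroot s0))%N.
  by move=> hs; apply: leq_trans hs; rewrite ltnS (leq_bigmax k).
exists T', (j \o i), (rho \o rho'), nu'; split.
  have [a1 a2 a3 a4] := ri; have [b1 b2 b3 b4] := rr.
  by split=> [|y z|a y|] /=; rewrite ?b1 ?b2 ?b3 ?b4 ?a4.
have sats' s' : (height (sroot s') <= height (sroot s0))%N -> s' <> s0 ->
    sat i nu s' -> sat (j \o i) nu' s'.
  rewrite /sat !teval_root => hs ne e.
  apply: etrans (etrans (congr1 j e) (rmorph0 j)).
  rewrite nuE // rmorphD rmorphXn rmorph_sum; congr (_ + _); apply: eq_bigr => k _.
  by rewrite rmorphM rmorphXn low //; exact: lowc.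
move=> s'; rewrite inE => s'l; have [->|ne] := pselect (s' = s0); last first.
  move: s'l; case: eqP => //= _ s'l; apply: sats' => //; last exact: h.
  exact: smax.
have nu0 : nu' s0 = x by rewrite /nu'; case: pselect.
rewrite /sat teval_root nu0.
apply: etrans evx; rewrite /evps [in RHS]big_ord_recr /= /mapps /p eqxx rmorph1 mul1r addrC.
congr (_ + _); apply: eq_bigr => k _; rewrite /= ltn_eqF // low; last exact: (lowc s0).
by congr (j _ * _); case: insubP => [k' _ /val_inj-> //|]; rewrite ltn_ord.
Qed.

Definition term_zmod : preZmod :=
  @PreZmod term teq (Cst 0) Opp Add teq_refl teq_sym teq_trans teq_opp
    teq_add teq_addA teq_addC teq_add0 teq_addN.
Definition term_ring : preRing :=
  @PreRing term_zmod (Cst 1) Mul teq_mul teq_mulA teq_mulC teq_mul1 teq_mulD.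

(** The second clause says that finitely generated ideals of R are contracted from E. Such an
    equation involves finitely many roots, hence holds in an extension of R with an R-linear
    retraction, which carries it back to R. *)
Lemma root_closure :
  exists (E : comPzRingType) (i : {rmorphism R -> E}),
  (forall d (p : ps E), monps d.+1 p -> exists x, evps d.+2 p x = 0) /\
  forall (I : finType) (a : I -> R) (t : I -> E) (r : R),
    i r = \sum_j i (a j) * t j -> exists b : I -> R, r = \sum_j a j * b j.
Proof.
pose Q := term_ring.
have [i iE] : exists i : {rmorphism R -> quotr Q}, forall a, i a = @rpi Q (Cst a).
  apply: (@rmorph_of R (quotr Q)); split=> [//|x y|x y].
    by rewrite (@rpiD Q); apply/(@rpiE Q); exact: teq_cstD.
  by rewrite (@rpiM Q); apply/(@rpiE Q); exact: teq_cstM.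
have sumE (T : Type) (s : seq T) F :
    @rpi Q (tsum s F) = \sum_(x <- s) @rpi Q (F x).
  by elim: s => [|x s IH]; rewrite ?big_nil // big_cons -IH (@rpiD Q).
have powE t n : @rpi Q (tpow t n) = @rpi Q t ^+ n.
  by elim: n => [|n IH] //; rewrite exprS -IH (@rpiM Q).
have rep (x : quotr Q) : exists t, @rpi Q t = x by elim/rpiW: x => t; exists t.
exists (quotr Q), i; split=> [d p [p1 p0]|I a t r e].
  pose c (j : 'I_d.+1) : term := projT1 (cid (rep (p j))).
  have cE j : @rpi Q (c j) = p j by exact: (projT2 (cid (rep (p j)))).
  exists (@rpi Q (Root c)).
  have /(@rpiE Q) e := teq_root c.
  apply: etrans e; rewrite /root_rel -(@rpiD Q) sumE powE.
  rewrite /evps big_ord_recr /= p1 mul1r addrC big_enum /=; congr (_ + _).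
  by apply: eq_bigr => j _; rewrite -(@rpiM Q) powE cE.
pose u j := projT1 (cid (rep (t j))).
have uE j : @rpi Q (u j) = t j by exact: (projT2 (cid (rep (t j)))).
have : @rpi Q (Cst r) = @rpi Q (tsum (enum I) (fun j => Mul (Cst (a j)) (u j))).
  rewrite -iE e sumE big_enum /=; apply: eq_bigr => j _.
  by rewrite -(@rpiM Q) -iE uE.
move=> /(@rpiE Q)/teq_sound[l hl].
have [T [k [rho [nu [kr h]]]]] := root_model l.
have := hl T k nu h; rewrite teval_sum /= big_enum /= => e'.
have [rho0 rhoD rhoZ _] := kr.
exists (fun j => rho (teval k nu (u j))).
rewrite -[LHS](retractionK r kr) e' (big_morph rho rhoD rho0).
by apply: eq_bigr => j _; rewrite rhoZ.
Qed.

End RootClosure.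

(** * Henselian local test rings and residue fields *)

Definition has_roots (E : comPzRingType) : Prop :=
  forall d (p : ps E), monps d.+1 p -> exists x, evps d.+2 p x = 0.

Lemma ps_const0 (R : comPzRingType) : ps_const (0 : R) = 0.
Proof. by apply: ps_ext => -[]. Qed.

Lemma mapps_ev (R S : comPzRingType) (f : {rmorphism R -> S}) n (p : ps R) x :
  evps n (mapps f p) (f x) = f (evps n p x).
Proof.
rewrite /evps rmorph_sum; apply: eq_bigr => i _.
by rewrite rmorphM rmorphXn.
Qed.

Lemma has_roots_quot (E K : comPzRingType) (p : {rmorphism E -> K}) :
  (forall y, exists x, p x = y) -> has_roots E -> has_roots K.
Proof.
move=> sp hE d q [q1 q0].
pose q' : ps E := fun n => if n == d.+1 then 1 else
  if (n <= d)%N then projT1 (cid (sp (q n))) else 0.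
have mq' : monps d.+1 q'.
  split=> [|n dn]; rewrite /q' ?eqxx // gtn_eqF // leqNgt.
  by rewrite ltnW.
have q'E : mapps p q' = q.
  apply: ps_ext => n; rewrite /mapps /q'.
  have [->|ne] := eqVneq; first by rewrite rmorph1 q1.
  case: leqP => dn; first by case: cid.
  by rewrite rmorph0 q0 // ltn_neqAle eq_sym ne.
by have [x xE] := hE d q' mq'; exists (p x); rewrite -q'E mapps_ev xE rmorph0.
Qed.

Lemma local_at_prime (E : comPzRingType) (n : set E) : prime_ideal n ->
  exists (H : comPzRingType) (l : {rmorphism E -> H}) (N : set H),
  [/\ prime_ideal N, (forall x, ~ N x -> exists y, x * y = 1),
      (forall a, N (l a) <-> n a),
      (forall a, l a = 0 -> exists m, ~ n m /\ m * a = 0)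
    & forall s, exists r m, ~ n m /\ s * l m = l r].
Proof.
move=> [ni n1 np]; pose M : set E := [set m | ~ n m].
have mM : mulset M by split=> // a b na nb /np[].
have [H [l [lu lf lk]]] := localization mM.
pose N : set H := [set s | exists a m, [/\ n a, M m & s * l m = l a]].
have NE a : N (l a) <-> n a.
  split=> [[b [m [nb Mm e]]]|na]; last first.
    by exists a, 1; rewrite rmorph1 mulr1; split=> //; case: mM.
  have : l (a * m - b) = 0 by rewrite rmorphB rmorphM e subrr.
  move=> /lk[t Mt e']; apply: contrapT => na.
  have : n (t * (a * m)).
    have -> : t * (a * m) = t * (a * m - b) + t * b by ring.
    by rewrite e' add0r; exact: idealMl.
  by move=> /np[|/np[]].
have unitM s r m : M m -> s * l m = l r -> ~ N s -> exists y, s * y = 1.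
  move=> Mm e Ns; have Mr : M r by move=> nr; apply: Ns; exists r, m.
  by have [y yE] := lu r Mr; exists (l m * y); rewrite mulrA e.
exists H, l, N; split=> //.
- split; [split | | ].
  + by rewrite -(rmorph0 l); apply/NE; exact: ideal0.
  + move=> s t [a [m [na Mm e]]] [b [m' [nb Mm' e']]].
    exists (a * m' + b * m), (m * m'); split.
    * by apply: idealD => //; exact: idealMr.
    * exact: mM.2.
    * by rewrite rmorphD !rmorphM -e -e'; ring.
  + move=> s t [b [m' [nb Mm' e']]]; have [r [m [Mm e]]] := lf s.
    exists (r * b), (m * m'); split; [exact: idealMl | exact: mM.2 |].
    by rewrite !rmorphM -e -e'; ring.
  + by rewrite -(rmorph1 l) => /NE.
  + move=> s t; have [r [m [Mm e]]] := lf s; have [r' [m' [Mm' e']]] := lf t.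
    move=> Nst; apply: contrapT => /not_orP[Ns Nt].
    have [y yE] := unitM _ _ _ Mm e Ns; have [y' yE'] := unitM _ _ _ Mm' e' Nt.
    have : N 1.
      have -> : 1 = (y * y') * (s * t).
        have -> : (y * y') * (s * t) = (s * y) * (t * y') by ring.
        by rewrite yE yE' mulr1.
      have [b [k [nb Mk ek]]] := Nst; have [c [j [Mj ej]]] := lf (y * y').
      exists (c * b), (j * k); split; [exact: idealMl | exact: mM.2 |].
      by rewrite !rmorphM -ek -ej; ring.
    by rewrite -(rmorph1 l) => /NE.
- by move=> s Ns; have [r [m [Mm e]]] := lf s; exact: unitM e Ns.
- by move=> a /lk[m Mm e]; exists m.
Qed.

Lemma has_roots_loc (E H : comPzRingType) (l : {rmorphism E -> H}) (n : set E) :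
  prime_ideal n -> (forall m, ~ n m -> exists y, l m * y = 1) ->
  (forall s, exists r m, ~ n m /\ s * l m = l r) ->
  has_roots E -> has_roots H.
Proof.
move=> [ni n1 np] lu lf hE d p [p1 p0].
have [m [Mm hm]] : exists m, ~ n m /\
    forall i, (i < d.+1)%N -> exists r, p i * l m = l r.
  elim: (d.+1) => [|k [m [Mm hm]]]; first by exists 1.
  have [r [m' [Mm' e]]] := lf (p k); exists (m * m').
  split=> [/np[]//|i]; rewrite ltnS leq_eqVlt => /orP[/eqP->|/hm[r' e']].
    by exists (r * m); rewrite !rmorphM -e; ring.
  by exists (r' * m'); rewrite !rmorphM -e'; ring.
have [r rE] : exists r : nat -> E, forall i, (i < d.+1)%N -> p i * l m = l (r i).
  exists (fun i => if pselect (i < d.+1)%N is left h then projT1 (cid (hm i h)) else 0).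
  by move=> i id; case: pselect => // h; case: cid.
(* With m a common denominator of the coefficients of p, this is m^(d+1) p(X / m); a root y of it
   gives the root y / m of p. *)
pose q : ps E := fun i => if i == d.+1 then 1 else
  if (i <= d)%N then r i * m ^+ (d - i) else 0.
have mq : monps d.+1 q.
  split=> [|i di]; rewrite /q ?eqxx // gtn_eqF // leqNgt.
  by rewrite ltnW.
have [y yE] := hE d q mq; have [u uE] := lu m Mm.
exists (l y * u).
have -> : evps d.+2 p (l y * u) = u ^+ d.+1 * l (evps d.+2 q y).
  rewrite /evps rmorph_sum mulr_sumr; apply: eq_bigr => -[i /=].
  rewrite ltnS leq_eqVlt => /orP[/eqP->|id] _.
    by rewrite p1 /q eqxx !mul1r rmorphXn exprMn mulrC.
  rewrite rmorphM rmorphXn exprMn /q ltn_eqF // -ltnS id rmorphM rmorphXn -rE //.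
  rewrite -[X in u ^+ X](subnK (ltnW id)) subSn // exprD exprS.
  have -> : p i * (l y ^+ i * u ^+ i) =
    p i * (l y ^+ i * u ^+ i) * (l m * u) * (l m * u) ^+ (d - i).
    by rewrite uE expr1n !mulr1.
  by rewrite exprMn; ring.
by rewrite yE rmorph0 mulr0.
Qed.

Lemma has_roots_split (H : comPzRingType) n (f : ps H) : has_roots H ->
  monps n f -> exists s : seq H, f = \prod_(a <- s) lin a.
Proof.
move=> hH; elim: n f => [|n IH] f mf.
  exists [::]; rewrite big_nil; case: mf => f1 f0.
  by apply: ps_ext => -[|k]; rewrite ?f1 ?f0.
have [a aE] := hH n f mf; have [q [fE _ /(_ _ mf)/IH[s sE]]] := lin_div a (monps_fin mf).
by exists (a :: s); rewrite big_cons -sE {1}fE aE ps_const0 addr0.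
Qed.

(** * Local rings with roots are Henselian *)

Section LocalFactor.
Variables (H : comPzRingType) (N : set H).
Hypothesis Np : prime_ideal N.

Let Ni : ideal N. Proof. by case: Np. Qed.
Let psN_ideal := ps_ideal Ni.

Lemma cong_lin_cancel a m (p : ps H) c : finps m p ->
  (forall n, N ((lin a * p - ps_const c) n)) -> (forall n, N (p n)) /\ N c.
Proof.
move=> fp h; have Np' : forall n, N (p n).
  apply: (monps_cancel Ni (lin_mon a) fp) => -[|n] // _.
  by have := h n.+1; rewrite psB /= subr0.
split=> //; have := h 0%N; rewrite psB lin_mul0 /= => h0.
rewrite -[c](subKr (- a * p 0%N)); apply: idealB => //.
exact: idealMl.
Qed.

Lemma finite_coefsD (p q : ps H) :
  finite_coefs p -> finite_coefs q -> finite_coefs (p + q).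
Proof.
move=> [m fp] [n fq]; exists (m + n)%N; apply: finpsD.
  exact: finpsW (leq_addr _ _) fp.
exact: finpsW (leq_addl _ _) fq.
Qed.

Lemma finite_coefsM (p q : ps H) :
  finite_coefs p -> finite_coefs q -> finite_coefs (p * q).
Proof. by move=> [m fp] [n fq]; exists (m + n)%N; exact: finps_mul. Qed.

Lemma finite_coefsN (p : ps H) : finite_coefs p -> finite_coefs (- p).
Proof. by move=> [m fp]; exists m; exact: finpsN. Qed.

Lemma finite_coefs_const c : finite_coefs (ps_const (c : H)).
Proof. by exists 1%N => -[]. Qed.

Lemma finite_coefs_lin (a : H) : finite_coefs (lin a).
Proof. by exists 2%N; exact: monps_fin (lin_mon a). Qed.

(** Modulo the prime N, a root a of g0 * h0 is a root of g0 or of h0. The factor X - a is given to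
    that side, and the induction continues with the quotient. *)
Lemma local_factor (s : seq H) k l (g0 h0 : ps H) :
  monps k g0 -> monps l h0 ->
  (forall n, N ((\prod_(a <- s) lin a - g0 * h0) n)) ->
  exists g h, [/\ monps k g, monps l h, \prod_(a <- s) lin a = g * h,
    forall n, N ((g - g0) n) & forall n, N ((h - h0) n)].
Proof.
have [_ N1 NM] := Np.
elim: s k l g0 h0 => [|a s IH] k l g0 h0 mg mh.
  rewrite big_nil => c; exists g0, h0; split=> //; last 2 first.
  - by move=> n; rewrite subrr; exact: ideal0.
  - by move=> n; rewrite subrr; exact: ideal0.
  have [kl|kl] := eqVneq (k + l)%N 0%N.
    have mgh := monps_mul mg mh; rewrite kl in mgh.
    by case: mgh => e1 e0; apply: ps_ext => -[|n]; rewrite ?e1 ?e0.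
  have := c (k + l)%N; have [e _] := monps_mul mg mh; rewrite psB e.
  case: (k + l)%N kl => // n _; rewrite [X in N (X - _)](_ : _ = 0) // sub0r => h.
  by case: N1; rewrite -[1]opprK; exact: idealN.
rewrite big_cons; set P := \prod_(b <- s) lin b => c.
have fP : finite_coefs P.
  rewrite /P; elim: s {IH P c} => [|b s IHs].
    by rewrite big_nil; exact: finite_coefs_const.
  by rewrite big_cons; apply: finite_coefsM => //; exact: finite_coefs_lin.
have key k' l' (g h : ps H) : monps k' g -> monps l' h ->
    (forall n, N ((lin a * P - g * h) n)) -> N (evps k'.+1 g a) ->
    exists g' h', [/\ monps k' g', monps l' h', lin a * P = g' * h',
      forall n, N ((g' - g) n) & forall n, N ((h' - h) n)].
  move=> mg' mh' c' Nx.
  have [g1 [gE fg1 mg1]] := lin_div a (monps_fin mg').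
  set x := evps k'.+1 g a in gE Nx.
  case: k' mg' fg1 mg1 @x gE Nx => [|k'] mg' fg1 mg1 x gE Nx.
    case: N1; have [<- _] := mg'; rewrite gE (_ : g1 = 0).
      by rewrite mulr0 add0r.
    by apply: ps_ext => n; exact: fg1.
  have {}mg1 := mg1 _ mg'.
  have Nc n : N ((ps_const x * h) n) by rewrite psCM; exact: idealMr.
  have [m fm] : finite_coefs (P - g1 * h).
    apply: finite_coefsD => //; apply/finite_coefsN/finite_coefsM.
      by exists k'.+1; exact: monps_fin mg1.
    by exists l'.+1; exact: monps_fin mh'.
  have [|cP _] := @cong_lin_cancel a m (P - g1 * h) 0 fm.
    move=> n; rewrite ps_const0 subr0.
    have -> : lin a * (P - g1 * h) = lin a * P - g * h + ps_const x * h.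
      by rewrite [in RHS]gE; ring.
    by rewrite psD; apply: idealD.
  have [g' [h' [mg2 mh2 PE cg ch]]] := IH _ _ _ _ mg1 mh' cP.
  exists (lin a * g'), h'; split=> //.
  - by rewrite -add1n; exact: monps_mul (lin_mon a) mg2.
  - by rewrite /P PE mulrA.
  - have -> : lin a * g' - g = lin a * (g' - g1) - ps_const x by rewrite gE; ring.
    move=> n; rewrite psB; apply: idealB => //; first exact: (idealMl (lin a) psN_ideal cg).
    by case: n => [|n] //; exact: ideal0.
have [g1 [gE [m1 fg1] _]] : exists g1, [/\ g0 = lin a * g1 + ps_const (evps k.+1 g0 a),
    finite_coefs g1 & True].
  by have [g1 [gE fg1 _]] := lin_div a (monps_fin mg); exists g1; split=> //; exists k.
have [h1 [hE fh1 _]] := lin_div a (monps_fin mh).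
set x := evps k.+1 g0 a in gE; set y := evps l.+1 h0 a in hE.
(* The product g0 * h0 equals (X - a) * w + x * y, so the remainder x * y must lie in N. *)
pose w := lin a * g1 * h1 + ps_const y * g1 + ps_const x * h1.
have fin1 : finite_coefs g1 by exists m1.
have fin2 : finite_coefs h1 by exists l.
have [m fm] : finite_coefs (P - w).
  apply: finite_coefsD => //; apply: finite_coefsN.
  by do !apply: finite_coefsD; do ?apply: finite_coefsM => //;
    do ?[exact: finite_coefs_const | exact: finite_coefs_lin].
have xy : ps_const x * ps_const y = ps_const (x * y).
  by apply: ps_ext => n; rewrite psCM; case: n => //= n; rewrite mulr0.
have [|_ Nxy] := @cong_lin_cancel a m (P - w) (x * y) fm.
  move=> n; have -> : lin a * (P - w) - ps_const (x * y) = lin a * P - g0 * h0.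
    by rewrite -xy gE hE /w; ring.
  exact: c.
case: (NM _ _ Nxy) => [Nx|Ny]; first exact: key c Nx.
have [|g' [h' [e1 e2 e3 e4 e5]]] := key l k h0 g0 mh mg _ Ny.
  by rewrite [h0 * g0]mulrC.
by exists h', g'; split=> //; rewrite e3 mulrC.
Qed.

Lemma local_henselian : has_roots H -> (forall x, ~ N x -> exists y, x * y = 1) ->
  henselian_pair N.
Proof.
move=> hH Nu; split=> //.
  apply/(jacobsonP Ni) => a Na; apply: Nu => N1a.
  by have [_ N1 _] := Np; apply: N1; rewrite -(addrK a 1); exact: idealB.
move=> f g0 h0 [n mf] [k mg] [l mh] c _.
have [s fE] := has_roots_split hH (mf : monps n (f : ps H)).
have [|g [h [mg' mh' e cg ch]]] := @local_factor s k l g0 h0 mg mh.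
  by rewrite -fE.
exists g, h; split=> //; [by exists k | by exists l |].
by move=> i; rewrite {1}fE e.
Qed.

End LocalFactor.

(** In the root closure E of F, the sum J of the annihilator of d and of ME is proper: otherwise d
    would lie in M d by contraction, and 1 - m is a unit for m in M. The localization of E at a
    maximal ideal over J is a local ring with roots, and d survives in it because its annihilator
    lies in that ideal. *)
Lemma henselian_test (F : comPzRingType) (M : set F) (d : F) :
  ideal M -> (forall a, M a -> exists b, (1 + a) * b = 1) -> d <> 0 ->
  exists (H : comPzRingType) (N : set H) (al : {rmorphism F -> H}),
    [/\ henselian_pair N, al @` M `<=` N & al d <> 0].
Proof.
move=> iM Mu d0; have [E [i [hE cE]]] := root_closure F.
pose J : set E := [set x | exists c y, [/\ c * i d = 0, extend i M y & x = c + y]].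
have iX := extend_ideal i M.
have iJ : ideal J.
  split=> [|_ _ [c [y [e My ->]]] [c' [y' [e' My' ->]]]|b _ [c [y [e My ->]]]].
  - by exists 0, 0; rewrite mul0r addr0; split=> //; exact: ideal0.
  - exists (c + c'), (y + y'); split; [by rewrite mulrDl e e' addr0 | exact: (idealD iX) | ring].
  - exists (b * c), (b * y); split; [by rewrite -mulrA e mulr0 | exact: (idealMl _ iX) | ring].
have J1 : ~ J 1.
  move=> [c [y [e My y1]]]; apply: d0.
  have [s [sM sE]] := extendP My.
  pose z (j : 'I_(size s)) := tnth (in_tuple s) j.
  have [|b bE] := cE 'I_(size s) (fun j => (z j).1 * d) (fun j => (z j).2) d.
    rewrite -[LHS]mul1r y1 mulrDl e add0r sE big_tnth mulr_suml.
    by apply: eq_bigr => j _; rewrite rmorphM mulrAC.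
  pose m := \sum_j (z j).1 * b j.
  have Mm : M (- m).
    by apply: idealN => //; apply: ideal_sum => // j _; apply: idealMr => //; apply: sM; exact: (mem_tnth j (in_tuple s)).
  have [u uE] := Mu _ Mm.
  have md : (1 - m) * d = 0.
    rewrite mulrBl mul1r {1}bE /m mulr_suml -sumrB big1 // => j _; ring.
  by rewrite -[d]mul1r -uE mulrAC md mul0r.
have [n [mn Jn]] := maximal_over iJ J1.
have np := maximal_prime mn.
have [H [l [N [Np Nu NE lk lf]]]] := local_at_prime np.
have hH : has_roots H.
  apply: (has_roots_loc np _ lf hE) => m nm; apply: Nu.
  by move/NE.
exists H, N, (l \o i); split; first exact: local_henselian.
  move=> _ [a Ma <-]; apply/NE/Jn; exists 0, (i a); split; rewrite ?mul0r ?add0r //.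
  exact: extend_mem.
move=> /lk[m [nm e]]; apply: nm; apply: Jn; exists m, 0.
by rewrite addr0; split=> //; exact: ideal0.
Qed.

(** K is a residue field of the root closure of the local ring at x; contraction makes the extension
    of the maximal ideal proper. *)
Lemma closed_field_at (T : comPzRingType) (x : set T) : prime_ideal x ->
  exists (K : fieldType) (h : {rmorphism T -> K}),
    has_roots K /\ forall a, h a = 0 <-> x a.
Proof.
move=> xp; have [S [l [N [Np Nu NE _ _]]]] := local_at_prime xp.
have [iN N1 _] := Np.
have [E [i [hE cE]]] := root_closure S.
have J1 : ~ extend i N 1.
  move=> /extendP[s [sN sE]]; apply: N1.
  pose z (j : 'I_(size s)) := tnth (in_tuple s) j.
  have [|b ->] := cE 'I_(size s) (fun j => (z j).1) (fun j => (z j).2) 1.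
    by rewrite rmorph1 sE big_tnth.
  apply: ideal_sum => // j _; apply: idealMr => //; apply: sN; exact: (mem_tnth j (in_tuple s)).
have [n [mn Jn]] := maximal_over (extend_ideal i N) J1.
have [ni n1 _] := mn.
have [K0 [p [sp pE]]] := quotient_ring ni.
have [||K [k [k' kK kK']]] := @field_of K0.
- by rewrite -(rmorph1 p) => /pE.
- move=> y; have [a <-] := sp y => na.
  have [b bE] := maximal_inv mn (fun h => na ((pE a).2 h)).
  exists (p b); apply/eqP; rewrite -subr_eq0 -oppr_eq0 opprB -(rmorph1 p) -rmorphM -rmorphB.
  by apply/eqP/pE.
have k0 a : k a = 0 -> a = 0 by move=> e; rewrite -(kK a) e -(rmorph0 k) kK.
exists K, (k \o p \o i \o l); split.
  apply: (@has_roots_quot E K (k \o p)) => // y.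
  by have [a aE] := sp (k' y); exists a; rewrite /= aE kK'.
move=> a; split=> /= [/k0/pE na|xa].
  apply: contrapT => nx; have [y yE] := Nu (l a) (fun h => nx ((NE a).1 h)).
  by apply: n1; rewrite -(rmorph1 i) -yE rmorphM; exact: idealMr.
have -> : p (i (l a)) = 0 by apply/pE; apply: Jn; apply: extend_mem; apply/NE.
exact: rmorph0.
Qed.

(** * Henselian pairs and neighbourhoods in a Henselization *)

Section HenselianPair.
Variables (S : comPzRingType) (I : set S).
Hypothesis hI : henselian_pair I.

Lemma henselian_ideal : ideal I. Proof. by case: hI. Qed.

Lemma henselian_unit a : I a -> exists b, (1 + a) * b = 1.
Proof. by have [iI mI _] := hI; exact: (jacobsonP iI).1. Qed.

(** The definition of a Henselian pair leaves the degrees of the lifted factors open; 1 is not in I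
    unless the ring is zero, so they are those of the given factors. *)
Lemma monps_cong j k (g g0 : ps S) : monps j g -> monps k g0 ->
  (forall n, I ((g - g0) n)) -> monps k g.
Proof.
move=> [g1 gj] [g01 g0k] c; have iI := henselian_ideal.
have [/eqP e|ne] := boolP (1 == 0 :> S).
  have all0 (x y : S) : x = y by rewrite -[x]mul1r -[y]mul1r e !mul0r.
  by split=> *; exact: all0.
have N1 : ~ I 1.
  move=> /(idealN iI)/henselian_unit[b]; rewrite subrr mul0r => /esym/eqP.
  exact/negP.
case: (ltngtP j k) => [jk|kj|<-]; last by split.
    have := c k; rewrite psB gj // g01 sub0r => /(idealN iI).
  by rewrite opprK => /N1.
by have := c j; rewrite psB g1 g0k // subr0 => /N1.
Qed.

Lemma henselian_lift n k l (f g0 h0 u v : ps S) :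
  monps n f -> monps k g0 -> monps l h0 -> finite_coefs u -> finite_coefs v ->
  (forall i, I ((f - g0 * h0) i)) ->
  (forall i, I ((u * g0 + v * h0 - 1) i)) ->
  exists g h, [/\ monps k g, monps l h, f = g * h,
    forall i, I ((g - g0) i) & forall i, I ((h - h0) i)].
Proof.
move=> mf mg mh fu fv c b; have [_ _ H] := hI.
have [|||||g [h [[j mg'] [m mh'] e cg ch]]] := H f g0 h0.
- by exists n.
- by exists k.
- by exists l.
- exact: c.
- exists u, v; split=> // i; have := b i; congr (I _); congr (_ - _).
  by case: i.
exists g, h; split=> //; [exact: monps_cong mg' mg cg | exact: monps_cong mh' mh ch |].
by apply: ps_ext => i; exact: e.
Qed.

End HenselianPair.

(** By uniqueness of coprime factorizations in S, two maps that agree on f, g0 and h0 agree on the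
    lifted factors. This is how the last clause of [nbhd] passes to a factorization algebra. *)
Lemma henselian_ext (S F : comPzRingType) (I : set S) (al be : {rmorphism F -> S})
    k l (f g h u v g0 h0 : ps F) m :
  henselian_pair I -> monps k g -> monps l h -> finps m u -> finps m v ->
  f = g * h -> (forall n, al (f n) = be (f n)) ->
  (forall n, I (al ((u * g + v * h - 1) n))) ->
  (forall n, al (g0 n) = be (g0 n)) -> (forall n, al (h0 n) = be (h0 n)) ->
  (forall n, I (al ((g - g0) n))) -> (forall n, I (be ((g - g0) n))) ->
  (forall n, I (al ((h - h0) n))) -> (forall n, I (be ((h - h0) n))) ->
  (forall n, al (g n) = be (g n)) /\ forall n, al (h n) = be (h n).
Proof.
move=> hI mg mh fu fv fE ef bez eg eh ag bg ah bh.
have iI := henselian_ideal hI.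
have sub (p q : ps F) n : al (q n) = be (q n) -> I (al ((p - q) n)) ->
    I (be ((p - q) n)) -> I ((mapps al p - mapps be p) n).
  move=> e a b; have := idealB iI a b; congr (I _).
  by rewrite !psB !rmorphB e /mapps; ring.
have [||||e e'] := @factorization_unique S I k l (mapps al g) (mapps be g)
  (mapps al h) (mapps be h) (mapps al u) (mapps al v) m iI
  (fun a => @henselian_unit S I hI a) (mapps_mon _ mg) (mapps_mon _ mg)
  (mapps_mon _ mh) (mapps_mon _ mh) (mapps_fin _ fu) (mapps_fin _ fv) _ _ _ _.
- move=> n; have := bez n; congr (I _).
  have [a1 aD aM] := mapps_rmorph al.
  by rewrite -aM -aM -aD !psB /mapps rmorphB; congr (_ - _); case: n => *; rewrite ?rmorph1 ?rmorph0.
- by move=> n; exact: (sub _ g0 n (eg n) (ag n) (bg n)).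
- by move=> n; exact: (sub _ h0 n (eh n) (ah n) (bh n)).
- by rewrite -!mappsM -fE; apply: ps_ext => n; exact: ef.
by split=> n; [exact: (congr1 (fun p => p n) e) | exact: (congr1 (fun p => p n) e')].
Qed.

Lemma eqflat_loc (R S : comPzRingType) (M : set R) (l : {rmorphism R -> S}) :
  mulset M -> (forall m, M m -> exists y, l m * y = 1) ->
  (forall s, exists r m, M m /\ s * l m = l r) ->
  (forall r, l r = 0 -> exists2 m, M m & m * r = 0) -> eqflat l.
Proof.
move=> [M1 MM] lu lf lk I r s rs.
have [m [Mm hm]] : exists m, M m /\ forall i, i \in enum I ->
    exists a, s i * l m = l a.
  elim: (enum I) => [|k e [m [Mm hm]]]; first by exists 1.
  have [a [m' [Mm' e']]] := lf (s k); exists (m * m').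
  split=> [|i]; first exact: MM.
  rewrite inE => /orP[/eqP->|/hm[b e2]].
    by exists (a * m); rewrite !rmorphM -e'; ring.
  by exists (b * m'); rewrite !rmorphM -e2; ring.
have hm' i : exists a, s i * l m = l a by apply: hm; rewrite mem_enum.
pose a i := projT1 (cid (hm' i)).
have aE i : s i * l m = l (a i) by exact: (projT2 (cid (hm' i))).
have : l (\sum_i r i * a i) = 0.
  transitivity ((\sum_i l (r i) * s i) * l m); last by rewrite rs mul0r.
  rewrite rmorph_sum mulr_suml; apply: eq_bigr => i _.
  by rewrite rmorphM -aE mulrA.
move=> /lk[t Mt e]; have [y yE] := lu t Mt; have [z zE] := lu m Mm.
exists unit, (fun i _ => t * a i), (fun=> y * z); split=> [i|_].
  rewrite (big_pred1 tt) /=; last by case.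
  rewrite rmorphM -aE -[LHS]mulr1 -yE -[LHS]mulr1 -zE; ring.
apply: etrans e; rewrite mulr_sumr; apply: eq_bigr => i _; ring.
Qed.

Section Henselization.
Variables (R : comPzRingType) (J : set R) (HZ : henselization J).
Local Notation H := (hz_ring HZ).
Local Notation K := (@hz_ideal _ _ HZ).
Local Notation io := (hz_map HZ).

Let hK : henselian_pair K := @hz_henselian _ _ HZ.
Let iK : ideal K := henselian_ideal hK.

Lemma hz_mem r : J r -> K (io r).
Proof. by move=> Jr; apply: hz_sub; exists r. Qed.

(* The subring P is again Henselian, so the universal property retracts H onto
   it. *)
Lemma hz_ind (P : set H) : subring P -> (forall r, P (io r)) ->
  (forall x y, P x -> K (x - 1) -> x * y = 1 -> P y) ->
  (forall k l m (f g0 h0 u v g h : ps H),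
    [/\ forall n, P (f n), forall n, P (g0 n), forall n, P (h0 n),
      forall n, P (u n) & forall n, P (v n)] ->
    [/\ monps k g0, monps l h0, finps m u, finps m v &
      forall n, K ((u * g0 + v * h0 - 1) n)] ->
    [/\ monps k g, monps l h, f = g * h,
      forall n, K ((g - g0) n) & forall n, K ((h - h0) n)] ->
    (forall n, P (g n)) /\ forall n, P (h n)) ->
  forall x, P x.
Proof.
move=> sP Pio Pinv Pfac; have [S [v [vi vP]]] := subring_ring sP.
pose N : set S := v @^-1` K.
have vPs s : P (v s) by apply/vP; exists s.
have iN : ideal N by exact: preim_ideal.
have hN : henselian_pair N.
  split=> //.
    apply/(jacobsonP iN) => a Na; have [b bE] := henselian_unit hK Na.
    have /vP[s sE] : P b.
      apply: Pinv bE; first by rewrite -(rmorph1 v) -rmorphD; exact: vPs.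
      by rewrite addrC addKr.
    by exists s; apply: vi; rewrite rmorphM rmorphD !rmorph1 sE.
  move=> f g0 h0 [n mf] [k mg] [l mh] c [u [w [[m fu] [m' fw] bez]]].
  pose M := (m + m')%N.
  have {}fu : finps M u by exact: finpsW (leq_addr _ _) fu.
  have {}fw : finps M w by exact: finpsW (leq_addl _ _) fw.
  have bez' i : K ((mapps v u * mapps v g0 + mapps v w * mapps v h0 - 1) i).
    have := bez i; rewrite /N /= rmorphB rmorphD; congr (K _); congr (_ - _).
      by rewrite psD -!mappsM.
    by case: i => *; rewrite /pone ?rmorph1 ?rmorph0.
  have [|g [h [mg' mh' e cg ch]]] := henselian_lift hK (mapps_mon v mf)
    (mapps_mon v mg) (mapps_mon v mh) (ex_intro _ M (mapps_fin v fu))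
    (ex_intro _ M (mapps_fin v fw)) _ bez'.
    move=> i; have := c i; rewrite /N /= rmorphB; congr (K _); congr (_ - _).
    by rewrite -mappsM.
  have [Pg Ph] := Pfac k l M (mapps v f) (mapps v g0) (mapps v h0) (mapps v u)
    (mapps v w) g h (And5 (fun n => vPs _) (fun n => vPs _) (fun n => vPs _)
      (fun n => vPs _) (fun n => vPs _))
    (And5 (mapps_mon v mg) (mapps_mon v mh) (mapps_fin v fu) (mapps_fin v fw) bez')
    (And5 mg' mh' e cg ch).
  have lift (p : ps H) : (forall n, P (p n)) -> exists p' : ps S, mapps v p' = p.
    move=> p0; have p1 i := (vP (p i)).1 (p0 i).
    exists (fun i => projT1 (cid (p1 i))); apply: ps_ext => i.
    exact: (projT2 (cid (p1 i))).
  have vmon i (p : ps S) : monps i (mapps v p) -> monps i p.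
    move=> [p1 p0]; split=> [|j ij]; apply: vi; first by rewrite rmorph1; exact: p1.
    by rewrite rmorph0; exact: p0.
  have [g' gE] := lift g Pg; have [h' hE] := lift h Ph.
  exists g', h'; split.
  - by exists k; apply: vmon; rewrite gE.
  - by exists l; apply: vmon; rewrite hE.
  - have fE : f = (g' : ps S) * h'.
      apply: ps_ext => i; apply: vi; apply: (congr1 (fun p => p i) (_ : mapps v f = mapps v (_ * _))).
      by rewrite mappsM gE hE.
    by move=> i; rewrite {1}fE.
  - move=> i; rewrite /N /= rmorphB; have := cg i; congr (K _).
    by rewrite -gE psB.
  - move=> i; rewrite /N /= rmorphB; have := ch i; congr (K _).
    by rewrite -hE psB.
have [|i iE] := @inj_lift _ _ _ v io vi.
  by move=> r; apply/vP; exact: Pio.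
have [|rho [[rN ri] _]] := hz_universal HZ hN (g := i).
  by move=> _ [r Jr <-]; rewrite /N /= iE; exact: hz_mem.
have [w [_ uniq]] := hz_universal HZ hK (@hz_sub _ _ HZ).
move=> x; apply/vP; exists (rho x).
have e1 : w = (v \o rho : {rmorphism H -> H}).
  apply: uniq; split=> [_ [y Ky <-]|r] /=; last by rewrite ri iE.
  by apply: (rN (rho y)); exists y.
have e2 : w = (idfun : {rmorphism H -> H}).
  by apply: uniq; split=> [_ [y Ky <-]|r].
by have := congr1 (fun h : {rmorphism H -> H} => h x) (etrans (esym e1) e2).
Qed.

(* H is the union of the images of such F, which play the role of the etale
   neighbourhoods of the pair. *)
Definition nbhd (F : comPzRingType) (p : {rmorphism R -> F})
    (q : {rmorphism F -> H}) : Prop :=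
  [/\ eqflat p, (forall r, q (p r) = io r),
    (forall a, K (q a) -> exists b, (1 + a) * b = 1)
  & forall (S : comPzRingType) (N : set S) (al be : {rmorphism F -> S}),
      henselian_pair N -> (forall a, K (q a) -> N (al a)) ->
      (forall a, K (q a) -> N (be a)) -> (forall r, al (p r) = be (p r)) ->
      forall a, al a = be a].

(** Elements of F0 mapping to 1 + K become units in H. Inverting them achieves the unit condition of
    [nbhd] and preserves flatness and uniqueness. *)
Lemma nbhd_loc (F0 : comPzRingType) (p0 : {rmorphism R -> F0})
    (q0 : {rmorphism F0 -> H}) :
  eqflat p0 -> (forall r, q0 (p0 r) = io r) ->
  (forall (S : comPzRingType) (N : set S) (al be : {rmorphism F0 -> S}),
      henselian_pair N -> (forall a, K (q0 a) -> N (al a)) ->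
      (forall a, K (q0 a) -> N (be a)) -> (forall r, al (p0 r) = be (p0 r)) ->
      forall a, al a = be a) ->
  exists (F : comPzRingType) (p : {rmorphism R -> F}) (q : {rmorphism F -> H})
    (th : {rmorphism F0 -> F}),
    [/\ nbhd p q, forall r, th (p0 r) = p r & forall a, q (th a) = q0 a].
Proof.
move=> fl qp E; pose M : set F0 := [set m | K (q0 m - 1)].
have mM : mulset M.
  split=> [|a b]; rewrite /M /= ?rmorph1 ?subrr; first exact: ideal0.
  rewrite rmorphM => Ka Kb; have -> : q0 a * q0 b - 1 = (q0 a - 1) * q0 b + (q0 b - 1).
    by ring.
  by apply: idealD => //; exact: idealMr.
have Ku x : K (x - 1) -> exists y, x * y = 1.
  by move=> /(henselian_unit hK)[y]; rewrite addrC subrK; exists y.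
have [F [th [tu tf tk]]] := localization mM.
have [|q qE] := loc_lift mM tu tf tk (g := q0); first by move=> m /Ku.
exists F, (th \o p0), q, th; split=> //; split.
- apply: (@eqflat_comp _ _ _ p0 th) => //; exact: (eqflat_loc mM tu tf tk).
- by move=> r /=; rewrite qE.
- move=> a Ka; have [r [m [Mm e]]] := tf a.
  have Kr : K (q0 r) by rewrite -qE -e rmorphM qE; exact: idealMr.
  have [|y yE] := tu (m + r).
    by rewrite /M /= rmorphD addrAC; apply: idealD.
  exists (th m * y); rewrite mulrA mulrDl mul1r e -rmorphD //.
- move=> S N al be hN aN bN ab a.
  have eth x : al (th x) = be (th x).
    apply: (E S N (al \o th) (be \o th)) => //= y Ky; [apply: aN | apply: bN];
      by rewrite qE.
  have [r [m [Mm e]]] := tf a; have [y yE] := tu m Mm.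
  have := congr1 al e; have := congr1 be e; rewrite !rmorphM -!eth => <- h.
  have u : al (th m) * al y = 1 by rewrite -rmorphM yE rmorph1.
  by rewrite -[LHS]mulr1 -[RHS]mulr1 -u !mulrA h.
Qed.

Lemma nbhd_base : exists (F : comPzRingType) (p : {rmorphism R -> F})
  (q : {rmorphism F -> H}), nbhd p q.
Proof.
have [|||F [p [q [_ [h _ _]]]]] := @nbhd_loc R idfun io; last by exists F, p, q.
- exact: eqflat_id.
- by [].
- by move=> S N al be _ _ _.
Qed.
End Henselization.

(** * Exhausting a Henselization by flat neighbourhoods *)

Section Neighbourhoods.
Variables (R : comPzRingType) (J : set R) (HZ : henselization J).
Local Notation H := (hz_ring HZ).
Local Notation K := (@hz_ideal _ _ HZ).
Local Notation io := (hz_map HZ).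

Let hK : henselian_pair K := @hz_henselian _ _ HZ.
Let iK : ideal K := henselian_ideal hK.

(** The factorization g * h is classified by a map from the universal factorization algebra of f to
    H. The universal factors are coprime modulo K because their images are congruent to g0 and
    h0. *)
Lemma nbhd_factor (F : comPzRingType) (p : {rmorphism R -> F})
    (q : {rmorphism F -> H}) k l m (f g0 h0 u v : ps F) (g h : ps H) :
  nbhd p q -> monps (k + l) f -> monps k g0 -> monps l h0 ->
  finps m u -> finps m v ->
  (forall n, K (q ((u * g0 + v * h0 - 1) n))) ->
  monps k g -> monps l h -> mapps q f = g * h ->
  (forall n, K ((g - mapps q g0) n)) -> (forall n, K ((h - mapps q h0) n)) ->
  exists (F' : comPzRingType) (p' : {rmorphism R -> F'})
    (q' : {rmorphism F' -> H}) (th : {rmorphism F -> F'}) (gg hh : ps F'),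
    [/\ nbhd p' q', forall a, q' (th a) = q a, mapps q' gg = g & mapps q' hh = h].
Proof.
move=> [fl qp _ E] mf mg0 mh0 fu fv bez mg mh e cg ch.
have [F1 [i [g1 [h1 [[mg1 mh1 fE fli] univ gen]]]]] := factorization_algebra mf.
have [w [wi wg wh]] := univ H q g h mg mh e.
have bez1 n : K (w ((mapps i u * g1 + mapps i v * h1 - 1) n)).
  rewrite [X in w (X n)](_ : _ = (mapps i u * (g1 - mapps i g0) +
    mapps i v * (h1 - mapps i h0)) + (mapps i u * mapps i g0 +
    mapps i v * mapps i h0 - 1)); last by ring.
  have -> : w ((mapps i u * (g1 - mapps i g0) + mapps i v * (h1 - mapps i h0) +
     (mapps i u * mapps i g0 + mapps i v * mapps i h0 - 1)) n) =
     (mapps q u * (g - mapps q g0) + mapps q v * (h - mapps q h0)) n +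
     q ((u * g0 + v * h0 - 1) n).
    rewrite psD rmorphD; congr (_ + _).
      have -> : forall x : ps F1, w (x n) = mapps w x n by [].
      have [w1 wD wM] := mapps_rmorph w.
      have wB x y : mapps w (x - y) = mapps w x - mapps w y.
        by apply: ps_ext => j; rewrite psB /mapps !psB rmorphB.
      by rewrite wD !wM !wB wg wh !(mapps_comp _ wi).
    rewrite !psB -!mappsM -mappsD /mapps !rmorphB -(wi ((u * g0 + v * h0) n)).
    by congr (_ - _); case: n => *; rewrite ?rmorph1 ?rmorph0.
  apply: idealD => //.
  have iP := ps_ideal iK.
  apply: (@idealD _ [set p0 : ps H | forall n, K (p0 n)] _ _ iP _ _ n);
    exact: (idealMl _ iP).
have [||S N al be hN aN bN ab|F' [p' [q' [th [nb _ qt]]]]] :=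
  @nbhd_loc R J HZ F1 (i \o p) w.
- exact: (@eqflat_comp _ _ _ p i).
- by move=> r /=; rewrite wi.
- have ei x : al (i x) = be (i x).
    apply: (E S N (al \o i) (be \o i)) => //= a Ka; [apply: aN|apply: bN];
    by rewrite wi.
  have [|||||eg eh] := @henselian_ext S F1 N al be k l (mapps i f) g1 h1
    (mapps i u) (mapps i v) (mapps i g0) (mapps i h0) m hN mg1 mh1
    (mapps_fin _ fu) (mapps_fin _ fv) fE (fun n => ei _) _ (fun n => ei _)
    (fun n => ei _).
  + by move=> n; apply/aN/bez1.
  + by move=> n; apply: aN; have := cg n; rewrite -wg !psB rmorphB /mapps -wi.
  + by move=> n; apply: bN; have := cg n; rewrite -wg !psB rmorphB /mapps -wi.
  + by move=> n; apply: aN; have := ch n; rewrite -wh !psB rmorphB /mapps -wi.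
  + by move=> n; apply: bN; have := ch n; rewrite -wh !psB rmorphB /mapps -wi.
  by apply: (gen _ (subring_eq al be)).
exists F', p', q', (th \o i), (mapps th g1), (mapps th h1); split=> //.
- by move=> a /=; rewrite qt wi.
- by rewrite (mapps_comp _ qt).
- by rewrite (mapps_comp _ qt).
Qed.

Record nb := Nb {
  nb_ring : comPzRingType;
  nb_p : {rmorphism R -> nb_ring};
  nb_q : {rmorphism nb_ring -> H};
  nb_P : nbhd nb_p nb_q
}.

Definition nb_le (X Y : nb) := range (nb_q X) `<=` range (nb_q Y).

(** Quantifying over all X builds directedness in: finitely many reachable elements can be captured
    one after the other by enlarging a single neighbourhood. *)
Definition reachable (s : H) :=
  forall X : nb, exists2 Y : nb, nb_le X Y & range (nb_q Y) s.

Lemma reachable_seq n (s : nat -> H) : (forall i, reachable (s i)) ->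
  forall X : nb, exists2 Y : nb, nb_le X Y &
    forall i, (i < n)%N -> range (nb_q Y) (s i).
Proof.
move=> rs; elim: n => [|n IH] X; first by exists X.
have [Y XY Ys] := IH X; have [Z YZ Zn] := rs n Y.
exists Z => [|i]; first by move=> x /XY /YZ.
by rewrite ltnS leq_eqVlt => /orP[/eqP->|/Ys/YZ].
Qed.

Lemma range_fin (X : nb) n (s : ps H) : finps n s ->
  (forall i, (i < n)%N -> range (nb_q X) (s i)) ->
  exists2 t : ps (nb_ring X), finps n t & mapps (nb_q X) t = s.
Proof.
move=> fs rs.
exists (fun i => if pselect (i < n)%N is left h then projT1 (cid2 (rs i h)) else 0).
  by move=> i ni; case: pselect => // h; rewrite leqNgt h in ni.
apply: ps_ext => i; rewrite /mapps; case: pselect => [h|/negP].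
  by case: cid2.
by rewrite -leqNgt => h; rewrite rmorph0 fs.
Qed.

Lemma range_mon (X : nb) n (s : ps H) : monps n s ->
  (forall i, (i < n)%N -> range (nb_q X) (s i)) ->
  exists2 t : ps (nb_ring X), monps n t & mapps (nb_q X) t = s.
Proof.
move=> [s1 s0] rs.
have [||t ft tE] := @range_fin X n (fun i => if (i < n)%N then s i else 0) _ _.
- by move=> k nk; rewrite ltnNge nk.
- by move=> i ni; rewrite ni; exact: rs.
exists (fun i => if i == n then 1 else t i).
  split=> [|k nk]; first by rewrite eqxx.
  by rewrite gtn_eqF // ft // ltnW.
apply: ps_ext => i; rewrite /mapps; case: eqVneq => [->|ne].
  by rewrite s1 rmorph1.
have := congr1 (fun p => p i) tE; rewrite /mapps => ->.
by case: ltnP => // ni; rewrite s0 // ltn_neqAle eq_sym ne.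
Qed.

Lemma hz_reachable s : reachable s.
Proof.
move: s; apply: hz_ind => [|r|x y rx Kx xy|k l m f g0 h0 u v g h].
- split.
  + by move=> X; exists X => //; exists 1 => //; rewrite rmorph1.
  + move=> x rx X; have [Y XY [t _ tx]] := rx X.
    by exists Y => //; exists (- t) => //; rewrite rmorphN tx.
  + move=> x y rx ry X; have [Y XY Yx] := rx X; have [Z YZ [t _ ty]] := ry Y.
    exists Z; first by move=> z /XY /YZ.
    have [t' _ tx] := YZ _ Yx; exists (t' + t) => //.
    by rewrite rmorphD tx ty.
  + move=> x y rx ry X; have [Y XY Yx] := rx X; have [Z YZ [t _ ty]] := ry Y.
    exists Z; first by move=> z /XY /YZ.
    have [t' _ tx] := YZ _ Yx; exists (t' * t) => //.
    by rewrite rmorphM tx ty.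
- move=> X; exists X => //; exists (nb_p X r) => //.
  by have [_ qp _ _] := nb_P X.
- move=> X; have [Y XY [t _ tx]] := rx X; exists Y => //.
  have [_ _ un _] := nb_P Y.
  have [|b bE] := un (t - 1); first by rewrite rmorphB rmorph1 tx.
  exists b => //; rewrite -[LHS]mul1r -xy -tx mulrAC -rmorphM.
  by rewrite -[t](subrKC 1) bE rmorph1 mul1r.
- move=> [rf rg0 rh0 ru rv] [mg0 mh0 fu fv bez] [mg mh e cg ch].
  suff ext (X : nb) : exists2 Y : nb, nb_le X Y & forall n,
      range (nb_q Y) (g n) /\ range (nb_q Y) (h n).
    by split=> n X; have [Y XY Yn] := ext X; exists Y => //; have [] := Yn n.
  pose n0 := (k + l + m)%N.
  have [X1 le1 r1] := reachable_seq n0 rf X.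
  have [X2 le2 r2] := reachable_seq n0 rg0 X1.
  have [X3 le3 r3] := reachable_seq n0 rh0 X2.
  have [X4 le4 r4] := reachable_seq n0 ru X3.
  have [Y le5 r5] := reachable_seq n0 rv X4.
  have mf : monps (k + l) f by rewrite e; exact: monps_mul.
  have [|f' mf' fE] := range_mon (X := Y) mf.
    move=> i hi; apply/le5/le4/le3/le2/r1; apply: leq_trans hi _; exact: leq_addr.
  have [|g0' mg0' gE] := range_mon (X := Y) mg0.
    move=> i hi; apply/le5/le4/le3/r2; apply: leq_trans hi _.
    by rewrite /n0 -addnA leq_addr.
  have [|h0' mh0' hE] := range_mon (X := Y) mh0.
    move=> i hi; apply/le5/le4/r3; apply: leq_trans hi _.
    by rewrite /n0 addnAC leq_addl.
  have [|u' fu' uE] := range_fin (X := Y) fu.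
    move=> i hi; apply/le5/r4; apply: leq_trans hi _; exact: leq_addl.
  have [|v' fv' vE] := range_fin (X := Y) fv.
    move=> i hi; apply/r5; apply: leq_trans hi _; exact: leq_addl.
  have [||||F' [p' [q' [th [gg [hh [nb' qt gg1 hh1]]]]]]] :=
    nbhd_factor (nb_P Y) mf' mg0' mh0' fu' fv' _ mg mh _ _ _.
  + move=> n; have := bez n; rewrite -gE -hE -uE -vE; congr (K _).
    rewrite -!mappsM -mappsD !psB /mapps rmorphB; congr (_ - _).
    by case: n => *; rewrite ?rmorph1 ?rmorph0.
  + by rewrite fE.
  + by rewrite gE.
  + by rewrite hE.
  exists (Nb nb') => [x [t _ tx]|n]; last first.
    split; first by exists (gg n) => //; rewrite -gg1.
    by exists (hh n) => //; rewrite -hh1.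
  have [t' _ tx'] : range (nb_q Y) x by apply/le5/le4/le3/le2/le1; exists t.
  by exists (th t') => //=; rewrite qt.
Qed.

(** A nonzero d survives in a Henselian test ring of F. The map from R to it extends to H by the
    universal property, and the uniqueness clause of [nbhd] identifies the test map with the
    composite through q; hence q d is not zero. *)
Lemma nbhd_inj (X : nb) d : nb_q X d = 0 -> d = 0.
Proof.
case: X d => F p q [/= _ qp un E] d qd; apply: contrapT => d0.
have iM : ideal (q @^-1` K) by exact: preim_ideal.
have [H2 [N [al [hN aN ad]]]] := henselian_test iM un d0.
have aN' a : K (q a) -> N (al a) by move=> Ka; apply: aN; exists a.
have [|w [[wN we] _]] := hz_universal HZ hN (g := al \o p).
  by move=> _ [r Jr <-] /=; apply: aN'; rewrite qp; exact: hz_mem.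
apply: ad; rewrite (E H2 N al (w \o q)) //=; first by rewrite qd rmorph0.
  by move=> a Ka; apply: wN; exists (q a).
by move=> r; rewrite qp we.
Qed.

Lemma nb_cover (I : finType) (s : I -> H) :
  exists (X : nb) (t : I -> nb_ring X), forall i, nb_q X (t i) = s i.
Proof.
have [F [p [q pq]]] := nbhd_base HZ.
have [Y _ Ys] := @reachable_seq #|I| (fun n => nth 0 [seq s i | i <- enum I] n)
  (fun i => hz_reachable _) (Nb pq).
have r i : range (nb_q Y) (s i).
  have := Ys (enum_rank i) (ltn_ord _); rewrite (nth_map i).
    by rewrite nth_enum_rank.
  by rewrite -cardE ltn_ord.
exists Y, (fun i => projT1 (cid2 (r i))) => i; by case: cid2.
Qed.

(** A relation in H lifts to a neighbourhood, holds there by [nbhd_inj], and is resolved there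
    because neighbourhoods are flat. *)
Lemma hz_eqflat : eqflat io.
Proof.
move=> I r s e; have [X [t tE]] := nb_cover s.
have [fl qp _ _] := nb_P X.
have [|L [c [z [zE cE]]]] := fl I r t.
  apply: nbhd_inj; rewrite rmorph_sum; apply: etrans e; apply: eq_bigr => i _.
  by rewrite rmorphM qp tE.
exists L, c, (fun j => nb_q X (z j)); split=> // i.
rewrite -tE zE rmorph_sum; apply: eq_bigr => j _.
by rewrite rmorphM qp.
Qed.

End Neighbourhoods.

(** * The ideal of a Henselization; diagonal idempotents *)

Lemma henselian_zero (Q : comPzRingType) : henselian_pair [set (0 : Q)].
Proof.
split; first exact: ideal_zero.
  apply/(jacobsonP (ideal_zero Q)) => a ->; exists 1.
  by rewrite addr0 mulr1.
move=> f g0 h0 mf mg mh c _; exists g0, h0; split=> //.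
- by move=> n; apply/eqP; rewrite -subr_eq0; apply/eqP; exact: c.
- by move=> n; exact: subrr.
- by move=> n; exact: subrr.
Qed.

Lemma henselian_quot (S Q : comPzRingType) (p : {rmorphism S -> Q}) (I : set S) :
  (forall y, exists x, p x = y) -> (forall x, p x = 0 -> I x) ->
  henselian_pair I -> henselian_pair (p @` I).
Proof.
move=> sp kp hI; have iI := henselian_ideal hI.
have iQ : ideal (p @` I).
  split=> [|_ _ [a Ia <-] [b Ib <-]|y _ [b Ib <-]].
  - by exists 0; [exact: ideal0 | exact: rmorph0].
  - by exists (a + b); [exact: idealD | exact: rmorphD].
  - have [x <-] := sp y; exists (x * b); [exact: idealMl | exact: rmorphM].
have pI x : (p @` I) (p x) -> I x.
  move=> [a Ia e]; apply: (ideal_eqm iI _ Ia); apply: kp.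
  by rewrite rmorphB e subrr.
pose s y := projT1 (cid (sp y)).
have sK y : p (s y) = y by rewrite /s; case: cid.
split=> //.
  apply/(jacobsonP iQ) => _ [a Ia <-]; have [b e] := henselian_unit hI Ia.
  by exists (p b); rewrite -(rmorph1 p) -rmorphD -rmorphM e rmorph1.
pose ml n (q : ps Q) : ps S := fun i => if i == n then 1 else
  if (n < i)%N then 0 else s (q i).
have mlP n q : monps n q -> monps n (ml n q) /\ mapps p (ml n q) = q.
  move=> [q1 q0]; split.
    by split=> [|k nk]; rewrite /ml ?eqxx // gtn_eqF // nk.
  apply: ps_ext => i; rewrite /mapps /ml; case: eqVneq => [->|ne].
    by rewrite q1 rmorph1.
  by case: ltnP => ni; [rewrite q0 ?rmorph0 | rewrite sK].
pose fl n (q : ps Q) : ps S := fun i => if (n <= i)%N then 0 else s (q i).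
have flP n q : finps n q -> finps n (fl n q) /\ mapps p (fl n q) = q.
  move=> q0; split=> [k nk|]; first by rewrite /fl nk.
  apply: ps_ext => i; rewrite /mapps /fl; case: leqP => ni; last by rewrite sK.
  by rewrite q0 ?rmorph0.
move=> f g0 h0 [n /mlP[mf ef]] [k /mlP[mg eg]] [l /mlP[mh eh]] c.
move=> [u [v [[m /flP[fu eu]] [m' /flP[fv ev]] bez]]].
have [||g [h [mg' mh' e cg ch]]] := henselian_lift hI mf mg mh
  (ex_intro _ m fu) (ex_intro _ m' fv).
- move=> i; apply: pI; have := c i; congr (_ _).
  transitivity ((mapps p (ml n f) - mapps p (ml k g0) * mapps p (ml l h0)) i).
    by rewrite ef eg eh.
  by rewrite -mappsM psB /mapps psB rmorphB.
- move=> i; apply: pI; have := bez i; congr (_ _).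
  transitivity ((mapps p (fl m u) * mapps p (ml k g0) +
    mapps p (fl m' v) * mapps p (ml l h0)) i - pone Q i).
    by rewrite eu ev eg eh.
  rewrite -!mappsM -mappsD psB rmorphB; congr (_ - _).
  by case: i => *; rewrite /pone ?rmorph1 ?rmorph0.
exists (mapps p g), (mapps p h); split.
- by exists k; exact: mapps_mon.
- by exists l; exact: mapps_mon.
- move=> i; transitivity (mapps p (ml n f) i); first by rewrite ef.
  by rewrite e mappsM.
- move=> i; exists ((g - ml k g0) i) => //.
  transitivity ((mapps p g - mapps p (ml k g0)) i); last by rewrite eg.
  by rewrite !psB rmorphB.
- move=> i; exists ((h - ml l h0) i) => //.
  transitivity ((mapps p h - mapps p (ml l h0)) i); last by rewrite eh.
  by rewrite !psB rmorphB.
Qed.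

(** The localization at 1 + J, which plays the role of the germs along V(J). *)
Lemma localize_along (T : comPzRingType) (J : set T) : ideal J ->
  exists (S : comPzRingType) (l : {rmorphism T -> S}) (r : set S),
  [/\ ideal r, forall a, J a -> r (l a),
      forall a, r a -> exists b, (1 + a) * b = 1
    & forall x, l x = 0 -> exists m, J (m - 1) /\ m * x = 0].
Proof.
move=> iJ; pose M : set T := [set m | J (m - 1)].
have mM : mulset M.
  split=> [|a b]; rewrite /M /= ?subrr; first exact: ideal0.
  move=> Ka Kb; have -> : a * b - 1 = (a - 1) * b + (b - 1) by ring.
  by apply: idealD => //; exact: idealMr.
have [S [l [lu lf lk]]] := localization mM.
pose r : set S := [set s | exists a m, [/\ J a, M m & s * l m = l a]].
have [M1 MM] := mM.
exists S, l, r; split.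
- split=> [|s t [a [m [Ja Mm e]]] [b [m' [Jb Mm' e']]]|s t [b [m' [Jb Mm' e']]]].
  + by exists 0, 1; rewrite mul0r rmorph0; split=> //; exact: ideal0.
  + exists (a * m' + b * m), (m * m'); split; last 1 first.
    * by rewrite rmorphD !rmorphM -e -e'; ring.
    * by apply: idealD => //; exact: idealMr.
    * exact: MM.
  + have [c [m [Mm e]]] := lf s; exists (c * b), (m * m'); split.
    * exact: idealMl.
    * exact: MM.
    * by rewrite !rmorphM -e -e'; ring.
- by move=> a Ja; exists a, 1; rewrite rmorph1 mulr1.
- move=> s [a [m [Ja Mm e]]]; have [|y yE] := lu (m + a).
    by rewrite /M /= addrAC; exact: idealD.
  by exists (l m * y); rewrite mulrA mulrDl mul1r e -rmorphD.
- by move=> x /lk[m Mm e]; exists m.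
Qed.

Section HzIdeal.
Variables (R : comPzRingType) (J : set R) (HZ : henselization J).
Local Notation H := (hz_ring HZ).
Local Notation K := (@hz_ideal _ _ HZ).
Local Notation io := (hz_map HZ).
Let hK : henselian_pair K := @hz_henselian _ _ HZ.
Let iK : ideal K := henselian_ideal hK.

(** Since (R/J, 0) is a Henselian pair, the quotient map of R extends to H, where it is applied to
    the given equation. *)
Lemma hz_unimodular (I : finType) (r : I -> R) (z : I -> H) : ideal J ->
  \sum_i io (r i) * z i = 1 -> exists y : I -> R, J (1 - \sum_i r i * y i).
Proof.
move=> iJ e; have [Q [p [sp pJ]]] := quotient_ring iJ.
have [|w [[_ wE] _]] := hz_universal HZ (henselian_zero Q) (g := p).
  by move=> _ [r' Jr <-]; apply/pJ.
exists (fun i => projT1 (cid (sp (w (z i))))); apply/pJ.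
have := congr1 w e; rewrite rmorph1 rmorphB rmorph1 => <-.
apply/eqP; rewrite subr_eq0 !rmorph_sum; apply/eqP; apply: eq_bigr => i _.
by case: cid => y yE /=; rewrite !rmorphM wE yE.
Qed.

(** The quotient map from H to H/JH and the composite H -> R/J -> H/JH both extend the map from R,
    to the pair formed by H/JH and the image of K. Uniqueness makes them equal, and the second one
    kills K. *)
Lemma hz_ideal_extend : ideal J -> K `<=` extend io J.
Proof.
move=> iJ; have iE := extend_ideal io J.
have EK : extend io J `<=` K by apply: extend_min => // r; exact: hz_mem.
have [Q [p [sp pJ]]] := quotient_ring iJ.
have [G [e [se eE]]] := quotient_ring iE.
have [|w [[wK wE] _]] := hz_universal HZ (henselian_zero Q) (g := p).
  by move=> _ [r Jr <-]; apply/pJ.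
have [|j jE] := @surj_lift _ _ _ p (e \o io) sp.
  by move=> r /pJ Jr /=; apply/eE; exact: extend_mem.
have hG : henselian_pair (e @` K).
  by apply: henselian_quot => // x /eE /EK.
have [|z [_ uniq]] := hz_universal HZ hG (g := e \o io).
  by move=> _ [r Jr <-] /=; exists (io r) => //; exact: hz_mem.
have e1 : z = e by apply: uniq; split.
have e2 : z = j \o w.
  apply: uniq; split=> [_ [y Ky <-] /=|r]; last by rewrite /= wE jE.
  have -> : w y = 0 by apply: wK; exists y.
  by exists 0; rewrite ?rmorph0 //; exact: ideal0.
move=> x Kx; apply/eE; rewrite -e1 e2 /=.
have -> : w x = 0 by apply: wK; exists x.
exact: rmorph0.
Qed.

End HzIdeal.

(** Converse of [tensor_epd]: for g = x (x) a z the matrix a moves across the tensor sign, so that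
    multiplying g by b on either side gives x (x) a' z = x a' (x) z. *)
Lemma epd_diagonal (A B T : comPzRingType) (f : {rmorphism A -> B})
    (S : comPzRingType) (j : {rmorphism B -> S}) (h : {rmorphism A -> S})
    (il ir : {rmorphism S -> T}) (mu : {rmorphism T -> S}) b :
  (forall a, h a = j (f a)) -> (forall a, il (h a) = ir (h a)) ->
  (forall s, mu (il s) = s) -> (forall s, mu (ir s) = s) ->
  epd f b -> exists g, mu g = 1 /\ g * (il (j b) - ir (j b)) = 0.
Proof.
move=> hE lr ml mr [I [L [a [x [z [xz /(_ _ (mem_head _ _))[a' [c r]]]]]]]].
pose g := \sum_i il (j (x i)) * ir (j (mxcol f a z i)).
have swap (d : I -> L -> A) : \sum_i il (j (x i)) * ir (j (mxcol f d z i)) =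
    \sum_k il (j (mxrow f d x k)) * ir (j (z k)).
  rewrite /mxcol /mxrow.
  under eq_bigr do rewrite !rmorph_sum mulr_sumr.
  rewrite exchange_big; apply: eq_bigr => k _.
  rewrite !rmorph_sum mulr_suml; apply: eq_bigr => i _.
  by rewrite !rmorphM -!hE -lr; ring.
exists g; split.
  rewrite rmorph_sum -(rmorph1 j) -xz rmorph_sum; apply: eq_bigr => i _.
  by rewrite rmorphM ml mr rmorphM.
have e1 : g * ir (j b) = \sum_i il (j (x i)) * ir (j (mxcol f a' z i)).
  rewrite mulr_suml; apply: eq_bigr => i _.
  by rewrite c !rmorphM; ring.
have e2 : g * il (j b) = \sum_k il (j (mxrow f a' x k)) * ir (j (z k)).
  rewrite /g swap mulr_suml; apply: eq_bigr => k _.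
  by rewrite r !rmorphM; ring.
by rewrite mulrBr e1 e2 swap subrr.
Qed.

(** * Pencils over a Henselization *)

Section HzEpd.
Variables (A R : comPzRingType) (f : {rmorphism A -> R}).
Variables (J : set R) (HZ : henselization J).
Local Notation H := (hz_ring HZ).
Local Notation K := (@hz_ideal _ _ HZ).
Local Notation io := (hz_map HZ).
Let hK : henselian_pair K := @hz_henselian _ _ HZ.
Let iK : ideal K := henselian_ideal hK.

(** The property P b says that b (x) 1 = 1 (x) b near the diagonal of H (x)_A H, which by flatness
    amounts to a pencil. For lifted factors, P follows from uniqueness of coprime factorizations in
    the localization along the diagonal. *)
Lemma hz_epd (h : {rmorphism A -> H}) : (forall a, h a = io (f a)) ->
  eqflat h -> (forall b, epd f b) -> forall b, epd h b.
Proof.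
move=> hE fl ef; have [T [il [ir it]]] := tensor_alg h h.
have [|mu [ml mr]] := it_univ it (p := idfun) (q := idfun); first by [].
have lr a : il (h a) = ir (h a) by exact: it_comm it a.
pose P : set H := [set b | exists g, mu g = 1 /\ g * (il b - ir b) = 0].
suff PH : forall b, P b.
  by move=> c; have [g [g1 g0]] := PH c; exact: (tensor_epd it fl ml mr g1 g0).
have Pring : subring P.
  split=> [|b [g [g1 g0]]|b c [g [g1 g0]] [k [k1 k0]]|b c [g [g1 g0]] [k [k1 k0]]].
  - by exists 1; rewrite !rmorph1 subrr mulr0.
  - by exists g; split=> //; rewrite !rmorphN -opprD mulrN g0 oppr0.
  - exists (g * k); split; first by rewrite rmorphM g1 k1 mulr1.
    rewrite !rmorphD (_ : _ * _ = k * (g * (il b - ir b)) + g * (k * (il c - ir c))); last by ring.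
    by rewrite g0 k0 !mulr0 addr0.
  - exists (g * k); split; first by rewrite rmorphM g1 k1 mulr1.
    rewrite !rmorphM (_ : _ * _ = k * il c * (g * (il b - ir b)) + g * ir b * (k * (il c - ir c))); last by ring.
    by rewrite g0 k0 !mulr0 addr0.
have muu g : K (mu g - 1) -> exists g', mu (g * g') = 1.
  move=> /(henselian_unit hK)[y]; rewrite addrC subrK => e.
  by exists (il y); rewrite rmorphM ml.
apply: hz_ind => // [r|x y [g [g1 g0]] _ xy|k l m p g0 h0 u v g h'].
- exact: epd_diagonal hE lr ml mr (ef r).
- exists g; split=> //.
  have -> : g * (il y - ir y) = - (g * (il x - ir x)) * (il y * ir y) +
     g * (il y * (1 - ir (x * y)) - ir y * (1 - il (x * y))) by rewrite !rmorphM; ring.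
  by rewrite g0 xy !rmorph1 subrr oppr0 mul0r !mulr0 subrr mulr0 addr0.
move=> [Pp Pg0 Ph0 Pu Pv] [mg0 mh0 fu fv bez] [mg mh e cg ch].
have [S [l' [r [ir' lr' ru lk]]]] := localize_along (preim_ideal mu iK).
pose al : {rmorphism H -> S} := l' \o il; pose be : {rmorphism H -> S} := l' \o ir.
have Pe x : P x -> al x = be x.
  move=> [y [y1 y0]]; have [|b bE] := ru (l' (y - 1)).
    by apply: lr' => /=; rewrite rmorphB y1 rmorph1 subrr; exact: ideal0.
  apply/eqP; rewrite -subr_eq0; apply/eqP; rewrite /= -rmorphB -[LHS]mul1r -bE.
  by rewrite -(rmorph1 l') -rmorphD subrKC mulrAC -rmorphM y0 rmorph0 mul0r.
have d x : r (al x - be x).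
  by rewrite /= -rmorphB; apply: lr'; rewrite /= rmorphB ml mr subrr; exact: ideal0.
have [||||E1 E2] := @factorization_unique S r k l (mapps al g) (mapps be g)
  (mapps al h') (mapps be h') (mapps al u) (mapps al v) m ir' ru
  (mapps_mon _ mg) (mapps_mon _ mg)
  (mapps_mon _ mh) (mapps_mon _ mh) (mapps_fin _ fu) (mapps_fin _ fv).
- move=> n; have : K ((u * g + v * h' - 1) n).
    have -> : u * g + v * h' - 1 = (u * (g - g0) + v * (h' - h0)) + (u * g0 + v * h0 - 1) by ring.
    rewrite psD; apply: idealD => //; have iP := ps_ideal iK.
    by apply: (@idealD _ [set p0 : ps H | forall n, K (p0 n)] _ _ iP _ _ n);
      exact: (idealMl _ iP).
  move=> Kn; have : r (al ((u * g + v * h' - 1) n)) by apply: lr'; rewrite /= ml.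
  congr (r _); rewrite -!mappsM -mappsD !psB /mapps rmorphB; congr (_ - _).
  by case: n {Kn} => *; rewrite ?rmorph1 ?rmorph0.
- by move=> n; exact: d.
- by move=> n; exact: d.
- by rewrite -!mappsM -e; apply: ps_ext => n; exact: Pe.
have back x : al x = be x -> P x.
  move=> ex; have [|y [Ky y0]] := lk (il x - ir x).
    by apply/eqP; rewrite rmorphB subr_eq0; apply/eqP.
  have [|y' e1] := muu y; first by move: Ky => /=; rewrite rmorphB rmorph1.
  by exists (y * y'); split=> //; rewrite mulrAC y0 mul0r.
by split=> n; apply: back; [exact: (congr1 (fun p => p n) E1) | exact: (congr1 (fun p => p n) E2)].
Qed.

End HzEpd.

(** * The descent setting *)

(* To be applied to R = B^h, C = (B (x)_A B)^h and D = R (x)_A R. *)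
Record descent_setting (A : comPzRingType) (I : set A) (R C D : comPzRingType)
    (f : {rmorphism A -> R}) (d0 d1 : {rmorphism R -> C})
    (il ir : {rmorphism R -> D}) (de : {rmorphism D -> C}) : Prop :=
  DescentSetting {
    ds_hensel : henselian_pair I;
    ds_flat : eqflat f;
    ds_epd : forall b, epd f b;
    ds_jac : forall a, extend f I a -> exists b, (1 + a) * b = 1;
    ds_unimodular : forall (J : finType) (c : J -> A) (z : J -> R),
      \sum_j f (c j) * z j = 1 -> exists y, \sum_j c j * y j = 1;
    ds_tensor : is_tensor f f il ir;
    ds_d0 : forall b, de (il b) = d0 b;
    ds_d1 : forall b, de (ir b) = d1 b;
    ds_eq : forall a, d0 (f a) = d1 (f a);
    ds_flatC : eqflat de;
    ds_epdC : forall (h : {rmorphism A -> C}), (forall a, h a = d0 (f a)) ->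
      forall c, epd h c;
    ds_unimodularC : forall (J : finType) (s : J -> D) (z : J -> C),
      \sum_j de (s j) * z j = 1 ->
      exists y, extend (il \o f) I (1 - \sum_j s j * y j)
  }.

Lemma epd_map (A B S : comPzRingType) (f : {rmorphism A -> B})
    (j : {rmorphism B -> S}) (h : {rmorphism A -> S}) b :
  (forall a, h a = j (f a)) -> epd f b -> epd h (j b).
Proof.
move=> hE /(jepd_map (q := idfun) (p := j) (k := h)); apply => a.
by rewrite hE.
Qed.

(** Modulo IB, the equation descends to B by [hz_unimodular], so the ideal I + (c) of A generates B
    and is the unit ideal by faithful flatness. Then 1 - a with a in I is a combination of the c j,
    and it is a unit. *)
Lemma hz_faithful (A B : comPzRingType) (f : {rmorphism A -> B}) (I : set A)
    (Bh : henselization (extend f I)) (J : finType) (c : J -> A)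
    (z : J -> hz_ring Bh) :
  henselian_pair I -> faithfully_flat f ->
  \sum_j hz_map Bh (f (c j)) * z j = 1 -> exists y, \sum_j c j * y j = 1.
Proof.
move=> hI ff e; have iI := henselian_ideal hI.
have [y yE] := hz_unimodular (extend_ideal f I) e.
pose m : set A := [set x | exists a t, I a /\ x = a + \sum_j c j * t j].
have im : ideal m.
  split=> [|_ _ [a [t [Ia ->]]] [b [u [Ib ->]]]|b _ [a [t [Ia ->]]]].
  - exists 0, (fun=> 0); rewrite big1 ?addr0 // => [|j _]; last by rewrite mulr0.
    by split=> //; exact: ideal0.
  - exists (a + b), (fun j => t j + u j); split; first exact: idealD.
    by under [X in _ = _ + X]eq_bigr do rewrite mulrDr; rewrite big_split addrACA.
  - exists (b * a), (fun j => b * t j); split; first exact: idealMl.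
    by rewrite mulrDr mulr_sumr; congr (_ + _); apply: eq_bigr => j _; ring.
have iX := extend_ideal f m.
have mI a : I a -> m a.
  move=> Ia; exists a, (fun=> 0); split=> //.
  by rewrite big1 ?addr0 // => j _; rewrite mulr0.
have mc j : m (c j).
  exists 0, (fun i => (i == j)%:R); split; first exact: ideal0.
  rewrite add0r (bigD1 j) //= eqxx mulr1 big1 ?addr0 // => i /negPf ->.
  by rewrite mulr0.
have /(faithfully_flat_extend ff im)[a [t [Ia a1]]] : extend f m 1.
  rewrite -[1](subrK (\sum_j f (c j) * y j)); apply: (idealD iX).
    by apply: (@extend_min _ _ f I _ iX _ _ yE) => a Ia; exact: (@extend_mem _ _ f m _ (mI _ Ia)).
  apply: (@ideal_sum _ (extend f m)) => // j _; apply: (@idealMr _ (extend f m)) => //.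
  exact: (@extend_mem _ _ f m _ (mc j)).
have [|b bE] := henselian_unit hI (a := - a); first exact: idealN.
exists (fun j => t j * b); rewrite -bE {1}a1 addrAC subrr add0r mulr_suml.
by apply: eq_bigr => j _; rewrite mulrA.
Qed.

(** * The setting for the Henselizations of the statement *)

Section Setting.
Variables (A : comPzRingType) (I : set A) (B : comPzRingType)
    (f : {rmorphism A -> B}).
Hypothesis hI : henselian_pair I.
Variables (Bh : henselization (extend f I))
  (BBh : henselization (extend (tensor_sq_map f) I)).
Local Notation R := (hz_ring Bh).
Local Notation C := (hz_ring BBh).
Local Notation d0 := (henselize Bh BBh (inl_sub f I)).
Local Notation d1 := (henselize Bh BBh (inr_sub f I)).
Local Notation f' := (hz_map Bh \o f : {rmorphism A -> R}).
Variables (D : comPzRingType) (il ir : {rmorphism R -> D}).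
Hypothesis it : is_tensor f' f' il ir.

Lemma d_eq a : d0 (f' a) = d1 (f' a).
Proof.
rewrite /= (henselizeE _ _ (inl_sub f I)) (henselizeE _ _ (inr_sub f I)).
by congr (hz_map BBh _); exact: esym (tensor_sq_mapE f a).
Qed.

Lemma hz_extend_min (N : set R) : ideal N -> (forall a, I a -> N (f' a)) ->
  @hz_ideal _ _ Bh `<=` N.
Proof.
move=> iN IN x /hz_ideal_extend-/(_ (extend_ideal _ _)).
move=> h; apply: (@extend_min _ _ (hz_map Bh) _ N iN _ x h) => b hb.
apply: (@extend_min _ _ f I (hz_map Bh @^-1` N) _ _ b hb) => //.
exact: preim_ideal.
Qed.

Variable de : {rmorphism D -> C}.
Hypotheses (de0 : forall b, de (il b) = d0 b) (de1 : forall b, de (ir b) = d1 b).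

Fact tensor_hz_sub : de @` extend (il \o f') I `<=` @hz_ideal _ _ BBh.
Proof.
have hK := @hz_henselian _ _ BBh; have iK := henselian_ideal hK.
move=> _ [x Ix <-]; move: x Ix.
apply: extend_min => [|a Ia]; first exact: (@preim_ideal _ _ de).
rewrite /= de0 henselizeE; apply: hz_mem.
exact: (@extend_mem _ _ (tensor_sq_map f)).
Qed.

(** A map from D to a Henselian pair restricts to B (x)_A B and extends from there to C. That the
    extension is compatible with D is the universal property of R: maps from R to S are determined
    by B. *)
Fact tensor_hz_universal (S : comPzRingType) (N : set S)
    (g : {rmorphism D -> S}) : henselian_pair N -> g @` (extend (il \o f') I) `<=` N ->
  exists! g' : {rmorphism C -> S},
    g' @` (@hz_ideal _ _ BBh) `<=` N /\ forall x, g' (de x) = g x.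
Proof.
move=> hN gN; have iN := henselian_ideal hN.
have gI a : I a -> N (g (il (f' a))).
  move=> Ia; apply: gN; exists (il (f' a)) => //.
  exact: (@extend_mem _ _ (il \o f')).
have itB := tensor_sq_is_tensor f.
have [|k [kl kr]] := it_univ itB (p := g \o il \o hz_map Bh) (q := g \o ir \o hz_map Bh).
  by move=> a /=; congr (g _); exact: it_comm it a.
have kN : k @` extend (tensor_sq_map f) I `<=` N.
  move=> _ [x Ix <-]; move: x Ix; apply: extend_min => [|a Ia].
    exact: (@preim_ideal _ _ k).
  by rewrite /= /tensor_sq_map /= kl; exact: gI.
have [g' [[gK gE] uniq]] := hz_universal BBh hN kN.
have ext (h : {rmorphism R -> S}) (h' : {rmorphism R -> S}) :
    (forall b, h (hz_map Bh b) = h' (hz_map Bh b)) ->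
    (forall a, I a -> N (h (f' a))) -> forall x, h x = h' x.
  move=> e hIN; have hN1 := hz_extend_min (preim_ideal h iN) hIN.
  have hN2 : @hz_ideal _ _ Bh `<=` h' @^-1` N.
    apply: hz_extend_min => [|a Ia]; first exact: preim_ideal.
    by rewrite /= -e; exact: hIN.
  have [|z [_ zu]] := hz_universal Bh hN (g := h \o hz_map Bh).
    move=> _ [x Ix <-] /=; move: x Ix; apply: extend_min => [|a Ia].
      exact: (@preim_ideal _ _ (h \o hz_map Bh)).
    exact: hIN.
  have e1 : z = h by apply: zu; split=> // _ [x Kx <-]; exact: hN1.
  have e2 : z = h' by apply: zu; split=> [_ [x Kx <-]|r]; [exact: hN2 | rewrite -e].
  by move=> x; rewrite -e1 e2.
exists g'; split.
  split=> // x; have [s ->] := it_span it x.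
  rewrite !rmorph_sum; apply: eq_bigr => z _; rewrite !rmorphM de0 de1.
  congr (_ * _).
    apply: (ext (g' \o d0) (g \o il)) => [b|a Ia] /=; first by rewrite henselizeE gE kl.
    by rewrite henselizeE gE kl; exact: gI.
  apply: (ext (g' \o d1) (g \o ir)) => [b|a Ia] /=; first by rewrite henselizeE gE kr.
  by rewrite henselizeE gE kr /= -(it_comm it a); exact: gI.
move=> g2 [gK2 gE2]; apply: uniq; split=> // x.
have [s ->] := it_span itB x.
rewrite !rmorph_sum; apply: eq_bigr => z _; rewrite !rmorphM kl kr /=.
by rewrite -!gE2 de0 de1 !henselizeE.
Qed.

Definition tensor_henselization : henselization (extend (il \o f') I) :=
  @Henselization D _ C _ de tensor_hz_sub (@hz_henselian _ _ BBh) tensor_hz_universal.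

Hypotheses (f_weakly_etale : weakly_etale f) (f_faithfully_flat : faithfully_flat f).

Lemma descent_settingP : descent_setting I f' d0 d1 il ir de.
Proof.
have fl : eqflat f' by apply: (@eqflat_comp _ _ _ f (hz_map Bh)) => //;
  [exact: flat_eqflat f_weakly_etale.1 | exact: hz_eqflat].
have flC : eqflat de by exact: (@hz_eqflat _ _ tensor_henselization).
have flr : eqflat ir by exact: eqflat_base_change it fl.
have ef : forall b, epd f' b by apply: hz_epd => //; exact: weakly_etale_epd.
split=> //.
- move=> a Ia; apply: (henselian_unit (@hz_henselian _ _ Bh)).
  have iK := henselian_ideal (@hz_henselian _ _ Bh).
  apply: (@extend_min _ _ f' I _ iK _ a Ia) => b Ib.
  by apply: hz_mem; exact: (@extend_mem _ _ f).
- by move=> J c z; exact: hz_faithful.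
- exact: d_eq.
- move=> h hE; apply: (@hz_epd _ _ (il \o f') _ tensor_henselization).
  + by move=> a; rewrite hE /= de0.
  + apply: (@eqflat_comp _ _ _ (ir \o f') de) => //.
      by move=> a; rewrite hE d_eq /= de1.
    exact: (@eqflat_comp _ _ _ f' ir).
  + move=> x; have [s ->] := it_span it x.
    have sub := epd_subring (il \o f'); apply: (subring_sum _ sub) => z _.
    have [_ _ _ M] := sub; apply: M; first exact: (epd_map (f := f')).
    apply: (epd_map (f := f')) => // a /=; exact: it_comm it a.
- move=> J s z; exact: (@hz_unimodular _ _ tensor_henselization) (extend_ideal _ _).
Qed.

End Setting.

(** * Algebras over a closed field that are split *)

Section Algebraic.
Variables (K : fieldType) (L : comPzRingType) (jk : {rmorphism K -> L}).
Variable b : L.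

Let mk p q (M : 'M[K]_(p, q)) : 'M[L]_(p, q) := map_mx jk M.

Let mkM p q r (M : 'M[K]_(p, q)) (N : 'M[K]_(q, r)) : mk (M *m N) = mk M *m mk N.
Proof. exact: map_mxM. Qed.

Lemma rank_one_split q (v : 'rV[K]_q) : v != 0 ->
  exists r (G : 'M[K]_(q, r)) (H : 'M[K]_(r, q)) (w : 'cV[K]_q),
    (r < q)%N /\ 1%:M = G *m H + w *m v.
Proof.
move=> v0; have [j vj] : exists j, v 0 j != 0.
  by have /rV0Pn := v0.
pose w : 'cV[K]_q := (v 0 j)^-1 *: delta_mx j 0.
have vw : v *m w = 1%:M.
  rewrite /w -scalemxAr -colE; apply/matrixP => i k.
  by rewrite !ord1 !mxE eqxx mulVf.
pose E := 1%:M - w *m v.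
exists (\rank E), (col_base E), (row_base E), w; split.
  rewrite ltn_neqAle rank_leq_row andbT; apply/negP => fE.
  have : v *m E = 0 by rewrite mulmxBr mulmx1 mulmxA vw mul1mx subrr.
  have /row_freeP[X EX] : row_free E by [].
  move/(congr1 (mulmx^~ X)); rewrite -mulmxA EX mulmx1 mul0mx => e.
  by rewrite e eqxx in v0.
by rewrite mulmx_base subrK.
Qed.

(** The condition s(b) c = 0, where s(b) is expressed through an evaluation map since the ring {poly
    L} requires L to be nonzero. *)
Definition killed (c : L) := exists2 s : {poly K}, s \is monic &
  forall h : {rmorphism {poly K} -> L}, h 'X = b -> (forall a, h a%:P = jk a) ->
    h s * c = 0.

Lemma pencil_unit p (a a' : 'M[K]_p) (x : 'rV[L]_p) (z : 'cV[L]_p) :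
  a \in unitmx -> mk a' *m z = b *: (mk a *m z) ->
  killed ((x *m mk a *m z) 0 0).
Proof.
move=> ua ez; exists (char_poly (a' *m invmx a)); first exact: char_poly_monic.
move=> h hX hc; pose M := a' *m invmx a; pose y := mk a *m z.
have My : mk M *m y = b *: y.
  by rewrite /y mulmxA -mkM /M -mulmxA mulVmx // mulmx1.
pose Z : 'M[L]_p := map_mx h (char_poly_mx M).
have ZE : Z = b%:M - mk M.
  apply/matrixP => i j; rewrite !mxE rmorphB rmorphMn hX /=.
  by rewrite hc.
have Zy : Z *m y = 0 by rewrite ZE mulmxBl mul_scalar_mx My subrr.
have dy : \det Z *: y = 0.
  by rewrite -mul_scalar_mx -mul_adj_mx -mulmxA Zy mulmx0.
have -> : h (char_poly M) = \det Z by rewrite /char_poly /Z det_map_mx.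
rewrite -mulmxA -/y mxE mulr_sumr big1 // => i _.
have := congr1 (fun Y : 'cV[L]_p => Y i 0) dy; rewrite !mxE mulrCA => ->.
exact: mulr0.
Qed.

(** Kronecker reduction along a left null vector u of a. If u also kills a', the rows can be reduced
    by one dimension. Otherwise u a' z = b u a z = 0 puts z in a hyperplane defined over K, and the
    columns can be reduced. The value x a z is unchanged. *)
Lemma pencil_row_step p q (a a' : 'M[K]_(p, q)) (x : 'rV[L]_p) (z : 'cV[L]_q)
    (u : 'rV[K]_p) : u != 0 -> u *m a = 0 ->
  mk a' *m z = b *: (mk a *m z) -> x *m mk a' = b *: (x *m mk a) ->
  exists p' q' (c c' : 'M[K]_(p', q')) (x' : 'rV[L]_p') (z' : 'cV[L]_q'),
    [/\ (p' + q' < p + q)%N, mk c' *m z' = b *: (mk c *m z'),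
        x' *m mk c' = b *: (x' *m mk c) &
        x *m mk a *m z = x' *m mk c *m z'].
Proof.
move=> u0 ua ez ex; have [ua'|v0] := eqVneq (u *m a') 0.
  have [r [G [H [w [rp e]]]]] := rank_one_split u0.
  have aE : a = G *m (H *m a).
    by rewrite -[LHS]mul1mx e mulmxDl -!mulmxA ua mulmx0 addr0.
  have aE' : a' = G *m (H *m a').
    by rewrite -[LHS]mul1mx e mulmxDl -!mulmxA ua' mulmx0 addr0.
  exists r, q, (H *m a), (H *m a'), (x *m mk G), z; split.
  - by rewrite ltn_add2r.
  - by rewrite !mkM -!mulmxA ez -scalemxAr.
  - by rewrite -!mulmxA -!mkM -aE -aE'.
  - by rewrite -!mulmxA ![_ *m (_ *m z)]mulmxA -!mkM -aE.
have [r [G [H [w [rp e]]]]] := rank_one_split v0.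
have uz : mk (u *m a') *m z = 0.
  rewrite mkM -mulmxA ez -scalemxAr mulmxA -mkM ua.
  by rewrite /mk map_mx0 mul0mx scaler0.
have zE : z = mk G *m (mk H *m z).
  transitivity (mk 1%:M *m z); first by rewrite /mk map_mx1 mul1mx.
  rewrite e /mk map_mxD -!/(mk _) mulmxDl (mkM G H) (mkM w) -!mulmxA uz mulmx0 addr0 //.
exists p, r, (a *m G), (a' *m G), x, (mk H *m z); split.
- by rewrite ltn_add2l.
- by rewrite !mkM -!mulmxA -zE.
- by rewrite !mkM !mulmxA ex -scalemxAl.
- by rewrite !mkM -!mulmxA -zE.
Qed.

(** Row and column reduction end with a square invertible a, for which b is an eigenvalue of a' a^-1
    and the characteristic polynomial applies. *)
Lemma pencil_killed n : forall p q (a a' : 'M[K]_(p, q)) (x : 'rV[L]_p)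
    (z : 'cV[L]_q), (p + q < n)%N ->
  mk a' *m z = b *: (mk a *m z) -> x *m mk a' = b *: (x *m mk a) ->
  killed ((x *m mk a *m z) 0 0).
Proof.
elim: n => // n IH p q a a' x z pq ez ex.
have tr r s (M : 'M[K]_(r, s)) : (mk M)^T = mk M^T by rewrite /mk map_trmx.
have [fa|] := boolP (row_free a); last first.
  rewrite -kermx_eq0 => /rowV0Pn[u /sub_kermxP ua u0].
  have [p' [q' [c [c' [x' [z' [lt ez' ex' ->]]]]]]] := pencil_row_step u0 ua ez ex.
  by apply: (IH p' q' c c') => //; rewrite -ltnS; exact: leq_trans lt _.
have [fb|] := boolP (row_free a^T); last first.
  rewrite -kermx_eq0 => /rowV0Pn[u /sub_kermxP ua u0].
  have [|| p' [q' [c [c' [x' [z' [lt ez' ex' e]]]]]]] :=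
    @pencil_row_step q p a^T a'^T z^T x^T u u0 ua.
  - by rewrite -!tr -!trmx_mul ex linearZ.
  - by rewrite -!tr -!trmx_mul ez linearZ.
  have -> : (x *m mk a *m z) 0 0 = (x' *m mk c *m z') 0 0.
    rewrite -e -tr -trmx_mul -trmx_mul mulmxA.
    by rewrite [in RHS]mxE.
  by apply: (IH p' q' c c') => //; rewrite -ltnS addnC in pq *; rewrite (leq_trans lt) // addnC.
have e : p = q.
  have := mxrank_tr a; rewrite (eqP fa) => r1; have := eqP fb; rewrite r1; done.
case: q / e a a' z pq ez ex fa fb => a a' z pq ez ex fa fb.
by apply: pencil_unit ez; rewrite -row_free_unit.
Qed.

End Algebraic.

Lemma closed_split (K : fieldType) : has_roots K -> forall p : {poly K},
  p \is monic -> exists s : seq K, p = \prod_(c <- s) ('X - c%:P).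
Proof.
move=> hK p; move: {2}(size p) (leqnn (size p)) => n.
elim: n p => [|n IH] p; first by rewrite leqn0 size_poly_eq0 => /eqP -> /monic_neq0; rewrite eqxx.
move=> sp mp; have [s1|s1] := eqVneq (size p) 1%N.
  exists [::]; rewrite big_nil; move: mp; have /size_poly1P[c c0 ->] : size p == 1%N by rewrite s1.
  by rewrite monicE lead_coefC => /eqP ->.
have s0 : size p != 0%N by rewrite size_poly_eq0 monic_neq0.
have [d dE] : exists d, size p = d.+2 by case: (size p) s0 s1 => // -[|d] // _ _; exists d.
have [|x xE] := hK d (fun i => p`_i).
  split=> [|k dk]; last by rewrite nth_default // dE.
  by have := monicP mp; rewrite lead_coefE dE.
have /factor_theorem[q pE] : root p x.
  apply/rootP; rewrite horner_coef dE; exact: xE.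
have mq : q \is monic by rewrite -(monicMr _ (monicXsubC x)) -pE.
have [|s sE] := IH q _ mq.
  by move: sp; rewrite pE size_Mmonic ?monic_neq0 ?monicXsubC // size_XsubC addn2.
by exists (x :: s); rewrite big_cons -sE mulrC.
Qed.

(* The roots are distinct: L is reduced and all its residue fields are K. *)
Definition split_alg (K : fieldType) (L : comPzRingType) (jk : {rmorphism K -> L}) :=
  forall x, exists2 s : seq K, uniq s & \prod_(c <- s) (x - jk c) = 0.

Lemma epd_split (K : fieldType) (L : comPzRingType) (jk : {rmorphism K -> L}) b :
  has_roots K -> epd jk b ->
  exists2 s : seq K, uniq s & \prod_(c <- s) (b - jk c) = 0.
Proof.
move=> hK [I [J [a0 [x0 [z0 [xz /(_ _ (mem_head _ _))[a0' [c0 r0]]]]]]]].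
pose mk p q (M : 'M[K]_(p, q)) : 'M[L]_(p, q) := map_mx jk M.
have mkM' p q r (M : 'M[K]_(p, q)) (N : 'M_(q, r)) : mk _ _ (M *m N) = mk _ _ M *m mk _ _ N.
  exact: map_mxM.
pose a : 'M[K]_(#|I|, #|J|) := \matrix_(i, j) a0 (enum_val i) (enum_val j).
pose a' : 'M[K]_(#|I|, #|J|) := \matrix_(i, j) a0' (enum_val i) (enum_val j).
pose x : 'rV[L]_#|I| := \row_i x0 (enum_val i).
pose z : 'cV[L]_#|J| := \col_j z0 (enum_val j).
have mz (d : I -> J -> K) i : ((mk _ _ (\matrix_(i, j) d (enum_val i) (enum_val j)) : 'M_(#|I|, #|J|)) *m z) i 0 =
    mxcol jk d z0 (enum_val i).
  rewrite mxE /mxcol [RHS](reindex (@enum_val _ predT)) /=; last exact/onW_bij/enum_val_bij.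
  by apply: eq_bigr => j _; rewrite !mxE.
have xm (d : I -> J -> K) j : (x *m (mk _ _ (\matrix_(i, j) d (enum_val i) (enum_val j)) : 'M_(#|I|, #|J|))) 0 j =
    mxrow jk d x0 (enum_val j).
  rewrite mxE /mxrow [RHS](reindex (@enum_val _ predT)) /=; last exact/onW_bij/enum_val_bij.
  by apply: eq_bigr => i _; rewrite !mxE mulrC.
have ez : mk _ _ a' *m z = b *: (mk _ _ a *m z).
  by apply/matrixP => i j; rewrite [RHS]mxE !ord1 !mz c0.
have ex : x *m mk _ _ a' = b *: (x *m mk _ _ a).
  by apply/matrixP => i j; rewrite [RHS]mxE !ord1 !xm r0.
have one : (x *m mk _ _ a *m z) 0 0 = 1.
  rewrite -mulmxA -xz mxE [RHS](reindex (@enum_val _ predT)) /=; last exact/onW_bij/enum_val_bij.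
  by apply: eq_bigr => i _; rewrite mz mxE.
have sqf k : exists u v, (b - jk k) * u = 0 /\ 1 = u + (b - jk k) * v.
  pose d := a' - k *: a.
  have dE : mk _ _ d = mk _ _ a' - jk k *: mk _ _ a.
    by apply/matrixP => i j; rewrite !mxE rmorphB rmorphM.
  have dz : mk _ _ d *m z = (b - jk k) *: (mk _ _ a *m z).
    by rewrite dE mulmxBl ez -scalemxAl scalerBl.
  have xd : x *m mk _ _ d = (b - jk k) *: (x *m mk _ _ a).
    by rewrite dE mulmxBr ex -scalemxAr scalerBl.
  pose g := pinvmx d; have dg : d *m g *m d = d by exact: mulmxKpV.
  exists ((x *m mk _ _ (a *m (1%:M - g *m d)) *m z) 0 0).
  exists ((x *m mk _ _ (a *m g) *m (mk _ _ a *m z)) 0 0); split.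
    transitivity (((b - jk k) *: (x *m mk _ _ a) *m mk _ _ (1%:M - g *m d) *m z) 0 0).
      by rewrite /mk map_mxM mulmxA -!scalemxAl [RHS]mxE.
    rewrite -xd -(mulmxA x) /mk -map_mxM mulmxBr mulmx1 mulmxA dg subrr.
    by rewrite map_mx0 mulmx0 mul0mx mxE.
  have -> : (b - jk k) * (x *m mk _ _ (a *m g) *m (mk _ _ a *m z)) 0 0 =
      (x *m mk _ _ (a *m g *m d) *m z) 0 0.
    by rewrite (mkM' _ _ _ (a *m g)) [in RHS]mulmxA -[in RHS](mulmxA _ _ z) dz -scalemxAr [RHS]mxE.
  transitivity ((x *m mk _ _ (a *m (1%:M - g *m d)) *m z +
    x *m mk _ _ (a *m g *m d) *m z) 0 0); last by rewrite mxE.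
  rewrite -one -mulmxDl -mulmxDr /mk -map_mxD mulmxBr mulmx1 mulmxA subrK //.
have sq k w : (b - jk k) * ((b - jk k) * w) = 0 -> (b - jk k) * w = 0.
  move=> e; have [u [v [bu e1]]] := sqf k.
  rewrite -[LHS]mulr1 e1 (_ : _ * _ = (b - jk k) * u * w + v * ((b - jk k) * ((b - jk k) * w))); last by ring.
  by rewrite bu e mul0r mulr0 addr0.
have [P mP hP] := pencil_killed (ltnSn _) ez ex.
have [s sE] := closed_split hK mP.
have [h [hX hc]] := @poly_eval_hom K L jk b.
have : \prod_(c <- s) (b - jk c) * 1 = 0.
  rewrite -[X in _ * X]one; apply: etrans (hP h hX hc); rewrite sE rmorph_prod; congr (_ * _); apply: eq_bigr => c _.
  by rewrite rmorphB hX hc.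
move=> e; exists (undup s); first exact: undup_uniq.
rewrite -[LHS]mulr1.
have main w : \prod_(c <- s) (b - jk c) * w = 0 ->
    \prod_(c <- undup s) (b - jk c) * w = 0.
  elim: s {sE e} w => //= c s IH w; rewrite big_cons => e; case: ifP => cs.
    apply: IH; have [s1 ps] : exists s1, perm_eq s (c :: s1).
      by exists (rem c s); exact: perm_to_rem.
    move: e; rewrite (perm_big _ ps) /= big_cons => e.
    by rewrite -mulrA; apply: sq; apply: etrans e; ring.
  by rewrite big_cons -mulrA mulrCA; apply: IH; apply: etrans e; ring.
exact: main.
Qed.

Section SplitPoints.
Variables (K : fieldType) (L : comPzRingType) (jk : {rmorphism K -> L}).
Hypothesis hs : split_alg jk.

Definition kpoint (x : {rmorphism L -> K}) := forall c, x (jk c) = c.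

Lemma split_point (J : set L) : ideal J -> ~ J 1 ->
  exists2 x : {rmorphism L -> K}, kpoint x & forall a, J a -> x a = 0.
Proof.
move=> iJ J1; have [m [mm Jm]] := maximal_over iJ J1.
have [im m1 pm] := maximal_prime mm.
have ex a : exists c, m (a - jk c).
  have [s _ e] := hs a.
  have : m (\prod_(c <- s) (a - jk c)) by rewrite e; exact: ideal0.
  elim: s {e} => [|c s IH]; first by rewrite big_nil.
  by rewrite big_cons => /pm[|/IH //]; exists c.
pose v a := projT1 (cid (ex a)).
have vP a : m (a - jk (v a)) by rewrite /v; case: cid.
have inj c c' : m (jk c - jk c') -> c = c'.
  rewrite -rmorphB => mc; apply/eqP; rewrite -subr_eq0; apply/negP => /negP n0.
  apply: m1; rewrite -(rmorph1 jk) -(mulfV n0) rmorphM; exact: idealMr.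
have vE a c : m (a - jk c) -> v a = c.
  move=> mc; apply: inj.
  have -> : jk (v a) - jk c = (a - jk c) - (a - jk (v a)) by ring.
  exact: idealB.
have [|x xE] := @rmorph_of L K v.
  split=> [|a b|a b]; apply: vE.
  - by rewrite rmorph1 subrr; exact: ideal0.
  - by rewrite rmorphD opprD addrACA; exact: idealD.
  - rewrite rmorphM (_ : _ - _ = (a - jk (v a)) * b + jk (v a) * (b - jk (v b))); last by ring.
    by apply: idealD => //; [exact: idealMr | exact: idealMl].
exists x => [c|a Ja]; rewrite xE; apply: vE; first by rewrite subrr; exact: ideal0.
by rewrite rmorph0 subr0; exact: Jm.
Qed.

(** L is von Neumann regular. The factors of the polynomial of a for nonzero roots multiply to u + a
    h with u a nonzero constant, and a (u + a h) = 0 because the root 0 is simple. *)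
Lemma split_regular (a : L) : exists y, a * a * y = a.
Proof.
have aux (s : seq K) : 0 \notin s -> exists u h, u != 0 /\ \prod_(c <- s) (a - jk c) = jk u + a * h.
  elim: s => [_|c s IH].
    by exists 1, 0; rewrite oner_neq0 big_nil rmorph1 mulr0 addr0.
  rewrite inE negb_or => /andP[c0 /IH[u [h [u0 e]]]].
  exists (- c * u), (jk u + a * h - jk c * h); split.
    by rewrite mulf_neq0 // oppr_eq0 eq_sym.
  by rewrite big_cons e rmorphM rmorphN; ring.
have [s us e] := hs a; have [u [h [u0 e']]] := aux (rem 0 s) (negbT (mem_rem_uniqF 0 us)).
have z : a * (jk u + a * h) = 0.
  rewrite -e'; have [s0|s0] := boolP (0 \in s).
    by apply: etrans e; rewrite (perm_big _ (perm_to_rem s0)) big_cons rmorph0 subr0.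
  by rewrite rem_id // e mulr0.
exists (- h * jk u^-1).
have e1 : jk u * jk u^-1 = 1 by rewrite -rmorphM mulfV // rmorph1.
rewrite -[RHS]mulr1 -e1 -[LHS]addr0 -(mul0r (jk u^-1)) -z; ring.
Qed.

Lemma split_indicator (a : L) : exists e, e * e = e /\
  forall x, kpoint x -> x e = (x a != 0)%:R.
Proof.
have [y yE] := split_regular a; exists (a * y); split.
  by transitivity ((a * a * y) * y); [ring | rewrite yE].
move=> x _; rewrite rmorphM; have [->|n0] := eqVneq; first by rewrite mul0r.
have := congr1 x yE; rewrite !rmorphM -mulrA => e; apply: (mulfI n0).
by rewrite e mulr1.
Qed.

Lemma split_reduced (a : L) : (forall x, kpoint x -> x a = 0) -> a = 0.
Proof.
move=> h; have [y yE] := split_regular a.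
pose J : set L := [set z | exists w, z = (1 - a * y) * w].
have iJ : ideal J.
  split=> [|_ _ [b ->] [c ->]|b _ [c ->]].
  - by exists 0; rewrite mulr0.
  - by exists (b + c); rewrite mulrDr.
  - by exists (b * c); rewrite mulrCA.
have [[w e]|J1] := pselect (J 1).
  by rewrite -[LHS]mulr1 e mulrA mulrBr mulr1 mulrA yE subrr mul0r.
have [x kx x0] := split_point iJ J1.
have : x (1 - a * y) = 0 by apply: x0; exists 1; rewrite mulr1.
by rewrite rmorphB rmorph1 rmorphM h // mul0r subr0 => /eqP; rewrite oner_eq0.
Qed.

Lemma idem_val (e : L) (x : {rmorphism L -> K}) : e * e = e -> x e = 0 \/ x e = 1.
Proof.
move=> /(congr1 x)/eqP; rewrite rmorphM -subr_eq0 -{3}[x e]mulr1 -mulrBr mulf_eq0.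
by rewrite subr_eq0 => /orP[]/eqP; [left | right].
Qed.

Definition kopen (P : {rmorphism L -> K} -> Prop) :=
  forall x, kpoint x -> P x ->
    exists2 a, x a != 0 & forall y, kpoint y -> y a != 0 -> P y.

Lemma split_sep (P0 P1 : {rmorphism L -> K} -> Prop) : kopen P0 -> kopen P1 ->
  (forall x, kpoint x -> P0 x \/ P1 x) ->
  exists e, e * e = e /\
    forall x, kpoint x -> (x e = 0 -> P0 x) /\ (x e = 1 -> P1 x).
Proof.
move=> o0 o1 cov.
pose J : set L := [set a | exists e, e * e = e /\ forall x, kpoint x ->
  x a != 0 -> (x e = 0 -> P0 x) /\ (x e = 1 -> P1 x)].
have iJ : ideal J.
  split=> [|a b [e [ee eP]] [e' [ee' eP']]|r a [e [ee eP]]].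
  - by exists 0; split; [rewrite mul0r | move=> x _; rewrite rmorph0 eqxx].
  - have [u [uu uP]] := split_indicator a.
    exists (u * e + (1 - u) * e'); split.
      transitivity ((u * u) * (e * e) + (u - u * u) * e * e' *+ 2 +
        (1 - u *+ 2 + u * u) * (e' * e')); first by ring.
      by rewrite uu ee ee'; ring.
    move=> x kx; rewrite !rmorphD !rmorphM rmorphB rmorph1 uP //.
    have [->|n0] := eqVneq (x a) 0.
      by rewrite mul0r add0r subr0 mul1r add0r; exact: eP'.
    by rewrite subrr mul0r addr0 mul1r => _; exact: eP.
  - exists e; split=> // x kx; rewrite rmorphM mulf_eq0 negb_or => /andP[_].
    exact: eP.
have [[e [ee eP]]|J1] := pselect (J 1).
  by exists e; split=> // x kx; apply: eP => //; rewrite rmorph1 oner_neq0.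
have [x kx x0] := split_point iJ J1.
case: (cov x kx) => Px; [have [a xa aP] := o0 x kx Px | have [a xa aP] := o1 x kx Px];
  case/eqP: xa; apply: x0.
- exists 0; split=> [|y ky ya]; first exact: mul0r.
  by rewrite rmorph0; split=> [_|/esym/eqP]; [exact: aP | rewrite oner_eq0].
- exists 1; split=> [|y ky ya]; first exact: mul1r.
  by rewrite rmorph1; split=> [/eqP|_]; [rewrite oner_eq0 | exact: aP].
Qed.

Lemma split_compact (T : eqType) (Z : T -> {rmorphism L -> K} -> Prop) :
  (forall r, kopen (Z r)) -> (forall x, kpoint x -> exists r, Z r x) ->
  exists s : seq T, forall x, kpoint x -> exists2 r, r \in s & Z r x.
Proof.
move=> oZ cov.
pose J : set L := [set a | exists s : seq T, forall x, kpoint x -> x a != 0 ->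
  exists2 r, r \in s & Z r x].
have iJ : ideal J.
  split=> [|a b [s sP] [t tP]|b a [s sP]].
  - by exists [::] => x _; rewrite rmorph0 eqxx.
  - exists (s ++ t) => x kx; rewrite rmorphD; have [->|n0] := eqVneq (x a) 0.
      by rewrite add0r => /(tP x kx)[r rt Zr]; exists r; rewrite // mem_cat rt orbT.
    by move=> _; have [r rs Zr] := sP x kx n0; exists r; rewrite // mem_cat rs.
  - exists s => x kx; rewrite rmorphM mulf_eq0 negb_or => /andP[_]; exact: sP.
have [[s sP]|J1] := pselect (J 1).
  by exists s => x kx; apply: sP => //; rewrite rmorph1 oner_neq0.
have [x kx x0] := split_point iJ J1.
have [r Zr] := cov x kx; have [a xa aP] := oZ r x kx Zr.
case/eqP: xa; apply: x0; exists [:: r] => y ky ya.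
by exists r; [exact: mem_head | exact: aP].
Qed.

End SplitPoints.

Lemma tensor_split (A R L : comPzRingType) (K : fieldType)
    (f : {rmorphism A -> R}) (k : {rmorphism A -> K}) (jl : {rmorphism R -> L})
    (jk : {rmorphism K -> L}) :
  has_roots K -> is_tensor f k jl jk -> (forall b, epd f b) -> split_alg jk.
Proof.
move=> hK it ef x; apply: epd_split => //.
have [s ->] := it_span it x; have sub := epd_subring jk.
apply: (subring_sum _ sub) => z _; have [_ _ _ M] := sub; apply: M.
  exact: (jepd_map (it_comm it) (ef z.1)).
exact: epd_base.
Qed.

(** * Integral closure *)

Section IntegralClosure.
Variable K : fieldType.
Implicit Types S : set K.

(** Integrality through a nonzero finitely generated S-submodule of K that is stable under
    multiplication; faithfulness is automatic in a field. All elements of s share one submodule. *)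
Definition jint S (s : seq K) := exists (I : finType) (v : I -> K),
  (exists i, v i != 0) /\ forall x, x \in s -> exists N : I -> I -> K,
    (forall i j, S (N i j)) /\ forall i, x * v i = \sum_j N i j * v j.

Definition integral S (x : K) := jint S [:: x].

Lemma mul_family (I J : finType) (N : I -> I -> K) (v : I -> K) (w : J -> K) x (p : I * J) :
  (forall i, x * v i = \sum_j N i j * v j) ->
  x * (v p.1 * w p.2) = \sum_q (N p.1 q.1 * (q.2 == p.2)%:R) * (v q.1 * w q.2).
Proof.
move=> h; case: p => i j /=; rewrite mulrA h mulr_suml.
rewrite -(pair_bigA _ (fun a b => N i a * (b == j)%:R * (v a * w b))) /=.
apply: eq_bigr => a _; rewrite (bigD1 j) //= eqxx mulr1 big1 ?addr0 => [|b /negPf ->]; [ring | by rewrite mulr0 mul0r].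
Qed.

Lemma jint_cat S s t : subring S -> jint S s -> jint S t -> jint S (s ++ t).
Proof.
move=> sS [I [v [[i0 vi] hv]]] [J [w [[j0 wj] hw]]].
have S0 := subring0 sS; have [S1 _ _ SM] := sS.
exists (I * J)%type, (fun p => v p.1 * w p.2); split.
  by exists (i0, j0); rewrite mulf_neq0.
have delta (T : eqType) (a b : T) : S (a == b)%:R by case: eqP.
move=> x; rewrite mem_cat => /orP[/hv|/hw] [N [NS NE]].
  exists (fun p q => N p.1 q.1 * (q.2 == p.2)%:R); split=> [p q|p].
    exact: SM.
  exact: mul_family.
exists (fun p q => N p.2 q.2 * (q.1 == p.1)%:R); split=> [p q|p].
  exact: SM.
rewrite [v p.1 * _]mulrC (@mul_family J I N w v x (p.2, p.1)) //.
rewrite (reindex (fun q : I * J => (q.2, q.1))) /=.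
  by apply: eq_bigr => q _; rewrite [w _ * _]mulrC.
by exists (fun q : J * I => (q.2, q.1)) => -[].
Qed.

Lemma integral_jint S s : subring S -> (forall x, x \in s -> integral S x) ->
  jint S s.
Proof.
move=> sS; elim: s => [|x s IH] h.
  by exists unit, (fun=> 1); split=> //; exists tt; exact: oner_neq0.
by rewrite -cat1s; apply: jint_cat => //; [apply: h; exact: mem_head |
  apply: IH => y ys; apply: h; rewrite inE ys orbT].
Qed.

Lemma integral_sub S x : subring S -> S x -> integral S x.
Proof.
move=> sS Sx; exists unit, (fun=> 1); split; first by exists tt; exact: oner_neq0.
move=> y; rewrite inE => /eqP ->; exists (fun _ _ => x); split=> // i.
by rewrite (big_pred1 tt) //; case.
Qed.

Lemma integral_subring S : subring S -> subring (integral S).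
Proof.
move=> sS; have [S1 SN SD SM] := sS.
have j2 x y : integral S x -> integral S y -> jint S [:: x; y].
  by move=> hx hy; apply: integral_jint => // z; rewrite !inE => /orP[]/eqP ->.
split.
- exact: integral_sub.
- move=> x [I [v [v0 /(_ _ (mem_head _ _))[N [NS NE]]]]]; exists I, v; split=> // y.
  rewrite inE => /eqP ->; exists (fun i j => - N i j); split=> [i j|i]; first exact: SN.
  by rewrite mulNr NE -sumrN; apply: eq_bigr => j _; rewrite mulNr.
- move=> x y hx hy; have [I [v [v0 h]]] := j2 x y hx hy; exists I, v; split=> // z.
  have [|N [NS NE]] := h x; first by rewrite !inE eqxx.
  have [|M [MS ME]] := h y; first by rewrite !inE eqxx orbT.
  rewrite inE => /eqP ->; exists (fun i j => N i j + M i j); split=> [i j|i]; first exact: SD.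
  rewrite mulrDl NE ME -big_split; by apply: eq_bigr => j _; rewrite mulrDl.
- move=> x y hx hy; have [I [v [v0 h]]] := j2 x y hx hy; exists I, v; split=> // z.
  have [|N [NS NE]] := h x; first by rewrite !inE eqxx.
  have [|M [MS ME]] := h y; first by rewrite !inE eqxx orbT.
  rewrite inE => /eqP ->; exists (fun i j => \sum_l M i l * N l j); split=> [i j|i].
    by apply: (subring_sum _ sS) => l _; exact: SM.
  rewrite -mulrA ME mulr_sumr; under eq_bigr do rewrite mulrCA NE.
  by rewrite exchange_mul.
Qed.

Lemma integral_idem S x : subring S -> integral (integral S) x -> integral S x.
Proof.
move=> sS [I [v [[i0 v0] /(_ _ (mem_head _ _))[N [NS NE]]]]].
have [|J [w [[j0 w0] h]]] := @integral_jint S [seq N p.1 p.2 | p <- enum {: I * I}] sS.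
  by move=> y /mapP[p _ ->]; exact: NS.
have P i j : exists M : J -> J -> K, (forall a b, S (M a b)) /\
    forall a, N i j * w a = \sum_b M a b * w b.
  by apply: h; apply/mapP; exists (i, j) => //; rewrite mem_enum.
pose M i j := projT1 (cid (P i j)).
have MP i j : (forall a b, S (M i j a b)) /\
    forall a, N i j * w a = \sum_b M i j a b * w b.
  by rewrite /M; case: cid.
exists (I * J)%type, (fun p => v p.1 * w p.2); split.
  by exists (i0, j0); rewrite mulf_neq0.
move=> y; rewrite inE => /eqP ->.
exists (fun p q => M p.1 q.1 p.2 q.2); split=> [p q|[i a]] /=.
  exact: (MP _ _).1.
rewrite mulrA NE mulr_suml.
rewrite -(pair_bigA _ (fun j b => M i j a b * (v j * w b))) /=.
apply: eq_bigr => j _; rewrite mulrAC (MP i j).2 mulr_suml.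
by apply: eq_bigr => b _; ring.
Qed.

Definition polys S (x : K) : set K :=
  [set y | exists2 p : {poly K}, (forall i, S p`_i) & y = p.[x]].

Lemma polys_subring S x : subring S -> subring (polys S x).
Proof.
move=> sS; have [S1 SN SD SM] := sS; have S0 := subring0 sS; split.
- exists 1; last by rewrite hornerC.
  by move=> i; rewrite coef1; case: (i == 0%N).
- move=> _ [p pS ->]; exists (- p); last by rewrite hornerN.
  by move=> i; rewrite coefN; exact: SN.
- move=> _ _ [p pS ->] [q qS ->]; exists (p + q); last by rewrite hornerD.
  by move=> i; rewrite coefD; exact: SD.
- move=> _ _ [p pS ->] [q qS ->]; exists (p * q); last by rewrite hornerM.
  by move=> i; rewrite coefM; apply: (subring_sum _ sS) => j _; exact: SM.
Qed.

Lemma polys_sub S x y : subring S -> S y -> polys S x y.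
Proof.
move=> sS Sy; exists y%:P; last by rewrite hornerC.
move=> i; rewrite coefC; case: eqP => // _; exact: subring0.
Qed.

Lemma polys_gen S x : subring S -> polys S x x.
Proof.
move=> sS; exists 'X; last by rewrite hornerX.
by move=> i; rewrite coefX; case: (i == 1%N); [case: sS | exact: subring0].
Qed.

Lemma polys_bound S x (I : finType) (N : I -> I -> K) :
  (forall i j, polys S x (N i j)) ->
  exists d (c : I -> I -> nat -> K), (forall i j n, S (c i j n)) /\
    forall i j, N i j = \sum_(n < d) c i j n * x ^+ n.
Proof.
move=> h; pose p i j := projT1 (cid2 (h i j)).
have [pS pE] : (forall i j n, S (p i j)`_n) /\ forall i j, N i j = (p i j).[x].
  by split=> i j; rewrite /p; case: cid2.
exists (\max_q size (p q.1 q.2)), (fun i j n => (p i j)`_n); split=> // i j.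
rewrite pE (@horner_coef_wide _ (\max_q size (p q.1 q.2)) (p i j)) //.
exact: (@leq_bigmax _ (fun q : I * I => size (p q.1 q.2)) (i, j)).
Qed.

(** The family x^n v_i w_j with n at most d1 + d2 is stable under y: for n at most d2 the relations
    over S[x] raise the exponent by less than d1, and for larger n those over S[1/x] lower it by
    less than d2. *)
Lemma integral_both S x y : subring S -> x != 0 ->
  integral (polys S x) y -> integral (polys S x^-1) y -> integral S y.
Proof.
move=> sS x0 [I [v [[i0 v0] /(_ _ (mem_head _ _))[N [/polys_bound NS NE]]]]].
move=> [J [w [[j0 w0] /(_ _ (mem_head _ _))[M [/polys_bound MS ME]]]]].
have [d1 [c [cS cE]]] := NS; have [d2 [e [eS eE]]] := MS.
have S0 := subring0 sS; have [S1 _ _ SM] := sS.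
have delta (T : eqType) (a b : T) : S (a == b)%:R by case: eqP.
pose D := (d1 + d2)%N.
pose V (p : 'I_D.+1 * (I * J)) := x ^+ p.1 * (v p.2.1 * w p.2.2).
exists ('I_D.+1 * (I * J))%type, V; split.
  by exists (ord0, (i0, j0)); rewrite /V expr0 mul1r mulf_neq0.
move=> z; rewrite inE => /eqP -> {z}.
suff h p : exists N' : 'I_D.+1 * (I * J) -> K, (forall q, S (N' q)) /\
    y * V p = \sum_q N' q * V q.
  exists (fun p => projT1 (cid (h p))).
  by split=> [p q|p]; case: cid => N1 [h1 h2] /=; [exact: h1 | exact: h2].
have sumS (T : finType) (F : T -> K) (N' : T -> 'I_D.+1 * (I * J) -> K) :
    (forall t q, S (N' t q)) -> (forall t, F t = \sum_q N' t q * V q) ->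
    exists N'' : 'I_D.+1 * (I * J) -> K, (forall q, S (N'' q)) /\
      \sum_t F t = \sum_q N'' q * V q.
  move=> h1 h2; exists (fun q => \sum_t N' t q); split=> [q|].
    by apply: (subring_sum _ sS).
  under eq_bigr do rewrite h2.
  by rewrite exchange_big; apply: eq_bigr => q _; rewrite mulr_suml.
have one (s : K) q : s * V q = \sum_r (s * (r == q)%:R) * V r.
  rewrite (bigD1 q) //= eqxx mulr1 big1 ?addr0 // => r /negPf ->.
  by rewrite mulr0 mul0r.
case: p => -[n nD] [i j]; rewrite /V /=.
have [nd|dn] := leqP n d2.
  have lt (m : 'I_d1) : (n + m < D.+1)%N by rewrite ltnS /D addnC leq_add // ltnW.
  have -> : y * (x ^+ n * (v i * w j)) = \sum_(t : I * 'I_d1)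
      c i t.1 t.2 * V (Ordinal (lt t.2), (t.1, j)).
    transitivity (x ^+ n * w j * (y * v i)); first by ring.
    rewrite NE mulr_sumr.
    rewrite -(pair_bigA _ (fun (a : I) (m : 'I_d1) => c i a m * V (Ordinal (lt m), (a, j)))) /=.
    apply: eq_bigr => a _; rewrite cE mulr_suml mulr_sumr.
    by apply: eq_bigr => m _; rewrite /V /= exprD; ring.
  apply: (sumS (I * 'I_d1)%type _ (fun t q => c i t.1 t.2 * (q == (Ordinal (lt t.2), (t.1, j)))%:R)).
    by move=> t q; exact: SM.
  by move=> t; exact: one.
have lt (m : 'I_d2) : (n - m < D.+1)%N by apply: leq_ltn_trans nD; exact: leq_subr.
have -> : y * (x ^+ n * (v i * w j)) = \sum_(t : J * 'I_d2)
    e j t.1 t.2 * V (Ordinal (lt t.2), (i, t.1)).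
  transitivity (x ^+ n * v i * (y * w j)); first by ring.
  rewrite ME mulr_sumr.
  rewrite -(pair_bigA _ (fun (a : J) (m : 'I_d2) => e j a m * V (Ordinal (lt m), (i, a)))) /=.
  apply: eq_bigr => a _; rewrite eE mulr_suml mulr_sumr.
  apply: eq_bigr => m _; rewrite /V /=.
  have mn : (m <= n)%N by apply: ltnW; apply: leq_trans (ltn_ord m) (ltnW dn).
  rewrite exprVn -[X in x ^+ X * v i](subnK mn) exprD.
  have u : x ^+ m * (x ^+ m)^-1 = 1 by rewrite mulfV // expf_neq0.
  transitivity (x ^+ m * (x ^+ m)^-1 * (x ^+ (n - m) * v i * (e j a m * w a))); first by ring.
  by rewrite u; ring.
apply: (sumS (J * 'I_d2)%type _ (fun t q => e j t.1 t.2 * (q == (Ordinal (lt t.2), (i, t.1)))%:R)).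
  by move=> t q; exact: SM.
by move=> t; exact: one.
Qed.

Lemma integral_mono S S' x : S `<=` S' -> integral S x -> integral S' x.
Proof.
move=> SS [I [v [v0 /(_ _ (mem_head _ _))[N [NS NE]]]]]; exists I, v; split=> // y.
by rewrite inE => /eqP ->; exists N; split=> // i j; exact: SS.
Qed.

End IntegralClosure.

(** * Idempotents are defined over the integral closure *)

Lemma big_option (V : nmodType) (J : finType) (F : option J -> V) :
  \sum_t F t = F None + \sum_j F (Some j).
Proof.
rewrite (bigD1 None) //=; congr (_ + _); rewrite (reindex_omap Some id) => [|[]//].
by apply: eq_bigl => j; rewrite eqxx.
Qed.

Section Core.
Variables (A R L : comPzRingType) (K : fieldType).
Variables (f : {rmorphism A -> R}) (k : {rmorphism A -> K}).
Variables (jl : {rmorphism R -> L}) (jk : {rmorphism K -> L}).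
Hypotheses (it : is_tensor f k jl jk) (fl : eqflat f) (ef : forall b, epd f b).

(** For a subring S that contains the image of A, this is the image of R (x)_A S in L. *)
Definition span_over (S : set K) : set L :=
  [set x | exists (I : finType) (b : I -> R) (c : I -> K),
    (forall i, S (c i)) /\ x = \sum_i jl (b i) * jk (c i)].

Lemma span_pure (S : set K) b c : S c -> span_over S (jl b * jk c).
Proof.
move=> Sc; exists unit, (fun=> b), (fun=> c); split=> //.
by rewrite (big_pred1 tt) //; case.
Qed.

Lemma span_subring (S : set K) : subring S -> subring (span_over S).
Proof.
move=> sS; have [S1 SN SD SM] := sS; split.
- by rewrite -[1]mulr1 -{1}(rmorph1 jl) -(rmorph1 jk); exact: span_pure.
- move=> _ [I [b [c [Sc ->]]]]; exists I, b, (fun i => - c i).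
  split=> [i|]; first exact: SN.
  by rewrite -sumrN; apply: eq_bigr => i _; rewrite rmorphN mulrN.
- move=> _ _ [I [b [c [Sc ->]]]] [J [b' [c' [Sc' ->]]]].
  exists (I + J)%type, (fun t => match t with inl i => b i | inr j => b' j end),
    (fun t => match t with inl i => c i | inr j => c' j end).
  by split=> [[]//|]; rewrite big_sumType.
- move=> _ _ [I [b [c [Sc ->]]]] [J [b' [c' [Sc' ->]]]].
  exists (I * J)%type, (fun t => b t.1 * b' t.2), (fun t => c t.1 * c' t.2).
  split=> [t|]; first exact: SM.
  rewrite mulr_suml -(pair_bigA _ (fun i j => jl (b i * b' j) * jk (c i * c' j))) /=.
  apply: eq_bigr => i _; rewrite mulr_sumr; apply: eq_bigr => j _.
  by rewrite !rmorphM mulrACA.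
Qed.

Lemma span_base (S : set K) b : subring S -> span_over S (jl b).
Proof. by move=> [S1 _ _ _]; rewrite -[jl b]mulr1 -(rmorph1 jk); exact: span_pure. Qed.

Lemma span_coef (S : set K) c : S c -> span_over S (jk c).
Proof. by move=> Sc; rewrite -[jk c]mul1r -(rmorph1 jl); exact: span_pure. Qed.

Lemma span_sub (S S' : set K) : S `<=` S' -> span_over S `<=` span_over S'.
Proof.
by move=> SS _ [I [b [c [Sc ->]]]]; exists I, b, c; split=> // i; exact: SS.
Qed.

(** Two expressions of x form a vanishing tensor. The equational criterion rewrites both over common
    elements z of R, and the resulting coefficients lie in S1 and in S2 at once. *)
Lemma span_inter (S1 S2 : set K) x : subring S1 -> subring S2 ->
  (forall a, S1 (k a)) -> (forall a, S2 (k a)) ->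
  span_over S1 x -> span_over S2 x -> span_over (S1 `&` S2) x.
Proof.
move=> s1 s2 k1 k2 [I [b [c [Sc xE]]]] [J [b' [c' [Sc' xE']]]].
have [|T [d [z [bE dE]]]] := it_zero it fl
  (x := fun t : I + J => match t with inl i => b i | inr j => b' j end)
  (y := fun t => match t with inl i => c i | inr j => - c' j end).
  rewrite big_sumType /= -xE; under eq_bigr do rewrite rmorphN mulrN.
  by rewrite sumrN -xE' subrr.
have dE' t : \sum_i k (d (inl i) t) * c i = \sum_j k (d (inr j) t) * c' j.
  have := dE t; rewrite big_sumType /=; under [X in _ + X]eq_bigr do rewrite mulrN.
  by rewrite sumrN => /eqP; rewrite subr_eq0 => /eqP.
exists T, z, (fun t => \sum_i k (d (inl i) t) * c i); split=> [t|].
  split; last rewrite dE'.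
    by apply: (subring_sum _ s1) => i _; have [_ _ _] := s1; apply.
  by apply: (subring_sum _ s2) => i _; have [_ _ _] := s2; apply.
rewrite xE; under [RHS]eq_bigr do rewrite rmorph_sum mulr_sumr.
rewrite exchange_big; apply: eq_bigr => i _.
rewrite (bE (inl i)) rmorph_sum mulr_suml; apply: eq_bigr => t _.
by rewrite !rmorphM (it_comm it); ring.
Qed.

(** * Idempotents over a valuation ring *)

Section Valuation.
Variable S : set K.
Hypotheses (sS : subring S) (val : forall x, S x \/ S x^-1).

Lemma max_coef (J : finType) (c : J -> K) j0 : c j0 != 0 ->
  exists2 m, c m != 0 & forall j, S (c j / c m).
Proof.
have [S1 SN SD SM] := sS; move=> h0.
suff h (s : seq J) : exists2 m, c m != 0 & forall j, j \in s -> S (c j / c m).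
  by have [m cm mP] := h (enum J); exists m => // i; apply: mP; rewrite mem_enum.
elim: s => [|j s [m cm mP]]; first by exists j0.
have [Sj|Sj] := val (c j / c m).
  by exists m => // l; rewrite inE => /orP[/eqP->|/mP].
have [cj|cj] := eqVneq (c j) 0.
  exists m => // l; rewrite inE => /orP[/eqP->|/mP//].
  by rewrite cj mul0r; exact: subring0.
exists j => // l; rewrite inE => /orP[/eqP->|/mP ls]; first by rewrite divff.
have -> : c l / c j = (c l / c m) * (c j / c m)^-1.
  by rewrite invf_div mulrA divfK.
exact: SM.
Qed.

(** Finitely generated torsion-free modules over a valuation ring are free. If x depends on the
    vectors already chosen, one coefficient of the relation, x included, divides all others; the
    corresponding vector is the one to leave out. *)
Lemma valuation_basis (N : set L) (s : seq L) : (forall x, x \in s -> N x) ->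
  exists (J : finType) (ze : J -> L), [/\ forall j, N (ze j),
    forall c : J -> K, \sum_j jk (c j) * ze j = 0 -> forall j, c j = 0
    & forall x, x \in s -> exists th : J -> K, (forall j, S (th j)) /\
        x = \sum_j jk (th j) * ze j].
Proof.
have [S1 SN SD SM] := sS; have S0 := subring0 sS.
elim: s => [_|x s IH Nxs].
  by exists void, (fun v : void => match v with end); split=> // c _ [].
have [|J [ze [Nz ind gen]]] := IH; first by move=> y ys; apply: Nxs; rewrite inE ys orbT.
have [[c cE]|nc] := pselect (exists c : J -> K, x = \sum_j jk (c j) * ze j); last first.
  exists (option J), (fun t => if t is Some j then ze j else x); split.
  - by move=> [j|] //; apply: Nxs; exact: mem_head.
  - move=> c; rewrite big_option /= => e.
    have [c0|c0] := eqVneq (c None) 0.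
      rewrite c0 rmorph0 mul0r add0r in e.
      by move=> [j|] //; exact: (ind (fun j => c (Some j)) e j).
    case: nc; exists (fun j => - (c None)^-1 * c (Some j)).
    have u : jk (c None)^-1 * jk (c None) = 1 by rewrite -rmorphM mulVf // rmorph1.
    rewrite -[LHS]mul1r -u -mulrA; move/eqP: e; rewrite addr_eq0 => /eqP ->.
    rewrite mulrN -mulNr mulr_sumr; apply: eq_bigr => j _.
    by rewrite rmorphM rmorphN mulrA.
  - move=> y; rewrite inE => /orP[/eqP->|/gen[th [Sth ->]]].
      exists (fun t => if t is Some j then 0 else 1); split=> [[]//|].
      by rewrite big_option /= big1 => [|j _]; rewrite ?rmorph0 ?mul0r // rmorph1 mul1r addr0.
    exists (fun t => if t is Some j then th j else 0); split=> [[]//|].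
    by rewrite big_option /= rmorph0 mul0r add0r.
pose d (t : option J) := if t is Some j then c j else 1.
have [[m|] dm dS] := @max_coef _ d None (oner_neq0 K); last first.
  exists J, ze; split=> // y; rewrite inE => /orP[/eqP->|/gen //].
  by exists c; split=> // j; have := dS (Some j); rewrite /= divr1.
have cm : c m != 0 by [].
pose z' j := if j == m then x else ze j.
have u : jk (c m)^-1 * jk (c m) = 1 by rewrite -rmorphM mulVf // rmorph1.
have sumz (a : J -> K) : \sum_j jk (a j) * z' j =
    \sum_j jk (if j == m then a m * c m else a j + a m * c j) * ze j.
  rewrite (bigD1 m) //= [RHS](bigD1 m) //= /z' eqxx cE (bigD1 m) //= mulrDr rmorphM mulrA -addrA.
  congr (_ + _); rewrite mulr_sumr -big_split; apply: eq_bigr => j /negPf ->.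
  by rewrite /= rmorphD rmorphM; ring.
have zm (a : J -> K) : \sum_j jk (a j) * ze j =
    \sum_j jk (if j == m then a m / c m else a j - a m * (c j / c m)) * z' j.
  rewrite sumz; apply: eq_bigr => j _; congr (jk _ * _); rewrite eqxx.
  case: eqVneq => [->|_]; first by rewrite divfK.
  by rewrite mulrAC mulrA subrK.
exists J, z'; split.
- by move=> j; rewrite /z'; case: eqP => // _; apply: Nxs; exact: mem_head.
- move=> a; rewrite sumz => /ind h j.
  have am : a m = 0 by have /eqP := h m; rewrite eqxx mulf_eq0 (negPf cm) orbF => /eqP.
  by have := h j; case: eqVneq => [->//|_]; rewrite am mul0r addr0.
- have cS j : S (c j / c m) by exact: (dS (Some j)).
  have iS : S (c m)^-1 by have := dS None; rewrite /= div1r.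
  move=> y; rewrite inE => /orP[/eqP->|/gen[th [Sth ->]]].
    exists (fun j => (j == m)%:R); split=> [j|]; first by case: eqP.
    rewrite (bigD1 m) //= /z' eqxx rmorph1 mul1r big1 ?addr0 // => j /negPf ->.
    by rewrite rmorph0 mul0r.
  exists (fun j => if j == m then th m / c m else th j - th m * (c j / c m)); split.
    move=> j; case: eqP => _; first exact: SM.
    by apply: SD => //; apply: SN; exact: SM.
  exact: zm.
Qed.

Lemma pencil_ext (I J : finType) (a : I -> J -> A) x z b : pencil f a x z b ->
  pencil jk (fun i j => k (a i j)) (fun i => jl (x i)) (fun j => jl (z j)) (jl b).
Proof.
have mc (d : I -> J -> A) i : mxcol jk (fun i j => k (d i j)) (fun j => jl (z j)) i =
    jl (mxcol f d z i).
  by rewrite /mxcol rmorph_sum; apply: eq_bigr => j _; rewrite rmorphM (it_comm it).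
have mr (d : I -> J -> A) j : mxrow jk (fun i j => k (d i j)) (fun i => jl (x i)) j =
    jl (mxrow f d x j).
  by rewrite /mxrow rmorph_sum; apply: eq_bigr => i _; rewrite rmorphM (it_comm it).
move=> [a' [ec er]]; exists (fun i j => k (a' i j)).
by split=> i; [rewrite !mc ec rmorphM | rewrite !mr er rmorphM].
Qed.

(* Expressing 1 through the pencil gives 1 = t1 + e t2 with t1, e t1 and e t2 in
   the span; hence e = e t1 + e t2. *)
Lemma valuation_idem e : e * e = e -> span_over S e.
Proof.
move=> ee; have sB := span_subring sS; have [B1 BN BD BM] := sB.
have [s eE] := it_span it e.
have [I [J [a [x [z [xz pz]]]]]] := @epd_jepd _ _ f [seq p.1 | p <- s] (fun b => ef b).
pose X i := jl (x i); pose Z j := jl (z j); pose y i := jl (mxcol f a z i).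
pose ka i j := k (a i j).
have yE i : mxcol jk ka Z i = y i.
  by rewrite /y /mxcol rmorph_sum; apply: eq_bigr => j _; rewrite rmorphM (it_comm it).
have rE j : mxrow jk ka X j = jl (mxrow f a x j).
  by rewrite /mxrow rmorph_sum; apply: eq_bigr => i _; rewrite rmorphM (it_comm it).
have [de [dc dr]] : pencil jk ka X Z e.
  rewrite eE; have : {subset s <= s} by [].
  elim: {1 3}s => [_|p t IH ps].
    by rewrite big_nil -(rmorph0 jk); exact: pencil_base.
  rewrite big_cons; apply: pencilD; last by apply: IH => q qt; apply: ps; rewrite inE qt orbT.
  rewrite mulrC; apply: pencilZ; apply: pencil_ext; apply: pz.
  by apply/mapP; exists p => //; apply: ps; exact: mem_head.
(* N is B + B e for B the span of R over S; it contains all Z j and all e y i. *)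
pose N : set L := [set n | exists b c, [/\ span_over S b, span_over S c & n = b + c * e]].
have [|T [ze [Nz ind gen]]] := @valuation_basis N ([seq Z j | j <- enum J] ++ [seq e * y i | i <- enum I]).
  move=> n; rewrite mem_cat => /orP[]/mapP[t _ ->].
    exists (Z t), 0; rewrite mul0r addr0; split=> //; first exact: span_base.
    exact: subring0.
  by exists 0, (y t); rewrite add0r mulrC; split=> //; [exact: subring0 | exact: span_base].
have gZ j : exists th : T -> K, (forall t, S (th t)) /\ Z j = \sum_t jk (th t) * ze t.
  by apply: gen; rewrite mem_cat; apply/orP; left; apply/mapP; exists j; rewrite ?mem_enum.
have gY i : exists th : T -> K, (forall t, S (th t)) /\ e * y i = \sum_t jk (th t) * ze t.
  by apply: gen; rewrite mem_cat; apply/orP; right; apply/mapP; exists i; rewrite ?mem_enum.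
pose th j := projT1 (cid (gZ j)); pose d' i := projT1 (cid (gY i)).
have [thS thE] : (forall j t, S (th j t)) /\ forall j, Z j = \sum_t jk (th j t) * ze t.
  by split=> j; rewrite /th; case: cid => ? [].
have [dS dE] : (forall i t, S (d' i t)) /\ forall i, e * y i = \sum_t jk (d' i t) * ze t.
  by split=> j; rewrite /d'; case: cid => ? [].
(* The matrix de is only known to be over K. Comparing coordinates in the basis ze shows that its
   product with th has entries in S. *)
have de' i t : \sum_j de i j * th j t = d' i t.
  apply/eqP; rewrite -subr_eq0; apply/eqP; move: t; apply: ind.
  under eq_bigr do rewrite rmorphB mulrBl.
  rewrite sumrB -dE -yE -dc /mxcol; apply/eqP; rewrite subr_eq0; apply/eqP.
  under eq_bigr do rewrite rmorph_sum mulr_suml.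
  rewrite exchange_big; apply: eq_bigr => j _; rewrite thE mulr_sumr.
  by apply: eq_bigr => t _; rewrite rmorphM mulrA.
pose sg t := \sum_j jl (mxrow f a x j) * jk (th j t).
have sgB t : span_over S (sg t).
  by apply: (subring_sum _ sB) => j _; exact: span_pure.
have xd t : \sum_i X i * jk (d' i t) = e * sg t.
  under eq_bigr do rewrite -de' rmorph_sum mulr_sumr.
  rewrite exchange_big /sg mulr_sumr; apply: eq_bigr => j _.
  rewrite mulrA -rE -dr /mxrow mulr_suml; apply: eq_bigr => i _.
  by rewrite rmorphM; ring.
have xy : \sum_i X i * y i = 1.
  rewrite -(rmorph1 jl) -xz rmorph_sum; apply: eq_bigr => i _; exact/esym/rmorphM.
pose b t := projT1 (cid (Nz t)); pose c t := projT1 (cid (projT2 (cid (Nz t)))).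
have bcE t : [/\ span_over S (b t), span_over S (c t) & ze t = b t + c t * e].
  by rewrite /b /c; case: cid => b1 h1 /=; case: cid.
have bB t : span_over S (b t) by case: (bcE t).
have cB t : span_over S (c t) by case: (bcE t).
have zE t : ze t = b t + c t * e by case: (bcE t).
pose t2 := \sum_t sg t * c t.
have B2 : span_over S t2 by apply: (subring_sum _ sB) => t _; exact: (BM).
have e1 : 1 - e * t2 = \sum_i X i * (y i - \sum_t jk (d' i t) * c t).
  under eq_bigr do rewrite mulrBr.
  rewrite sumrB xy; congr (_ - _); rewrite /t2 mulr_sumr.
  under [RHS]eq_bigr do rewrite mulr_sumr.
  rewrite exchange_big; apply: eq_bigr => t _.
  by rewrite mulrA -xd mulr_suml; apply: eq_bigr => i _; rewrite mulrA.
have t1B : span_over S (1 - e * t2).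
  rewrite e1; apply: (subring_sum _ sB) => i _; apply: (BM); first exact: span_base.
  apply: (BD); first exact: span_base.
  apply: (BN); apply: (subring_sum _ sB) => t _; apply: (BM) => //.
  by apply: span_coef.
have et1B : span_over S (e * (1 - e * t2)).
  rewrite e1 mulr_sumr; apply: (subring_sum _ sB) => i _.
  have -> : e * (X i * (y i - \sum_t jk (d' i t) * c t)) =
      X i * \sum_t jk (d' i t) * b t.
    rewrite mulrCA; congr (_ * _); rewrite mulrBr dE mulr_sumr -sumrB.
    by apply: eq_bigr => t _; rewrite zE; ring.
  apply: (BM); first exact: span_base.
  by apply: (subring_sum _ sB) => t _; apply: (BM) => //; exact: span_coef.
have -> : e = e * (1 - e * t2) + (1 - (1 - e * t2)).
  transitivity (e + e * t2 - (e * e) * t2); first by rewrite ee; ring.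
  by ring.
by apply: (BD) => //; apply: (BD) => //; exact: BN.
Qed.

End Valuation.

Lemma chain_select (F : set (set K)) (Q : set K) (I : finType) (c : I -> K) :
  total_on F (fun X Y => X `<=` Y) -> (exists X, F X) ->
  (forall i, ((\bigcup_(X in F) X) `|` Q) (c i)) ->
  exists2 X, F X & forall i, (X `|` Q) (c i).
Proof.
move=> tot [X0 FX0] h.
suff [X FX XP] : exists2 X, F X & forall i, i \in enum I -> (X `|` Q) (c i).
  by exists X => // i; apply: XP; rewrite mem_enum.
elim: (enum I) => [|i s [X FX XP]]; first by exists X0.
case: (h i) => [[Y FY Yi]|Qi]; last first.
  by exists X => // j; rewrite inE => /orP[/eqP->|/XP//]; right.
have [XY|YX] := tot X Y FX FY.
  exists Y => // j; rewrite inE => /orP[/eqP->|/XP[/XY|]]; by [left | right].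
exists X => // j; rewrite inE => /orP[/eqP->|/XP//]; left; exact: YX.
Qed.

(* A maximal integrally closed S for which e is not in the span of S would be a
   valuation ring, since the spans for S[x] and S[1/x] meet in that for S. *)
Lemma idem_integral e : e * e = e -> span_over (integral (range k)) e.
Proof.
move=> ee; apply: contrapT => ne.
have sk := range_subring k.
pose Q := range k.
(* The image of A is joined to X so that the empty chain is covered by the Zorn argument. *)
pose P := [set X : set K | subring (X `|` Q) /\ ~ span_over (integral (X `|` Q)) e].
have [F FP tot|X [[sX nX] Xmax]] := @Zorn_bigcup K P.
  have [F0|F0] := pselect (exists X, F X); last first.
    have -> : \bigcup_(X in F) X = set0.
      by apply/seteqP; split=> // x [X FX]; case: F0; exists X.
    by rewrite /P /= set0U.
  pose U := (\bigcup_(X in F) X) `|` Q.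
  have sel (I : finType) (c : I -> K) : (forall i, U (c i)) ->
      exists2 X, F X & forall i, (X `|` Q) (c i).
    exact: chain_select.
  have UX X : F X -> X `|` Q `<=` U by move=> FX x [Xx|Qx]; [left; exists X | right].
  split.
    have two x y : U x -> U y -> exists2 X, F X & (X `|` Q) x /\ (X `|` Q) y.
      move=> Ux Uy; have [[]//|X FX h] := sel bool (fun b => if b then x else y).
      by exists X => //; split; [exact: (h true) | exact: (h false)].
    split=> [|x Ux|x y Ux Uy|x y Ux Uy].
    - by right; case: sk.
    - have [X FX [Xx _]] := two x x Ux Ux; have [[_ h _ _] _] := FP X FX.
      by apply: (UX X) => //; exact: h.
    - have [X FX [Xx Xy]] := two x y Ux Uy; have [[_ _ h _] _] := FP X FX.
      by apply: (UX X) => //; exact: h.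
    - have [X FX [Xx Xy]] := two x y Ux Uy; have [[_ _ _ h] _] := FP X FX.
      by apply: (UX X) => //; exact: h.
  move=> [I [b [c [ic eE]]]].
  have one x : integral U x -> exists2 X, F X & integral (X `|` Q) x.
    move=> [J [v [v0 /(_ _ (mem_head _ _))[N [NU NE]]]]].
    have [|X FX h] := sel (J * J)%type (fun p => N p.1 p.2); first by move=> p; exact: NU.
    exists X => //; exists J, v; split=> // y; rewrite inE => /eqP ->.
    by exists N; split=> // i j; exact: (h (i, j)).
  have [X FX h] : exists2 X, F X & forall i, i \in enum I -> integral (X `|` Q) (c i).
    elim: (enum I) => [|i s [X FX XP]]; first by have [X FX] := F0; exists X.
    have [Y FY iY] := one _ (ic i).
    have mono Y1 Y2 x : Y1 `<=` Y2 -> integral (Y1 `|` Q) x -> integral (Y2 `|` Q) x.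
      by move=> h; apply: integral_mono; exact: setSU.
    have [XY|YX] := tot X Y FX FY.
      exists Y => // j; rewrite inE => /orP[/eqP->|/XP] //; exact: mono.
    exists X => // j; rewrite inE => /orP[/eqP->|/XP//]; exact: mono iY.
  have [_] := FP X FX; apply; exists I, b, c; split=> // i; apply: h.
  by rewrite mem_enum.
pose S := integral (X `|` Q).
have sS : subring S by exact: integral_subring.
have XS : X `|` Q `<=` S by move=> x; exact: integral_sub.
have kS a : S (k a) by apply: XS; right; exists a.
have maxS S' x : subring S' -> S `<=` S' -> S' x -> ~ S x -> span_over (integral S') e.
  move=> sS' SS' S'x nSx; apply: contrapT => h; apply: (Xmax S').
    split=> [y Xy|S'X]; first by apply/SS'/XS; left.
    by apply/nSx/XS; left; exact: S'X.
  rewrite /P /=; have -> : S' `|` Q = S'; last by split.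
  by apply/seteqP; split=> y; [case=> // -[a _ <-]; exact: SS' | left].
have val x : S x \/ S x^-1.
  have [->|x0] := eqVneq x 0; first by left; exact: subring0.
  apply: contrapT => /not_orP[n1 n2].
  have p1 := polys_subring x sS; have p2 := polys_subring x^-1 sS.
  have sp1 : S `<=` polys S x by move=> y; exact: polys_sub.
  have sp2 : S `<=` polys S x^-1 by move=> y; exact: polys_sub.
  have h1 := maxS _ x p1 sp1 (polys_gen x sS) n1.
  have h2 := maxS _ x^-1 p2 sp2 (polys_gen x^-1 sS) n2.
  apply: nX; apply: span_sub (span_inter (integral_subring p1) (integral_subring p2) _ _ h1 h2).
  - by move=> y [i1 i2]; apply: integral_idem => //; apply: (integral_both sS x0).
  - by move=> a; apply: integral_sub => //; exact: sp1.
  - by move=> a; apply: integral_sub => //; exact: sp2.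
exact: nX (valuation_idem sS val ee).
Qed.

End Core.

(** * Idempotents and Henselian pairs *)

Lemma tensor_ext (A B C T U : comPzRingType) (f : {rmorphism A -> B})
    (g : {rmorphism A -> C}) (il : {rmorphism B -> T}) (ir : {rmorphism C -> T})
    (u v : {rmorphism T -> U}) : is_tensor f g il ir ->
  (forall b, u (il b) = v (il b)) -> (forall c, u (ir c) = v (ir c)) ->
  forall t, u t = v t.
Proof.
move=> it hl hr t; have [s ->] := it_span it t.
by rewrite !rmorph_sum; apply: eq_bigr => z _; rewrite !rmorphM hl hr.
Qed.

Lemma tensor_inj (A B C C' T T' : comPzRingType) (f : {rmorphism A -> B})
    (g : {rmorphism A -> C}) (g' : {rmorphism A -> C'}) (v : {rmorphism C -> C'})
    (il : {rmorphism B -> T}) (ir : {rmorphism C -> T})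
    (il' : {rmorphism B -> T'}) (ir' : {rmorphism C' -> T'})
    (j : {rmorphism T -> T'}) :
  is_tensor f g il ir -> is_tensor f g' il' ir' -> eqflat f ->
  injective v -> (forall a, v (g a) = g' a) ->
  (forall b, j (il b) = il' b) -> (forall c, j (ir c) = ir' (v c)) ->
  forall t, j t = 0 -> t = 0.
Proof.
move=> it it' fl vi vg jl jr t; have [n [x [y ->]]] := is_tensor_spanI it t.
rewrite rmorph_sum; under eq_bigr do rewrite rmorphM jl jr.
move=> /(it_zero it' fl)[J [c [z [xE cE]]]].
under eq_bigr do rewrite xE rmorph_sum mulr_suml.
rewrite exchange_big big1 // => k _.
transitivity (il (z k) * ir (\sum_i g (c i k) * y i)).
  rewrite rmorph_sum mulr_sumr; apply: eq_bigr => i _.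
  by rewrite !rmorphM (it_comm it); ring.
rewrite [X in ir X](_ : _ = 0) ?rmorph0 ?mulr0 //; apply: vi; rewrite rmorph0.
apply: etrans (cE k); rewrite rmorph_sum; apply: eq_bigr => i _.
by rewrite rmorphM vg.
Qed.

(** * Faithfully flat descent of elements *)

Section Descend.
Variables (A R M RM T : comPzRingType) (f : {rmorphism A -> R}).
Variables (g : {rmorphism A -> M}) (rl : {rmorphism R -> RM}) (rm : {rmorphism M -> RM}).
Hypotheses (it : is_tensor f g rl rm) (fl : eqflat f).
Hypothesis um : forall (J : finType) (c : J -> A) (z : J -> R),
  \sum_j f (c j) * z j = 1 -> exists y, \sum_j c j * y j = 1.

Lemma base_inj m : rm m = 0 -> m = 0.
Proof.
move=> e; have [|J [c [z [xE cE]]]] := it_zero it fl (x := fun _ : unit => 1) (y := fun=> m).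
  by rewrite (big_pred1 tt) ?rmorph1 ?mul1r //; case.
have [y yE] := um (esym (xE tt)).
have cm j : g (c tt j) * m = 0.
  by have := cE j; rewrite (big_pred1 tt) //; case.
rewrite -[m]mul1r -(rmorph1 g) -yE rmorph_sum mulr_suml big1 // => j _.
by rewrite rmorphM mulrAC cm mul0r.
Qed.

Variables (hf : {rmorphism A -> RM}) (tl : {rmorphism R -> T}) (tr : {rmorphism RM -> T}).
Hypotheses (hfE : forall a, hf a = rl (f a)) (it2 : is_tensor f hf tl tr).

(** The hypothesis is the descent condition for x in R (x)_A M. Read as a vanishing tensor, it
    provides elements of A that generate the unit ideal and whose products with x come from M. *)
Lemma descend_tensor (I : finType) (b : I -> R) (m : I -> M) :
  \sum_i tl (b i) * tr (rm (m i)) = tr (\sum_i rl (b i) * rm (m i)) ->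
  exists mu, \sum_i rl (b i) * rm (m i) = rm mu.
Proof.
set x := \sum_i rl (b i) * rm (m i) => e.
have [|J [c [z [xE cE]]]] := it_zero it2 fl
  (x := fun t : option I => if t is Some i then b i else 1)
  (y := fun t => if t is Some i then rm (m i) else - x).
  by rewrite big_option /= rmorph1 mul1r rmorphN e addNr.
have [y yE] := um (esym (xE None)).
have cx j : rl (f (c None j)) * x = rm (\sum_i g (c (Some i) j) * m i).
  have := cE j; rewrite big_option /= hfE mulrN addrC => /eqP.
  rewrite subr_eq0 => /eqP <-; rewrite rmorph_sum; apply: eq_bigr => i _.
  by rewrite rmorphM hfE (it_comm it).
exists (\sum_j g (y j) * \sum_i g (c (Some i) j) * m i).
rewrite -[LHS]mul1r -(rmorph1 rl) -(rmorph1 f) -yE !rmorph_sum mulr_suml.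
apply: eq_bigr => j _; rewrite [RHS]rmorphM -cx -(it_comm it) !rmorphM; ring.
Qed.

End Descend.

Lemma comaximal_pow (S : comPzRingType) (a b : S) m n : a + b = 1 ->
  exists u v, u * a ^+ m + v * b ^+ n = 1.
Proof.
move=> e.
have step (c d : S) k : c + d = 1 -> exists u v, u * c ^+ k + v * d = 1.
  move=> e1; elim: k => [|k [u [v h]]]; first by exists 1, 0; rewrite expr0; ring.
  exists u, (u * c ^+ k + v); rewrite exprS.
  transitivity ((u * c ^+ k) * (c + d) + v * d); first by ring.
  by rewrite e1 mulr1.
have [u [v h]] := step a b m e.
have [|v' [u' h']] := step (v * b) (u * a ^+ m) n; first by rewrite addrC.
exists (u' * u), (v' * v ^+ n); rewrite -h' exprMn; ring.
Qed.

(* The block matrix is multiplication by a on the family (v, a v) when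
   (a^2 - a) v = M v; modulo I its characteristic polynomial is
   X^n (X - 1)^n. *)
Lemma henselian_idem (A : comNzRingType) (I : set A) n (M : 'M[A]_n) :
  henselian_pair I -> (forall i j, I (M i j)) ->
  exists g h : {poly A}, [/\ char_poly (block_mx 0 1%:M M 1%:M) = g * h,
    (size g <= n.+1)%N /\ forall i, I (g - 'X^n)`_i &
    (size h <= n.+1)%N /\ forall i, I (h - ('X - 1) ^+ n)`_i].
Proof.
move=> hI MI; have iI := henselian_ideal hI.
set E := block_mx _ _ _ _; set F := char_poly E.
pose P : set {poly A} := [set p | forall i, I p`_i].
have iP : ideal P.
  split=> [i|p q hp hq i|p q hq i]; first by rewrite coef0; exact: ideal0.
    by rewrite coefD; exact: idealD.
  by rewrite coefM; apply: ideal_sum => // j _; exact: idealMl.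
have FE : P (F - 'X^n * ('X - 1) ^+ n).
  pose Z : 'M[{poly A}]_(n + n) := block_mx 'X%:M (- 1%:M) 0 ('X - 1)%:M.
  have -> : 'X^n * ('X - 1) ^+ n = \det Z by rewrite det_ublock !det_scalar.
  apply: det_congr => // i j.
  have -> : char_poly_mx E = block_mx 'X%:M (- 1%:M) (- map_mx polyC M) ('X - 1)%:M.
    rewrite /char_poly_mx /E map_block_mx scalar_mx_block opp_block_mx add_block_mx.
    by rewrite ?map_scalar_mx ?add0r map_mx0 subr0 !rmorph1 [X in _ = block_mx _ _ _ X]raddfB.
  rewrite /Z !mxE; case: (split i) => a; rewrite !mxE; case: (split j) => b;
    rewrite ?subrr; try exact: (ideal0 iP).
  rewrite !mxE subr0 => l; rewrite coefN coefC; case: eqP => _; last by rewrite oppr0; exact: ideal0.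
  by apply: idealN.
pose ps_of (p : {poly A}) : ps A := fun i => p`_i.
have psM p q : ps_of (p * q) = ps_of p * ps_of q by apply: ps_ext => i; rewrite /ps_of coefM.
have mon k p : p \is monic -> size p = k.+1 -> monps k (ps_of p).
  move=> mp sp; split=> [|l kl]; last by rewrite /ps_of nth_default // sp.
  by have := monicP mp; rewrite lead_coefE sp.
have fin (p : {poly A}) : finite_coefs (ps_of p).
  by exists (size p) => l h; rewrite /ps_of nth_default.
have sX1 : size (('X - 1) ^+ n : {poly A}) = n.+1 by rewrite -polyC1 size_exp_XsubC.
have mX1 : ('X - 1) ^+ n \is (@monic A) by rewrite -polyC1 monic_exp // monicXsubC.
have [u [v uv]] := @comaximal_pow {poly A} 'X (1 - 'X) n n (subrKC 'X 1).
have [|i|g [h [[mg g0] [mh h0] e cg ch]]] := henselian_lift hI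
  (mon (n + n)%N F (char_poly_monic E) (size_char_poly E))
  (mon n 'X^n (monicXn _ _) (size_polyXn _ _)) (mon n _ mX1 sX1)
  (fin u) (fin (v * (-1) ^+ n)).
- by move=> i; have := FE i; congr (I _); rewrite -psM coefB.
- have -> : (ps_of u * ps_of 'X^n + ps_of (v * (-1) ^+ n) * ps_of (('X - 1) ^+ n) - 1) i =
      (u * 'X^n + v * (-1) ^+ n * ('X - 1) ^+ n)`_i - (1 : ps A) i.
    by rewrite -!psM coefD.
  rewrite -mulrA -exprMn mulN1r opprB uv coef1.
  by case: i => [|i]; rewrite ?subrr; exact: ideal0.
have gE (p : ps A) : (forall l, (n < l)%N -> p l = 0) ->
    forall i, (\poly_(j < n.+1) p j)`_i = p i.
  by move=> p0 i; rewrite coef_poly; case: ltnP => // /p0.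
exists (\poly_(j < n.+1) g j), (\poly_(j < n.+1) h j); split.
- apply/polyP => i; rewrite coefM -[LHS]/(ps_of F i) e.
  by apply: eq_bigr => j _; rewrite !gE.
- split=> [|i]; first exact: size_poly.
  by have := cg i; rewrite coefB gE.
- split=> [|i]; first exact: size_poly.
  by have := ch i; rewrite coefB gE.
Qed.

(** The determinant trick on (v, a v) makes a a root of g * h. K is a field, so a is a root of one
    factor, and this factor is congruent modulo I to X^n or to (X - 1)^n. *)
Lemma idem_mod_nz (A : comNzRingType) (I : set A) (K : fieldType)
    (k : {rmorphism A -> K}) n (v : 'I_n -> K) (M : 'I_n -> 'I_n -> A) a :
  henselian_pair I -> (exists i, v i != 0) -> (forall i j, I (M i j)) ->
  (forall i, (a * a - a) * v i = \sum_j k (M i j) * v j) ->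
  exists c : 'I_n.+1 -> A, (forall i, I (c i)) /\
    (a ^+ n + \sum_i k (c i) * a ^+ i = 0 \/ (a - 1) ^+ n + \sum_i k (c i) * a ^+ i = 0).
Proof.
move=> hI [i0 vi] MI ME.
pose M' : 'M[A]_n := \matrix_(i, j) M i j.
have [|g [h [FE [sg gI] [sh hI']]]] := @henselian_idem A I n M' hI.
  by move=> i j; rewrite mxE.
set E := block_mx _ _ _ _ in FE.
have [e [eX eC]] := poly_eval_hom k a.
pose Z : 'M[K]_(n + n) := map_mx e (char_poly_mx E).
pose w : 'cV[K]_n := \col_i v i.
pose y : 'cV[K]_(n + n) := col_mx w (a *: w).
have ZE : Z = a%:M - map_mx k E.
  apply/matrixP => i j; rewrite !mxE rmorphB rmorphMn eX /=.
  by rewrite eC.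
have Zy : Z *m y = 0.
  rewrite ZE mulmxBl mul_scalar_mx /y /E map_block_mx map_mx0 map_mx1 mul_block_col.
  rewrite mul0mx add0r !mul1mx scale_col_mx.
  have -> : map_mx k M' *m w + a *: w = a *: (a *: w).
    apply/matrixP => i j; rewrite !mxE mulrA.
    have -> : a * a * v i = (a * a - a) * v i + a * v i by ring.
    by rewrite ME; congr (_ + _); apply: eq_bigr => l _; rewrite !mxE.
  by rewrite subrr.
have dy : \det Z *: y = 0.
  by rewrite -mul_scalar_mx -mul_adj_mx -mulmxA Zy mulmx0.
have d0 : e g * e h = 0.
  rewrite -rmorphM -FE /char_poly -det_map_mx.
  have := congr1 (fun Y : 'cV[K]_(n + n) => Y (lshift n i0) 0) dy.
  rewrite mxE /y col_mxEu !mxE => /eqP; rewrite mulf_eq0 (negPf vi) orbF => /eqP.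
  by [].
have ev (p q : {poly A}) : (size p <= n.+1)%N -> (forall i, I (p)`_i) ->
    exists c : 'I_n.+1 -> A, (forall i, I (c i)) /\ e p = \sum_i k (c i) * a ^+ i.
  move=> sp Ip; exists (fun i => p`_i); split=> //.
  have {1}-> : p = \poly_(i < n.+1) p`_i.
    apply/polyP => i; rewrite coef_poly; case: ltnP => // h'.
    by rewrite nth_default // (leq_trans sp).
  rewrite poly_def rmorph_sum; apply: eq_bigr => i _.
  by rewrite -mul_polyC rmorphM eC rmorphXn eX.
have fin (p q : {poly A}) : (size p <= n.+1)%N -> (size q <= n.+1)%N ->
    (forall i, I (p - q)`_i) -> e p = 0 ->
    exists c : 'I_n.+1 -> A, (forall i, I (c i)) /\ e q + \sum_i k (c i) * a ^+ i = 0.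
  move=> sp sq Ipq ep; have [|c [cI cE]] := ev (p - q) 0 _ Ipq.
    by apply: leq_trans (size_polyD _ _) _; rewrite size_polyN geq_max sp.
  by exists c; split=> //; rewrite -cE rmorphB ep add0r subrr.
have /orP[/eqP e0|/eqP e0] : (e g == 0) || (e h == 0) by rewrite -mulf_eq0 d0.
  have [|c [cI cE]] := fin g 'X^n sg _ gI e0; first by rewrite size_polyXn.
  by exists c; split=> //; left; apply: etrans cE; rewrite rmorphXn eX.
have [|c [cI cE]] := fin h (('X - 1) ^+ n) sh _ hI' e0.
  by rewrite -polyC1 size_exp_XsubC.
by exists c; split=> //; right; apply: etrans cE; rewrite rmorphXn rmorphB eX rmorph1.
Qed.

Lemma idem_mod (A : comPzRingType) (I : set A) (K : fieldType)
    (k : {rmorphism A -> K}) (J : finType) (v : J -> K) (M : J -> J -> A) a :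
  henselian_pair I -> (exists i, v i != 0) -> (forall i j, I (M i j)) ->
  (forall i, (a * a - a) * v i = \sum_j k (M i j) * v j) ->
  exists c : 'I_#|J|.+1 -> A, (forall i, I (c i)) /\
    (a ^+ #|J| + \sum_i k (c i) * a ^+ i = 0 \/
     (a - 1) ^+ #|J| + \sum_i k (c i) * a ^+ i = 0).
Proof.
move=> hI [i0 vi] MI ME.
have ne : (1 : A) != 0.
  by apply/negP => /eqP/(congr1 k)/eqP; rewrite rmorph1 rmorph0 oner_eq0.
pose V : comNzRingType := HB.pack (A : Type) A (GRing.PzSemiRing_isNonZero.Build A ne).
apply: (@idem_mod_nz V I K k #|J| (fun i => v (enum_val i))
  (fun i j => M (enum_val i) (enum_val j)) a hI).
- by exists (enum_rank i0); rewrite enum_rankK.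
- by move=> i j; exact: MI.
- move=> i; rewrite ME (reindex (@enum_val _ predT)) //=; exact/onW_bij/enum_val_bij.
Qed.

Lemma idem_pow (S : comPzRingType) (a : S) n : a * a = a -> a ^+ n.+1 = a.
Proof. by move=> aa; elim: n => [|n IH]; rewrite ?expr1 // exprS IH. Qed.

Section IntegralNakayama.
Variables (A R M RM Q RQ L : comPzRingType) (K : fieldType) (I : set A).
Variables (f : {rmorphism A -> R}) (k : {rmorphism A -> K}) (g : {rmorphism A -> M}).
Variables (rl : {rmorphism R -> RM}) (rm : {rmorphism M -> RM}) (v : {rmorphism M -> K}).
Variables (p : {rmorphism M -> Q}) (h : {rmorphism A -> Q}).
Variables (ql : {rmorphism R -> RQ}) (qr : {rmorphism Q -> RQ}) (pi : {rmorphism RM -> RQ}).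
Variables (jl : {rmorphism R -> L}) (jk : {rmorphism K -> L}) (j : {rmorphism RM -> L}).
Hypothesis fl : eqflat f.
Hypothesis jac : forall a, extend f I a -> exists b, (1 + a) * b = 1.
Hypotheses (it : is_tensor f g rl rm) (itQ : is_tensor f h ql qr).
Hypotheses (vg : forall a, v (g a) = k a) (hE : forall a, h a = p (g a)).
Hypothesis vint : forall m, integral (range k) (v m).
Hypothesis pker : forall m, p m = 0 -> extend g I m.
Hypotheses (pil : forall b, pi (rl b) = ql b) (pir : forall m, pi (rm m) = qr (p m)).
Hypotheses (jlE : forall b, j (rl b) = jl b) (jkE : forall m, j (rm m) = jk (v m)).
Hypothesis jlk : forall a, jl (f a) = jk (k a).

(** By flatness x lies in I (R (x) M). As M is integral over A, multiplication by x acts on a finite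
    family w of K through a matrix over IR; since x is idempotent, this matrix fixes the family x w,
    which Nakayama's lemma over R then kills. *)
Lemma idem_zero x : x * x = x -> pi x = 0 -> j x = 0.
Proof.
move=> xx px.
pose X : set RM := [set y | exists s : seq (R * M),
  (forall z, z \in s -> extend f I z.1) /\ y = \sum_(z <- s) rl z.1 * rm z.2].
have iE := extend_ideal f I.
have iX : ideal X.
  split=> [|_ _ [s [sI ->]] [t [tI ->]]|y _ [t [tI ->]]].
  - by exists [::]; split=> //; rewrite big_nil.
  - exists (s ++ t); split; last by rewrite big_cat.
    by move=> z; rewrite mem_cat => /orP[/sI|/tI].
  - have [s ->] := it_span it y.
    exists [seq (a.1 * b.1, a.2 * b.2) | a <- s, b <- t]; split.
      by move=> z /allpairsP[[a b] [_ /= /tI bI ->]]; exact: (idealMl _ iE).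
    rewrite big_allpairs_dep mulr_suml; apply: eq_bigr => a _.
    rewrite mulr_sumr; apply: eq_bigr => b _; rewrite !rmorphM mulrACA //.
have [s [sI xE]] : X x.
  have [n [b [m xE]]] := is_tensor_spanI it x.
  have [|J [c [z [bE cE]]]] := it_zero itQ fl (x := b) (y := fun i => p (m i)).
    apply: etrans px; rewrite xE rmorph_sum; apply: eq_bigr => i _.
    by rewrite rmorphM pil pir.
  have Xy l : X (rm (\sum_i g (c i l) * m i)).
    apply: (@extend_min _ _ g I (rm @^-1` X)); first exact: preim_ideal.
      move=> a Ia; exists [:: (f a, 1)]; split.
        by move=> z'; rewrite inE => /eqP ->; exact: extend_mem.
      by rewrite big_seq1 /= rmorph1 mulr1 (it_comm it).
    apply: pker; apply: etrans (cE l); rewrite rmorph_sum; apply: eq_bigr => i _.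
    by rewrite rmorphM hE.
  rewrite xE; under eq_bigr do rewrite bE rmorph_sum mulr_suml.
  rewrite exchange_big; apply: ideal_sum => // l _.
  rewrite (_ : \sum_(i < n) _ = rl (z l) * rm (\sum_i g (c i l) * m i)); first exact: idealMl.
  rewrite rmorph_sum mulr_sumr; apply: eq_bigr => i _.
  by rewrite !rmorphM (it_comm it); ring.
have [||J [w [[j0 w0] wP]]] := @integral_jint K (range k) [seq v z.2 | z <- s].
- exact: range_subring.
- by move=> y /mapP[z _ ->]; exact: vint.
have wN z : z \in s -> exists N : J -> J -> A, forall i, v z.2 * w i = \sum_l k (N i l) * w l.
  move=> zs; have [|N [NS NE]] := wP (v z.2); first by apply/mapP; exists z.
  exists (fun i l => projT1 (cid2 (NS i l))) => i; rewrite NE; apply: eq_bigr => l _.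
  by case: cid2 => a _ /= ->.
have [P [PI PE]] : exists P : J -> J -> R, (forall i l, extend f I (P i l)) /\
    forall i, j x * jk (w i) = \sum_l jl (P i l) * jk (w l).
  rewrite xE; move: wN sI; elim: (s) => [|z t IH] wN sI.
    exists (fun _ _ => 0); split=> [i l|i]; first exact: ideal0 iE.
    by rewrite big_nil rmorph0 mul0r big1 // => l _; rewrite rmorph0 mul0r.
  have [||P [PI PE]] := IH.
  - by move=> y yt; apply: wN; rewrite inE yt orbT.
  - by move=> y yt; apply: sI; rewrite inE yt orbT.
  have [N NE] := wN z (mem_head _ _).
  exists (fun i l => z.1 * f (N i l) + P i l); split=> [i l|i].
    by apply: (idealD iE) => //; apply: (idealMr _ iE); exact: sI (mem_head _ _).
  rewrite big_cons rmorphD mulrDl PE rmorphM jlE jkE -mulrA -rmorphM NE.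
  rewrite rmorph_sum mulr_sumr -big_split; apply: eq_bigr => l _ /=.
  by rewrite !(rmorphD, rmorphM) jlk; ring.
have z0 := @nakayama R L jl (extend f I) J P (fun i => j x * jk (w i)) iE jac PI.
have : j x * jk (w j0) = 0.
  apply: z0 => i; rewrite -{1}xx rmorphM -mulrA PE mulr_sumr.
  by apply: eq_bigr => l _; ring.
move=> e; rewrite -[LHS]mulr1 -(rmorph1 jk) -(mulfV w0) rmorphM mulrA e.
exact: mul0r.
Qed.

End IntegralNakayama.

Section Connected.
Variables (A : comPzRingType) (I : set A) (R C D : comPzRingType).
Variables (f : {rmorphism A -> R}) (d0 d1 : {rmorphism R -> C}).
Variables (il ir : {rmorphism R -> D}) (de : {rmorphism D -> C}).
Hypothesis ds : descent_setting I f d0 d1 il ir de.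
Variables (K : fieldType) (k : {rmorphism A -> K}).
Variables (L CK : comPzRingType) (jl : {rmorphism R -> L}) (jk : {rmorphism K -> L}).
Variables (cl : {rmorphism C -> CK}) (ck : {rmorphism K -> CK}).
Variables (E0 E1 : {rmorphism L -> CK}).
Hypotheses (itL : is_tensor f k jl jk) (itC : is_tensor (d0 \o f) k cl ck).
Hypotheses (E0l : forall b, E0 (jl b) = cl (d0 b)) (E0k : forall c, E0 (jk c) = ck c).
Hypotheses (E1l : forall b, E1 (jl b) = cl (d1 b)) (E1k : forall c, E1 (jk c) = ck c).

Lemma idem_connected e : e * e = e -> E0 e = E1 e -> e = 0 \/ e = 1.
Proof.
move=> ee eq01; have fl := ds_flat ds; have hI := ds_hensel ds.
have iI := henselian_ideal hI; have itD := ds_tensor ds.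
have sk := range_subring k.
have [M [v [vi vP]]] := subring_ring (integral_subring sk).
have [|g gE] := inj_lift vi (g := k).
  by move=> a; apply/vP; apply: integral_sub => //; exists a.
have vint m : integral (range k) (v m) by apply/vP; exists m.
have [T [b [c [ci eE]]]] := idem_integral itL fl (ds_epd ds) ee.
pose u i := projT1 (cid ((vP (c i)).1 (ci i))).
have uE i : v (u i) = c i by rewrite /u; case: cid.
have [RM [rl [rm itM]]] := tensor_alg f g.
have [|j [jlE jkE]] := it_univ itM (p := jl) (q := jk \o v).
  by move=> a /=; rewrite gE (it_comm itL).
have jinj x : j x = 0 -> x = 0 by exact: (tensor_inj itM itL fl vi gE jlE jkE).
pose e' := \sum_i rl (b i) * rm (u i).
have je : j e' = e.
  rewrite eE rmorph_sum; apply: eq_bigr => i _.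
  by rewrite rmorphM jlE jkE /= uE.
have ee' : e' * e' = e'.
  apply/eqP; rewrite -subr_eq0; apply/eqP/jinj.
  by rewrite rmorphB rmorphM je ee subrr.
pose fD : {rmorphism A -> D} := il \o f.
have flD : eqflat fD.
  apply: (@eqflat_comp _ _ _ f ir) => //; last exact: eqflat_base_change itD fl.
  exact: it_comm itD.
have [DM [dl [dm itDM]]] := tensor_alg fD g.
have [DK [Dl [Dk itDK]]] := tensor_alg fD k.
have [|jD [jDl jDm]] := it_univ itDM (p := Dl) (q := Dk \o v).
  by move=> a /=; rewrite gE -(it_comm itDK).
have jDinj x : jD x = 0 -> x = 0 by exact: (tensor_inj itDM itDK flD vi gE jDl jDm).
have [|El [Ell Elm]] := it_univ itM (p := dl \o il) (q := dm).
  by move=> a; rewrite -(it_comm itDM).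
have [|Er [Erl Erm]] := it_univ itM (p := dl \o ir) (q := dm).
  by move=> a; rewrite -(it_comm itDM) /= (it_comm itD).
have [TC [tl [tr itT]]] := tensor_alg de Dl.
have [|w [wl wk]] := it_univ itC (p := tl) (q := tr \o Dk).
  by move=> a /=; rewrite -(it_comm itDK) -(it_comm itT) /= (ds_d0 ds).
have trl x : tr (jD (El x)) = w (E0 (j x)).
  move: x; apply: (@tensor_ext _ _ _ _ _ f g rl rm (tr \o jD \o El) (w \o E0 \o j) itM) => y /=.
    by rewrite Ell /= jDl -(it_comm itT) (ds_d0 ds) jlE E0l wl.
  by rewrite Elm jDm jkE /= E0k wk.
have trr x : tr (jD (Er x)) = w (E1 (j x)).
  move: x; apply: (@tensor_ext _ _ _ _ _ f g rl rm (tr \o jD \o Er) (w \o E1 \o j) itM) => y /=.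
    by rewrite Erl /= jDl -(it_comm itT) (ds_d1 ds) jlE E1l wl.
  by rewrite Erm jDm jkE /= E1k wk.
(* By flatness of D -> C, such an x is killed by elements of D that generate the unit ideal in C,
   hence the unit ideal of D modulo ID. So x is a multiple of an element of ID. *)
have small x : tr (jD x) = 0 -> extend (dl \o fD) I x.
  move=> e0; have [|J [s [z [zE sE]]]] := it_zero itT (ds_flatC ds)
    (x := fun _ : unit => 1) (y := fun=> jD x).
    by rewrite (big_pred1 tt) ?rmorph1 ?mul1r //; case.
  have [y yI] := ds_unimodularC ds (esym (zE tt)).
  have sx l : dl (s tt l) * x = 0.
    by apply: jDinj; rewrite rmorphM jDl; have := sE l; rewrite (big_pred1 tt) //; case.
  have -> : x = dl (1 - \sum_l s tt l * y l) * x.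
    rewrite rmorphB rmorph1 mulrBl mul1r rmorph_sum mulr_suml big1 ?subr0 // => l _.
    by rewrite rmorphM mulrAC sx mul0r.
  have iX := extend_ideal (dl \o fD) I; apply: (idealMr _ iX).
  apply: (@extend_min _ _ fD I (dl @^-1` (extend (dl \o fD) I)) _ _ _ yI); first exact: preim_ideal.
  by move=> a Ia; exact: (@extend_mem _ _ (dl \o fD)).
have sml : extend (dl \o fD) I (El e' - Er e').
  have -> : El e' - Er e' = El e' * (1 - Er e') - Er e' * (1 - El e') by ring.
  have iX := extend_ideal (dl \o fD) I; apply: (idealB iX); apply: small.
    rewrite !rmorphM !rmorphB !rmorph1 trl trr je -eq01 -(rmorph1 w) -rmorphB -rmorphM.
    by rewrite mulrBr mulr1 -rmorphM ee subrr rmorph0.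
  rewrite !rmorphM !rmorphB !rmorph1 trl trr je -eq01 -(rmorph1 w) -rmorphB -rmorphM.
  by rewrite mulrBr mulr1 -rmorphM ee subrr rmorph0.
have [Q [p [sp pE]]] := quotient_ring (extend_ideal g I).
pose h : {rmorphism A -> Q} := p \o g.
have hI0 a : I a -> h a = 0 by move=> Ia; apply/pE; exact: extend_mem.
have [RQ [ql [qr itQ]]] := tensor_alg f h.
have [|pi [pil pir]] := it_univ itM (p := ql) (q := qr \o p).
  exact: it_comm itQ.
pose hf : {rmorphism A -> RQ} := ql \o f.
have [RT [tl2 [tr2 itT2]]] := tensor_alg f hf.
have [|md [mdl mdr]] := it_univ itD (p := tl2) (q := tr2 \o ql).
  exact: it_comm itT2.
have [|m [ml mm]] := it_univ itDM (p := md) (q := tr2 \o qr \o p).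
  by move=> a /=; rewrite mdl (it_comm itT2) /= (it_comm itQ).
have e1 : m (El e') = m (Er e').
  apply/eqP; rewrite -subr_eq0 -rmorphB; apply/eqP.
  apply: (@extend_min _ _ (dl \o fD) I (m @^-1` [set 0]) _ _ _ sml).
    exact: preim_ideal (ideal_zero _).
  move=> a Ia /=; rewrite ml mdl (it_comm itT2) /= (it_comm itQ) hI0 //.
  by rewrite !rmorph0.
have pe : pi e' = \sum_i ql (b i) * qr (p (u i)).
  by rewrite rmorph_sum; apply: eq_bigr => i _; rewrite rmorphM pil pir.
(* Modulo I the two images of e' in D (x) A' agree, so e' descends to an idempotent mu of Q =
   A'/IA'. *)
have [||mu muE] := @descend_tensor A R Q RQ RT f h ql qr itQ fl (ds_unimodular ds)
  hf tl2 tr2 _ itT2 T b (fun i => p (u i)).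
- by [].
- rewrite -pe; transitivity (m (El e')).
    rewrite !rmorph_sum; apply: eq_bigr => i _.
    by rewrite !rmorphM Ell Elm /= ml mm mdl.
  rewrite e1 !rmorph_sum; apply: eq_bigr => i _.
  by rewrite !rmorphM Erl Erm /= ml mm mdr pil pir.
rewrite -pe in muE.
have mumu : mu * mu = mu.
  apply/eqP; rewrite -subr_eq0; apply/eqP.
  apply: (base_inj itQ fl (ds_unimodular ds)).
  by rewrite rmorphB rmorphM -muE -rmorphM ee' subrr.
have mu01 : mu = 0 \/ mu = 1.
  have [a aE] := sp mu.
  have : extend g I (a * a - a) by apply/pE; rewrite rmorphB rmorphM aE mumu subrr.
  move=> /extendP[s [sI aaE]].
  have [|J [w' [[j0 w0] wP]]] := @integral_jint K (range k) [seq v z.2 | z <- s] sk.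
    by move=> y /mapP[z _ ->]; exact: vint.
  have [P [PI PE]] : exists P : J -> J -> A, (forall i l, I (P i l)) /\
      forall i, (v a * v a - v a) * w' i = \sum_l k (P i l) * w' l.
    rewrite -rmorphM -rmorphB aaE; move: wP sI; elim: (s) => [|z t IH] wP sI.
      exists (fun _ _ => 0); split=> [i l|i]; first exact: ideal0.
      by rewrite big_nil rmorph0 mul0r big1 // => l _; rewrite rmorph0 mul0r.
    have [||P [PI PE]] := IH.
    - by move=> y yt; apply: wP; rewrite inE yt orbT.
    - by move=> y yt; apply: sI; rewrite inE yt orbT.
    have [N [NS NE]] := wP (v z.2) (mem_head _ _).
    exists (fun i l => z.1 * projT1 (cid2 (NS i l)) + P i l); split=> [i l|i].
      by apply: idealD => //; apply: idealMr => //; exact: sI (mem_head _ _).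
    rewrite big_cons rmorphD mulrDl PE rmorphM gE -mulrA NE mulr_sumr -big_split.
    apply: eq_bigr => l _ /=; case: cid2 => n _ nE /=.
    by rewrite -nE rmorphD rmorphM mulrDl mulrA.
  have [|cc [ccI H]] := @idem_mod A I K k J w' P (v a) hI _ PI PE; first by exists j0.
  (* A positive exponent is required: then the power of an idempotent is the idempotent itself. *)
  have J0 : #|J| = #|J|.-1.+1 by rewrite prednK //; apply/card_gt0P; exists j0.
  have back (y : M) : v y ^+ #|J| + \sum_i k (cc i) * v a ^+ i = 0 -> p y ^+ #|J| = 0.
    move=> e0; have /(congr1 p) : y ^+ #|J| + \sum_i g (cc i) * a ^+ i = 0.
      apply: vi; rewrite rmorph0 rmorphD rmorphXn rmorph_sum; apply: etrans e0.
      by congr (_ + _); apply: eq_bigr => i _; rewrite rmorphM gE rmorphXn.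
    rewrite rmorph0 rmorphD rmorphXn rmorph_sum big1 ?addr0 // => i _.
    by rewrite rmorphM (hI0 _ (ccI i) : p (g (cc i)) = 0) mul0r.
  case: H => H.
    by left; rewrite -(idem_pow #|J|.-1 mumu) -J0 -aE; exact: back.
  right; have := back (a - 1); rewrite rmorphB rmorph1 => /(_ H).
  rewrite rmorphB rmorph1 aE => H'.
  have : (1 - mu) ^+ #|J| = 0 by rewrite -opprB exprNn H' mulr0.
  rewrite J0 idem_pow; first by move/eqP; rewrite subr_eq0 => /eqP.
  by transitivity (1 - mu *+ 2 + mu * mu); [ring | rewrite mumu; ring].
have zero x : x * x = x -> pi x = 0 -> j x = 0.
  apply: (@idem_zero A R M RM Q RQ L K I f k g rl rm v p h ql qr pi jl jk j) => //.
  - exact: ds_jac ds.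
  - by move=> y /pE.
  - exact: it_comm itL.
case: mu01 => muE'; rewrite muE' in muE.
  by left; rewrite -je; apply: zero => //; rewrite muE rmorph0.
right; apply/eqP; rewrite -subr_eq0 -oppr_eq0 opprB -je -(rmorph1 j) -rmorphB; apply/eqP.
apply: zero; last by rewrite rmorphB muE !rmorph1 subrr.
by transitivity (1 - e' *+ 2 + e' * e'); [ring | rewrite ee'; ring].
Qed.

End Connected.

(** * Fibres and functions *)

Section DescentPoints.
Variables (A : comPzRingType) (I : set A) (R C D : comPzRingType).
Variables (f : {rmorphism A -> R}) (d0 d1 : {rmorphism R -> C}).
Variables (il ir : {rmorphism R -> D}) (de : {rmorphism D -> C}).
Hypothesis ds : descent_setting I f d0 d1 il ir de.

Let fl : eqflat f := ds_flat ds.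
Let itD := ds_tensor ds.

Section Fibre.
Variables (K : fieldType) (k : {rmorphism A -> K}).
Variables (L : comPzRingType) (jl : {rmorphism R -> L}) (jk : {rmorphism K -> L}).
Hypotheses (hK : has_roots K) (itL : is_tensor f k jl jk).

Lemma fibre_split : split_alg jk.
Proof. exact: tensor_split hK itL (ds_epd ds). Qed.

Lemma fibre_point (phi : {rmorphism R -> K}) : (forall a, phi (f a) = k a) ->
  exists2 x : {rmorphism L -> K}, kpoint jk x &
    (x \o jl : {rmorphism R -> K}) = phi.
Proof.
move=> h; have [|x [xl xk]] := it_univ itL (p := phi) (q := idfun); first exact: h.
by exists x; [exact: xk | apply: rmorph_ext].
Qed.

Lemma point_fibre (x : {rmorphism L -> K}) a : kpoint jk x -> x (jl (f a)) = k a.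
Proof. by move=> kx; rewrite (it_comm itL) kx. Qed.

(** The fibre CK of C over k with its two maps from the fibre of R. A K-point of CK amounts to a map
    y from C to K over k, and the two maps send it to the restrictions of y along d0 and d1. *)
Lemma square_tensor : exists (CK : comPzRingType) (ck : {rmorphism K -> CK})
  (E0 E1 : {rmorphism L -> CK}),
  [/\ split_alg ck,
    forall x : {rmorphism CK -> K}, kpoint ck x ->
      exists y : {rmorphism C -> K}, [/\ forall a, y (d0 (f a)) = k a,
        kpoint jk (x \o E0), kpoint jk (x \o E1),
        ((x \o E0) \o jl : {rmorphism R -> K}) = y \o d0
      & ((x \o E1) \o jl : {rmorphism R -> K}) = y \o d1]
    & forall e, e * e = e -> E0 e = E1 e -> e = 0 \/ e = 1].
Proof.
have [CK [cl [ck itC]]] := tensor_alg (d0 \o f) k.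
have [|E0 [E0l E0k]] := it_univ itL (p := cl \o d0) (q := ck).
  exact: it_comm itC.
have [|E1 [E1l E1k]] := it_univ itL (p := cl \o d1) (q := ck).
  by move=> a; rewrite -(it_comm itC) /= -(ds_eq ds).
exists CK, ck, E0, E1; split.
- apply: (tensor_split hK itC) => c; exact: (ds_epdC ds (h := d0 \o f)).
- move=> x kx; exists (x \o cl); split.
  + by move=> a /=; have /= -> := it_comm itC a; exact: kx.
  + by move=> c /=; rewrite E0k.
  + by move=> c /=; rewrite E1k.
  + by apply: rmorph_ext => b /=; rewrite E0l.
  + by apply: rmorph_ext => b /=; rewrite E1l.
- exact: (idem_connected ds itL itC E0l E0k E1l E1k).
Qed.

(** P is cut out by an idempotent e. Invariance gives E0 e = E1 e at all K-points of the split
    algebra CK, hence in CK. *)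
Lemma clopen_connected (P : {rmorphism R -> K} -> Prop) :
  kopen jk (fun x => P (x \o jl)) -> kopen jk (fun x => ~ P (x \o jl)) ->
  (forall y : {rmorphism C -> K}, (forall a, y (d0 (f a)) = k a) ->
    (P (y \o d0) <-> P (y \o d1))) ->
  forall p q : {rmorphism R -> K}, (forall a, p (f a) = k a) ->
    (forall a, q (f a) = k a) -> P p -> P q.
Proof.
move=> oP oN inv p q pk qk Pp; have hs := fibre_split.
have [|e [ee eP]] := split_sep hs oN oP; first by move=> x _; case: (pselect (P (x \o jl))); tauto.
have [CK [ck [E0 [E1 [hsC pt conn]]]]] := square_tensor.
have [x kx xE] := fibre_point pk; have [y ky yE] := fibre_point qk.
have [//|e0|e1] := conn e ee.
- apply/eqP; rewrite -subr_eq0; apply/eqP/(split_reduced hsC) => z kz.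
  have [w [wk k0 k1 w0 w1]] := pt z kz.
  have [n0 y0] := eP _ k0; have [n1 y1] := eP _ k1.
  rewrite w0 in n0 y0; rewrite w1 in n1 y1.
  rewrite rmorphB; have /= i0 := idem_val (z \o E0) ee; have /= i1 := idem_val (z \o E1) ee.
  have iw := inv w wk.
  case: i0 => h0; case: i1 => h1; rewrite h0 h1 ?subrr //.
    by case: (n0 h0); apply/iw/y1.
  by case: (n1 h1); apply/iw/y0.
- by have [n0 _] := eP x kx; case: n0; rewrite ?xE // e0 rmorph0.
- by have [_ y1] := eP y ky; rewrite -yE; apply: y1; rewrite e1 rmorph1.
Qed.

End Fibre.

Lemma descent_effective b : il b = ir b -> exists a, f a = b.
Proof.
move=> e; have [|J [c [z [xE cE]]]] := it_zero itD fl
  (x := fun t : bool => if t then b else 1) (y := fun t => if t then 1 else - b).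
  by rewrite big_bool /= rmorphN !rmorph1 mulr1 mul1r e subrr.
have [y yE] := ds_unimodular ds (esym (xE false)).
exists (\sum_j y j * c true j); rewrite -[RHS]mul1r -(rmorph1 f) -yE.
rewrite !rmorph_sum mulr_suml; apply: eq_bigr => j _.
have := cE j; rewrite big_bool /= mulr1 mulrN => /eqP; rewrite subr_eq0 => /eqP h.
by rewrite !rmorphM h; ring.
Qed.

(** * Descent of functions *)

Section Function.
Variable b : R.
Hypothesis db : d0 b = d1 b.
Local Notation delta := (il b - ir b).

Section Relation.
Variables (K : fieldType) (k : {rmorphism A -> K}).

(* b (x) 1 = 1 (x) b holds in the local ring of D at the point (p, q). *)
Definition near_eq (p q : {rmorphism R -> K}) := exists (h : {rmorphism D -> K}) s,
  [/\ forall x, h (il x) = p x, forall x, h (ir x) = q x, s * delta = 0 & h s != 0].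

(** The pencil of b supplies a g that annihilates b (x) 1 - 1 (x) b and equals 1 on the diagonal. *)
Lemma near_eq_refl p : near_eq p p.
Proof.
have [|mu [ml mr]] := it_univ itD (p := idfun) (q := idfun); first by [].
have [g [g1 g0]] := @epd_diagonal A R D f R idfun f il ir mu b (fun=> erefl)
  (it_comm itD) ml mr (ds_epd ds b).
exists (p \o mu), g; split=> //.
- by move=> x /=; rewrite ml.
- by move=> x /=; rewrite mr.
- by rewrite /= g1 rmorph1 oner_neq0.
Qed.

Lemma near_eq_sym p q : near_eq p q -> near_eq q p.
Proof.
move=> [h [s [hl hr s0 hs]]].
have [|sw [swl swr]] := it_univ itD (p := ir) (q := il).
  by move=> a; rewrite (it_comm itD).
have sws x : sw (sw x) = x.
  by apply: (@tensor_ext _ _ _ _ _ f f il ir (sw \o sw) idfun itD) => y /=; rewrite ?swl ?swr ?swl.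
exists (h \o sw), (sw s); split=> [x|x||] /=.
- by rewrite swl hr.
- by rewrite swr hl.
- have := congr1 sw s0; rewrite rmorphM rmorphB swl swr rmorph0 => e.
  by rewrite -opprB mulrN e oppr0.
- by rewrite sws.
Qed.

(** In the triple tensor product T, delta13 = delta12 + delta23 is killed by t = s12 s'23. Since T
    is flat over D through the outer factors, t is a combination of elements of D that kill delta,
    and one of these is nonzero at (p, r). *)
Lemma near_eq_trans (p q r : {rmorphism R -> K}) : (forall a, p (f a) = r (f a)) ->
  near_eq p q -> near_eq q r -> near_eq p r.
Proof.
move=> pr [h [s [hl hr s0 hs]]] [h' [s' [hl' hr' s0' hs']]].
pose fD : {rmorphism A -> D} := il \o f.
have [T [tl [tr itT]]] := tensor_alg f fD.
have [|m12 [m12l m12r]] := it_univ itD (p := tr \o il) (q := tl).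
  by move=> a; rewrite (it_comm itT).
have [|m23 [m23l m23r]] := it_univ itD (p := tl) (q := tr \o ir).
  by move=> a /=; rewrite (it_comm itT) /= (it_comm itD).
have [|g [gl gr]] := it_univ itD (p := p) (q := r); first exact: pr.
have [|g3 [g3l g3r]] := it_univ itT (p := q) (q := g).
  by move=> a /=; rewrite gl -hr -hl (it_comm itD).
pose t := m12 s * m23 s'.
have td : t * tr delta = 0.
  have -> : tr delta = m12 delta + m23 delta.
    by rewrite !rmorphB m12l m12r m23l m23r /= addrA subrK.
  transitivity (m23 s' * m12 (s * delta) + m12 s * m23 (s' * delta)).
    by rewrite /t [m12 (_ * _)]rmorphM [m23 (_ * delta)]rmorphM; ring.
  by rewrite s0 s0' !rmorph0 !mulr0 addr0.
have [n [x [y tE]]] := is_tensor_spanI itT t.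
have [|J [c [z [xE cE]]]] := it_zero itT fl (x := x) (y := fun i => y i * delta).
  apply: etrans td; rewrite tE mulr_suml; apply: eq_bigr => i _.
  by rewrite rmorphM mulrA.
pose sj j := \sum_i fD (c i j) * y i.
have tE' : t = \sum_j tl (z j) * tr (sj j).
  rewrite tE; under eq_bigr do rewrite xE rmorph_sum mulr_suml.
  rewrite exchange_big; apply: eq_bigr => j _; rewrite /sj rmorph_sum mulr_sumr.
  by apply: eq_bigr => i _; rewrite !rmorphM (it_comm itT); ring.
have g12 : g3 (m12 s) = h s.
  apply: (@tensor_ext _ _ _ _ _ f f il ir (g3 \o m12) h itD) => w /=.
    by rewrite m12l /= g3r gl hl.
  by rewrite m12r g3l hr.
have g23 : g3 (m23 s') = h' s'.
  apply: (@tensor_ext _ _ _ _ _ f f il ir (g3 \o m23) h' itD) => w /=.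
    by rewrite m23l g3l hl'.
  by rewrite m23r /= g3r gr hr'.
have gt : g3 t != 0 by rewrite rmorphM g12 g23 mulf_neq0.
have [j gj] : exists j, g (sj j) != 0.
  apply: contrapT => H; case/eqP: gt; rewrite tE' rmorph_sum big1 // => j _.
  rewrite rmorphM g3r; have [->|nz] := eqVneq (g (sj j)) 0; first exact: mulr0.
  by case: H; exists j.
exists g, (sj j); split=> //.
rewrite -(cE j) /sj mulr_suml; apply: eq_bigr => i _; exact/esym/mulrA.
Qed.

Lemma near_eq_open (L : comPzRingType) (jl : {rmorphism R -> L})
    (jk : {rmorphism K -> L}) (p : {rmorphism R -> K}) : is_tensor f k jl jk ->
  (forall a, p (f a) = k a) -> kopen jk (fun x => near_eq p (x \o jl)).
Proof.
move=> itL pk x kx [h [s [hl hr s0 hs]]].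
have [t tE] := it_span itD s.
have ev (y : {rmorphism L -> K}) (g : {rmorphism D -> K}) : kpoint jk y ->
    (forall z, g (il z) = p z) -> (forall z, g (ir z) = y (jl z)) ->
    g s = y (\sum_(z <- t) jk (p z.1) * jl z.2).
  move=> ky gl gr; rewrite tE !rmorph_sum; apply: eq_bigr => z _.
  by rewrite !rmorphM gl gr ky.
exists (\sum_(z <- t) jk (p z.1) * jl z.2); first by rewrite -(ev x h).
move=> y ky ya; have [|g [gl gr]] := it_univ itD (p := p) (q := y \o jl).
  by move=> a; rewrite pk /= (point_fibre itL).
by exists g, s; split=> //; rewrite (ev y g).
Qed.

End Relation.

(** If the annihilator of delta lies in a maximal ideal x, a geometric point of x gives a pair (p,
    q) in one fibre. The classes of [near_eq] are clopen, and invariant because delta dies in the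
    flat D-algebra C. So p is near_eq to q, which produces an annihilator of delta outside x. *)
Lemma descent_delta : delta = 0.
Proof.
pose a : set D := [set s | s * delta = 0].
have ia : ideal a.
  split=> [|s t|s t]; rewrite /a /= ?mul0r // ?mulrDl.
    by move=> -> ->; rewrite addr0.
  by rewrite -mulrA => ->; rewrite mulr0.
have [|a1] := pselect (a 1); first by rewrite /a /= mul1r.
have [x [mx ax]] := maximal_over ia a1.
have [K [h [hK hx]]] := closed_field_at (maximal_prime mx).
pose k : {rmorphism A -> K} := h \o il \o f.
have [L [jl [jk itL]]] := tensor_alg f k.
pose p : {rmorphism R -> K} := h \o il; pose q : {rmorphism R -> K} := h \o ir.
have pk c : p (f c) = k c by [].
have qk c : q (f c) = k c by rewrite /k /= (it_comm itD).
have op := near_eq_open itL.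
have [|y yk|g [s [gl gr s0 gs]]] :=
  @clopen_connected K k L jl jk hK itL (near_eq p) (op p pk) _ _ p q pk qk
    (near_eq_refl p).
- move=> y ky ny; have [e ye eP] := op (y \o jl) (fun c => point_fibre itL c ky) y ky (near_eq_refl _).
  exists e => // z kz ze h1; apply: ny; apply: near_eq_trans h1 (near_eq_sym (eP z kz ze)).
  by move=> c; rewrite pk /= (point_fibre itL).
- have U : near_eq (y \o d0) (y \o d1).
    have dd : de delta = 0 by rewrite rmorphB (ds_d0 ds) (ds_d1 ds) db subrr.
    have fC : eqflat de := ds_flatC ds.
    have [|J [c [t [tE cE]]]] := fC unit (fun=> delta) (fun=> 1).
      by rewrite big1 // => i _; rewrite dd mul0r.
    have [j yj] : exists j, y (de (c tt j)) != 0.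
      apply: contrapT => H; have := congr1 y (tE tt); rewrite rmorph1 rmorph_sum big1.
        by move/eqP; rewrite oner_eq0.
      move=> j _; rewrite rmorphM; have [->|nz] := eqVneq (y (de (c tt j))) 0.
        exact: mul0r.
      by case: H; exists j.
    exists (y \o de), (c tt j); split=> //= [z|z|].
    + by rewrite (ds_d0 ds).
    + by rewrite (ds_d1 ds).
    + by have := cE j; rewrite (big_pred1 tt) => [|[]//]; rewrite mulrC.
  have pd0 c : p (f c) = (y \o d0) (f c) by rewrite pk /= yk.
  have pd1 c : p (f c) = (y \o d1) (f c) by rewrite pk /= -(ds_eq ds) yk.
  split=> h1; first exact: near_eq_trans pd1 h1 U.
  exact: near_eq_trans pd0 h1 (near_eq_sym U).
- have gh : g s = h s.
    apply: (@tensor_ext _ _ _ _ _ f f il ir g h itD) => z; [exact: gl | exact: gr].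
  by case/eqP: gs; rewrite gh; apply/hx/ax.
Qed.

Lemma descent_function : exists a, f a = b.
Proof.
by apply: descent_effective; apply/eqP; rewrite -subr_eq0; apply/eqP/descent_delta.
Qed.

End Function.
End DescentPoints.

(** * Constancy on fibres *)

Section KopenIdem.
Variables (K : fieldType) (L : comPzRingType) (jk : {rmorphism K -> L}).

Lemma kopen_idem1 e : e * e = e -> kopen jk (fun x => x e = 1).
Proof.
move=> ee x kx xe; exists e; first by rewrite xe oner_neq0.
by move=> y ky ye; case: (idem_val y ee) => // y0; rewrite y0 eqxx in ye.
Qed.

Lemma kopen_idem0 e : e * e = e -> kopen jk (fun x => x e = 0).
Proof.
move=> ee x kx xe; exists (1 - e); first by rewrite rmorphB rmorph1 xe subr0 oner_neq0.
move=> y ky; case: (idem_val y ee) => // y1.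
by rewrite rmorphB rmorph1 y1 subrr eqxx.
Qed.

Lemma kopenU (P Q : {rmorphism L -> K} -> Prop) :
  kopen jk P -> kopen jk Q -> kopen jk (fun x => P x \/ Q x).
Proof.
move=> oP oQ x kx [/(oP x kx)|/(oQ x kx)] [a xa aP]; exists a => // y ky ya.
  by left; exact: aP.
by right; exact: aP.
Qed.

Lemma prod_idem (T : Type) (s : seq T) (u : T -> L) :
  (forall t, u t * u t = u t) -> (\prod_(t <- s) u t) * (\prod_(t <- s) u t) = \prod_(t <- s) u t.
Proof.
move=> uu; elim: s => [|t s IH]; first by rewrite big_nil mulr1.
by rewrite big_cons mulrACA uu IH.
Qed.

Lemma prod_one (T : eqType) (s : seq T) (u : T -> L) (x : {rmorphism L -> K}) :
  (forall t, u t * u t = u t) ->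
  x (\prod_(t <- s) u t) = 1 <-> forall t, t \in s -> x (u t) = 1.
Proof.
move=> uu; elim: s => [|t s IH]; first by rewrite big_nil rmorph1.
rewrite big_cons rmorphM; case: (idem_val x (uu t)) => xt; rewrite xt ?mul0r ?mul1r.
  split=> [/eqP|/(_ t (mem_head _ _))]; first by rewrite eq_sym oner_eq0.
  by rewrite xt => /eqP; rewrite eq_sym oner_eq0.
split=> [/IH h z|h]; last by apply/IH => z zs; apply: h; rewrite inE zs orbT.
by rewrite inE => /orP[/eqP->|/h].
Qed.

End KopenIdem.

Section FibreConstant.
Variables (A : comPzRingType) (I : set A) (R C D : comPzRingType).
Variables (f : {rmorphism A -> R}) (d0 d1 : {rmorphism R -> C}).
Variables (il ir : {rmorphism R -> D}) (de : {rmorphism D -> C}).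
Hypothesis ds : descent_setting I f d0 d1 il ir de.
Variables (K : fieldType) (k : {rmorphism A -> K}).
Variables (L : comPzRingType) (jl : {rmorphism R -> L}) (jk : {rmorphism K -> L}).
Hypotheses (hK : has_roots K) (itL : is_tensor f k jl jk).
(** In the application, Q says that the image in X lies in a fixed affine chart, O r that the
    function r on it has a prescribed value, and S that the image is a prescribed geometric
    point. *)
Variables (T : eqType) (Q S : {rmorphism R -> K} -> Prop)
  (O : T -> {rmorphism R -> K} -> Prop).
Hypotheses (oQ : kopen jk (fun x => Q (x \o jl)))
  (oO : forall r, kopen jk (fun x => O r (x \o jl)))
  (oN : forall r, kopen jk (fun x => Q (x \o jl) /\ ~ O r (x \o jl)))
  (oS : kopen jk (fun x => ~ S (x \o jl))).
Hypothesis SE : forall p, S p <-> Q p /\ forall r, O r p.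
Hypothesis invS : forall y : {rmorphism C -> K}, (forall a, y (d0 (f a)) = k a) ->
  (S (y \o d0) <-> S (y \o d1)).
Hypothesis invO : forall r (y : {rmorphism C -> K}), (forall a, y (d0 (f a)) = k a) ->
  (O r (y \o d0) <-> O r (y \o d1)).

(* V is clopen with S <= V <= Q; by compactness finitely many of the O r cut V
   down to a clopen set that is stable under passing from y d0 to y d1. *)
Lemma fibre_constant (p q : {rmorphism R -> K}) : (forall a, p (f a) = k a) -> (forall a, q (f a) = k a) ->
  S p -> S q.
Proof.
move=> pk qk Sp; have hs := fibre_split ds hK itL.
have [|e [ee eP]] := split_sep hs oS oQ.
  move=> x _; have [/SE[Qx _]|] := pselect (S (x \o jl)); by [right | left].
(* On V, given by e = 1, the condition O r is clopen, and u tells whether it holds. *)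
have uex r : exists u, u * u = u /\ forall x, kpoint jk x ->
    (x u = 0 -> x e = 0 \/ Q (x \o jl) /\ ~ O r (x \o jl)) /\ (x u = 1 -> O r (x \o jl)).
  have [x kx|u [uu uP]] := split_sep hs (kopenU (kopen_idem0 ee) (@oN r)) (@oO r).
    have [xO|nO] := pselect (O r (x \o jl)); first by right.
    left; case: (idem_val x ee) => xe; [by left | right].
    by split=> //; exact: (eP x kx).2.
  by exists u; split=> // x kx; have [u0 u1] := uP x kx.
pose u t := if t is Some r then projT1 (cid (uex r)) else 1.
have uu t : u t * u t = u t by case: t => [r|] /=; [case: cid => ? [] | rewrite mulr1].
have u0 r x : kpoint jk x -> x (u (Some r)) = 0 -> x e = 0 \/ ~ O r (x \o jl).
  by move=> kx /=; case: cid => w [_ h] /= /(h x kx).1[|[]]; [left | right].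
have u1 r x : kpoint jk x -> x (u (Some r)) = 1 -> O r (x \o jl).
  by move=> kx /=; case: cid => w [_ h] /= /(h x kx).2.
have [CK [ck [E0 [E1 [hsC pt conn]]]]] := square_tensor ds hK itL.
(* Compactness of the K-points of CK: finitely many of the conditions O r, imposed together with e =
   1 after F, already force e = 1 after F'. *)
have comp (F F' : {rmorphism L -> CK}) :
    (forall z, kpoint ck z -> [/\ kpoint jk (z \o F), kpoint jk (z \o F') &
      S ((z \o F) \o jl) -> S ((z \o F') \o jl)]) ->
    exists s : seq (option T), forall z, kpoint ck z -> z (F e) = 1 ->
      (forall t, t \in s -> z (F (u t)) = 1) -> z (F' e) = 1.
  move=> hF; pose Z t (z : {rmorphism CK -> K}) :=
    if t is Some r then z (F (u t)) = 0 else z (F e) = 0 \/ z (F' e) = 1.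
  have img (G : {rmorphism L -> CK}) a : a * a = a -> G a * G a = G a.
    by rewrite -rmorphM => ->.
  have [[r|]|z kz|s sP] := @split_compact K CK ck hsC (option T) Z.
  - by apply: kopen_idem0; exact: img.
  - by apply: kopenU; [apply: kopen_idem0; exact: img | apply: kopen_idem1; exact: img].
  - have [k0 k1 hS] := hF z kz; apply: contrapT => nZ.
    have ze : z (F e) = 1.
      by case: (idem_val z (img F e ee)) => // h; case: nZ; exists None; left.
    have ze' : z (F' e) = 0.
      by case: (idem_val z (img F' e ee)) => // h; case: nZ; exists None; right.
    apply: ((eP _ k1).1 ze'); apply: hS; apply/SE; split; first exact: (eP _ k0).2.
    move=> r; apply: (u1 r _ k0).
    by case: (idem_val (z \o F) (uu (Some r))) => // h; case: nZ; exists (Some r).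
  - exists s => z kz ze h; have [[r|] ts] := sP z kz; rewrite /Z.
      by move/eqP; rewrite h // oner_eq0.
    by case=> // /eqP; rewrite ze oner_eq0.
have [|s0 s0P] := comp E0 E1.
  move=> z kz; have [y [yk k0 k1 y0 y1]] := pt z kz; split=> //.
  by rewrite y0 y1 => /(invS yk).
have [|s1 s1P] := comp E1 E0.
  move=> z kz; have [y [yk k0 k1 y0 y1]] := pt z kz; split=> //.
  by rewrite y0 y1 => /(invS yk).
have [x kx xE] := fibre_point itL pk; have [y ky yE] := fibre_point itL qk.
have xe : x e = 1.
  by case: (idem_val x ee) => // /(eP x kx).1; rewrite xE.
have xu t : x (u t) = 1.
  case: t => [r|]; last exact: rmorph1.
  case: (idem_val x (uu (Some r))) => // /(u0 r x kx)[|]; first by rewrite xe => /eqP; rewrite oner_eq0.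
  by rewrite xE; case; have [_] := (SE p).1 Sp; apply.
(* Adding an arbitrary t0 to the finite list keeps N invariant, so every single O r is obtained at
   q. *)
have main t0 : y e = 1 /\ y (u t0) = 1.
  pose s := t0 :: s0 ++ s1; pose N := e * \prod_(t <- s) u t.
  have NN : N * N = N by rewrite /N mulrACA ee (prod_idem _ uu).
  have N1 (w : {rmorphism L -> K}) : w N = 1 <-> w e = 1 /\ forall t, t \in s -> w (u t) = 1.
    rewrite /N rmorphM; case: (idem_val w ee) => we; rewrite we ?mul0r ?mul1r.
      by split=> [/eqP|[/eqP]]; rewrite eq_sym oner_eq0.
    by rewrite (prod_one s w uu); split=> [h|[]].
  have N01 : E0 N = E1 N.
    apply/eqP; rewrite -subr_eq0; apply/eqP/(split_reduced hsC) => z kz.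
    have [w [wk k0 k1 w0 w1]] := pt z kz.
    have sub0 t : t \in s0 -> t \in s by rewrite inE mem_cat => ->; rewrite orbT.
    have sub1 t : t \in s1 -> t \in s by rewrite inE mem_cat => ->; rewrite !orbT.
    have half (F F' : {rmorphism L -> CK}) : kpoint jk (z \o F) -> kpoint jk (z \o F') ->
        (forall r, O r ((z \o F) \o jl) -> O r ((z \o F') \o jl)) ->
        (z (F e) = 1 -> (forall t, t \in s -> z (F (u t)) = 1) -> z (F' e) = 1) ->
        z (F N) = 1 -> z (F' N) = 1.
      move=> kF kF' hO hz /(N1 (z \o F))[/= ze zu]; apply/(N1 (z \o F')) => /=.
      have ze' := hz ze zu; split=> // -[r|] ts; last by rewrite !rmorph1.
      case: (idem_val (z \o F') (uu (Some r))) => // /(u0 r _ kF')[/=|].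
        by rewrite ze' => /eqP; rewrite oner_eq0.
      by case; apply: hO; apply: (u1 r _ kF); exact: zu.
    have a01 : z (E0 N) = 1 -> z (E1 N) = 1.
      apply: half => // [r|ze zu]; first by rewrite w0 w1 => /(invO r wk).
      by apply: s0P => // t /sub0; exact: zu.
    have a10 : z (E1 N) = 1 -> z (E0 N) = 1.
      apply: half => // [r|ze zu]; first by rewrite w0 w1 => /(invO r wk).
      by apply: s1P => // t /sub1; exact: zu.
    rewrite rmorphB; case: (idem_val (z \o E0) NN) => /= h0; case: (idem_val (z \o E1) NN) => /= h1;
      rewrite h0 h1 ?subrr //.
      by move: (a10 h1) => /eqP; rewrite h0 eq_sym oner_eq0.
    by move: (a01 h0) => /eqP; rewrite h1 eq_sym oner_eq0.
  have xN : x N = 1 by apply/N1.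
  have [N0|Ne] := conn N NN N01.
    by move/eqP: xN; rewrite N0 rmorph0 eq_sym oner_eq0.
  have /N1[ye yu] : y N = 1 by rewrite Ne rmorph1.
  by split=> //; apply: yu; exact: mem_head.
apply/SE; split=> [|r].
  by rewrite -yE; apply: (eP y ky).2; have [] := main None.
by rewrite -yE; apply: (u1 r y ky); have [] := main (Some r).
Qed.

End FibreConstant.

(** * Affine spectra *)

Section SpecBasics.
Variable R : comPzRingType.
Implicit Types p q : spec R.

Lemma spec_ext p q : (forall a, spec_ideal p a <-> spec_ideal q a) -> p = q.
Proof.
case: p q => [p pp] [q pq] /= h.
have e : p = q by apply/seteqP; split=> a /h.
by case: q / e pq {h} => pq; rewrite (Prop_irrelevance pp pq).
Qed.

Lemma open_basic (V : opens (spec R)) p : oset V p ->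
  exists2 a, ~ spec_ideal p a & forall q, ~ spec_ideal q a -> oset V q.
Proof.
have [E ->] := openP V; move=> /vanishingN[a Ea na]; exists a => // q nq.
by apply/vanishingN; exists a.
Qed.

Lemma prime_pow p g n : ~ spec_ideal p g -> ~ spec_ideal p (g ^+ n).
Proof.
move=> ng; elim: n => [|n IH]; first by rewrite expr0; exact: primeN1.
by rewrite exprS; exact: primeNM.
Qed.

Lemma pow_mulset (g : R) : mulset [set x | exists n, x = g ^+ n].
Proof.
split=> [|_ _ [n ->] [m ->]]; first by exists 0%N.
by exists (n + m)%N; rewrite exprD.
Qed.

Lemma pow_in_ideal (J : set R) g : ideal J ->
  (forall q, ~ spec_ideal q g -> exists2 a, J a & ~ spec_ideal q a) ->
  exists n, J (g ^+ n).
Proof.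
move=> iJ h; apply: contrapT => nJ.
have [|P [pP JP PM]] := prime_avoiding iJ (pow_mulset g).
  by move=> x Jx [n e]; apply: nJ; exists n; rewrite -e.
have [|a Ja na] := h (SpecPt pP); last by apply: na; exact: JP.
by move=> /PM; apply; exists 1%N; rewrite expr1.
Qed.

Lemma vanish_pow g b : (forall q (ng : ~ spec_ideal q g),
    exists t, ~ spec_ideal q t /\ t * b = 0) -> exists n, g ^+ n * b = 0.
Proof.
move=> h; apply: (@pow_in_ideal [set t | t * b = 0]) => [|q nq].
  split=> [|s t|s t] /=; rewrite ?mul0r // ?mulrDl.
    by move=> -> ->; rewrite addr0.
  by rewrite -mulrA => ->; rewrite mulr0.
by have [t [nt e]] := h q nq; exists t.
Qed.

(** Sections over D(g) are the elements of R_g: finitely many local fractions suffice, and they are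
    brought to a form that agrees by cross multiplication without further factors. *)
Lemma section_basic (U : opens (spec R)) (s : spec_sect U) g :
  (forall q, ~ spec_ideal q g -> oset U q) ->
  exists b n, forall q (Uq : oset U q), ~ spec_ideal q g ->
    exists ng, s q Uq = @frac R q b (g ^+ n) ng.
Proof.
move=> gU.
pose rep a h := (forall q, ~ spec_ideal q h -> ~ spec_ideal q g) /\
  forall q (Uq : oset U q), ~ spec_ideal q h ->
  exists nh, s q Uq = @frac R q a h nh.
pose F : set R := [set h | exists a, rep a h].
have id_ext := extend_ideal (idfun : {rmorphism R -> R}) F.
have [q ng|n /extendP[l [lF lE]]] := pow_in_ideal (g := g) id_ext.
  have [V [a [h [Vq VU rE]]]] := ss_locP s (gU q ng).
  have [c nc cV] := open_basic Vq.
  have [nh _] := rE q (gU q ng) Vq.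
  exists (g * (c * h)); last by do 2 apply: primeNM => //.
  apply: (@extend_mem _ _ (idfun : {rmorphism R -> R})).
  exists (g * (c * a)); split=> [q' n' qg|q' Uq' n'].
    by apply: n'; exact: primeMr.
  have nc' : ~ spec_ideal q' c.
    by move=> qc; apply: n'; apply: primeMl; exact: primeMr.
  have [nh' ->] := rE q' Uq' (cV q' nc').
  exists n'; apply/fracE; exists 1; split; first exact: primeN1.
  change (1 * (a * (g * (c * h)) - g * (c * a) * h) = 0); ring.
pose m := size l.
pose h (i : 'I_m) := (tnth (in_tuple l) i).1; pose z (i : 'I_m) := (tnth (in_tuple l) i).2.
have hF i : F (h i) by apply: lF; exact: (mem_tnth i (in_tuple l)).
have gE : g ^+ n = \sum_i h i * z i by rewrite lE big_tnth.
pose a i := projT1 (cid (hF i)).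
have aP i : rep (a i) (h i) by rewrite /a; case: cid.
have hg i := (aP i).1; have aE i := (aP i).2.
have ex i j : exists N, (h i * h j) ^+ N * (a i * h j - a j * h i) = 0.
  apply: vanish_pow => q nq.
  have ni : ~ spec_ideal q (h i) by move=> qi; apply: nq; exact: primeMr.
  have nj : ~ spec_ideal q (h j) by move=> qj; apply: nq; exact: primeMl.
  have Uq := gU q (hg i q ni).
  have [ni' e] := aE i q Uq ni; have [nj' e'] := aE j q Uq nj.
  by apply/(fracE _ _ ni' nj'); rewrite -e e'.
pose N := \max_(p : 'I_m * 'I_m) projT1 (cid (ex p.1 p.2)).
have NE i j : (h i * h j) ^+ N * (a i * h j - a j * h i) = 0.
  have le : (projT1 (cid (ex i j)) <= N)%N.
    exact: (@leq_bigmax _ (fun p : 'I_m * 'I_m => projT1 (cid (ex p.1 p.2))) (i, j)).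
  rewrite -(subnK le) exprD -mulrA.
  by case: (cid (ex i j)) => N0 /= ->; rewrite mulr0.
(* Expanding each fraction by the common power N absorbs the annihilators found in [NE]. *)
pose a' i := a i * h i ^+ N; pose h' i := h i ^+ N.+1.
have comp i j : a' i * h' j = a' j * h' i.
  apply/eqP; rewrite -subr_eq0; apply/eqP; apply: etrans (NE i j).
  by rewrite /a' /h' !exprS exprMn; ring.
(* The x for which x s is a global element. This ideal contains every h' i, hence a power of g. *)
pose J : set R := [set x | exists b, forall q (Uq : oset U q), ~ spec_ideal q g ->
   s q Uq * frac x (@primeN1 R q) = frac b (@primeN1 R q)].
have iJ : ideal J.
  split=> [|x y [b bE] [c cE]|x y [b bE]].
  - exists 0 => q Uq _; elim/fracW: (s q Uq) => c d nd.
    by rewrite fracM; apply/fracE; exists 1; split; [exact: primeN1 | ring].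
  - exists (b + c) => q Uq ng.
    transitivity (s q Uq * frac x (@primeN1 R q) + s q Uq * frac y (@primeN1 R q)).
      rewrite -mulrDr fracD; congr (_ * _); apply/fracE; exists 1.
      by split; [exact: primeN1 | ring].
    rewrite bE // cE // fracD; apply/fracE; exists 1.
    by split; [exact: primeN1 | ring].
  - exists (x * b) => q Uq ng.
    transitivity (frac x (@primeN1 R q) * (s q Uq * frac y (@primeN1 R q))).
      rewrite mulrCA fracM; congr (_ * _); apply/fracE; exists 1.
      by split; [exact: primeN1 | ring].
    rewrite bE // fracM; apply/fracE; exists 1.
    by split; [exact: primeN1 | ring].
have cover q : ~ spec_ideal q g -> exists j, ~ spec_ideal q (h j).
  move=> ng; apply: contrapT => H; apply: (@prime_pow q g n ng); rewrite gE.
  elim/big_rec: _ => [|i x _ qx]; first exact: prime0.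
  apply: primeD => //; apply: primeMr; apply: contrapT => nh; apply: H; by exists i.
have h'J i : J (h' i).
  exists (a' i) => q Uq ng; have [j nj] := cover q ng.
  have [nj' ->] := aE j q Uq nj.
  rewrite fracM; apply/fracE; exists (h j ^+ N); split; first exact: prime_pow.
  have := comp i j; rewrite /a' /h' !mulr1 => e.
  transitivity (a j * h j ^+ N * h i ^+ N.+1 - a i * h i ^+ N * h j ^+ N.+1).
    by rewrite !exprS; ring.
  by rewrite e subrr.
have [q ng|k [b bE]] := pow_in_ideal (g := g) iJ.
  have [j nj] := cover q ng; exists (h' j) => //; exact: prime_pow.
exists b, k => q Uq ng; exists (prime_pow ng).
have := bE q Uq ng; elim/fracW: (s q Uq) => c d nd.
rewrite fracM => /fracE[t [nt e]]; apply/fracE; exists t; split=> //.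
by apply: etrans e; ring.
Qed.

End SpecBasics.

(** * Going down and the quotient topology *)

Section SpecFlat.
Variables (A R : comPzRingType) (f : {rmorphism A -> R}).
Hypothesis fl : eqflat f.

Lemma flat_annihilator c t : f c * t = 0 -> exists (J : finType) (d : J -> A) (z : J -> R),
  t = \sum_j f (d j) * z j /\ forall j, c * d j = 0.
Proof.
move=> e; have [|J [d [z [tE dE]]]] := fl (I := unit) (r := fun=> c) (s := fun=> t).
  by rewrite big1.
exists J, (d tt), z; split=> // j.
by have := dE j; rewrite (big_pred1 tt) //; case.
Qed.

Lemma prime_sum (S : comPzRingType) (q : spec S) (J : finType) (x z : J -> S) :
  ~ spec_ideal q (\sum_j x j * z j) -> exists j, ~ spec_ideal q (x j).
Proof.
move=> nq; apply: contrapT => H; apply: nq.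
elim/big_rec: _ => [|i y _ qy]; first exact: prime0.
by apply: primeD => //; apply: primeMr; apply: contrapT => nh; apply: H; exists i.
Qed.

Lemma loc_map_inj (q : spec R) : injective (@loc_map A R f q).
Proof.
move=> x y; elim/fracW: x => a g ng; elim/fracW: y => b h nh.
rewrite !loc_mapE => /fracE[t [nt e]].
have [|J [d [z [tE dE]]]] := @flat_annihilator (a * h - b * g) t.
  by rewrite mulrC rmorphB !rmorphM.
rewrite tE in nt; have [j nj] := prime_sum nt.
by apply/fracE; exists (d j); split=> //; rewrite mulrC.
Qed.

Lemma flat_relation (p : set A) (a : A) (s : R) : ideal p ->
  extend f p (f a * s) -> exists (J : finType) (c : J -> A) (t : J -> R),
    s = \sum_j f (c j) * t j /\ forall j, p (a * c j).
Proof.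
move=> ip /extendP[l [lp lE]].
pose m := size l.
pose x (i : 'I_m) := (tnth (in_tuple l) i).1; pose z (i : 'I_m) := (tnth (in_tuple l) i).2.
have xp i : p (x i) by apply: lp; exact: (mem_tnth i (in_tuple l)).
have e : f a * s = \sum_i f (x i) * z i by rewrite lE big_tnth.
have [|J [c [t [sE cE]]]] := fl (I := option 'I_m)
  (r := fun u => if u is Some i then x i else a)
  (s := fun u => if u is Some i then - z i else s).
  rewrite big_option /= e; under [X in _ + X]eq_bigr do rewrite mulrN.
  by rewrite sumrN subrr.
exists J, (c None), t; split=> [|j]; first exact: sE None.
have := cE j; rewrite big_option /= => /eqP; rewrite addr_eq0 => /eqP ->.
by apply: idealN => //; apply: ideal_sum => // i _; exact: idealMr.
Qed.

Lemma prime_ideal_of (S : comPzRingType) (p : spec S) : ideal (spec_ideal p).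
Proof. by have [] := spec_prime p. Qed.

(** By [flat_relation] the extension of p0 contains no product f a * s with a outside p0 and s
    outside q; a prime over it that avoids these products is the one sought. *)
Lemma going_down (p0 : spec A) (q : spec R) : spec_ideal p0 `<=` spec_ideal (spec_fun f q) ->
  exists2 q0 : spec R, spec_fun f q0 = p0 & spec_ideal q0 `<=` spec_ideal q.
Proof.
move=> p0q.
pose M : set R := [set x | exists a s, [/\ ~ spec_ideal p0 a, ~ spec_ideal q s & x = f a * s]].
have mM : mulset M.
  split=> [|_ _ [a [s [na ns ->]]] [b [t [nb nt ->]]]].
    by exists 1, 1; rewrite rmorph1 mulr1; split=> //; exact: primeN1.
  by exists (a * b), (s * t); rewrite rmorphM mulrACA; split=> //; exact: primeNM.
have [|P [pP fP PM]] := prime_avoiding (extend_ideal f (spec_ideal p0)) mM.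
  move=> x ex [a [s [na ns xE]]]; rewrite xE in ex.
  have [J [c [t [sE cE]]]] := flat_relation (prime_ideal_of p0) ex.
  rewrite sE in ns; have [j nj] := prime_sum ns; apply: nj; apply: p0q.
  by have [_ _ /(_ _ _ (cE j))[/na|]] := spec_prime p0.
exists (SpecPt pP) => [|x Px].
  apply: spec_ext => a; split=> [Pa|pa] /=; last by apply: fP; exact: (@extend_mem _ _ f (spec_ideal _) a pa).
  apply: contrapT => na; apply: (PM _ Pa); exists a, 1.
  by rewrite mulr1; split=> //; exact: primeN1.
apply: contrapT => nx; apply: (PM _ Px); exists 1, x.
by rewrite rmorph1 mul1r; split=> //; exact: primeN1.
Qed.

Hypothesis um : forall (J : finType) (c : J -> A) (z : J -> R),
  \sum_j f (c j) * z j = 1 -> exists y, \sum_j c j * y j = 1.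

Lemma spec_surj (p : spec A) : exists q : spec R, spec_fun f q = p.
Proof.
pose M : set R := [set x | exists2 a, ~ spec_ideal p a & x = f a].
have mM : mulset M.
  split=> [|_ _ [a na ->] [b nb ->]]; first by exists 1; [exact: primeN1 | rewrite rmorph1].
  by exists (a * b); [exact: primeNM | rewrite rmorphM].
have [|P [pP fP PM]] := prime_avoiding (extend_ideal f (spec_ideal p)) mM.
  move=> x ex [a na xE]; rewrite xE -[f a]mulr1 in ex.
  have [J [c [t [sE cE]]]] := flat_relation (prime_ideal_of p) ex.
  have [y yE] := um (esym sE); apply: (@primeN1 A p); rewrite -yE.
  elim/big_rec: _ => [|i z _ pz]; first exact: prime0.
  apply: primeD => //; apply: primeMr.
  by have [_ _ /(_ _ _ (cE i))[/na|]] := spec_prime p.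
exists (SpecPt pP); apply: spec_ext => a; split=> [Pa|pa] /=; last by apply: fP; exact: (@extend_mem _ _ f (spec_ideal _) a pa).
by apply: contrapT => na; apply: (PM _ Pa); exists a.
Qed.

(** The complement of the preimage is V(J), and the complement of V is V(f^-1 J): a prime p over
    f^-1 J contains the image of a point of V(J), and going down from a point q over p puts q itself
    in V(J). *)
Lemma spec_submersive (V : set (spec A)) : open (spec_fun f @^-1` V) -> open V.
Proof.
move=> [E VE].
have inV q : ~ V (spec_fun f q) <-> E `<=` spec_ideal q.
  have e : (spec_fun f @^-1` V) q <-> (~` vanishing E) q by rewrite VE.
  split=> [nV|Eq /e //]; apply: contrapT => nE; apply: nV; exact/e.
pose J : set R := extend (idfun : {rmorphism R -> R}) E.
have iJ : ideal J by exact: extend_ideal.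
have EJ : E `<=` J by move=> x Ex; exact: (@extend_mem _ _ (idfun : {rmorphism R -> R})).
have JE (q : spec R) : E `<=` spec_ideal q -> J `<=` spec_ideal q.
  by move=> Eq; apply: extend_min => //; exact: prime_ideal_of.
exists (f @^-1` J); apply/seteqP; split=> p.
  move=> Vp vp; have [q qp] := spec_surj p.
  pose M : set R := [set x | exists2 a, ~ spec_ideal p a & x = f a].
  have mM : mulset M.
    split=> [|_ _ [a na ->] [b nb ->]]; first by exists 1; [exact: primeN1 | rewrite rmorph1].
    by exists (a * b); [exact: primeNM | rewrite rmorphM].
  have [|P [pP JP PM]] := prime_avoiding iJ mM.
    by move=> x Jx [a na xE]; apply: na; apply: vp; rewrite /= -xE.
  pose q' := SpecPt pP.
  have [|q0 q0E q0q] := @going_down (spec_fun f q') q.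
    rewrite qp => a Pa; apply: contrapT => na; apply: (PM _ Pa).
    by exists a.
  suff : ~ V p by [].
  rewrite -qp; apply/inV => x Ex; apply: q0q.
  have /inV : ~ V (spec_fun f q0); last exact.
  by rewrite q0E; apply/inV => y /EJ /JP.
move=> vp; apply: contrapT => nV; apply: vp => a Ja.
have [q qp] := spec_surj p; rewrite -qp in nV *.
by have /JE := (inV q).1 nV; apply.
Qed.

End SpecFlat.

(** Sections on a spectrum are families of elements of local rings, so pointwise comparison avoids
    transport along equal preimages of open sets. *)
Lemma spec_hom_ext (R : comPzRingType) (X : lrs) (g h : lrs_hom (Spec R) X) :
  (forall p, g p = h p) ->
  (forall (U : opens X) (s : sect U) p (Up : oset U (g p)) (Up' : oset U (h p)),
    ss_val (rh_sharp g U s : spec_sect _) (Up : oset (preimo (rh_cont g) U) p) =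
    ss_val (rh_sharp h U s : spec_sect _) (Up' : oset (preimo (rh_cont h) U) p)) ->
  g = h.
Proof.
case: g h => [[g cg sg rg] lg] [[h ch sh rh] lh] /= e.
have gh : g = h by apply: funext.
case: h / gh ch sh rh lh {e} => ch; have -> : ch = cg by exact: Prop_irrelevance.
move=> sh rh lh e.
have sgh : sg = sh.
  apply: functional_extensionality_dep => U; apply: rmorph_ext => s.
  by apply: ss_eq => p Up; exact: e.
case: sh / sgh rh lh {e} => rh; have -> : rh = rg by exact: Prop_irrelevance.
by move=> lh; have -> : lh = lg by exact: Prop_irrelevance.
Qed.

Lemma points_mapE (X : scheme) (R S : comPzRingType) (phi : {rmorphism R -> S})
    (w : points X R) (U : opens X) (s : sect U) (q : spec S)
    (Uq : oset U (w (spec_fun phi q))) (Uq' : oset (preimo (rh_cont (points_map phi w)) U) q) :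
  ss_val (rh_sharp (points_map phi w) U s : spec_sect _) Uq' =
  loc_map (ss_val (rh_sharp w U s : spec_sect _)
    (Uq : oset (preimo (rh_cont w) U) (spec_fun phi q))).
Proof.
congr (loc_map (ss_val _ _)); exact: Prop_irrelevance.
Qed.

(** * Values of sections at geometric points *)

Section Observables.
Variables (X : scheme) (R : comPzRingType) (w : points X R).

Definition kernel_pt (K : fieldType) (phi : {rmorphism R -> K}) (q : spec R) :=
  forall a, spec_ideal q a <-> phi a = 0.

Lemma kernel_ex (K : fieldType) (phi : {rmorphism R -> K}) :
  exists q, kernel_pt phi q.
Proof.
have pP : prime_ideal [set a | phi a = 0].
  split; first exact: preim_ideal (ideal_zero _).
    by rewrite /= rmorph1 => /eqP; rewrite oner_eq0.
  move=> a b /=; rewrite rmorphM => /eqP; rewrite mulf_eq0.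
  by move=> /orP[]/eqP; [left | right].
by exists (SpecPt pP).
Qed.

Lemma kernel_uniq (K : fieldType) (phi : {rmorphism R -> K}) q q' :
  kernel_pt phi q -> kernel_pt phi q' -> q = q'.
Proof. by move=> h h'; apply: spec_ext => a; rewrite h h'. Qed.

(* The K-point w phi of X lies in U, and s takes the value c there. *)
Definition obs (K : fieldType) (U : opens X) (s : sect U) (c : K)
    (phi : {rmorphism R -> K}) : Prop :=
  exists (q : spec R) (Uq : oset U (w q)) b g (ng : ~ spec_ideal q g),
    [/\ kernel_pt phi q,
      ss_val (rh_sharp w U s : spec_sect _) (Uq : oset (preimo (rh_cont w) U) q)
        = frac b ng & phi b = c * phi g].

Variables (K : fieldType) (phi : {rmorphism R -> K}).

Lemma obs_mem U (s : sect U) c q : kernel_pt phi q -> obs s c phi -> oset U (w q).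
Proof.
by move=> kq [q' [Uq [b [g [ng [kq' _ _]]]]]]; rewrite (kernel_uniq kq kq').
Qed.

Lemma obs_ex U (s : sect U) q : kernel_pt phi q -> oset U (w q) ->
  exists c, obs s c phi.
Proof.
move=> kq Uq.
have [b [g [ng e]]] : exists b g (ng : ~ spec_ideal q g),
    ss_val (rh_sharp w U s : spec_sect _) (Uq : oset (preimo (rh_cont w) U) q) = frac b ng.
  by elim/fracW: (ss_val _ _) => b g ng; exists b, g, ng.
exists (phi b / phi g), q, Uq, b, g, ng; split=> //.
by rewrite divfK //; apply/eqP => /kq.
Qed.

Lemma obs_frac U (s : sect U) c q (Uq : oset U (w q)) b g (ng : ~ spec_ideal q g) :
  kernel_pt phi q -> obs s c phi ->
  ss_val (rh_sharp w U s : spec_sect _) (Uq : oset (preimo (rh_cont w) U) q) = frac b ng ->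
  phi b = c * phi g.
Proof.
move=> kq [q' [Uq' [b' [g' [ng' [kq' e' h]]]]]] e.
have qq := kernel_uniq kq' kq; subst q'.
move: e'; rewrite (Prop_irrelevance Uq' Uq) => e'.
have /fracE[t [nt]] := etrans (esym e) e'.
have g'0 : phi g' != 0 by apply/eqP => /kq.
have t0 : phi t != 0 by apply/eqP => /kq.
move/(congr1 phi)/eqP; rewrite rmorph0 rmorphM rmorphB !rmorphM mulf_eq0 (negPf t0) /=.
rewrite subr_eq0 h => /eqP e2; apply: (mulIf g'0); rewrite e2; ring.
Qed.

Lemma obs_uniq U (s : sect U) c c' : obs s c phi -> obs s c' phi -> c = c'.
Proof.
move=> [q [Uq [b [g [ng [kq e h]]]]]] o'.
have h' := obs_frac kq o' e.
have g0 : phi g != 0 by apply/eqP => /kq.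
by apply: (mulIf g0); rewrite -h h'.
Qed.

Lemma obs_res (U V : opens X) (VU : V `<=` U) (s : sect U) c q : kernel_pt phi q ->
  oset V (w q) -> obs s c phi -> obs (res VU s) c phi.
Proof.
move=> kq Vq [q' [Uq [b [g [ng [kq' e h]]]]]].
have qq := kernel_uniq kq' kq; subst q'.
exists q, Vq, b, g, ng; split=> //.
rewrite -e rh_res /=; congr (ss_val _ _); exact: Prop_irrelevance.
Qed.

Lemma obs_one (U : opens X) q : kernel_pt phi q -> oset U (w q) -> obs (1 : sect U) 1 phi.
Proof.
move=> kq Uq; exists q, Uq, 1, 1, (@primeN1 R q); split=> //; last by rewrite mul1r.
by rewrite rmorph1.
Qed.

Lemma obs_mul U (s t : sect U) c d : obs s c phi -> obs t d phi ->
  obs (s * t) (c * d) phi.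
Proof.
move=> [q [Uq [b [g [ng [kq e h]]]]]] [q' [Uq' [b' [g' [ng' [kq' e' h']]]]]].
have qq := kernel_uniq kq' kq; subst q'.
move: e'; rewrite (Prop_irrelevance Uq' Uq) => e'.
exists q, Uq, (b * b'), (g * g'), (primeNM ng ng'); split=> //.
  rewrite rmorphM -fracM -e -e' //.
by rewrite !rmorphM h h' mulrACA.
Qed.

End Observables.

Lemma obs_map (X : scheme) (R C : comPzRingType) (d : {rmorphism R -> C})
    (w : points X R) (K : fieldType) (y : {rmorphism C -> K}) (U : opens X) (s : sect U) c :
  obs (points_map d w) s c y <-> obs w s c (y \o d).
Proof.
have [p kp] := kernel_ex y.
have kd : kernel_pt (y \o d) (spec_fun d p) by move=> a; exact: kp.
split=> o.
  have Up : oset U (points_map d w p) := obs_mem kp o.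
  have [b [g [ng e]]] : exists b g (ng : ~ spec_ideal (spec_fun d p) g),
      ss_val (rh_sharp w U s : spec_sect _) (Up : oset (preimo (rh_cont w) U) (spec_fun d p)) = frac b ng.
    by elim/fracW: (ss_val _ _) => b g ng; exists b, g, ng.
  exists (spec_fun d p), Up, b, g, ng; split=> //.
  apply: (@obs_frac X C (points_map d w) K y U s c p Up (d b) (d g) ng kp o).
  by rewrite (@points_mapE X R C d w U s p Up Up) e loc_mapE.
have Up : oset U (w (spec_fun d p)) := obs_mem kd o.
have [b [g [ng e]]] : exists b g (ng : ~ spec_ideal (spec_fun d p) g),
    ss_val (rh_sharp w U s : spec_sect _) (Up : oset (preimo (rh_cont w) U) (spec_fun d p)) = frac b ng.
  by elim/fracW: (ss_val _ _) => b g ng; exists b, g, ng.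
exists p, Up, (d b), (d g), ng; split=> //.
  by rewrite (@points_mapE X R C d w U s p Up Up) e loc_mapE.
exact: (obs_frac kd o e).
Qed.

(** Near x the section is one fraction b / g, and it takes the value c where b - c g vanishes. For a
    split algebra this zero set is open. *)
Lemma obs_open (X : scheme) (R L : comPzRingType) (w : points X R) (K : fieldType)
    (jl : {rmorphism R -> L}) (jk : {rmorphism K -> L}) (U : opens X) (s : sect U) c :
  split_alg jk -> kopen jk (fun x => obs w s c (x \o jl)).
Proof.
move=> hs x kx o; have [q kq] := kernel_ex (x \o jl).
have Uq := obs_mem kq o.
have [V [b [g [Vq VU rE]]]] := ss_locP (rh_sharp w U s : spec_sect _) (Uq : oset (preimo (rh_cont w) U) q).
have [a na aV] := open_basic Vq.
have [ng e] := rE q Uq Vq.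
have [u [uu uP]] := split_indicator hs (jl b - jk c * jl g).
have d0 : x (jl b - jk c * jl g) = 0.
  by rewrite rmorphB rmorphM kx; have /= -> := obs_frac kq o e; rewrite subrr.
exists (jl a * (1 - u)).
  rewrite rmorphM rmorphB rmorph1 uP // d0 eqxx subr0 mulr1.
  by apply/eqP => /(kq a).2.
move=> y ky; rewrite rmorphM rmorphB rmorph1 uP // mulf_eq0 negb_or => /andP[ya].
have [d1 _|_] := eqVneq (y (jl b - jk c * jl g)) 0; last by rewrite subrr eqxx.
have [p kp] := kernel_ex (y \o jl).
have np : ~ spec_ideal p a by move=> /kp /= e0; rewrite e0 eqxx in ya.
have Vp := aV p np; have [ng' e'] := rE p (VU p Vp) Vp.
exists p, (VU p Vp), b, g, ng'; split=> //=.
by move: d1; rewrite rmorphB rmorphM ky => /eqP; rewrite subr_eq0 => /eqP.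
Qed.

(** * Values of functions on an affine chart *)

Section AffineChart.
Variables (X : scheme) (S : comPzRingType) (j : lrs_hom (Spec S) X).
Hypothesis oi : open_immersion j.

Definition chart_img (V : set (spec S)) (oV : open V) : opens X :=
  Opens (let: And3 _ h _ := oi in h V oV).

Definition chart : opens X := chart_img openT.

Lemma chart_surj (V : opens X) (t : spec_ring (preimo (rh_cont j) V)) :
  V `<=` range j -> exists s : sect V, rh_sharp j V s = t.
Proof.
by have [_ _ h] := oi; move=> /h[g _ gK]; exists (g t); exact: gK.
Qed.

Lemma chart_inj (V : opens X) (s t : sect V) : V `<=` range j ->
  (forall y (Vy : oset V (j y)),
    ss_val (rh_sharp j V s : spec_sect _) (Vy : oset (preimo (rh_cont j) V) y) =
    ss_val (rh_sharp j V t : spec_sect _) (Vy : oset (preimo (rh_cont j) V) y)) -> s = t.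
Proof.
have [_ _ h] := oi; move=> /h/bij_inj inj e; apply: inj.
by apply: ss_eq => y Vy; exact: e.
Qed.

Definition rho (r : S) : sect chart :=
  projT1 (cid (@chart_surj chart (ss_const (preimo (rh_cont j) chart) r) (fun x h => h))).

Lemma rhoE r y (Yy : oset chart (j y)) :
  ss_val (rh_sharp j chart (rho r) : spec_sect _)
    (Yy : oset (preimo (rh_cont j) chart) y) = frac r (@primeN1 S y).
Proof. by rewrite /rho; case: cid => s /= ->. Qed.

Variables (R : comPzRingType) (w : points X R) (K : fieldType).

(** Locally s * g = b on the chart, so the values of the functions [rho r] determine those of every
    section near j y. *)
Lemma chart_frac (U : opens X) (s : sect U) y (Uy : oset U (j y)) :
  exists b g, ~ spec_ideal y g /\ forall (phi : {rmorphism R -> K}) q c vb vg,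
    kernel_pt phi q -> w q = j y -> obs w s c phi ->
    obs w (rho b) vb phi -> obs w (rho g) vg phi -> vb = c * vg.
Proof.
have [V [b [g [Vy VU rE]]]] := ss_locP (rh_sharp j U s : spec_sect _) (Uy : oset (preimo (rh_cont j) U) y).
have [ng _] := rE y Uy Vy.
exists b, g; split=> // phi q c vb vg kq wq os ob og.
pose W := chart_img (openP V).
have WU : W `<=` U by move=> _ [z Vz <-]; exact: VU.
have WY : W `<=` chart by move=> _ [z Vz <-]; exists z.
have Wq : oset W (w q) by rewrite wq; exists y.
have e : res WU s * res WY (rho g) = res WY (rho b).
  apply: chart_inj => [x|z Wz]; first by move=> [z _ <-]; exists z.
  have [z' Vz jz] := Wz.
  have [ji _ _] := oi; move/ji: jz => jz; subst z'.
  rewrite rmorphM !rh_res /=.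
  transitivity (ss_val (rh_sharp j U s : spec_sect _) (VU z Vz) *
    ss_val (rh_sharp j chart (rho g) : spec_sect _) (WY _ Wz : oset (preimo (rh_cont j) chart) z)).
    by congr (_ * _); congr (ss_val _ _); exact: Prop_irrelevance.
  transitivity (ss_val (rh_sharp j chart (rho b) : spec_sect _) (WY _ Wz : oset (preimo (rh_cont j) chart) z)); last first.
    by congr (ss_val _ _); exact: Prop_irrelevance.
  rewrite !rhoE; have [ng' ->] := rE z (VU z Vz) Vz.
  rewrite fracM; apply/fracE; exists 1; split; first exact: primeN1.
  by ring.
have o1 := obs_mul (obs_res WU kq Wq os) (obs_res WY kq Wq og).
rewrite e in o1; exact: obs_uniq (obs_res WY kq Wq ob) o1.
Qed.

(** A function outside the prime y is invertible near j y, so its value is nonzero. A function in y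
    has a noninvertible germ, and w, being a local morphism, carries it into the maximal ideal at
    q. *)
Lemma chart_zero (phi : {rmorphism R -> K}) q y r v : kernel_pt phi q -> w q = j y ->
  obs w (rho r) v phi -> (spec_ideal y r <-> v = 0).
Proof.
move=> kq wq o.
have Yq : oset chart (w q) by rewrite wq; exists y.
have Yy : oset chart (j y) by exists y.
split=> [yr|v0]; last first.
  apply: contrapT => nr.
  pose W := chart_img (openP (dopen r)).
  have WR : W `<=` range j by move=> _ [z _ <-]; exists z.
  have nz z : oset (preimo (rh_cont j) W) z -> ~ spec_ideal z r.
    move=> [z' rz jz]; have [ji _ _] := oi; move/ji: jz => jz; subst z'.
    exact/dopenE.
  have tP : locally_frac (fun z (Wz : oset (preimo (rh_cont j) W) z) => frac 1 (nz z Wz)).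
    move=> z Wz; exists (preimo (rh_cont j) W), 1, r; split=> // z' Wz' _.
    by exists (nz z' Wz').
  have [t tE] := chart_surj (SpecSect tP : spec_ring (preimo (rh_cont j) W)) WR.
  have WY : W `<=` chart by move=> _ [z Vz <-]; exists z.
  have Wq : oset W (w q) by rewrite wq; exists y => //; exact/dopenE.
  have e : res WY (rho r) * t = 1.
    apply: chart_inj => // z Wz; rewrite rmorphM rmorph1 rh_res tE /=.
    transitivity (ss_val (rh_sharp j chart (rho r) : spec_sect _) (WY _ Wz : oset (preimo (rh_cont j) chart) z) * frac 1 (nz z Wz)).
      by congr (_ * _); congr (ss_val _ _); exact: Prop_irrelevance.
    rewrite rhoE fracM; apply/fracE; exists 1; split; first exact: primeN1.
    by ring.
  have [c oc] := obs_ex t kq Wq.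
  have := obs_mul (obs_res WY kq Wq o) oc; rewrite e v0 mul0r => o1.
  have /eqP := obs_uniq o1 (obs_one kq Wq); by rewrite eq_sym oner_eq0.
have [m [[im m1 mm] mu]] := lrs_local (w q : X).
have gm : m (germ Yq (rho r)).
  pose J : set (stalk (w q : X)) := [set c | exists d, c = d * germ Yq (rho r)].
  have iJ : ideal J.
    split=> [|_ _ [a ->] [b ->]|a _ [b ->]].
    - by exists 0; rewrite mul0r.
    - by exists (a + b); rewrite mulrDl.
    - by exists (a * b); rewrite mulrA.
  have [[d dE]|J1] := pselect (J 1); last first.
    have [n [mn Jn]] := maximal_over iJ J1.
    by rewrite (mu n mn); apply: Jn; exists 1; rewrite mul1r.
  move: dE; elim/germW: d => U Uq d.
  have Vq : oset (opensI U chart) (w q) by split.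
  rewrite -(germ_res (@opensIl _ U chart) Uq Vq) -(germ_res (@opensIr _ U chart) Yq Vq).
  rewrite germM -(germ1 Vq) => /rpiE[W [h [k [Wq]]]] /= e.
  have Wy : oset W (j y) by rewrite -wq.
  pose ev (s : sect W) : loc y := ss_val (rh_sharp j W s : spec_sect _) (Wy : oset (preimo (rh_cont j) W) y).
  have evM s t : ev (s * t) = ev s * ev t by rewrite /ev rmorphM.
  have ev1 : ev 1 = 1 by rewrite /ev rmorph1.
  have evr : ev (res k (res (@opensIr _ U chart) (rho r))) = frac r (@primeN1 S y).
    rewrite -(rhoE r Yy) /ev !rh_res /=; congr (ss_val _ _); exact: Prop_irrelevance.
  have : ev (res k (res (@opensIl _ U chart) d)) * frac r (@primeN1 S y) = 1.
    rewrite -evr -evM -rmorphM; apply: etrans ev1; congr ev.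
    by rewrite -(rmorph1 (res h)); exact: esym e.
  move: (ev _) => u.
  elim/fracW: u => a g ng; rewrite fracM => e1.
  have : spec_ideal y 1.
    apply: (frac_eq_in (esym e1 : frac 1 (@primeN1 S y) = _)).
    exact: primeMl.
  by move/primeN1.
have [sm _] := max_ideal_unit (@stalk_max_ideal R q) (@stalk_maxN1 R q) (@stalk_max_unit R q).
have mm' : maximal_ideal m by [].
have := @lh_local _ _ w q m _ mm' sm (stalk_map (f := w) (germ Yq (rho r))).
case; first by exists (germ Yq (rho r)).
move=> a [g [ng [qa]]].
rewrite (@stalk_mapE _ _ w q chart Yq (rho r)) germ_evalE => e.
have := obs_frac kq o e; have /= -> := (kq a).1 qa.
move/esym/eqP; rewrite mulf_eq0 => /orP[/eqP //|/eqP/kq //].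
Qed.

End AffineChart.

Section ObsAffine.
Variables (X : scheme) (S : comPzRingType) (j : lrs_hom (Spec S) X).
Hypothesis oi : open_immersion j.
Variables (R : comPzRingType) (w : points X R) (K : fieldType).
Variables (phi psi : {rmorphism R -> K}) (q q' : spec R).
Hypotheses (kq : kernel_pt phi q) (kq' : kernel_pt psi q').
Hypotheses (rq : range j (w q)) (rq' : range j (w q')).
Hypothesis same : forall r c, obs w (rho oi r) c phi -> obs w (rho oi r) c psi.

Lemma obs_affine_pt : w q = w q'.
Proof.
have [y _ yq] := rq; have [y' _ yq'] := rq'.
suff -> : w q = j y' by [].
rewrite -yq; congr (rh_fun j); apply: spec_ext => r.
have [v ov] := obs_ex (rho oi r) kq (rq : oset (chart oi) (w q)).
rewrite (chart_zero kq (esym yq) ov).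
by rewrite (chart_zero kq' (esym yq') (same ov)).
Qed.

Lemma obs_affine (U : opens X) (s : sect U) c : obs w s c phi -> obs w s c psi.
Proof.
move=> o; have e := obs_affine_pt; have [y _ yq] := rq.
have Uq := obs_mem kq o.
have Uy : oset U (j y) by rewrite yq.
have [b [g [ng h]]] := @chart_frac X S j oi R w K U s y Uy.
have [vb ob] := obs_ex (rho oi b) kq (rq : oset (chart oi) (w q)).
have [vg og] := obs_ex (rho oi g) kq (rq : oset (chart oi) (w q)).
have e1 := h _ _ _ _ _ kq (esym yq) o ob og.
have Uq' : oset U (w q') by rewrite -e.
have [c' o'] := obs_ex s kq' Uq'.
have yq' : w q' = j y by rewrite -e yq.
have e2 := h _ _ _ _ _ kq' yq' o' (same ob) (same og).
have vg0 : vg != 0.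
  by apply/eqP => v0; apply: ng; apply/(chart_zero kq (esym yq) og).
by rewrite (mulIf vg0 (etrans (esym e1) e2)).
Qed.

End ObsAffine.

(** A closed field K1 at q1 is tensored with R/q2 over P, the quotient of A at the common image. K1
    is flat over P, so no nonzero element of R/q2 dies, and a prime avoiding them all leads to K. *)
Lemma amalgam (A R : comPzRingType) (f : {rmorphism A -> R}) (q1 q2 : spec R) :
  spec_fun f q1 = spec_fun f q2 ->
  exists (K : fieldType) (p1 p2 : {rmorphism R -> K}),
    [/\ has_roots K, kernel_pt p1 q1, kernel_pt p2 q2 & forall a, p1 (f a) = p2 (f a)].
Proof.
move=> e; have e' a : spec_ideal q1 (f a) <-> spec_ideal q2 (f a).
  by rewrite -[spec_ideal q1 _]/(spec_ideal (spec_fun f q1) a) e.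
have [K1 [h1 [_ h1E]]] := closed_field_at (spec_prime q1).
have [P [pp [sp pE]]] := quotient_ring (prime_ideal_of (spec_fun f q1)).
have [W [om [so oE]]] := quotient_ring (prime_ideal_of q2).
have [|g1 g1E] := surj_lift (g := h1 \o f) sp.
  by move=> a /pE /= h; apply/h1E.
have [|g2 g2E] := surj_lift (g := om \o f) sp.
  by move=> a /pE /= h; apply/oE/e'.
have [T [il [ir it]]] := tensor_alg g1 g2.
have g10 x : g1 x = 0 -> x = 0.
  by have [a <-] := sp x; rewrite g1E => /h1E h; apply/pE.
have fl : eqflat g1.
  move=> I r s rs.
  have [[i0 ri]|r0] := pselect (exists i, g1 (r i) != 0); last first.
    exists I, (fun i j => (i == j)%:R), s; split=> [i|j].
      under eq_bigr do rewrite rmorph_nat; by rewrite delta_sum.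
    rewrite big1 // => i _; rewrite [r i]g10 ?mul0r //.
    by apply/eqP/negP => /negP h; apply: r0; exists i.
  (* The relation is solved for s i0, with pivot r i0. *)
  exists I, (fun i j => if i == i0 then if j == i0 then 0 else - r j else (i == j)%:R * r i0),
    (fun j => s j / g1 (r i0)); split=> [i|j].
    have [->|ne] := eqVneq i i0.
      have /eqP : \sum_i g1 (r i) * s i = 0 by [].
      rewrite (bigD1 i0) //= addr_eq0 => /eqP h.
      rewrite (bigD1 i0) //= eqxx rmorph0 mul0r add0r.
      apply: (mulfI ri); rewrite h mulr_sumr -sumrN; apply: eq_bigr => j /negPf ->.
      by rewrite rmorphN mulrCA [g1 (r i0) * _]mulrC divfK // mulNr.
    rewrite (bigD1 i) //= eqxx big1 => [|j /negPf jn]; last first.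
      by rewrite eq_sym jn mul0r rmorph0 mul0r.
    by rewrite addr0 mul1r mulrC divfK.
  have [->|ne] := eqVneq j i0.
    rewrite big1 // => i _; case: eqVneq => [->|n0]; first by rewrite mulr0.
    by rewrite mul0r mulr0.
  rewrite (bigD1 i0) //= eqxx (bigD1 j) //= (negPf ne) eqxx mul1r big1 => [|i].
    by rewrite addr0; ring.
  by move=> /andP[/negPf -> /negPf ->]; rewrite mul0r mulr0.
pose M : set T := [set x | exists2 s, ~ spec_ideal q2 s & x = ir (om s)].
have mM : mulset M.
  split=> [|_ _ [a na ->] [b nb ->]].
    by exists 1; [exact: primeN1 | rewrite !rmorph1].
  by exists (a * b); [exact: primeNM | rewrite !rmorphM].
have [|x [px _ xM]] := prime_avoiding (ideal_zero T) mM.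
  move=> x -> [s ns s0]; have [|J [c [z [cE zE]]]] := it_zero it fl
    (x := fun _ : unit => 1) (y := fun=> om s).
    by rewrite (big_pred1 tt) => [|[]//]; rewrite rmorph1 mul1r.
  have [j cj] : exists j, g1 (c tt j) != 0.
    apply: contrapT => H; have := cE tt; rewrite big1 => [/eqP|j _].
      by rewrite oner_eq0.
    have [->|n0] := eqVneq (g1 (c tt j)) 0; first exact: mul0r.
    by case: H; exists j.
  have := zE j; rewrite (big_pred1 tt) => [|[]//].
  have [a aE] := sp (c tt j); rewrite -aE g2E /= -rmorphM => /oE.
  have [_ _ pr] := spec_prime q2; case/pr => // /e' h; case/eqP: cj.
  by rewrite -aE g1E; apply/h1E.
have [K [h [hK hE]]] := closed_field_at px.
exists K, (h \o il \o h1), (h \o ir \o om); split=> //= a.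
- have := fmorph_eq0 (h \o il : {rmorphism K1 -> K}) (h1 a) => /= h0.
  by split=> [/h1E/eqP|/eqP]; [rewrite -h0 => /eqP | rewrite h0 => /eqP/h1E].
- split=> [/oE z0 /=|h0]; first by rewrite z0 !rmorph0.
  apply: contrapT => na; apply: (xM (ir (om a))); last by exists a.
  by apply/hE.
- by rewrite -[h1 (f a)]g1E (it_comm it) g2E.
Qed.

Section Fibres.
Variables (A : comPzRingType) (I : set A) (R C D : comPzRingType).
Variables (f : {rmorphism A -> R}) (d0 d1 : {rmorphism R -> C}).
Variables (il ir : {rmorphism R -> D}) (de : {rmorphism D -> C}).
Hypothesis ds : descent_setting I f d0 d1 il ir de.
Variables (X : scheme) (w : points X R).
Hypothesis wd : points_map d0 w = points_map d1 w.

(** A common geometric fibre is supplied by [amalgam]. In a chart around w q1, having the same image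
    as p1 means taking the same values on all functions r, the situation of [fibre_constant]. *)
Lemma constant_on_fibres (q1 q2 : spec R) : spec_fun f q1 = spec_fun f q2 ->
  w q1 = w q2.
Proof.
move=> /amalgam[K [p1 [p2 [hK k1 k2 pf]]]].
pose k : {rmorphism A -> K} := p1 \o f.
have [L [jl [jk itL]]] := tensor_alg f k.
have hs := fibre_split ds hK itL.
have [S [j [oi rj]]] := scheme_affine (w q1).
have rq1 : oset (chart oi) (w q1) := rj.
pose c r := projT1 (cid (obs_ex (rho oi r) k1 rq1)).
have cE r : obs w (rho oi r) (c r) p1 by rewrite /c; case: cid.
pose Q (p : {rmorphism R -> K}) := obs w (1 : sect (chart oi)) 1 p.
pose O r (p : {rmorphism R -> K}) := obs w (rho oi r) (c r) p.
pose E p := Q p /\ forall r, O r p.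
have Qr p q : kernel_pt p q -> Q p -> range j (w q) by move=> kq h; exact: (obs_mem kq h).
have fwd p r v : E p -> obs w (rho oi r) v p1 -> obs w (rho oi r) v p.
  by move=> [_ Op] h; rewrite (obs_uniq h (cE r)); exact: Op.
have bwd p r v : E p -> obs w (rho oi r) v p -> obs w (rho oi r) v p1.
  by move=> [_ Op] h; rewrite (obs_uniq h (Op r)); exact: cE.
have Ept p q : kernel_pt p q -> E p -> w q1 = w q.
  move=> kq Ep; apply: (@obs_affine_pt X S j oi R w K p1 p q1 q k1 kq rj (Qr p q kq Ep.1)).
  by move=> r v; exact: fwd.
have Eobs p (U : opens X) (s : sect U) v : E p -> obs w s v p -> obs w s v p1.
  move=> Ep; have [q kq] := kernel_ex p.
  apply: (@obs_affine X S j oi R w K p p1 q q1 kq k1 (Qr p q kq Ep.1) rj).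
  by move=> r v'; exact: bwd.
have E1 : E p1 by split; [exact: (obs_one k1 rq1) | exact: cE].
have inv (U : opens X) (s : sect U) v (y : {rmorphism C -> K}) :
    obs w s v (y \o d0) <-> obs w s v (y \o d1).
  by rewrite -!obs_map wd.
suff E2 : E p2 by exact: Ept k2 E2.
apply: (@fibre_constant A I R C D f d0 d1 il ir de ds K k L jl jk hK itL S Q E O
  _ _ _ _ _ _ _ p1 p2) => //.
- exact: obs_open.
- by move=> r; exact: obs_open.
- move=> r x kx [Qx nO]; have [q kq] := kernel_ex (x \o jl).
  have [v ov] := obs_ex (rho oi r) kq (Qr _ _ kq Qx : oset (chart oi) (w q)).
  have [a xa aP] := obs_open hs kx ov.
  exists a => // y ky ya; have oy := aP y ky ya; have [q' kq'] := kernel_ex (y \o jl).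
  split; first exact: (obs_one kq' (obs_mem kq' oy)).
  by move=> oy'; apply: nO; rewrite /O -(obs_uniq oy oy').
(* X need not be separated, so a second chart, around the image of x, is used: either w q1 is
   outside it, or some function on it separates x from p1. Both persist near x. *)
- move=> x kx nE; have [q kq] := kernel_ex (x \o jl).
  have [S' [j' [oi' rj']]] := scheme_affine (w q).
  have rq' : oset (chart oi') (w q) := rj'.
  have [rq|nrq] := pselect (range j' (w q1)); last first.
    have [a xa aP] := obs_open hs kx (obs_one kq rq').
    exists a => // y ky ya Ey; have [qy kqy] := kernel_ex (y \o jl).
    by apply: nrq; rewrite (Ept _ _ kqy Ey); exact: (obs_mem kqy (aP y ky ya)).
  have [same|/existsNP[r /existsNP[v /not_implyP[ov nov]]]] :=
      pselect (forall r v, obs w (rho oi' r) v (x \o jl) -> obs w (rho oi' r) v p1).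
    case: nE; have wqq := obs_affine_pt kq k1 rj' rq same.
    have rjq : oset (chart oi) (w q) by rewrite wqq.
    split; first exact: (obs_one kq rjq).
    move=> r; have [v ov] := obs_ex (rho oi r) kq rjq.
    rewrite /O (_ : c r = v) //.
    exact: (obs_uniq (cE r) (obs_affine kq k1 rj' rq same ov)).
  have [a xa aP] := obs_open hs kx ov.
  by exists a => // y ky ya Ey; apply: nov; exact: Eobs Ey (aP y ky ya).
- move=> y yk; split=> -[h1 h2]; split=> [|r]; first [exact/inv | by apply/inv; exact: h2].
- by move=> r y _; exact: inv.
- by move=> a; rewrite /k /= pf.
Qed.

End Fibres.

(** * Descent of morphisms *)

Lemma sect_transport (R : comPzRingType) (U : opens (spec R)) (s : spec_sect U)
    (p p' : spec R) (Up : oset U p) (Up' : oset U p') a g (ng : ~ spec_ideal p g) :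
  p = p' -> s p Up = frac a ng -> exists ng' : ~ spec_ideal p' g, s p' Up' = frac a ng'.
Proof. by move=> e; subst p'; rewrite (Prop_irrelevance Up' Up); exists ng. Qed.

Lemma hom_value_eq (X : lrs) (R : comPzRingType) (w w' : lrs_hom (Spec R) X)
    (U : opens X) (s : sect U) p (Up : oset U (w p)) (Up' : oset U (w' p)) :
  w = w' ->
  ss_val (rh_sharp w U s : spec_sect _) (Up : oset (preimo (rh_cont w) U) p) =
  ss_val (rh_sharp w' U s : spec_sect _) (Up' : oset (preimo (rh_cont w') U) p).
Proof. by move=> e; subst w'; rewrite (Prop_irrelevance Up' Up). Qed.

Section Assembly.
Variables (A : comPzRingType) (I : set A) (R C D : comPzRingType).
Variables (f : {rmorphism A -> R}) (d0 d1 : {rmorphism R -> C}).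
Variables (il ir : {rmorphism R -> D}) (de : {rmorphism D -> C}).
Hypothesis ds : descent_setting I f d0 d1 il ir de.
Variable X : scheme.

Let fl : eqflat f := ds_flat ds.
Let surj (p : spec A) : exists q : spec R, spec_fun f q = p :=
  spec_surj fl (ds_unimodular ds) p.

Lemma points_map_equal (s : points X A) :
  points_map d0 (points_map f s) = points_map d1 (points_map f s).
Proof.
have pe (x : spec C) : spec_fun f (spec_fun d0 x) = spec_fun f (spec_fun d1 x).
  by apply: spec_ext => a /=; rewrite (ds_eq ds).
apply: spec_hom_ext => [x|U t x U0 U1]; first by congr (rh_fun s); exact: pe.
rewrite (@points_mapE X R C d0 _ U t x U0) (@points_mapE X R C d1 _ U t x U1).
rewrite (@points_mapE X A R f s U t _ U0) (@points_mapE X A R f s U t _ U1).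
have [a [g [ng e]]] : exists a g (ng : ~ spec_ideal (spec_fun f (spec_fun d0 x)) g),
    ss_val (rh_sharp s U t : spec_sect _) (U0 : oset (preimo (rh_cont s) U) _) = frac a ng.
  by elim/fracW: (ss_val _ _) => a g ng; exists a, g, ng.
have [ng' e'] := @sect_transport A _ (rh_sharp s U t : spec_sect _) _ _ U0 U1 a g ng (pe x) e.
rewrite e e' (@loc_mapE A R f _ a g ng) (@loc_mapE A R f _ a g ng').
rewrite (@loc_mapE R C d0 _ (f a) (f g) ng) (@loc_mapE R C d1 _ (f a) (f g) ng').
apply/fracE; exists 1; split; first exact: primeN1.
by rewrite !(ds_eq ds) subrr mulr0.
Qed.

Lemma points_map_inj : injective (@points_map X A R f).
Proof.
move=> s s' e.
have pt p : s p = s' p.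
  have [q <-] := surj p.
  exact: (congr1 (fun w : points X R => w q) e).
apply: spec_hom_ext => // U t p; have [q <-] := surj p => Up Up'.
apply: (loc_map_inj fl).
rewrite -(@points_mapE X A R f s U t q Up Up) -(@points_mapE X A R f s' U t q Up' Up').
exact: hom_value_eq.
Qed.

Variable w : points X R.
Hypothesis wd : points_map d0 w = points_map d1 w.

Definition lift_pt (p : spec A) : spec R := projT1 (cid (surj p)).

Lemma lift_ptE p : spec_fun f (lift_pt p) = p.
Proof. by rewrite /lift_pt; case: cid. Qed.

Definition desc_fun (p : spec A) : X := w (lift_pt p).

Lemma desc_funE q : desc_fun (spec_fun f q) = w q.
Proof. by apply: (constant_on_fibres ds wd); exact: lift_ptE. Qed.

Lemma desc_cont : continuous (desc_fun : Spec A -> X).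
Proof.
apply/continuousP => U oU; apply: (spec_submersive fl (ds_unimodular ds)).
have -> : spec_fun f @^-1` (desc_fun @^-1` U) = w @^-1` U.
  by apply/seteqP; split=> q /=; rewrite desc_funE.
exact: openP (preimo (rh_cont w) (Opens oU)).
Qed.

Section Sections.
Variables (U : opens X) (s : sect U).
Local Notation sg := (rh_sharp w U s : spec_sect (preimo (rh_cont w) U)).

(** Over D(g0) in Spec A the section is b / g0^n. Its two pullbacks to C agree, so a power of g0
    equalizes d0 b and d1 b, and [descent_function] applies to the corresponding multiple of b. *)
Lemma desc_local p : oset U (desc_fun p) ->
  exists ag : A * A, ~ spec_ideal p ag.2 /\ forall q : spec R, ~ spec_ideal q (f ag.2) ->
    exists (Uq : oset (preimo (rh_cont w) U) q) ng,
      ss_val sg Uq = @frac R q (f ag.1) (f ag.2) ng.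
Proof.
move=> Up; have [g0 ng0 gU] := @open_basic A (preimo desc_cont U) p Up.
have gU' (q : spec R) : ~ spec_ideal q (f g0) -> oset (preimo (rh_cont w) U) q.
  by move=> nq; have := gU (spec_fun f q) nq; rewrite /= desc_funE.
have [b [n bE]] := section_basic sg gU'.
pose e := d0 (f g0).
have [m mE] : exists m, e ^+ m * (d0 b - d1 b) = 0.
  apply: vanish_pow => x nx.
  have n0 : ~ spec_ideal (spec_fun d0 x) (f g0) by [].
  have n1 : ~ spec_ideal (spec_fun d1 x) (f g0) by rewrite /= -(ds_eq ds).
  have U0 := gU' _ n0; have U1 := gU' _ n1.
  have := @hom_value_eq X C (points_map d0 w) (points_map d1 w) U s x U0 U1 wd.
  rewrite (@points_mapE X R C d0 w U s x U0) (@points_mapE X R C d1 w U s x U1).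
  have [k0 ->] := bE _ U0 n0; have [k1 ->] := bE _ U1 n1.
  rewrite !loc_mapE => /fracE[t [nt e1]].
  exists (t * e ^+ n); split; first by apply: primeNM => //; exact: prime_pow.
  apply: etrans e1; rewrite !rmorphXn -(ds_eq ds) -/e; ring.
have [|a aE] := descent_function ds (b := f (g0 ^+ m) * b).
  rewrite !rmorphM rmorphXn !rmorphXn -(ds_eq ds) -/e.
  by apply/eqP; rewrite -subr_eq0 -mulrBr mE.
(* The extra factor g0 makes the denominator vanish wherever g0 does, also when m + n is 0. *)
exists (g0 * a, g0 ^+ (m + n).+1); split; first exact: prime_pow.
move=> q nq.
have nq0 : ~ spec_ideal q (f g0).
  by move=> h; apply: nq; rewrite rmorphXn exprS; exact: primeMr.
exists (gU' q nq0), nq; have [ng ->] := bE q (gU' q nq0) nq0; apply/fracE; exists 1; split; first exact: primeN1.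
by rewrite rmorphM aE !rmorphXn exprS exprD; ring.
Qed.

Definition desc_rep p (Up : oset U (desc_fun p)) : A * A := projT1 (cid (desc_local Up)).
Local Notation desc_num Up := (desc_rep Up).1.
Local Notation desc_den Up := (desc_rep Up).2.

Lemma desc_denP p (Up : oset U (desc_fun p)) : ~ spec_ideal p (desc_den Up).
Proof. by rewrite /desc_rep; case: cid => g /= [h _]. Qed.

Lemma desc_fracE p (Up : oset U (desc_fun p)) q : ~ spec_ideal q (f (desc_den Up)) ->
  exists (Uq : oset (preimo (rh_cont w) U) q) ng,
    ss_val sg Uq = @frac R q (f (desc_num Up)) (f (desc_den Up)) ng.
Proof. by rewrite /desc_rep; case: cid => g /= [_ h]; exact: h. Qed.

Definition desc_val p (Up : oset (preimo desc_cont U) p) : loc p :=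
  frac (desc_num Up) (@desc_denP _ Up).

Lemma desc_valE q (Up : oset (preimo desc_cont U) (spec_fun f q))
    (Uq : oset (preimo (rh_cont w) U) q) :
  loc_map (desc_val Up) = ss_val sg Uq.
Proof.
rewrite /desc_val loc_mapE.
have [Uq' [ng e]] := desc_fracE (@desc_denP _ Up : ~ spec_ideal q (f _)).
by rewrite (Prop_irrelevance Uq Uq') e; congr frac; exact: Prop_irrelevance.
Qed.

Lemma desc_locP : locally_frac desc_val.
Proof.
move=> p Up; exists (dopen (desc_den Up)), (desc_num Up), (desc_den Up); split.
- by apply/dopenE; exact: desc_denP.
- move=> p' /dopenE; have [q <-] := surj p' => nq.
  by have [Uq _] := desc_fracE (nq : ~ spec_ideal q (f _)); rewrite /= desc_funE.
move=> p'; have [q <-] := surj p' => Up' /dopenE nq; exists nq.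
apply: (loc_map_inj fl).
have [Uq [ng e]] := desc_fracE (nq : ~ spec_ideal q (f _)).
by rewrite (desc_valE Up' Uq) e loc_mapE; congr frac; exact: Prop_irrelevance.
Qed.

Definition desc_sect : spec_ring (preimo desc_cont U) := SpecSect desc_locP.

End Sections.

Lemma desc_mem (U : opens X) q : oset (preimo desc_cont U) (spec_fun f q) ->
  oset (preimo (rh_cont w) U) q.
Proof. by rewrite /= desc_funE. Qed.

Lemma desc_sect_rmorph (U : opens X) : is_rmorph (@desc_sect U).
Proof.
split=> [|s t|s t]; apply: ss_eq => p; have [q <-] := surj p => Up;
  apply: (loc_map_inj fl); have Uq := desc_mem Up.
- rewrite [LHS](desc_valE 1 Up Uq) rmorph1 [RHS]loc_mapE; apply/fracE; exists 1.
  by split; [exact: primeN1 | rewrite rmorph1; ring].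
- rewrite [LHS](desc_valE (s + t) Up Uq) rmorphD.
  rewrite [RHS](@loc_mapD A R f q (desc_val s Up) (desc_val t Up)).
  by rewrite (desc_valE s Up Uq) (desc_valE t Up Uq).
- rewrite [LHS](desc_valE (s * t) Up Uq) rmorphM.
  rewrite [RHS](@loc_mapM A R f q (desc_val s Up) (desc_val t Up)).
  by rewrite (desc_valE s Up Uq) (desc_valE t Up Uq).
Qed.

Definition desc_sharp (U : opens X) :
    {rmorphism sect U -> spec_ring (preimo desc_cont U)} :=
  projT1 (cid (rmorph_of (desc_sect_rmorph U))).

Lemma desc_sharpE (U : opens X) s q (Up : oset (preimo desc_cont U) (spec_fun f q))
    (Uq : oset (preimo (rh_cont w) U) q) :
  loc_map (ss_val (desc_sharp U s : spec_sect _) Up) = ss_val (rh_sharp w U s : spec_sect _) Uq.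
Proof.
rewrite /desc_sharp; case: cid => g /= gE; rewrite gE; exact: desc_valE.
Qed.

Lemma desc_sharp_res (U V : opens X) (h : V `<=` U) s :
  desc_sharp V (res h s) = @spec_res A _ _ (preimoS desc_cont h) (desc_sharp U s).
Proof.
apply: ss_eq => p; have [q <-] := surj p => Vp; apply: (loc_map_inj fl).
have Vq := desc_mem Vp.
rewrite (desc_sharpE _ Vp Vq) [RHS](desc_sharpE s _ (h _ Vq)) rh_res /=.
congr (ss_val _ _); exact: Prop_irrelevance.
Qed.

Definition desc_rs : rs_hom (Spec A) X :=
  @RsHom (Spec A) X desc_fun desc_cont desc_sharp desc_sharp_res.

Lemma desc_rs_local (p : Spec A) : local_map (@stalk_map _ _ desc_rs p).
Proof.
move=> m n Mm Mn _ [c mc <-].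
have [_ /(_ _ Mn) <-] := max_ideal_unit (@stalk_max_ideal A p) (@stalk_maxN1 A p)
  (@stalk_max_unit A p).
have [Mq _] := max_ideal_unit (@stalk_max_ideal R (lift_pt p))
  (@stalk_maxN1 R (lift_pt p)) (@stalk_max_unit R (lift_pt p)).
move: mc; elim/germW: c => U Ux s mc.
have [a [g [ng [qa]]]] : stalk_max (stalk_map (f := w) (germ Ux s : stalk (w (lift_pt p)))).
  by apply: (@lh_local _ _ w (lift_pt p) m _ Mm Mq); exists (germ Ux s).
rewrite (@stalk_mapE _ _ w (lift_pt p) U Ux s) germ_evalE => e.
rewrite (@stalk_mapE _ _ desc_rs p U Ux s) /stalk_max /= germ_evalE.
have [b [h [nh vE]]] : exists b h (nh : ~ spec_ideal p h),
    ss_val (desc_sharp U s : spec_sect _) (Ux : oset (preimo desc_cont U) p) = frac b nh.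
  by elim/fracW: (ss_val _ _) => b h nh; exists b, h, nh.
exists b, h, nh; split=> //.
have Up : oset (preimo desc_cont U) (spec_fun f (lift_pt p)) by rewrite lift_ptE.
have [nh' vE'] := @sect_transport A _ (desc_sharp U s : spec_sect _) _ _ Ux Up b h nh
  (esym (lift_ptE p)) vE.
have := desc_sharpE s Up (Ux : oset (preimo (rh_cont w) U) (lift_pt p)).
rewrite vE' loc_mapE e => e2.
have : spec_ideal (spec_fun f (lift_pt p)) b by exact: (frac_eq_in e2 qa).
by rewrite lift_ptE.
Qed.

Definition desc : points X A := @LrsHom (Spec A) X desc_rs desc_rs_local.

Lemma points_map_desc : points_map f desc = w.
Proof.
apply: spec_hom_ext => [q|U s q Up Uq]; first exact: desc_funE.
rewrite (@points_mapE X A R f desc U s q Up); exact: desc_sharpE.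
Qed.

End Assembly.

Theorem points_equalizer (A : comPzRingType) (I : set A) (R C D : comPzRingType)
    (f : {rmorphism A -> R}) (d0 d1 : {rmorphism R -> C})
    (il ir : {rmorphism R -> D}) (de : {rmorphism D -> C}) (X : scheme) :
  descent_setting I f d0 d1 il ir de ->
  equalizer (@points_map X A R f) (@points_map X R C d0) (@points_map X R C d1).
Proof.
move=> ds; split=> [s|w wd]; first exact: (points_map_equal ds).
exists (desc ds wd); split; first exact: points_map_desc.
by move=> s sE; apply: (points_map_inj ds); rewrite sE points_map_desc.
Qed.

Theorem theorem2 (A : comPzRingType) (I : set A) (B : comPzRingType)
    (f : {rmorphism A -> B})
    (A_henselian : henselian_pair I)
    (f_weakly_etale : weakly_etale f)
    (f_faithfully_flat : faithfully_flat f)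
    (Bh : henselization (extend f I))
    (BBh : henselization (extend (tensor_sq_map f) I))
    (X : scheme) :
  equalizer
    (@points_map X A (hz_ring Bh) (hz_map Bh \o f))
    (@points_map X (hz_ring Bh) (hz_ring BBh) (henselize Bh BBh (inl_sub f I)))
    (@points_map X (hz_ring Bh) (hz_ring BBh) (henselize Bh BBh (inr_sub f I))).
Proof.
pose d0 := henselize Bh BBh (inl_sub f I).
pose d1 := henselize Bh BBh (inr_sub f I).
have [D [il [ir it]]] := tensor_alg (hz_map Bh \o f) (hz_map Bh \o f).
have [|de [de0 de1]] := it_univ it (p := d0) (q := d1); first exact: d_eq.
exact: points_equalizer (descent_settingP A_henselian it de0 de1 f_weakly_etale
  f_faithfully_flat).
Qed.
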